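(* Let the area of two-dimensional lattices $L$ be normalized to $1$, and let $a>1$. Consider the problem of minimizing $E_f(L)$ over such lattices, with potential $f=f_{\alpha,P}$ or $f=g_{\alpha,P}$ of the form $$f_{\alpha,P}(r):=\int_1^\infty\big(e^{-\pi\alpha x r}-b\,e^{-\pi a\alpha x r}\big)P(x)\,dx,\qquad \alpha\ge1,\ b\le\sqrt a,$$ $$g_{\alpha,P}(r):=\int_1^\infty\Big(rx-\frac{b}{\alpha}\Big)e^{-\pi\alpha x r}P(x)\,dx,\qquad \alpha\ge1,\ b\le\frac{1}{2\pi},$$ where $P$ is any real function (not necessarily continuous) such that $f_{\alpha,P}(r)$, $g_{\alpha,P}(r)$ are finite and $P(x)\ge0$. Then there exist $\beta_c=\sqrt a$ and $\beta_s=\frac{1}{2\pi}$, independent of $P$, such that: (i) if $b\le\beta_c$, the minimizer of $E_{f_{\alpha,P}}(L)$ exists and is always the hexagonal lattice; (ii) if $b\le\beta_s$, the minimizer of $E_{g_{\alpha,P}}(L)$ exists and is always the hexagonal lattice.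
   Context: For a potential $f$ and a two-dimensional lattice $L\subset\mathbb{R}^2$, $E_f(L)=\sum_{\mathbb{P}\in L\setminus\{0\}}f(|\mathbb{P}|^2)$, where $|\cdot|$ is the Euclidean norm on $\mathbb{R}^2$. The hexagonal lattice of area $1$ is $\Lambda_1=\sqrt{\frac{2}{\sqrt3}}\,\big[\mathbb{Z}(1,0)\oplus\mathbb{Z}(\frac12,\frac{\sqrt3}{2})\big]$ (lattices being considered up to rotation).
   Formalization: That every minimizer is the hexagonal lattice is claimed only when P is not almost everywhere zero on [1,∞); for P = 0 the energy vanishes for every lattice and all lattices are minimizers. That the hexagonal lattice is a minimizer is claimed for all P. *)

(* Defs.v *)
From mathcomp Require Import all_boot all_order all_algebra.
From mathcomp Require Import all_classical all_reals all_analysis.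

Set Implicit Arguments.
Unset Strict Implicit.
Unset Printing Implicit Defensive.

Import Order.TTheory GRing.Theory Num.Theory.
Import numFieldNormedType.Exports.

Local Open Scope classical_set_scope.
Local Open Scope ring_scope.

(* The plane is 'rV[R]_2. The norm `|p| that the library puts on 'rV[R]_2 is
   the sup norm, so the squared Euclidean norm is defined here. *)
Definition sqnorm (R : realType) (p : 'rV[R]_2) : R := \sum_(i < 2) p 0 i ^+ 2.

(* The Z-span of the two rows of B. *)
Definition lattice (R : realType) (B : 'M[R]_2) : set 'rV[R]_2 :=
  [set map_mx intr z *m B | z in [set: 'rV[int]_2]].

Definition is_lattice_of_area (R : realType) (A : R) (L : set 'rV[R]_2) : Prop :=
  exists B : 'M[R]_2, [/\ B \in unitmx, `|\det B| = A & L = lattice B].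

Definition hexagonal_basis (R : realType) : 'M[R]_2 :=
  Num.sqrt (2 / Num.sqrt 3) *:
    \matrix_(i < 2, j < 2)
      (if i == 0 then [:: 1; 0] else [:: 1 / 2; Num.sqrt 3 / 2])`_j.

Definition Lambda1 (R : realType) : set 'rV[R]_2 := lattice (hexagonal_basis R).
Arguments Lambda1 R : clear implicits.

Definition is_rotation (R : realType) (Q : 'M[R]_2) : Prop :=
  Q *m Q^T = 1%:M /\ \det Q = 1.

Definition is_hexagonal (R : realType) (L : set 'rV[R]_2) : Prop :=
  exists2 Q : 'M[R]_2, is_rotation Q & L = [set p *m Q | p in Lambda1 R].

(* \esum only makes sense for nonnegative families, hence the splitting of the
   absolutely convergent lattice sum into positive and negative parts. *)
Definition energy (R : realType) (f : R -> R) (L : set 'rV[R]_2) : \bar R :=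
  let F p := (f (sqnorm p))%:E in
  let D := L `\ 0 in
  (\esum_(p in D) F^\+ p - \esum_(p in D) F^\- p)%E.

Definition is_minimizer (R : realType) (f : R -> R) (L : set 'rV[R]_2) : Prop :=
  is_lattice_of_area 1 L /\
  forall L', is_lattice_of_area 1 L' -> (energy f L <= energy f L')%E.

Definition f_integrand (R : realType) (a alpha b : R) (P : R -> R) (r x : R) : R :=
  (expR (- (pi * alpha * x * r)) - b * expR (- (pi * a * alpha * x * r))) * P x.

Definition g_integrand (R : realType) (alpha b : R) (P : R -> R) (r x : R) : R :=
  (r * x - b / alpha) * expR (- (pi * alpha * x * r)) * P x.

Definition potential (R : realType) (h : R -> R -> R) (r : R) : R :=
  \int[lebesgue_measure]_(x in `[1, +oo[) h r x.

(* Only the values at r > 0 enter a lattice sum over nonzero points. *)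
Definition finite_potential (R : realType) (h : R -> R -> R) : Prop :=
  forall r : R, 0 < r ->
    lebesgue_measure.-integrable `[1, +oo[ (EFin \o h r).

(* When P vanishes almost everywhere on [1, +oo[ the potential is zero and every
   lattice is a minimizer, so this case is excluded from the uniqueness claim. *)
Definition nontrivial_weight (R : realType) (P : R -> R) : Prop :=
  ~ {ae lebesgue_measure, forall x : R, 1 <= x -> P x = 0}.

(* Main.v *)
Require Import Defs.
From mathcomp Require Import all_boot all_order all_algebra.
From mathcomp Require Import all_classical all_reals all_analysis.
From mathcomp Require Import measurable_realfun ring lra zify ssrZ.
From Stdlib Require BinInt.

Set Implicit Arguments.
Unset Strict Implicit.
Unset Printing Implicit Defensive.

Import Order.TTheory GRing.Theory Num.Theory.
Import numFieldNormedType.Exports.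

Local Open Scope classical_set_scope.
Local Open Scope ring_scope.

(** Write q for pi times the squared length of a lattice vector, theta_L(s)
    for the sum of exp (- s q) over L, h_s(v) = (s v - 1/2) exp (- s v), and
    K_L(s) for the sum of h_s(q) over the nonzero vectors of L. Both potentials
    are integrals over x of Gaussians against the weight P, so a difference of
    energies is an integral of P times a difference of lattice sums taken at
    s = alpha x >= 1. With D(s) = theta_L(s) - theta_Lambda(s), where Lambda is
    the hexagonal lattice, this difference of lattice sums is
      D(s) - b D(a s)   and
      (K_L(s) - K_Lambda(s) + (1/2 - pi b) D(s)) / (pi alpha)
    for the two families. The theorem therefore follows from pointwise
    inequalities; exchanging sum and integral is [asum_Rintegral], and the
    assembly is [hexagonal_optimal].

    Everything rests on one inequality, [hfun_sum_lt]: K_L(s) > K_Lambda(s) for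
    every s > 1 and every L of area 1 which is not hexagonal. Indeed
    phi(s) = sqrt s D(s) has derivative - (K_L(s) - K_Lambda(s)) / sqrt s and
    tends to 0, so it is decreasing and nonnegative on s >= 1. Nonnegativity
    gives D >= 0, and phi(s) > phi(a s) reads D(s) > sqrt a D(a s); hence the
    threshold sqrt a for b in the first family, and 1 / (2 pi) in the second,
    where 1/2 - pi b has to be nonnegative.

    The functional equation theta_L(1/s) = s theta_L(s), which comes from the
    one-dimensional theta transformation, makes K_L(1) = 1/2 for every L. So it
    is natural to compare h_s with h_1. On v > 1/2 the ratio r = h_s / h_1 is
    convex and decreasing. Its tangent at the smallest nonzero value
    v0 = 2 pi / sqrt 3 of q on Lambda gives, when all values of q exceed 1/2,
      K_L(s) >= r(v0) / 2 + |r'(v0)| * (sum of (v0 - q) h_1(q)),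
    whereas K_Lambda(s) <= r(v0) / 2 because r is decreasing. After reduction a
    lattice is described by the least nonzero value t of q and a shear x in
    [0, 1/2]. For t between 0.65 and 2.6 the sum on the right is nonnegative
    ([region_two]); adding a multiple of a function whose lattice sum is
    independent of L turns this into a statement about single terms. For
    t <= 0.65 the vectors on the line of the shortest one dominate and their sum
    is computed by the theta transformation ([region_three]). For t >= 2.6 the
    lattice is close to Lambda ([region_one]): adding to h_s multiples of h_1
    and of another function of constant lattice sum produces a convex function,
    which is averaged over the rotations of the hexagonal form acting on the
    index set Z^2; the six shortest vectors then win more than the other ones can lose. *)

(** * Absolutely convergent sums *)

Section AbsoluteSums.
Variables (R : realType) (I : choiceType).
Implicit Types (f g : I -> R) (e : R).

(** A finite value of the sum of the absolute values; the library sums families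
    over arbitrary index types in the extended reals only. *)
Definition absum f : Prop := (\esum_(i in [set: I]) `|f i|%:E < +oo)%E.

(** The difference of the sums of positive and negative parts, so that no order
    of summation has to be chosen on the index type. *)
Definition asum_def f : R :=
  fine (\esum_(i in [set: I]) (EFin \o f)^\+ i)%E
  - fine (\esum_(i in [set: I]) (EFin \o f)^\- i)%E.

Fact asum_key : unit. Proof. exact: tt. Qed.
Definition asum := locked_with asum_key asum_def.
Canonical asum_unlockable := [unlockable fun asum].

Lemma absum_le f g : (forall i, `|f i| <= g i) -> absum g -> absum f.
Proof.
move=> fg; apply: le_lt_trans; apply: le_esum => i _.
by rewrite lee_fin; apply: le_trans (fg i) (ler_norm _).
Qed.

Lemma absum_norm f : absum f -> absum (fun i => `|f i|).
Proof. by apply: le_lt_trans; apply: le_esum => i _; rewrite normr_id. Qed.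

Lemma absumD f g : absum f -> absum g -> absum (fun i => f i + g i).
Proof. by move=> sf sg; exact: (summableD (f := EFin \o f) (g := EFin \o g)). Qed.

Lemma absumZ f e : absum f -> absum (fun i => e * f i).
Proof.
move=> sf; rewrite /absum.
have key : forall e', 0 <= e' ->
    (\esum_(i in [set: I]) (e' * `|f i|)%:E <= e'%:E * \esum_(i in [set: I]) `|f i|%:E)%E.
  move=> e' e'0; apply: ge_ereal_sup => _ [X [fX _] <-].
  rewrite fsumEFin// fsbig_finite//= -mulr_sumr EFinM lee_wpmul2l ?lee_fin//.
  rewrite -sumEFin; apply: ereal_sup_ubound; exists X => //.
  by rewrite fsbig_finite.
rewrite (eq_esum (b := fun i => (`|e| * `|f i|)%:E)); last by move=> i _; rewrite normrM.
apply: le_lt_trans (key _ (normr_ge0 e)) _.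
have ge : (0 <= \esum_(i in [set: I]) `|f i|%:E)%E.
  by apply: esum_ge0 => i _; rewrite lee_fin.
move: sf ge; rewrite /absum; case: (esum _ _) => [r||]//= _ _.
by rewrite -EFinM ltry.
Qed.

Lemma absumN f : absum f -> absum (fun i => - f i).
Proof. by apply: le_lt_trans; apply: le_esum => i _; rewrite normrN. Qed.

Lemma absumB f g : absum f -> absum g -> absum (fun i => f i - g i).
Proof. by move=> sf sg; apply: absumD => //; exact: absumN. Qed.

Lemma asum_esum f : (forall i, 0 <= f i) -> absum f ->
  (asum f)%:E = (\esum_(i in [set: I]) (f i)%:E)%E.
Proof.
move=> f0 sf; rewrite unlock /asum_def.
rewrite [X in fine X - _](eq_esum (b := fun i => (f i)%:E)); last first.
  by move=> i _; rewrite funeposE /=; apply/max_idPl; rewrite lee_fin.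
rewrite [X in _ - fine X]esum1; last first.
  by move=> i _; rewrite funenegE /=; apply/max_idPr; rewrite lee_fin oppr_le0.
rewrite subr0 fineK// ge0_fin_numE; last by apply: esum_ge0 => i _; rewrite lee_fin.
by move: sf; rewrite /absum (eq_esum (b := fun i => (f i)%:E))// => i _; rewrite ger0_norm.
Qed.

Lemma asumB_ge0 f g : absum f -> absum g ->
  (forall i, 0 <= f i) -> (forall i, 0 <= g i) ->
  asum (fun i => f i - g i) = asum f - asum g.
Proof.
move=> sf sg f0 g0.
have := @esumB R I [set: I] (EFin \o f) (EFin \o g) sf sg.
have f0' i : [set: I] i -> (0 <= (EFin \o f) i)%E by rewrite /= lee_fin.
have g0' i : [set: I] i -> (0 <= (EFin \o g) i)%E by rewrite /= lee_fin.
move=> /(_ f0' g0') H.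
have sfg : summable [set: I] (EFin \o (fun i => f i - g i)) by exact: absumB.
apply: EFin_inj; rewrite [RHS]EFinB (asum_esum f0 sf) (asum_esum g0 sg) -H unlock /asum_def EFinB.
have fin1 := summable_funepos sfg; have fin2 := summable_funeneg sfg.
rewrite !fineK//.
- rewrite summableE in fin2; rewrite (eq_esum (b := fun i => `|(EFin \o (fun i => (f i - g i)%R))^\- i|%E))// => i _.
  by rewrite gee0_abs.
- rewrite summableE in fin1; rewrite (eq_esum (b := fun i => `|(EFin \o (fun i => (f i - g i)%R))^\+ i|%E))// => i _.
  by rewrite gee0_abs.
Qed.

Lemma asumD_ge0 f g : absum f -> absum g ->
  (forall i, 0 <= f i) -> (forall i, 0 <= g i) ->
  asum (fun i => f i + g i) = asum f + asum g.
Proof.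
move=> sf sg f0 g0; apply: EFin_inj.
rewrite [RHS]EFinD !asum_esum//.
- by rewrite -esumD// => i _; rewrite lee_fin.
- by move=> i; rewrite addr_ge0.
- exact: absumD.
Qed.

Let pp f i : R := Num.max (f i) 0.
Let nn f i : R := Num.max (- f i) 0.
Let ppE f i : f i = pp f i - nn f i.
Proof.
rewrite /pp /nn; case: (lerP 0 (f i)) => h; case: (lerP 0 (- f i)) => h';
rewrite ?subr0 ?sub0r ?opprK//; by move: h h'; lra.
Qed.
Let pp0 f i : 0 <= pp f i. Proof. by rewrite /pp le_max lexx orbT. Qed.
Let nn0 f i : 0 <= nn f i. Proof. by rewrite /nn le_max lexx orbT. Qed.
Let spp f : absum f -> absum (pp f).
Proof.
move=> /absum_norm; apply: absum_le => i; rewrite ger0_norm// /pp.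
by rewrite ge_max ler_norm normr_ge0.
Qed.
Let snn f : absum f -> absum (nn f).
Proof.
move=> /absum_norm; apply: absum_le => i; rewrite ger0_norm// /nn.
by rewrite ge_max -normrN ler_norm normr_ge0.
Qed.

Lemma eq_asum f g : f =1 g -> asum f = asum g.
Proof. by move=> /funext ->. Qed.

Lemma asum_posneg f : absum f -> asum f = asum (pp f) - asum (nn f).
Proof.
by move=> sf; rewrite -(asumB_ge0 (spp sf) (snn sf))//; apply: eq_asum; exact: ppE.
Qed.

Lemma asumD f g : absum f -> absum g ->
  asum (fun i => f i + g i) = asum f + asum g.
Proof.
move=> sf sg.
rewrite (eq_asum (g := fun i => (pp f i + pp g i) - (nn f i + nn g i))); last first.
  by move=> i; rewrite {1}(ppE f) {1}(ppE g); ring.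
have p1 := spp sf; have p2 := spp sg; have n1 := snn sf; have n2 := snn sg.
rewrite asumB_ge0; try by [exact: absumD | move=> i; rewrite addr_ge0].
by rewrite !asumD_ge0// (asum_posneg sf) (asum_posneg sg); ring.
Qed.

Lemma asumN f : absum f -> asum (fun i => - f i) = - asum f.
Proof.
move=> sf; rewrite (eq_asum (g := fun i => nn f i - pp f i)); last first.
  by move=> i; rewrite {1}(ppE f) opprB.
rewrite (asumB_ge0 (snn sf) (spp sf))//.
by rewrite (asum_posneg sf) opprB.
Qed.

Lemma asumB f g : absum f -> absum g ->
  asum (fun i => f i - g i) = asum f - asum g.
Proof. by move=> sf sg; rewrite asumD ?asumN//; exact: absumN. Qed.

Lemma asum_ge0 f : (forall i, 0 <= f i) -> 0 <= asum f.
Proof.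
move=> f0; rewrite unlock /asum_def [X in _ - fine X]esum1 ?subr0.
  by apply: fine_ge0; apply: esum_ge0.
by move=> i _; rewrite funenegE /=; apply/max_idPr; rewrite lee_fin oppr_le0.
Qed.

Lemma ler_asum f g : absum f -> absum g -> (forall i, f i <= g i) ->
  asum f <= asum g.
Proof.
move=> sf sg fg; rewrite -subr_ge0 -asumB//; apply: asum_ge0 => i.
by rewrite subr_ge0.
Qed.

Lemma ler_norm_asum f g : absum g -> (forall i, `|f i| <= g i) ->
  `|asum f| <= asum g.
Proof.
move=> sg fg; have sf := absum_le fg sg; rewrite ler_norml -asumN//.
apply/andP; split; apply: ler_asum => //; first exact: absumN.
- by move=> i; have := fg i; rewrite ler_norml => /andP[].
- by move=> i; rewrite (le_trans (ler_norm _))// fg.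
Qed.

Lemma asum_finite (s : seq I) f : uniq s -> (forall i, i \notin s -> f i = 0) ->
  absum f /\ asum f = \sum_(i <- s) f i.
Proof.
move=> us fs.
have fin g : (forall i, i \notin s -> g i = 0) -> (forall i, 0 <= g i) ->
    (\esum_(i in [set: I]) (g i)%:E = (\sum_(i <- s) g i)%:E)%E.
  move=> gs g0.
  rewrite (_ : (\esum_(i in [set: I]) _)%E = (\esum_(i in [set` s]) (g i)%:E)%E).
    rewrite esum_fset; [|exact: finite_seq|by move=> i _; rewrite lee_fin].
    by rewrite -fsbig_seq// sumEFin.
  rewrite [RHS]esum_mkcond; apply: eq_esum => i _; case: ifPn => //.
  by rewrite notin_setE /= => /negP/gs ->.
have sf : absum f.
  rewrite /absum fin ?ltry// => i; first by move/fs ->; rewrite normr0.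
split=> //; rewrite asum_posneg//.
have -> : asum (pp f) = \sum_(i <- s) pp f i.
  apply: EFin_inj; rewrite asum_esum//; last exact: spp.
  by rewrite fin// => i /fs; rewrite /pp => ->; rewrite maxxx.
have -> : asum (nn f) = \sum_(i <- s) nn f i.
  apply: EFin_inj; rewrite asum_esum//; last exact: snn.
  by rewrite fin// => i /fs; rewrite /nn => ->; rewrite oppr0 maxxx.
by rewrite -sumrB; apply: eq_bigr => i _; rewrite -ppE.
Qed.

Lemma asum_zero : asum (fun=> 0) = 0.
Proof. by have [|_ ->] := @asum_finite [::] (fun=> 0) isT; rewrite ?big_nil. Qed.

Lemma asum_split (s : seq I) f : uniq s -> absum f ->
  asum f = \sum_(i <- s) f i + asum (fun i => if i \in s then 0 else f i).
Proof.
move=> us sf.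
have [s1 e1] := @asum_finite s (fun i => if i \in s then f i else 0) us
  ltac:(by move=> i /negbTE ->).
have s2 : absum (fun i => if i \in s then 0 else f i).
  by apply: absum_le (absum_norm sf) => i; case: ifP => // _; rewrite normr0.
rewrite (_ : \sum_(i <- s) f i = asum (fun i => if i \in s then f i else 0)).
  by rewrite -asumD//; apply: eq_asum => i; case: ifP => _; rewrite ?addr0 ?add0r.
by rewrite e1 !big_seq; apply: eq_bigr => i ->.
Qed.

Lemma asum_ge_sum (s : seq I) f : uniq s -> absum f ->
  (forall i, i \notin s -> 0 <= f i) -> \sum_(i <- s) f i <= asum f.
Proof.
move=> us sf f0; rewrite (asum_split us sf) lerDl; apply: asum_ge0 => i.
by case: ifPn => // /f0.
Qed.

Lemma asumZ f e : absum f -> asum (fun i => e * f i) = e * asum f.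
Proof.
move=> sf.
have pos (c : R) g : 0 <= c -> (forall i, 0 <= g i) -> absum g ->
    asum (fun i => c * g i) <= c * asum g.
  move=> c0 g0 sg; rewrite -lee_fin asum_esum; last 2 first.
  - by move=> i; rewrite mulr_ge0.
  - exact: absumZ.
  apply: ge_ereal_sup => _ [X [fX _] <-].
  rewrite fsumEFin// fsbig_finite//= -mulr_sumr lee_fin ler_wpM2l//.
  by apply: asum_ge_sum => // i _.
have pos' (c : R) g : 0 <= c -> (forall i, 0 <= g i) -> absum g ->
    asum (fun i => c * g i) = c * asum g.
  move=> c0 g0 sg; apply/eqP; rewrite eq_le pos//=.
  have [->|cn] := eqVneq c 0.
    by rewrite mul0r; apply: asum_ge0 => i; rewrite mul0r.
  have cp : 0 < c by rewrite lt_neqAle eq_sym cn.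
  rewrite mulrC -ler_pdivlMr// [_ / c]mulrC.
  apply: le_trans (pos c^-1 (fun i => c * g i) _ _ _).
  - by rewrite (_ : (fun i => c^-1 * (c * g i)) = g)//; apply/funext => i; rewrite mulKf.
  - by rewrite invr_ge0.
  - by move=> i; rewrite mulr_ge0.
  - exact: absumZ.
have nnc (c : R) : 0 <= c -> asum (fun i => c * f i) = c * asum f.
  move=> c0; rewrite (asum_posneg sf) mulrBr -!pos' //; [|exact: snn|exact: spp].
  rewrite -asumB; [|exact/absumZ/spp|exact/absumZ/snn].
  by apply: eq_asum => i; rewrite -mulrBr -ppE.
case: (leP 0 e) => [/nnc//|e0].
rewrite -[e]opprK mulNr -nnc ?oppr_ge0 ?ltW// -asumN; last exact: absumZ.
by apply: eq_asum => i; rewrite mulNr.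
Qed.

Lemma absum_tail g e : (forall i, 0 <= g i) -> absum g -> 0 < e ->
  exists2 s : seq I, uniq s & asum (fun i => if i \in s then 0 else g i) < e.
Proof.
move=> g0 sg e0.
have : ((asum g - e)%:E < \esum_(i in [set: I]) (g i)%:E)%E.
  by rewrite -asum_esum// lte_fin ltrBlDr ltrDl.
move=> /ereal_sup_gt[_ [X [fX _]] <-]; rewrite fsumEFin// fsbig_finite//= lte_fin => H.
exists (finmap.enum_fset (fset_set X)); first exact: finmap.fset_uniq.
by have := asum_split (finmap.fset_uniq (fset_set X)) sg; move: H; lra.
Qed.

(** Dominated convergence for sums: outside a finite set carrying almost all of
    the mass of [g] every term of the sequence is negligible, and finitely many
    indices converge simultaneously. *)
Lemma asum_dominated (f : nat -> I -> R) (l g : I -> R) :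
  absum g -> (forall n i, `|f n i| <= g i) ->
  (forall i, f ^~ i @ \oo --> l i) ->
  absum l /\ (fun n => asum (f n)) @ \oo --> asum l.
Proof.
move=> sg fg fl.
have g0 i : 0 <= g i by apply: le_trans (fg 0%N i).
have lg i : `|l i| <= g i.
  have h : (fun n => `|f n i|) @ \oo --> `|l i| by apply: cvg_norm.
  rewrite -(cvg_lim _ h)//; apply: limr_le; first by apply: cvgP h.
  by near=> n.
have sl := absum_le lg sg.
split=> //; apply/cvgrPdist_le => e e0.
have e3 : 0 < e / 4 by rewrite divr_gt0.
have [s us ts] := absum_tail g0 sg e3.
have sf n : absum (f n) by exact: absum_le (fg n) sg.
have cs : (fun n => \sum_(i <- s) f n i) @ \oo --> \sum_(i <- s) l i.
  by apply: cvg_big => //; exact: add_continuous.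
move/cvgrPdist_le : cs => /(_ _ e3) cs.
near=> n.
have : `|\sum_(i <- s) l i - \sum_(i <- s) f n i| <= e / 4 by near: n; apply: cs.
rewrite (asum_split us sl) (asum_split us (sf n)).
set A := \sum_(_ <- _) _; set B := asum _; set C := \sum_(_ <- _) _; set D := asum _.
move=> h1.
have st : absum (fun i => if i \in s then 0 else g i).
  by apply: absum_le sg => i; case: ifP; rewrite ?normr0 ?ger0_norm.
have h2 : `|B| <= e / 4.
  apply: le_trans (ltW ts); apply: ler_norm_asum => // i.
  by case: ifP; rewrite ?normr0.
have h3 : `|D| <= e / 4.
  apply: le_trans (ltW ts); apply: ler_norm_asum => // i.
  by case: ifP; rewrite ?normr0.
by move: h1 h2 h3; rewrite !ler_norml; lra.
Unshelve. all: by end_near.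
Qed.

End AbsoluteSums.

Section Reindexing.
Variables (R : realType).

Lemma absum_inj (I J : choiceType) (e : I -> J) (f : J -> R) :
  injective e -> absum f -> absum (f \o e).
Proof.
move=> ie; apply: le_lt_trans.
rewrite -(@esum_image R I J [set: I] e (fun j => `|f j|%:E)); last first.
  by move=> x y _ _ /ie.
by rewrite [leLHS]esum_mkcond; apply: le_esum => j _; case: ifP => // _; rewrite lee_fin.
Qed.

Lemma asum_reindex (I J : choiceType) (e : I -> J) (e' : J -> I) (f : J -> R) :
  cancel e e' -> cancel e' e -> asum f = asum (f \o e).
Proof.
move=> K K'; have b : set_bij [set: I] [set: J] e.
  by split=> // [x y _ _ /(can_inj K)//|y _]; exists (e' y).
by rewrite !unlock /asum_def !(reindex_esum _ _ _ _ b).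
Qed.

Lemma esum_prod (I J : choiceType) (F : I * J -> \bar R) :
  (forall p, 0 <= F p)%E ->
  (\esum_(p in [set: I * J]) F p =
   \esum_(i in [set: I]) \esum_(j in [set: J]) F (i, j))%E.
Proof.
move=> F0; rewrite (@esum_esum R I J setT (fun=> setT) (fun i j => F (i, j)))//.
rewrite (_ : setT `*`` (fun=> setT) = [set: I * J]); last by apply/seteqP; split.
by apply: eq_esum => -[].
Qed.

Lemma absum_prod (I J : choiceType) (f : I * J -> R) :
  (forall i, absum (fun j => f (i, j))) ->
  absum (fun i => asum (fun j => `|f (i, j)|)) -> absum f.
Proof.
move=> s1 s2; rewrite /absum esum_prod; last by move=> p; rewrite lee_fin.
apply: le_lt_trans s2; apply: le_esum => i _.
rewrite -asum_esum//; last exact: absum_norm.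
by rewrite lee_fin ler_norm.
Qed.

Lemma absum_mul (I J : choiceType) (f : I -> R) (g : J -> R) :
  absum f -> absum g -> absum (fun p : I * J => f p.1 * g p.2).
Proof.
move=> sf sg; apply: absum_prod => /= [i|]; first exact: absumZ.
rewrite (_ : (fun _ => _) = fun i => asum (fun j => `|g j|) * `|f i|).
  exact/absumZ/absum_norm.
apply/funext => i; rewrite mulrC -asumZ; last exact: absum_norm.
by apply: eq_asum => j; rewrite normrM.
Qed.

Lemma asum_fubini_ge0 (I J : choiceType) (f : I * J -> R) :
  (forall p, 0 <= f p) -> absum f ->
  [/\ forall i, absum (fun j => f (i, j)),
      absum (fun i => asum (fun j => f (i, j)))
    & asum f = asum (fun i => asum (fun j => f (i, j)))].
Proof.
move=> f0 sf.
have s1 i : absum (fun j => f (i, j)).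
  by apply: (@absum_inj _ _ (fun j => (i, j)) f) => // x y [].
have E : (\esum_(i in [set: I]) (asum (fun j => f (i, j)))%:E
          = \esum_(p in [set: I * J]) (f p)%:E)%E.
  rewrite esum_prod; last by move=> p; rewrite lee_fin.
  by apply: eq_esum => i _; rewrite asum_esum.
have s2 : absum (fun i => asum (fun j => f (i, j))).
  rewrite /absum (eq_esum (b := fun i => (asum (fun j => f (i, j)))%:E)).
    by rewrite E -asum_esum// ltry.
  by move=> i _; rewrite ger0_norm ?asum_ge0.
split=> //; apply: EFin_inj; rewrite !asum_esum// => i; exact: asum_ge0.
Qed.

Lemma asum_fubini (I J : choiceType) (f : I * J -> R) :
  absum f ->
  [/\ forall i, absum (fun j => f (i, j)),
      absum (fun i => asum (fun j => f (i, j)))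
    & asum f = asum (fun i => asum (fun j => f (i, j)))].
Proof.
move=> sf.
have s1 i : absum (fun j => f (i, j)).
  by apply: (@absum_inj _ _ (fun j => (i, j)) f) => // x y [].
have sn := absum_norm sf.
have sp : absum (fun p => f p + `|f p|) by exact: absumD.
have p0 p : 0 <= f p + `|f p| by have := ler_norm (- f p); rewrite normrN; lra.
have [a1 a2 a3] := asum_fubini_ge0 p0 sp.
have [b1 b2 b3] := asum_fubini_ge0 (fun p => normr_ge0 (f p)) sn.
have E i : asum (fun j => f (i, j)) =
    asum (fun j => f (i, j) + `|f (i, j)|) - asum (fun j => `|f (i, j)|).
  by rewrite asumD ?addrK//; exact/absum_norm.
have EE : (fun i => asum (fun j => f (i, j))) = fun i =>
    asum (fun j => f (i, j) + `|f (i, j)|) - asum (fun j => `|f (i, j)|).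
  exact/funext.
split=> //; first by rewrite EE; exact: absumB.
by rewrite EE asumB// -a3 -b3 asumD// addrK.
Qed.

Lemma absum_geometric (q : R) : 0 <= q < 1 -> absum (fun n : nat => q ^+ n).
Proof.
move=> /andP[q0 q1]; apply: (@le_lt_trans _ _ ((1 - q)^-1)%:E); last exact: ltry.
apply: ge_ereal_sup => _ [X [fX _] <-].
rewrite fsumEFin// lee_fin fsbig_finite//=.
move: (finmap.fset_uniq (fset_set X)); move: (finmap.enum_fset _) => s us.
have [N XN] : exists N, forall i, i \in s -> (i < N)%N.
  by exists (\max_(k <- s) k).+1 => i iX; rewrite ltnS; apply: leq_bigmax_seq.
have H : \sum_(i <- s) `|q ^+ i| <= \sum_(0 <= i < N) q ^+ i.
  rewrite [leRHS](bigID (mem s))/=.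
  rewrite (_ : \sum_(0 <= i < N | i \in s) q ^+ i = \sum_(i <- s) `|q ^+ i|).
    by rewrite lerDl; apply: sumr_ge0 => i _; exact: exprn_ge0.
  under [RHS]eq_bigr do rewrite ger0_norm ?exprn_ge0//.
  rewrite -[LHS]big_filter; apply: perm_big; apply: uniq_perm => //.
    by rewrite filter_uniq// iota_uniq.
  move=> i; rewrite mem_filter mem_index_iota /=.
  by case: (boolP (i \in s)) => //= /XN ->.
apply: le_trans H _; rewrite big_mkord.
have q1' : 1 - q != 0 by rewrite subr_eq0 eq_sym lt_eqF.
rewrite -[leRHS]mul1r ler_pdivlMr ?subr_gt0// mulrC -opprB mulNr -subrX1.
by rewrite opprB gerBl exprn_ge0.
Qed.

Lemma absum_geometric_int (q : R) : 0 <= q < 1 -> absum (fun n : int => q ^+ `|n|%N).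
Proof.
move=> q01; have /andP[q0 q1] := q01.
have sb : absum (fun _ : bool => 1 : R).
  by have [] := @asum_finite R bool [:: true; false] (fun=> 1) isT; case.
have := absum_mul sb (absum_geometric q01).
move=> /(@absum_inj _ _ (fun n : int => match n with Posz k => (true, k) | Negz k => (false, k) end)).
move=> /(_ ltac:(by move=> [?|?] [?|?] [] // ->)).
apply: le_lt_trans; apply: le_esum => -[k|k] _; rewrite lee_fin /= mul1r ?normrX//.
by rewrite exprS ler_piMl ?exprn_ge0// ltW// ger0_norm.
Qed.

End Reindexing.

Section GaussianSums.
Variables (R : realType) (I : choiceType).

(** All lattice sums of this development are dominated by Gaussian sums of such
    families; the rate c is arbitrary, so half of it can always be spent on
    absorbing a polynomial factor. *)
Definition gsummable (q : I -> R) : Prop :=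
  (forall i, 0 <= q i) /\ forall c : R, 0 < c -> absum (fun i => expR (- (c * q i))).

Lemma expR_mul_le (c x : R) : 0 < c -> 0 <= x ->
  x * expR (- (c * x)) <= 2 / c * expR (- (c / 2 * x)).
Proof.
move=> c0 x0.
have c2 : 0 < c / 2 by rewrite divr_gt0.
have h := expR_ge1Dx (c / 2 * x).
rewrite (_ : - (c * x) = - (c / 2 * x) + - (c / 2 * x)); last by field.
rewrite expRD mulrA ler_wpM2r ?expR_ge0// expRN ler_pdivrMr ?expR_gt0//.
rewrite [leLHS](_ : x = 2 / c * (c / 2 * x)); last by field; rewrite gt_eqF.
by rewrite ler_wpM2l ?divr_ge0 ?ltW//; move: h; lra.
Qed.

Lemma absum_qexp (q : I -> R) (c : R) : gsummable q -> 0 < c ->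
  absum (fun i => q i * expR (- (c * q i))).
Proof.
move=> [q0 sq] c0; apply: (@absum_le _ _ _ (fun i => 2 / c * expR (- (c / 2 * q i)))).
  by move=> i; rewrite ger0_norm ?mulr_ge0 ?expR_ge0// expR_mul_le.
by apply: absumZ; apply: sq; rewrite divr_gt0.
Qed.

Lemma absum_q2exp (q : I -> R) (c : R) : gsummable q -> 0 < c ->
  absum (fun i => q i ^+ 2 * expR (- (c * q i))).
Proof.
move=> sq c0; have q0 := sq.1.
have c2 : 0 < c / 2 by rewrite divr_gt0.
apply: (@absum_le _ _ _ (fun i => 2 / c * (q i * expR (- (c / 2 * q i))))); last first.
  by apply: absumZ; exact: absum_qexp.
move=> i; rewrite ger0_norm ?mulr_ge0 ?exprn_ge0 ?expR_ge0// expr2 -mulrA.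
by rewrite [leRHS]mulrCA ler_wpM2l// expR_mul_le.
Qed.

Lemma expR_taylor1 (x : R) : 0 <= expR x - 1 - x <= x ^+ 2 * expR `|x|.
Proof.
have h1 := expR_ge1Dx x.
have h2 : expR x - 1 <= x * expR x.
  have := expR_ge1Dx (- x); rewrite expRN => h.
  have : (1 - x) * expR x <= (expR x)^-1 * expR x by rewrite ler_wpM2r ?expR_ge0//; lra.
  by rewrite mulVf ?gt_eqF ?expR_gt0//; lra.
apply/andP; split; first by lra.
case: (leP 0 x) => x0.
  rewrite ger0_norm//.
  have : x * (expR x - 1) <= x * (x * expR x) by rewrite ler_wpM2l.
  by have := h2; nra.
rewrite ltr0_norm//.
have e1 : 1 <= expR (- x) by rewrite -expR0 ler_expR; lra.
have : x ^+ 2 <= x ^+ 2 * expR (- x) by rewrite ler_peMr// sqr_ge0.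
have := expR_gt0 x; nra.
Qed.

(** Termwise differentiation of a Gaussian sum: the second-order Taylor
    remainder of each term is bounded by a summable family. *)
Lemma is_derive_gsum (q : I -> R) (s : R) : gsummable q -> 0 < s ->
  is_derive s 1 (fun s => asum (fun i => expR (- (s * q i))))
    (- asum (fun i => q i * expR (- (s * q i)))).
Proof.
move=> sq s0; have q0 := sq.1.
set F := fun s => _; set D := asum _.
have s2 : 0 < s / 2 by rewrite divr_gt0.
pose M := asum (fun i => q i ^+ 2 * expR (- (s / 2 * q i))).
have M0 : 0 <= M.
  by apply: asum_ge0 => i; rewrite mulr_ge0 ?exprn_ge0 ?expR_ge0.
have key h : `|h| <= s / 2 -> `|F (s + h) - F s + h * D| <= h ^+ 2 * M.
  move=> hs; have hs' := hs; move: hs'; rewrite ler_norml => /andP[hs1 hs2].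
  have sh0 : 0 < s + h by lra.
  have := absum_qexp sq s0 => sqe.
  rewrite /F /D -asumZ// -asumB; [|exact: sq.2..].
  rewrite -asumD; [|by apply: absumB; exact: sq.2|exact: absumZ].
  rewrite -asumZ; last exact: absum_q2exp.
  apply: ler_norm_asum => [|i]; first by apply: absumZ; exact: absum_q2exp.
  have := expR_taylor1 (- (h * q i)) => /andP[t0 t1].
  rewrite (_ : - ((s + h) * q i) = - (s * q i) + - (h * q i)); last by ring.
  rewrite expRD (_ : _ + _ = expR (- (s * q i)) * (expR (- (h * q i)) - 1 - - (h * q i))); last by ring.
  rewrite ger0_norm ?mulr_ge0 ?expR_ge0//.
  apply: (@le_trans _ _ (expR (- (s * q i)) * ((- (h * q i)) ^+ 2 * expR `|- (h * q i)|))).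
    by rewrite ler_wpM2l ?expR_ge0.
  rewrite (_ : expR _ * _ = h ^+ 2 * (q i ^+ 2 * (expR (- (s * q i)) * expR `|- (h * q i)|))); last by ring.
  rewrite ler_wpM2l ?sqr_ge0// ler_wpM2l ?sqr_ge0// -expRD ler_expR normrN normrM (ger0_norm (q0 i)).
  have : `|h| * q i <= s / 2 * q i by rewrite ler_wpM2r.
  by lra.
have H : h^-1 *: (F (h *: 1 + s) - F s) @[h --> 0^'] --> - D.
  apply/cvgrPdist_le => e e0; near=> h.
  have h0 : h != 0 by near: h; exact: nbhs_dnbhs_neq.
  have hs : `|h| <= s / 2.
    near: h; apply: dnbhs0_le => //.
  have he : `|h| <= e / (M + 1).
    near: h; apply: dnbhs0_le; rewrite divr_gt0//; lra.
  have k1 := key h hs.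
  rewrite /GRing.scale /= mulr1 [h + s]addrC.
  rewrite (_ : - D - _ = - h^-1 * (F (s + h) - F s + h * D)); last first.
    by move: (F (s + h)) (F s) => A B; field.
  rewrite normrM normrN normfV ler_pdivrMl ?normr_gt0//.
  apply: (le_trans k1); rewrite -real_normK ?num_real// expr2 -mulrA ler_wpM2l//.
  apply: (le_trans (ler_wpM2r M0 he)).
  by rewrite mulrAC ler_pdivrMr ?ler_wpM2l ?ltW//; lra.
by apply: DeriveDef; [exact: cvgP H|exact: cvg_lim H].
Unshelve. all: by end_near.
Qed.

End GaussianSums.

(** * A finite theta identity *)

Section Calculus.
Variable R : realType.
Implicit Types (f : R -> R) (a b x : R).

Lemma MVT_is_derive f (f' : R -> R) a b : a < b ->
  (forall x, a <= x <= b -> is_derive x 1 f (f' x)) ->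
  exists2 c, a < c < b & f b - f a = f' c * (b - a).
Proof.
move=> ab df.
have [||c cab ->] := @MVT R f f' a b ab.
- by move=> x /[!in_itv]/= /andP[ax xb]; apply: df; rewrite !ltW.
- apply/continuous_in_subspaceT => x; rewrite inE /= in_itv /= => xab.
  by have [h _] := df _ xab; exact/differentiable_continuous/derivable1_diffP.
by exists c.
Qed.

Lemma is_derive_ge0_le f (f' : R -> R) a b : a <= b ->
  (forall x, a <= x <= b -> is_derive x 1 f (f' x)) ->
  (forall x, a <= x <= b -> 0 <= f' x) -> f a <= f b.
Proof.
rewrite le_eqVlt => /predU1P[->//|ab] df f0.
have [c /andP[ac cb] E] := MVT_is_derive ab df.
rewrite -subr_ge0 E mulr_ge0 ?subr_ge0 ?f0 ?ltW//.
Qed.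

Lemma sin_le_id x : 0 <= x -> sin x <= x.
Proof.
move=> x0; pose f := fun y : R => y - sin y.
have : f 0 <= f x.
  by apply: (is_derive_ge0_le (f' := fun y => 1 - cos y)) => // y _; rewrite subr_ge0 cos_le1.
by rewrite /f sin0; lra.
Qed.

Lemma cos_ge_quad x : 1 - x ^+ 2 / 2 <= cos x.
Proof.
wlog x0 : x / 0 <= x.
  move=> H; case: (leP 0 x) => [/H//|x0].
  by rewrite -cosN -sqrrN; apply: H; lra.
pose f := fun y : R => cos y + 2^-1 * y ^+ 2.
have : f 0 <= f x.
  apply: (is_derive_ge0_le (f' := fun y => - sin y + y)) => //.
    move=> y _; apply: is_derive_eq.
    by rewrite /GRing.scale /=; field.
  by move=> y /andP[y0 _]; have := sin_le_id y0; lra.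
by rewrite /f cos0 expr0n /=; lra.
Qed.

Lemma sin_ge_mul_cos x : 0 <= x <= pi -> x * cos x <= sin x.
Proof.
move=> /andP[x0 xpi]; pose f := fun y : R => sin y - y * cos y.
have : f 0 <= f x.
  apply: (is_derive_ge0_le (f' := fun y => y * sin y)) => //.
    move=> y _; apply: is_derive_eq.
    by rewrite /GRing.scale /=; ring.
  move=> y /andP[y0 yx]; rewrite mulr_ge0// sin_ge0_pi// y0/=; lra.
by rewrite /f sin0; lra.
Qed.

Lemma sin_ge_half x : 0 <= x <= pi / 2 -> x / 2 <= sin x.
Proof.
move=> /andP[x0 xpi]; have pi0 := pi_gt0 R.
have h := @sin_ge_mul_cos (x / 2) ltac:(lra).
have c0 : 0 <= cos (x / 2) by apply: cos_ge0_pihalf; lra.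
have c1 : 0 <= cos x by apply: cos_ge0_pihalf; lra.
have e1 : sin x = 2 * (sin (x / 2) * cos (x / 2)).
  rewrite {1}(_ : x = x / 2 *+ 2); last by rewrite -mulr_natr; field.
  by rewrite sin_mulr2n; ring.
have e2 : cos x = 2 * cos (x / 2) ^+ 2 - 1.
  rewrite {1}(_ : x = x / 2 *+ 2); last by rewrite -mulr_natr; field.
  by rewrite cos_mulr2n; ring.
rewrite e1; nra.
Qed.

End Calculus.

Section FiniteTheta.
Variable R : realType.
Implicit Types (M n : nat) (j k u : int).

(** The binomial weights are the Fourier coefficients of (cos (y / 2)) ^ (2 M),
    and tend to a Gaussian after rescaling. *)
Definition bweight M u : R := 'C(M.*2, M + `|u|)%:R / 4 ^+ M.

Lemma bweight_ge0 M u : 0 <= bweight M u.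
Proof. by rewrite divr_ge0 ?exprn_ge0. Qed.

Lemma bweightN M u : bweight M (- u) = bweight M u.
Proof. by rewrite /bweight abszN. Qed.

Lemma bweight0 u : bweight 0 u = (u == 0)%:R.
Proof.
rewrite /bweight double0 add0n expr0 divr1 bin0n.
by rewrite absz_eq0.
Qed.

Lemma bweightS M u : bweight M.+1 u =
  bweight M (u - 1) / 4 + bweight M u / 2 + bweight M (u + 1) / 4.
Proof.
wlog : u / (0 <= u)%R.
  move=> H; case: (leP 0 u) => [/H//|u0].
  have := H (- u) ltac:(by rewrite oppr_ge0 ltW).
  rewrite !bweightN.
  rewrite (_ : - u - 1 = - (u + 1)); last by ring.
  rewrite (_ : - u + 1 = - (u - 1)); last by ring.
  by rewrite !bweightN => ->; ring.
case: u => // u _.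
have bin2 (m k : nat) : 'C(m.+2, k.+2) = ('C(m, k) + 2 * 'C(m, k.+1) + 'C(m, k.+2))%N.
  by rewrite !binS; lia.
rewrite /bweight doubleS.
case: u => [|u].
  rewrite sub0r add0r !addn0 addn1.
  rewrite (_ : 'C(M.*2.+2, M.+1) = 2 * ('C(M.*2, M) + 'C(M.*2, M.+1)))%N; last first.
    rewrite binS (_ : 'C(M.*2.+1, M) = 'C(M.*2.+1, M.+1)); last first.
      by rewrite -(@bin_sub M.*2.+1 M)//; [congr ('C(_, _)); lia|lia].
    by rewrite binS; lia.
  by rewrite natrM natrD exprS; field; rewrite expf_neq0.
have -> : `|(Posz u.+1 - 1)%R|%N = u by lia.
have -> : `|(Posz u.+1 + 1)%R|%N = u.+2 by lia.
have -> : (M.+1 + u.+1 = (M + u).+2)%N by lia.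
have -> : `|Posz u.+1|%N = u.+1 by [].
rewrite !addnS (bin2 M.*2 (M + u)%N) natrD natrD natrM exprS; field.
by rewrite expf_neq0.
Qed.

Lemma absum_bweight M : absum (bweight M).
Proof.
elim: M => [|M IH].
  have [] // := @asum_finite R int [:: 0] (bweight 0) isT.
  by move=> i; rewrite inE bweight0 => /negbTE ->.
rewrite (_ : bweight M.+1 = fun u => 4^-1 * bweight M (u - 1) + 2^-1 * bweight M u + 4^-1 * bweight M (u + 1)).
  have s1 : absum (fun u => bweight M (u - 1)) by apply: (absum_inj (e := fun u : int => u - 1)) IH; exact: addIr.
  have s2 : absum (fun u => bweight M (u + 1)) by apply: (absum_inj (e := fun u : int => u + 1)) IH; exact: addIr.
  by apply: absumD; [apply: absumD|]; exact: absumZ.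
by apply/funext => u; rewrite bweightS; field.
Qed.

Lemma absum_bweight_prog M (N : nat) j : (0 < N)%N ->
  absum (fun k : int => bweight M (j + k * N%:Z)).
Proof.
move=> N0; apply: (absum_inj (e := fun k : int => j + k * N%:Z)) (absum_bweight M).
by move=> x y /addrI/(mulIf _); apply; lia.
Qed.

Lemma cos_int (m : int) : cos (2 * pi * m%:~R) = 1 :> R.
Proof.
have nat_case n : cos (2 * pi * n%:R) = 1 :> R.
  elim: n => [|n IH]; first by rewrite mulr0 cos0.
  rewrite (_ : 2 * pi * n.+1%:R = 2 * pi * n%:R + pi *+ 2); first by rewrite cosD2pi.
  by rewrite -natr1 -[_ *+ 2]mulr_natr; ring.
case: m => n; first exact: nat_case.
by rewrite NegzE mulrNz mulrN cosN; exact: nat_case.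
Qed.

Lemma sin_pi_int (m : int) : sin (pi * m%:~R) = 0 :> R.
Proof.
have nat_case n : sin (pi * n%:R) = 0 :> R.
  elim: n => [|n IH]; first by rewrite mulr0 sin0.
  by rewrite -natr1 mulrDr mulr1 sinD IH sinpi mul0r mulr0 addr0.
case: m => n; first exact: nat_case.
by rewrite NegzE mulrNz mulrN sinN nat_case oppr0.
Qed.

(** The denominator in the closed form of a sum of cosines in arithmetic
    progression. *)
Lemma sin_pi_frac_neq0 (N : nat) j : (0 < N)%N -> ~~ (N%:Z %| j)%Z ->
  sin (pi * j%:~R / N%:R) != 0 :> R.
Proof.
move=> N0 Nj.
have [q [r [jE [r0 rN]]]] : exists q r, j = q * N%:Z + r%:Z /\ (0 < r)%N /\ (r < N)%N.
  exists (j %/ N%:Z)%Z, `|(j %% N%:Z)%Z|%N.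
  have h0 : (0 <= j %% N%:Z)%Z by apply: modz_ge0; lia.
  have h1 : (j %% N%:Z)%Z < N%:Z by apply: ltz_pmod; lia.
  have h2 := divz_eq j N%:Z.
  have h3 : (j %% N%:Z)%Z != 0 by apply: contra Nj => /eqP/dvdz_mod0P.
  by split; [lia|split; lia].
have NR : N%:R != 0 :> R by rewrite pnatr_eq0 -lt0n.
rewrite jE (_ : pi * _ / N%:R = pi * q%:~R + pi * r%:R / N%:R); last first.
  by rewrite intrD intrM; field.
rewrite sinD sin_pi_int mul0r add0r mulf_eq0 negb_or; apply/andP; split.
  apply/eqP => c0; have := cos2Dsin2 (pi * q%:~R : R).
  by rewrite c0 sin_pi_int expr0n addr0 => /esym/eqP; rewrite oner_eq0.
rewrite gt_eqF//; apply: sin_gt0_pi; apply/andP; split.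
  by rewrite divr_gt0 ?mulr_gt0 ?pi_gt0 ?ltr0n.
by rewrite ltr_pdivrMr ?ltr0n// ltr_pM2l ?pi_gt0// ltr_nat.
Qed.

Let theta_lhs M n j : R :=
  let N := n.*2.+1 in
  \sum_(i < N) cos (pi * (i%:R - n%:R) / N%:R) ^+ M.*2 * cos (2 * pi * (i%:R - n%:R) * j%:~R / N%:R).

Lemma sum_cos_progression n j : let N := n.*2.+1 in
  \sum_(i < N) cos (2 * pi * (i%:R - n%:R) * j%:~R / N%:R) = N%:R * (N%:Z %| j)%Z%:R :> R.
Proof.
move=> N; have N0 : N%:R != 0 :> R by rewrite pnatr_eq0.
have NE : N%:R = 2 * n%:R + 1 :> R by rewrite /N -natr1 -muln2 natrM mulrC.
case: (boolP (N%:Z %| j)%Z) => [/dvdzP[q ->]|Nj].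
  rewrite mulr1 (eq_bigr (fun=> 1)) ?sumr_const ?card_ord// => i _.
  rewrite (_ : _ / _ = 2 * pi * (((i : nat)%:Z - n%:Z) * q)%:~R) ?cos_int//.
  by rewrite !intrM intrB; field.
rewrite mulr0; have s0 := @sin_pi_frac_neq0 N j isT Nj.
apply: (mulfI s0); rewrite mulr0 mulr_sumr.
pose F (m : nat) : R := sin (pi * j%:~R / N%:R * (2 * m%:R - 2 * n%:R - 1)) / 2.
rewrite (eq_bigr (fun i : 'I_N => F i.+1 - F i)); last first.
  move=> i _; rewrite /F -[i.+1%:R]natr1.
  set a := pi * j%:~R / N%:R; set c := cos _.
  rewrite (_ : a * (2 * (i%:R + 1) - _ - _) = a * (2 * (i%:R - n%:R)) + a); last by ring.
  rewrite (_ : a * (2 * i%:R - _ - _) = a * (2 * (i%:R - n%:R)) - a); last by ring.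
  rewrite sinD sinB (_ : c = cos (a * (2 * (i%:R - n%:R)))); first by field.
  by congr cos; rewrite /a; field.
rewrite -(big_mkord xpredT (fun i => F i.+1 - F i)) telescope_sumr//.
rewrite /F mulr0 sub0r (_ : _ / N%:R * (2 * N%:R - _ - 1) = pi * j%:~R); last first.
  by rewrite NE; field; rewrite -NE.
rewrite (_ : _ / N%:R * (- _ - 1) = - (pi * j%:~R)); last first.
  by rewrite NE; field; rewrite -NE.
by rewrite sinN sin_pi_int oppr0 mul0r subrr.
Qed.

(** The finite analogue of Poisson summation, following Polya: sampling the
    trigonometric polynomial cos ^ (2 M) at N equidistant points folds its
    Fourier coefficients modulo N. The induction on M multiplies by cos ^ 2 on
    one side and uses Pascal's rule [bweightS] on the other; the case M = 0 is
    the orthogonality of characters. *)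
Lemma finite_theta M n j : theta_lhs M n j =
  n.*2.+1%:R * asum (fun k : int => bweight M (j + k * n.*2.+1%:Z)).
Proof.
rewrite /theta_lhs; set N := n.*2.+1.
have N0 : N%:R != 0 :> R by rewrite pnatr_eq0.
elim: M j => [|M IH] j.
  rewrite (eq_bigr (fun i : 'I_N => cos (2 * pi * (i%:R - n%:R) * j%:~R / N%:R))); last first.
    by move=> i _; rewrite expr0 mul1r.
  rewrite sum_cos_progression -/N; congr (_ * _).
  case: (boolP (N%:Z %| j)%Z) => [/dvdzP[q jE]|Nj].
    have [|_ ->] := @asum_finite R int [:: - q] (fun k : int => bweight 0 (j + k * N%:Z)) isT.
      move=> i; rewrite inE bweight0 jE => iq; case: eqP => // h.
      by move: iq; rewrite (_ : i = - q) ?eqxx//; nia.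
    by rewrite big_seq1 bweight0 jE mulNr subrr eqxx.
  rewrite (eq_asum (g := fun=> 0)) ?asum_zero// => k; rewrite bweight0; case: eqP => // h.
  by case/negP: Nj; apply/dvdzP; exists (- k); lia.
have s0 := absum_bweight_prog M j (ltn0Sn n.*2).
have s1 := absum_bweight_prog M (j - 1) (ltn0Sn n.*2).
have s2 := absum_bweight_prog M (j + 1) (ltn0Sn n.*2).
rewrite (eq_asum (g := fun k => 4^-1 * bweight M (j - 1 + k * N%:Z) +
   2^-1 * bweight M (j + k * N%:Z) + 4^-1 * bweight M (j + 1 + k * N%:Z))); last first.
  move=> k; rewrite bweightS (_ : j + _ - 1 = j - 1 + k * N%:Z); last by ring.
  by rewrite (_ : j + _ + 1 = j + 1 + k * N%:Z); [field|ring].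
rewrite asumD; [|by apply: absumD; exact: absumZ|exact: absumZ].
rewrite asumD; [|exact: absumZ..].
rewrite !asumZ// [RHS]mulrDr [X in _ = X + _]mulrDr !(mulrCA N%:R) -!IH !mulr_sumr -!big_split /=.
apply: eq_bigr => i _.
set y := (i%:R - n%:R : R).
rewrite doubleS 2!exprS (_ : 2 * pi * y * (j - 1)%:~R / N%:R = 2 * pi * y * j%:~R / N%:R - pi * y / N%:R *+ 2); last first.
  by rewrite intrB -[_ *+ 2]mulr_natr; field.
rewrite (_ : 2 * pi * y * (j + 1)%:~R / N%:R = 2 * pi * y * j%:~R / N%:R + pi * y / N%:R *+ 2); last first.
  by rewrite intrD -[_ *+ 2]mulr_natr; field.
move: (2 * pi * y * j%:~R / N%:R) (pi * y / N%:R) => A B.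
by rewrite (cosB A) (cosD A) cos_mulr2n -[_ *+ 2]mulr_natr; field.
Qed.

End FiniteTheta.

(** * The theta transformation as a limit of finite identities *)

Section PoissonLimit.
Variable R : realType.
Implicit Types (M n : nat) (j k : int).

Lemma gsummable_shift (x : R) : gsummable (fun k : int => (k%:~R + x) ^+ 2).
Proof.
split=> [i|c c0]; first exact: sqr_ge0.
have q0 : 0 <= expR (- (2 * c)) < (1 : R) by rewrite expR_ge0 expR_lt1; lra.
apply: absum_le (absumZ (expR (c * (2 * `|x| + 1))) (absum_geometric_int q0)) => k /=.
rewrite ger0_norm ?expR_ge0// -expRM_natl -expRD ler_expR.
have h1 : `|(k%:~R : R)| <= `|k%:~R + x| + `|x|.
  by rewrite -{1}(addrK x k%:~R); apply: ler_normB.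
have h2 : (`|k|%N%:R : R) = `|k%:~R| by rewrite natr_absz intr_norm.
rewrite h2 -[(_ + x) ^+ 2]real_normK ?num_real//.
have := sqr_ge0 (`|k%:~R + x| - 1 : R).
move: h1; set a := `|_ + x|; set b := `|k%:~R|; set d := `|x| => h1 h3; nra.
Qed.

(** The binomial weights divided by the central one: these tend to a Gaussian
    without any knowledge of the size of the central coefficient. *)
Let rho M (u : nat) : R := 'C(M.*2, M + u)%:R / 'C(M.*2, M)%:R.

Let binM0 M : 0 < 'C(M.*2, M)%:R :> R.
Proof. by rewrite ltr0n bin_gt0 -addnn leq_addr. Qed.

Let rhoS M (u : nat) : (u <= M)%N -> rho M u.+1 = rho M u * ((M%:R - u%:R) / (M%:R + u%:R + 1)).
Proof.
move=> uM; rewrite /rho addnS [RHS]mulrAC; congr (_ / _).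
have := mul_bin_left M.*2 (M + u).
rewrite (_ : M.*2 - (M + u) = M - u)%N; last by rewrite -addnn; lia.
move=> /(congr1 (fun m : nat => m%:R : R)); rewrite !natrM natrB// => h.
have h0 : M%:R + u%:R + 1 != 0 :> R by rewrite gt_eqF// ltr_pwDr// addr_ge0.
apply: (mulfI h0); rewrite mulrC [_ * _ in RHS]mulrC mulrA divfK//.
by rewrite [RHS]mulrC -h mulrC -natr1 natrD.
Qed.

(** By induction on u: the quotient of consecutive ratios is bounded through
    1 + z <= exp z. *)
Lemma binomial_ratio_ub M (u : nat) : rho M u <= expR (- (u%:R ^+ 2 / (M%:R + u%:R))).
Proof.
have [Mu|] := leqP M.+1 u.
  by rewrite /rho bin_small ?mul0r ?expR_ge0// -addnn; lia.
elim: u => [_|u IH uM].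
  by rewrite expr0n mul0r oppr0 expR0 /rho addn0 divff// gt_eqF.
have uM' : (u < M.+1)%N by exact: ltnW.
rewrite rhoS//; apply: (@le_trans _ _ (expR (- (u%:R ^+ 2 / (M%:R + u%:R))) * expR (- ((2 * u%:R + 1) / (M%:R + u%:R + 1))))).
  apply: ler_pM => //; [by rewrite divr_ge0| |exact: IH|].
    by rewrite divr_ge0 ?subr_ge0 ?ler_nat ?addr_ge0.
  apply: le_trans (expR_ge1Dx _).
  have h0 : 0 < M%:R + u%:R + 1 :> R by rewrite ltr_pwDr// addr_ge0.
  rewrite ler_pdivrMr// mulrDl mul1r mulNr divfK ?gt_eqF//; lra.
rewrite -expRD ler_expR -opprD lerN2 -[u.+1%:R]natr1 addrA.
have M0 : 0 < M%:R :> R by rewrite ltr0n; lia.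
have h1 : 0 < M%:R + u%:R :> R by rewrite ltr_pwDl.
have h2 : 0 < M%:R + u%:R + 1 :> R by lra.
rewrite (_ : (_ + 1) ^+ 2 = u%:R ^+ 2 + (2 * u%:R + 1)); last by ring.
rewrite mulrDl lerD2r ler_wpM2l ?sqr_ge0// lef_pV2 ?posrE//; lra.
Qed.

Lemma binomial_ratio_lb M (u : nat) : (u < M)%N -> expR (- (u%:R ^+ 2 / (M%:R - u%:R))) <= rho M u.
Proof.
elim: u => [_|u IH uM].
  by rewrite expr0n mul0r oppr0 expR0 /rho addn0 divff// gt_eqF.
have uM' : (u < M)%N by exact: ltnW.
have h1 : 1 < M%:R - u%:R :> R by rewrite ltrBrDr nat1r ltr_nat.
rewrite (rhoS (ltnW uM')); apply: (@le_trans _ _ (expR (- (u%:R ^+ 2 / (M%:R - u%:R))) * expR (- ((2 * u%:R + 1) / (M%:R - u%:R))))).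
  rewrite -expRD ler_expR -opprD lerN2 -[u.+1%:R]natr1 -mulrDl opprD addrA.
  rewrite (_ : u%:R ^+ 2 + 2 * u%:R + 1 = (u%:R + 1) ^+ 2); last by ring.
  rewrite ler_wpM2l ?sqr_ge0// lef_pV2 ?posrE//; lra.
apply: ler_pM; rewrite ?expR_ge0 ?IH//.
rewrite expRN -[leRHS]invf_div lef_pV2 ?posrE ?expR_gt0//; last by rewrite divr_gt0//; lra.
rewrite [leLHS](_ : _ = 1 + (2 * u%:R + 1) / (M%:R - u%:R)) ?expR_ge1Dx//.
by field; rewrite gt_eqF//; lra.
Qed.

Let bweight_rho M (u : int) : bweight R M u = bweight R M 0 * rho M `|u|.
Proof.
by rewrite /bweight /rho addn0; field; rewrite expf_neq0// gt_eqF.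
Qed.

Lemma bweight_centralS M :
  bweight R M.+1 0 = bweight R M 0 * ((2 * M%:R + 1) / (2 * M%:R + 2)).
Proof.
rewrite bweightS sub0r add0r bweightN [bweight R M 1]bweight_rho rhoS//.
rewrite /rho addn0 divff ?gt_eqF// subr0 addr0 mul1r; field.
by rewrite !gt_eqF// ltr_wpDl ?mulr_ge0.
Qed.

(** The limit of M times the squared central weight exists by monotonicity. Its
    value 1 / pi is found afterwards, from the self-dual case of the
    transformation formula, which replaces Wallis' product. *)
Lemma central_binomial_cvg : exists2 c : R, 0 < c &
  (fun M => (bweight R M 0) ^+ 2 * M%:R) @ \oo --> c.
Proof.
pose a M := (bweight R M 0) ^+ 2 * M%:R.
have b0 M : 0 < bweight R M 0.
  by rewrite /bweight divr_gt0 ?exprn_gt0// addn0.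
have aS M : a M <= a M.+1.
  have h : 0 <= M%:R :> R by [].
  have key : M%:R <= ((2 * M%:R + 1) / (2 * M%:R + 2)) ^+ 2 * M.+1%:R :> R.
    rewrite expr_div_n mulrAC ler_pdivlMr ?exprn_gt0 ?ltr_wpDl ?mulr_ge0//.
    by rewrite -[M.+1%:R]natr1; nra.
  rewrite [a M.+1](_ : _ = bweight R M 0 ^+ 2 * (((2 * M%:R + 1) / (2 * M%:R + 2)) ^+ 2 * M.+1%:R)).
    by rewrite /a; apply: ler_wpM2l => //; exact: sqr_ge0.
  by rewrite /a bweight_centralS; move: (bweight _ _ _) (_ / _) => x y; ring.
have aub M : a M <= 1.
  suff : (bweight R M 0) ^+ 2 * (2 * M%:R + 1) <= 1.
    by rewrite /a; apply: le_trans; rewrite ler_wpM2l ?sqr_ge0//; have : 0 <= M%:R :> R by []; lra.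
  elim: M => [|M IH]; first by rewrite /bweight /= expr0 bin0 divr1; lra.
  have h : 0 <= M%:R :> R by [].
  have key : ((2 * M%:R + 1) / (2 * M%:R + 2)) ^+ 2 * (2 * M.+1%:R + 1) <= 2 * M%:R + 1 :> R.
    rewrite expr_div_n mulrAC ler_pdivrMr ?exprn_gt0 ?ltr_wpDl ?mulr_ge0//.
    by rewrite -[M.+1%:R]natr1; nra.
  apply: le_trans IH; apply: (le_trans _ (ler_wpM2l (sqr_ge0 (bweight R M 0)) key)).
  by rewrite bweight_centralS; move: (bweight _ _ _) (_ / _) => x y; lra.
have nd : nondecreasing_seq a by apply/nondecreasing_seqP.
have ca : cvgn a.
  by apply: nondecreasing_is_cvgn => //; exists 1 => _ [M _ <-].
exists (limn a); last exact: ca.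
apply: (@lt_le_trans _ _ (a 1%N)); first by rewrite /a mulr_gt0 ?exprn_gt0.
exact: nondecreasing_cvgn_le.
Qed.

Variables (tau x : R).
Hypothesis tau0 : 0 < tau.

Let N n : nat := n.*2.+1.
Let M n : nat := (Num.truncn (tau * (N n)%:R ^+ 2)).+1.
Let j n : int := Num.floor (x * (N n)%:R).

Let N0 n : 0 < (N n)%:R :> R. Proof. by rewrite ltr0n. Qed.
Let N1 n : 1 <= (N n)%:R :> R. Proof. by rewrite ler1n. Qed.

Let cN : (fun n => (N n)%:R^-1 : R) @ \oo --> (0 : R).
Proof.
apply: (@squeeze_cvgr _ _ _ _ (fun=> 0) (@harmonic R)); last 2 first.
- exact: cvg_cst.
- exact: cvg_harmonic.
near=> n; rewrite invr_ge0 ltW//= lef_pV2 ?posrE//.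
by rewrite ler_nat /N -addnn; lia.
Unshelve. all: by end_near.
Qed.

Let M_lb n : tau * (N n)%:R ^+ 2 <= (M n)%:R.
Proof. by rewrite ltW// /M truncnS_gt. Qed.

Let M_ub n : (M n)%:R <= tau * (N n)%:R ^+ 2 + 1.
Proof.
by rewrite /M -natr1 lerD2r truncn_le mulr_ge0 ?sqr_ge0 ?ltW.
Qed.

Let M0 n : 0 < (M n)%:R :> R. Proof. by rewrite ltr0n. Qed.

Let cM : (fun n => (M n)%:R / (N n)%:R ^+ 2 : R) @ \oo --> tau.
Proof.
apply: (@squeeze_cvgr _ _ _ _ (fun=> tau) (fun n => tau + (N n)%:R^-1 * (N n)%:R^-1)).
- near=> n; have n2 : 0 < (N n)%:R ^+ 2 :> R by rewrite exprn_gt0.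
  rewrite ler_pdivlMr// M_lb/= ler_pdivrMr// mulrDl.
  by rewrite -expr2 exprVn mulVf ?gt_eqF// M_ub.
- exact: cvg_cst.
- by rewrite -[X in _ --> X]addr0 -[X in _ + X](mulr0 0); apply: cvgD; [exact: cvg_cst|exact: cvgM].
Unshelve. all: by end_near.
Qed.

Let j_lb n : x - (N n)%:R^-1 <= (j n)%:~R / (N n)%:R.
Proof.
rewrite ler_pdivlMr// mulrBl mulVf ?gt_eqF// lerBlDr -intrD1.
exact/ltW/floorD1_gt.
Qed.

Let j_ub n : (j n)%:~R / (N n)%:R <= x.
Proof. by rewrite ler_pdivrMr// floor_le. Qed.

Let cj : (fun n => (j n)%:~R / (N n)%:R : R) @ \oo --> x.
Proof.
apply: (@squeeze_cvgr _ _ _ _ (fun n => x - (N n)%:R^-1) (fun=> x)).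
- by near=> n; rewrite j_lb j_ub.
- by rewrite -[X in _ --> X]subr0; apply: cvgB => //; exact: cvg_cst.
- exact: cvg_cst.
Unshelve. all: by end_near.
Qed.

Let A n (r : int) : R := if (`|r| <= n)%N then
  cos (pi * r%:~R / (N n)%:R) ^+ (M n).*2 * cos (2 * pi * r%:~R * (j n)%:~R / (N n)%:R) else 0.

Let asumA n : asum (A n) = (N n)%:R * asum (fun k : int => bweight R (M n) (j n + k * (N n)%:Z)).
Proof.
rewrite -finite_theta.
have [||_ ->] := @asum_finite R int [seq (i%:Z - n%:Z) | i <- iota 0 (N n)] (A n).
- by rewrite map_inj_uniq ?iota_uniq// => a b /addIr[].
- move=> r; apply: contraNeq => Ar.
  have rn : (`|r| <= n)%N by move: Ar; rewrite /A; case: ifP => //; rewrite eqxx.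
  apply/mapP; exists `|(r + n%:Z)%R|%N; last by lia.
  by rewrite mem_iota /N; lia.
rewrite big_map -[N n]subn0 -/(index_iota 0 (N n)) big_mkord; apply: eq_bigr => i _.
rewrite /A ifT; first by rewrite intrB.
by have := ltn_ord i; rewrite /N; lia.
Qed.

Let gauss_int (c : R) : 0 < c -> absum (fun r : int => expR (- (c * r%:~R ^+ 2))).
Proof.
move=> c0; have := (gsummable_shift 0).2 c c0.
by congr absum; apply/funext => r; rewrite addr0.
Qed.

Let A_dom n r : `|A n r| <= expR (- (tau * r%:~R ^+ 2)).
Proof.
rewrite /A; case: ifPn => [rn|_]; last by rewrite normr0 expR_ge0.
set y := pi * _ / _.
have pi2 := pi_ge2 R.
have ny : `|y| = pi * `|r%:~R| / (N n)%:R.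
  by rewrite /y normrM normrM (gtr0_norm (pi_gt0 R)) normfV [`|(N n)%:R|]gtr0_norm.
have yb : 0 <= `|y| <= pi / 2.
  rewrite normr_ge0/= ny -mulrA ler_wpM2l ?pi_ge0//.
  rewrite ler_pdivrMr// -[`|r%:~R|]intr_norm -natr_absz /N -[n.*2.+1%:R]natr1 -muln2 natrM.
  have : (`|r|%N%:R : R) <= n%:R by rewrite ler_nat.
  lra.
have c2 : cos y ^+ 2 <= expR (- (y ^+ 2 / 4)).
  have h := sin_ge_half yb.
  have h2 : y ^+ 2 / 4 <= sin y ^+ 2.
    rewrite -[y ^+ 2]real_normK ?num_real// -[sin y ^+ 2](_ : sin `|y| ^+ 2 = _).
      have : 0 <= `|y| / 2 by rewrite divr_ge0.
      by move: h; nra.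
    by case: (leP 0 y) => y0; [rewrite ger0_norm|rewrite ltr0_norm// sinN sqrrN].
  have := expR_ge1Dx (- (y ^+ 2 / 4)).
  have := cos2Dsin2 y; lra.
rewrite normrM -[leRHS]mulr1; apply: ler_pM => //; last first.
  by rewrite ler_norml cos_geN1 cos_le1.
rewrite -muln2 mulnC exprM ger0_norm; last by apply: exprn_ge0; exact: sqr_ge0.
apply: (@le_trans _ _ (expR (- (y ^+ 2 / 4)) ^+ (M n))).
  by apply: lerXn2r; rewrite ?nnegrE ?sqr_ge0 ?expR_ge0.
rewrite -expRM_natl ler_expR mulrN lerN2 -[y ^+ 2]real_normK ?num_real// ny.
rewrite -[r%:~R ^+ 2]real_normK ?num_real// !exprMn exprVn.
have h := M_lb n; have n2 : 0 < (N n)%:R ^+ 2 :> R by rewrite exprn_gt0.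
rewrite !mulrA ler_pdivlMr// ler_pdivlMr//.
have p4 : 4 <= pi ^+ 2 :> R by nra.
have key : (tau * (N n)%:R ^+ 2) * (4 * `|r%:~R| ^+ 2) <= (M n)%:R * (pi ^+ 2 * `|r%:~R| ^+ 2).
  apply: ler_pM => //.
  - exact: mulr_ge0 (ltW tau0) (sqr_ge0 _).
  - by apply: ler_wpM2r => //; exact: sqr_ge0.
by move: key; lra.
Qed.

Let cvg_expR (u : nat -> R) l : u @ \oo --> l -> (fun n => expR (u n)) @ \oo --> expR l.
Proof. by move=> h; apply: continuous_cvg => //; exact: continuous_expR. Qed.

Let A_cvg r : A ^~ r @ \oo --> expR (- (pi ^+ 2 * tau * r%:~R ^+ 2)) * cos (2 * pi * r%:~R * x).
Proof.
have near_r : \forall n \near \oo, (`|r| <= n)%N by exists `|r|%N.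
pose B n := cos (pi * r%:~R / (N n)%:R) ^+ (M n).*2 * cos (2 * pi * r%:~R * ((j n)%:~R / (N n)%:R)) : R.
have AB : \forall n \near \oo, B n = A n r.
  by near=> n; rewrite /A ifT; [rewrite /B mulrA|near: n].
apply: cvg_trans; first by apply: near_eq_cvg AB.
apply: cvgM; last first.
  apply: continuous_cvg; first exact: continuous_cos.
  by apply: cvgM => //; exact: cvg_cst.
pose y n : R := pi * r%:~R / (N n)%:R.
have cy : y @ \oo --> (0 : R).
  by rewrite -(mulr0 (pi * r%:~R)); apply: cvgM => //; exact: cvg_cst.
pose w n : R := (M n)%:R / (N n)%:R ^+ 2 * (pi * r%:~R) ^+ 2.
have wE n : w n = (M n)%:R * y n ^+ 2.
  by rewrite /w /y expr_div_n; field; rewrite gt_eqF.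
have cw : w @ \oo --> pi ^+ 2 * tau * r%:~R ^+ 2.
  rewrite (_ : _ * _ = tau * (pi * r%:~R) ^+ 2); last by ring.
  by apply: cvgM => //; exact: cvg_cst.
have cy2 : (fun n => 1 - y n ^+ 2) @ \oo --> (1 : R).
  rewrite -[X in _ --> X]subr0 -[X in 1 - X](mulr0 0).
  apply: cvgB; first exact: cvg_cst.
  rewrite (_ : (fun n => y n ^+ 2) = (fun n => y n * y n)); last by apply/funext.
  exact: cvgM.
have small : \forall n \near \oo, y n ^+ 2 < 1 / 2.
  have : \forall n \near \oo, 1 / 2 < 1 - y n ^+ 2.
    by move/cvgr_gt : cy2; apply; lra.
  by apply: filterS => n; lra.
apply: (@squeeze_cvgr _ _ _ _ (fun n => expR (- (w n * (1 - y n ^+ 2)^-1))) (fun n => expR (- (w n * (1 - y n ^+ 2))))).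
- near=> n; have sn : y n ^+ 2 < 1 / 2 by near: n.
  have q0 := sqr_ge0 (y n).
  have c1 := cos_ge_quad (y n).
  have cpos : 0 < cos (y n) by move: c1 sn; lra.
  have c0 : 1 - y n ^+ 2 <= cos (y n) ^+ 2 by nra.
  have s0 : y n ^+ 2 * (1 - y n ^+ 2) <= sin (y n) ^+ 2.
    have yn : `|y n| <= 1.
      by rewrite -(@ler_pXn2r _ 2)// ?nnegrE// real_normK ?num_real// expr1n; lra.
    have := @sin_ge_mul_cos R `|y n|; have pi2 := pi_ge2 R.
    move=> /(_ ltac:(rewrite normr_ge0 /=; lra)).
    rewrite -(_ : cos (y n) = cos `|y n|); last by case: (leP 0 (y n)) => y0; [rewrite ger0_norm|rewrite ltr0_norm// cosN].
    rewrite -[sin (y n) ^+ 2](_ : sin `|y n| ^+ 2 = _); last by case: (leP 0 (y n)) => y0; [rewrite ger0_norm|rewrite ltr0_norm// sinN sqrrN].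
    move=> h; apply: (@le_trans _ _ ((`|y n| * cos (y n)) ^+ 2)).
      by rewrite [leRHS]exprMn real_normK ?num_real// ler_wpM2l.
    by rewrite ler_pXn2r ?nnegrE ?mulr_ge0 ?(ltW cpos)//; apply: le_trans h; rewrite mulr_ge0// ltW.
  have d0 : 0 < 1 - y n ^+ 2 by lra.
  have e1 : expR (- (y n ^+ 2 * (1 - y n ^+ 2)^-1)) <= cos (y n) ^+ 2.
    apply: le_trans c0; rewrite expRN invf_ple ?posrE ?expR_gt0//.
    apply: le_trans (expR_ge1Dx _).
    have frac (z : R) : 0 < 1 - z -> (1 - z)^-1 = 1 + z / (1 - z).
      by move=> z0; field; rewrite gt_eqF.
    by rewrite -(frac _ d0).
  have e2 : cos (y n) ^+ 2 <= expR (- (y n ^+ 2 * (1 - y n ^+ 2))).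
    have := expR_ge1Dx (- (y n ^+ 2 * (1 - y n ^+ 2))).
    by have := cos2Dsin2 (y n); lra.
  have E (a b c : R) : - (a * b * c) = a * - (b * c) by ring.
  rewrite -muln2 mulnC exprM -/(y n) wE (E (M n)%:R (y n ^+ 2) (1 - y n ^+ 2)^-1).
  rewrite (E (M n)%:R (y n ^+ 2) (1 - y n ^+ 2)) !expRM_natl; apply/andP; split.
    by apply: lerXn2r; rewrite ?nnegrE ?expR_ge0 ?sqr_ge0.
  by apply: lerXn2r; rewrite ?nnegrE ?expR_ge0 ?sqr_ge0.
- apply: cvg_expR; apply: cvgN; rewrite -[X in _ --> X]mulr1; apply: cvgM => //.
  by rewrite -[X in _ --> X]invr1; apply: cvgV => //; exact: oner_neq0.
- by apply: cvg_expR; apply: cvgN; rewrite -[X in _ --> X]mulr1; apply: cvgM.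
Unshelve. all: by end_near.
Qed.

Let rho_dom n (k : int) : `|rho (M n) `|j n + k * (N n)%:Z| |
  <= expR ((2 * `|x| + 3) / (2 * (tau + 1))) * expR (- (tau + 1)^-1) ^+ `|k|%N.
Proof.
set u := `|(_ + _)%R|%N; rewrite ger0_norm ?divr_ge0//.
have t1 : 0 < tau + 1 by rewrite ltr_wpDr.
rewrite -expRM_natl -expRD.
have uE : (u%:R : R) = `|(j n)%:~R / (N n)%:R + k%:~R| * (N n)%:R.
  rewrite /u natr_absz intr_norm intrD intrM -[X in _ = _ * X](gtr0_norm (N0 n)) -normrM.
  by congr `| _ |; field; rewrite gt_eqF.
have [Mu|uM] := leqP (M n).+1 u.
  by rewrite /rho bin_small ?mul0r ?expR_ge0// -addnn; lia.
apply: le_trans (binomial_ratio_ub _ _) _; rewrite ler_expR.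
have uMR : (u%:R : R) <= (M n)%:R by rewrite ler_nat.
have n2 : 0 < (N n)%:R ^+ 2 :> R by rewrite exprn_gt0.
have M2 : (M n)%:R <= (tau + 1) * (N n)%:R ^+ 2.
  have N2 : 1 <= (N n)%:R ^+ 2 :> R by rewrite exprn_ege1.
  by have := M_ub n; lra.
set v := `|(j n)%:~R / (N n)%:R + k%:~R| in uE.
have v0 : 0 <= v by exact: normr_ge0.
have vk : `|k%:~R| - `|x| - 1 <= v.
  have h1 : `|k%:~R| <= v + `|(j n)%:~R / (N n)%:R|.
    by rewrite -[k%:~R](addKr ((j n)%:~R / (N n)%:R)) addrC; exact: ler_normB.
  have h2 : `|(j n)%:~R / (N n)%:R| <= `|x| + 1.
    have h3 := j_lb n; have h4 := j_ub n; have h5 : (N n)%:R^-1 <= 1 :> R by rewrite invf_le1.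
    rewrite ler_norml; have := ler_norm x; have := ler_norm (- x); rewrite normrN; lra.
  lra.
have step : v ^+ 2 / (2 * (tau + 1)) <= u%:R ^+ 2 / ((M n)%:R + u%:R).
  have Mu0 : 0 < (M n)%:R + u%:R :> R by rewrite ltr_pwDl.
  rewrite ler_pdivlMr// mulrAC ler_pdivrMr ?mulr_gt0// uE exprMn.
  have : v ^+ 2 * ((M n)%:R + v * (N n)%:R) <= v ^+ 2 * ((N n)%:R ^+ 2 * (2 * (tau + 1))).
    by rewrite ler_wpM2l ?sqr_ge0// -uE; lra.
  by lra.
apply: (@le_trans _ _ (- (v ^+ 2 / (2 * (tau + 1))))); first by rewrite lerN2.
have kE : (`|k|%N%:R : R) = `|k%:~R| by rewrite natr_absz intr_norm.
rewrite kE.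
have h : 2 * (`|k%:~R| - `|x| - 1) - 1 <= v ^+ 2.
  by have := sqr_ge0 (v - 1); move: vk; set K := `|k%:~R|; nra.
rewrite [leRHS](_ : _ = (2 * `|x| + 3 - 2 * `|k%:~R|) / (2 * (tau + 1))); last first.
  by field; rewrite gt_eqF.
rewrite -mulNr; apply: ler_wpM2r; first by rewrite invr_ge0 mulr_ge0 ?ltW.
by move: h; move: (v ^+ 2) `|x| `|k%:~R| => V X K; lra.
Qed.

Let rho_cvg (k : int) : (fun n => rho (M n) `|j n + k * (N n)%:Z|) @ \oo -->
  expR (- (tau^-1 * (k%:~R + x) ^+ 2)).
Proof.
pose u n := `|(j n + k * (N n)%:Z)%R|%N.
pose v n : R := `|(j n)%:~R / (N n)%:R + k%:~R|.
pose m n : R := (M n)%:R / (N n)%:R ^+ 2.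
have uE n : ((u n)%:R : R) = v n * (N n)%:R.
  rewrite /u /v natr_absz intr_norm intrD intrM -[X in _ = _ * X](gtr0_norm (N0 n)) -normrM.
  by congr `| _ |; field; rewrite gt_eqF.
have cv : v @ \oo --> `|x + k%:~R|.
  by apply: cvg_norm; apply: cvgD => //; exact: cvg_cst.
have cvN : (fun n => v n * (N n)%:R^-1) @ \oo --> (0 : R).
  by rewrite -(mulr0 `|x + k%:~R|); apply: cvgM.
have cpm (s : R) : (fun n => m n + s * (v n * (N n)%:R^-1)) @ \oo --> tau.
  rewrite -[X in _ --> X]addr0 -[X in _ + X](mulr0 s).
  by apply: cvgD => //; apply: cvgM => //; exact: cvg_cst.
have lim (s : R) : (fun n => expR (- (v n ^+ 2 / (m n + s * (v n * (N n)%:R^-1))))) @ \oo -->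
    expR (- (tau^-1 * (k%:~R + x) ^+ 2)).
  apply: cvg_expR; apply: cvgN; rewrite mulrC; apply: cvgM.
    rewrite (_ : (k%:~R + x) ^+ 2 = `|x + k%:~R| * `|x + k%:~R|); last first.
      by rewrite -expr2 real_normK ?num_real// addrC.
    rewrite (_ : (fun n => v n ^+ 2) = (fun n => v n * v n)); last by apply/funext.
    exact: cvgM.
  by apply: cvgV; [rewrite gt_eqF|exact: cpm].
have mpos : \forall n \near \oo, 0 < m n + -1 * (v n * (N n)%:R^-1).
  by move/cvgr_gt : (cpm (-1)); apply.
have conv (s : R) n : v n ^+ 2 / (m n + s * (v n * (N n)%:R^-1)) = (u n)%:R ^+ 2 / ((M n)%:R + s * (u n)%:R).
  have E : m n + s * (v n * (N n)%:R^-1) = ((M n)%:R + s * (u n)%:R) / (N n)%:R ^+ 2.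
    by rewrite uE /m; field; rewrite gt_eqF.
  rewrite E uE exprMn.
  have [->|D0] := eqVneq ((M n)%:R + s * (v n * (N n)%:R)) 0.
    by rewrite mul0r invr0 !mulr0.
  by field; rewrite D0 gt_eqF.
apply: (@squeeze_cvgr _ _ _ _ (fun n => expR (- (v n ^+ 2 / (m n + -1 * (v n * (N n)%:R^-1)))))
  (fun n => expR (- (v n ^+ 2 / (m n + 1 * (v n * (N n)%:R^-1)))))); [|exact: lim|exact: lim].
near=> n; rewrite !conv mul1r mulN1r binomial_ratio_ub andbT.
apply: binomial_ratio_lb; rewrite -(ltr_nat R) -/(u n) uE.
have : 0 < m n + -1 * (v n * (N n)%:R^-1) by near: n.
rewrite mulN1r subr_gt0 /m ltr_pdivlMr ?exprn_gt0//.
by rewrite expr2 mulrA divfK ?gt_eqF.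
Unshelve. all: by end_near.
Qed.

Let sumA := asum (fun r : int => expR (- (pi ^+ 2 * tau * r%:~R ^+ 2)) * cos (2 * pi * r%:~R * x)).
Let sumB := asum (fun k : int => expR (- (tau^-1 * (k%:~R + x) ^+ 2))).

(** Let the number N of sampling points tend to infinity with M ~ tau N^2 and
    j ~ x N in [finite_theta]: both sides converge termwise with Gaussian
    domination. *)
Lemma polya_limit (c : R) : (fun M => (bweight R M 0) ^+ 2 * M%:R) @ \oo --> c ->
  0 <= c -> sumA = Num.sqrt (c / tau) * sumB.
Proof.
move=> cc c0.
have dA : absum (fun r : int => expR (- (tau * r%:~R ^+ 2))) by exact: gauss_int.
have [_ cA] := asum_dominated dA A_dom A_cvg.
have dB : absum (fun k : int => expR ((2 * `|x| + 3) / (2 * (tau + 1))) * expR (- (tau + 1)^-1) ^+ `|k|%N).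
  by apply: absumZ; apply: absum_geometric_int; rewrite expR_ge0 expR_lt1 oppr_lt0 invr_gt0 ltr_wpDr.
have [_ cB] := asum_dominated dB rho_dom rho_cvg.
have AE n : asum (A n) = (N n)%:R * bweight R (M n) 0 * asum (fun k : int => rho (M n) `|j n + k * (N n)%:Z|).
  rewrite asumA -mulrA; congr (_ * _).
  rewrite -asumZ; last by apply: absum_le dB => k; exact: rho_dom.
  by apply: eq_asum => k; rewrite -bweight_rho.
have Moo : (fun n => M n) @ \oo --> \oo.
  move=> P [m _ mP]; exists (Num.truncn ((m%:R : R) / tau)).+1 => // n /= mn; apply: mP => /=.
  rewrite -(ler_nat R); apply: le_trans (M_lb n).
  have h1 : m%:R / tau <= (N n)%:R.
    apply/ltW/(lt_le_trans (truncnS_gt _)); rewrite ler_nat (leq_trans mn)// /N -addnn; lia.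
  have : m%:R <= tau * (N n)%:R by rewrite mulrC -ler_pdivrMr.
  move/le_trans; apply; apply: ler_wpM2l; first exact: ltW.
  by rewrite expr2; apply: ler_peMr => //; exact: ltW.
have cg : (fun n => (N n)%:R * bweight R (M n) 0) @ \oo --> Num.sqrt (c / tau).
  have h : (fun n => Num.sqrt (bweight R (M n) 0 ^+ 2 * (M n)%:R * ((M n)%:R / (N n)%:R ^+ 2)^-1)) @ \oo --> Num.sqrt (c / tau).
    apply: continuous_cvg; first exact: sqrt_continuous.
    apply: cvgM; last by apply: cvgV => //; rewrite gt_eqF.
    exact: (cvg_comp _ _ Moo cc).
  apply: cvg_trans h; apply: near_eq_cvg; near=> n.
  rewrite (_ : _ * _ * _ = ((N n)%:R * bweight R (M n) 0) ^+ 2).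
    by rewrite sqrtr_sqr ger0_norm// mulr_ge0// bweight_ge0.
  by move: (bweight _ _ _) => b; field; rewrite !gt_eqF.
have lim1 : (fun n => asum (A n)) @ \oo --> Num.sqrt (c / tau) * sumB.
  rewrite (_ : (fun n => _) = (fun n => (N n)%:R * bweight R (M n) 0 * asum (fun k : int => rho (M n) `|j n + k * (N n)%:Z|))).
    exact: cvgM cg cB.
  exact/funext.
exact: (cvg_unique _ cA lim1).
Unshelve. all: by end_near.
Qed.

End PoissonLimit.

Section Poisson.
Variable R : realType.

(** The unknown constant in [polya_limit] is determined by the self-dual
    parameter tau = 1 / pi at x = 0, where both sums coincide. *)
Theorem theta_transformation (t x : R) : 0 < t ->
  asum (fun k : int => expR (- (t * (k%:~R + x) ^+ 2))) =
  Num.sqrt (pi / t) *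
  asum (fun k : int => expR (- (pi ^+ 2 / t * k%:~R ^+ 2)) * cos (2 * pi * k%:~R * x)).
Proof.
move=> t0; have [c c0 cc] := central_binomial_cvg R.
have pi0 := pi_gt0 R.
have gs (d : R) : 0 < d -> absum (fun k : int => expR (- (d * k%:~R ^+ 2))).
  move=> d0; have := (gsummable_shift (0 : R)).2 d d0.
  by congr absum; apply/funext => r; rewrite addr0.
(* at the self-dual parameter both sums are equal and nonzero *)
have cE : c = pi^-1.
  have ip0 : 0 < pi^-1 :> R by rewrite invr_gt0.
  have := polya_limit 0 ip0 cc (ltW c0).
  rewrite invrK; set S1 := asum _; set S2 := asum _ => E.
  have S12 : S1 = S2.
    apply: eq_asum => k; rewrite addr0 mulr0 cos0 mulr1.
    by rewrite (_ : pi ^+ 2 * pi^-1 = pi)// expr2 mulfK// gt_eqF.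
  have S20 : 0 < S2.
    have h := @asum_ge_sum R int [:: 0] (fun k : int => expR (- (pi * (k%:~R + 0) ^+ 2))) isT.
    apply: lt_le_trans (h _ _); first by rewrite big_seq1 expR_gt0.
      by have := gs _ pi0; congr absum; apply/funext => k; rewrite addr0.
    by move=> *; exact: expR_ge0.
  have : Num.sqrt (c * pi) = 1 by apply: (mulIf (lt0r_neq0 S20)); rewrite mul1r -E.
  move=> /(congr1 (fun z => z ^+ 2)); rewrite sqr_sqrtr ?mulr_ge0 ?(ltW c0) ?(ltW pi0)// expr1n => h.
  by rewrite -[LHS](mulfK (lt0r_neq0 pi0)) h mul1r.
have it0 : 0 < t^-1 by rewrite invr_gt0.
have := polya_limit x it0 cc (ltW c0).
rewrite !invrK cE => E; rewrite E mulrA -sqrtrM ?divr_ge0 ?ltW//.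
by rewrite mulrACA divff ?(lt0r_neq0 pi0)// mulVf ?(lt0r_neq0 t0)// mulr1 sqrtr1 mul1r.
Qed.

End Poisson.

(** * Theta series of binary quadratic forms *)

Section QuadraticForms.
Variable R : realType.
Implicit Types (t x s c : R) (p : int * int).

(** pi times the squared length of n u1 + m u2, with p = (m, n), in a lattice of
    covolume 1 with pi |u1|^2 = t and <u1, u2> / |u1|^2 = x. *)
Definition qform t x p : R :=
  t * (p.2%:~R + p.1%:~R * x) ^+ 2 + pi ^+ 2 / t * p.1%:~R ^+ 2.

Lemma qform_ge0 t x p : 0 < t -> 0 <= qform t x p.
Proof.
move=> t0; apply: addr_ge0; apply: mulr_ge0; try exact: sqr_ge0; first exact: ltW.
by apply: divr_ge0; [exact: sqr_ge0|exact: ltW].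
Qed.

Lemma qform0 t x : qform t x 0 = 0.
Proof. by rewrite /qform mul0r addr0 expr0n !mulr0 addr0. Qed.

Lemma gsummable_sqr : gsummable (fun k : int => k%:~R ^+ 2 : R).
Proof.
have := gsummable_shift (0 : R); congr gsummable.
by apply/funext => k; rewrite addr0.
Qed.

Lemma absum_theta_cos c (y : R) : 0 < c ->
  absum (fun k : int => expR (- (c * k%:~R ^+ 2)) * cos (2 * pi * k%:~R * y)).
Proof.
move=> c0; apply: absum_le (gsummable_sqr.2 c c0) => k.
by rewrite normrM ger0_norm ?expR_ge0// ler_piMr ?expR_ge0// ler_norml cos_geN1 cos_le1.
Qed.

Lemma row_sum_le c (y : R) : 0 < c ->
  asum (fun k : int => expR (- (c * (k%:~R + y) ^+ 2))) <=
  Num.sqrt (pi / c) * asum (fun k : int => expR (- (pi ^+ 2 / c * k%:~R ^+ 2))).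
Proof.
move=> c0; rewrite theta_transformation// ler_wpM2l ?sqrtr_ge0//.
have d0 : 0 < pi ^+ 2 / c by rewrite divr_gt0 ?exprn_gt0 ?pi_gt0.
apply: ler_asum; [exact: absum_theta_cos|exact: gsummable_sqr.2|move=> k].
by rewrite ler_piMr ?expR_ge0 ?cos_le1.
Qed.

(** Summing over the rows m fixed: the theta transformation bounds each row
    uniformly in the shift m x. *)
Lemma gsummable_qform t x : 0 < t -> gsummable (qform t x).
Proof.
move=> t0; split=> [p|c c0]; first exact: qform_ge0.
have ct : 0 < c * t by rewrite mulr_gt0.
have E p : expR (- (c * qform t x p)) =
    expR (- (c * (pi ^+ 2 / t) * p.1%:~R ^+ 2)) * expR (- (c * t * (p.2%:~R + p.1%:~R * x) ^+ 2)).
  by rewrite -expRD /qform; congr expR; ring.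
have d0 : 0 < c * (pi ^+ 2 / t) by rewrite mulr_gt0// divr_gt0 ?exprn_gt0 ?pi_gt0.
rewrite (funext E); apply: absum_prod => /= [m|].
  by apply: absumZ; exact: (gsummable_shift (m%:~R * x)).2.
apply: absum_le (absumZ _ (gsummable_sqr.2 _ d0)) => m.
rewrite ger0_norm; last by apply: asum_ge0.
under eq_asum do rewrite normrM !(ger0_norm (expR_ge0 _)).
rewrite asumZ; last exact: (gsummable_shift (m%:~R * x)).2.
by rewrite mulrC; apply: ler_wpM2r; [exact: expR_ge0|exact: row_sum_le].
Qed.

Definition theta t x s := asum (fun p => expR (- (s * qform t x p))).

(** The theta series after the one-dimensional transformation in n; up to
    exchanging the two indices it is symmetric under s -> 1 / s. *)
Let Phi t x s := asum (fun p : int * int =>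
  expR (- (pi ^+ 2 / t * (s * p.1%:~R ^+ 2 + s^-1 * p.2%:~R ^+ 2))) *
  cos (2 * pi * p.2%:~R * (p.1%:~R * x))).

Let absum_Phi t x s : 0 < t -> 0 < s -> absum (fun p : int * int =>
  expR (- (pi ^+ 2 / t * (s * p.1%:~R ^+ 2 + s^-1 * p.2%:~R ^+ 2))) *
  cos (2 * pi * p.2%:~R * (p.1%:~R * x))).
Proof.
move=> t0 s0; have e0 : 0 < pi ^+ 2 / t by rewrite divr_gt0 ?exprn_gt0 ?pi_gt0.
have a1 := gsummable_sqr.2 _ (mulr_gt0 e0 s0).
have si0 : 0 < s^-1 by rewrite invr_gt0.
have a2 := gsummable_sqr.2 _ (mulr_gt0 e0 si0).
apply: absum_le (absum_mul a1 a2) => p.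
rewrite [leRHS](_ : _ = expR (- (pi ^+ 2 / t * (s * p.1%:~R ^+ 2 + s^-1 * p.2%:~R ^+ 2)))); last first.
  by rewrite -expRD; congr expR; ring.
rewrite normrM ger0_norm ?expR_ge0//.
by rewrite ler_piMr ?expR_ge0// ler_norml cos_geN1 cos_le1.
Qed.

Let PhiV t x s : 0 < t -> 0 < s -> Phi t x s^-1 = Phi t x s.
Proof.
move=> t0 s0; rewrite /Phi (@asum_reindex _ _ _ (fun p : int * int => (p.2, p.1)) (fun p => (p.2, p.1))); try by case.
by apply: eq_asum => -[m n] /=; rewrite invrK; congr (expR _ * cos _); ring.
Qed.

Let theta_Phi t x s : 0 < t -> 0 < s -> theta t x s = Num.sqrt (pi / (s * t)) * Phi t x s.
Proof.
move=> t0 s0; have st0 : 0 < s * t by rewrite mulr_gt0.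
rewrite /theta /Phi; have [_ _ ->] := asum_fubini ((gsummable_qform x t0).2 s s0).
have [_ sP ->] := asum_fubini (absum_Phi x t0 s0).
rewrite -asumZ//; apply: eq_asum => m /=.
have si0 : 0 < pi ^+ 2 / (s * t) by rewrite divr_gt0 ?exprn_gt0 ?pi_gt0.
rewrite (eq_asum (g := fun n : int => expR (- (s * (pi ^+ 2 / t) * m%:~R ^+ 2)) * expR (- (s * t * (n%:~R + m%:~R * x) ^+ 2)))); last first.
  by move=> n; rewrite -expRD /qform /=; congr expR; ring.
rewrite asumZ; last exact: (gsummable_shift (m%:~R * x)).2.
rewrite theta_transformation// mulrCA; congr (_ * _).
rewrite -asumZ; last exact: absum_theta_cos.
apply: eq_asum => n /=; rewrite mulrA -expRD; congr (expR _ * _).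
by field; rewrite !lt0r_neq0.
Qed.

(** Transforming the sum over n for each fixed m produces a double sum that is
    invariant under s -> 1 / s together with (m, n) -> (n, m), so that the
    two-dimensional functional equation needs no two-dimensional Poisson
    formula. *)
Lemma theta_inv t x s : 0 < t -> 0 < s -> theta t x s^-1 = s * theta t x s.
Proof.
move=> t0 s0; have si0 : 0 < s^-1 by rewrite invr_gt0.
rewrite !theta_Phi// PhiV// mulrA; congr (_ * _).
have st0 : 0 < pi / (s * t) by rewrite divr_gt0 ?mulr_gt0 ?pi_gt0.
rewrite -{2}(ger0_norm (ltW s0)) -sqrtr_sqr -sqrtrM ?sqr_ge0//.
by congr Num.sqrt; field; rewrite !lt0r_neq0.
Qed.

Lemma is_derive_theta t x s : 0 < t -> 0 < s ->
  is_derive s 1 (theta t x) (- asum (fun p => qform t x p * expR (- (s * qform t x p)))).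
Proof. by move=> t0 s0; exact: is_derive_gsum (gsummable_qform x t0) s0. Qed.

(** The derivative of the functional equation [theta_inv] at its fixed point
    s = 1. *)
Lemma asum_h1_full t x : 0 < t ->
  asum (fun p => (qform t x p - 2^-1) * expR (- qform t x p)) = 0.
Proof.
move=> t0; have gq := gsummable_qform x t0.
have s1 := gq.2 1 ltr01; have s2 := absum_qexp gq ltr01.
have E1 p : expR (- (1 * qform t x p)) = expR (- qform t x p) by rewrite mul1r.
rewrite (funext E1) in s1.
have E2 : (fun p => qform t x p * expR (- (1 * qform t x p))) = fun p => qform t x p * expR (- qform t x p).
  by apply/funext => p; rewrite E1.
rewrite E2 in s2.
rewrite (eq_asum (g := fun p => qform t x p * expR (- qform t x p) - 2^-1 * expR (- qform t x p))); last first.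
  by move=> p; ring.
rewrite asumB//; last exact: absumZ.
rewrite asumZ//; set D := asum _; set T := asum _.
have dT : is_derive (1 : R) 1 (theta t x) (- D).
  by have := is_derive_theta x t0 ltr01; rewrite E2.
have TE : theta t x 1 = T by rewrite /theta (funext E1).
pose F s := theta t x s^-1 - s * theta t x s.
have dI : is_derive (1 : R) 1 (fun s : R => s^-1) (-1).
  apply: is_derive_eq; first exact: (is_deriveV (f := id) (oner_neq0 R)).
  by rewrite /= expr1n invr1 /GRing.scale /= mulr1.
have dT' : is_derive (1^-1 : R) 1 (theta t x) (- D) by rewrite invr1.
have dC : is_derive (1 : R) 1 (theta t x \o (fun s : R => s^-1)) (- D * -1).
  exact: is_derive1_comp.
have dM : is_derive (1 : R) 1 (fun s : R => s * theta t x s) (T - D).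
  have dM0 : is_derive (1 : R) 1 ((id : R -> R) * theta t x) ((id : R -> R) 1 *: (- D) + theta t x 1 *: (1 : R)).
    exact: is_deriveM.
  by apply: is_derive_eq; rewrite TE /GRing.scale /=; ring.
have F0 : \forall s \near (1 : R), (theta t x \o (fun s : R => s^-1)) s = s * theta t x s.
  near=> s; rewrite /= theta_inv//; near: s; exact: (lt_nbhsr ltr01).
have dC' := near_eq_is_derive F0 dC.
have := @derive_val _ _ _ _ _ _ _ dC'; rewrite (@derive_val _ _ _ _ _ _ _ dM); lra.
Unshelve. all: by end_near.
Qed.

Definition asum0 (F : int * int -> R) := asum (fun p => if p == 0 then 0 else F p).

Lemma absum_if0 (F : int * int -> R) : absum F -> absum (fun p => if p == 0 then 0 else F p).
Proof.
by move=> /absum_norm; apply: absum_le => p; case: ifP => _; rewrite ?normr0.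
Qed.

Lemma asum0E (F : int * int -> R) : absum F -> asum0 F = asum F - F 0.
Proof.
move=> sF; have := @asum_split R _ [:: 0] F isT sF; rewrite big_seq1 => ->.
by rewrite addrAC subrr add0r; apply: eq_asum => p; rewrite inE.
Qed.

Lemma absum_h1 t x : 0 < t -> absum (fun p => (qform t x p - 2^-1) * expR (- qform t x p)).
Proof.
move=> t0; have gq := gsummable_qform x t0.
have s1 := gq.2 1 ltr01; have s2 := absum_qexp gq ltr01.
have := absumB s2 (absumZ 2^-1 s1); congr absum; apply/funext => p.
by rewrite mul1r; ring.
Qed.

(** The moment sum at s = 1 is the same for all lattices of area 1. *)
Lemma asum0_h1 t x : 0 < t ->
  asum0 (fun p => (qform t x p - 2^-1) * expR (- qform t x p)) = 2^-1.
Proof.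
move=> t0; rewrite asum0E ?asum_h1_full//; last exact: absum_h1.
by rewrite qform0 oppr0 expR0; lra.
Qed.

(** The functional equation at s = 2/3 and 3/2: a second function with a lattice
    sum independent of the lattice, used to correct a potential without
    changing the comparison. *)
Lemma asum0_gauss_dual t x : 0 < t ->
  asum0 (fun p => expR (- (2 / 3 * qform t x p)) - 3 / 2 * expR (- (3 / 2 * qform t x p))) = 2^-1.
Proof.
move=> t0; have gq := gsummable_qform x t0.
have h1 : 0 < 2 / 3 :> R by lra.
have h2 : 0 < 3 / 2 :> R by lra.
rewrite asum0E; last by apply: absumB; [exact: gq.2|apply: absumZ; exact: gq.2].
rewrite asumB; [|exact: gq.2|by apply: absumZ; exact: gq.2].
rewrite asumZ; last exact: gq.2.
have := theta_inv x t0 h2; rewrite /theta (_ : (3 / 2)^-1 = 2 / 3) => [->|].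
  by rewrite subrr qform0 !mulr0 oppr0 expR0; lra.
by field.
Qed.

(** The derivative in t of the one-dimensional transformation at x = 0. The
    right-hand side converges very fast when t is small. *)
Lemma asum_row0 t : 0 < t ->
  asum (fun n : int => (t * n%:~R ^+ 2 - 2^-1) * expR (- (t * n%:~R ^+ 2))) =
  - (Num.sqrt (pi / t) * asum (fun k : int => pi ^+ 2 / t * k%:~R ^+ 2 * expR (- (pi ^+ 2 / t * k%:~R ^+ 2)))).
Proof.
move=> t0; pose c : R := pi ^+ 2 / t.
have c0 : 0 < c by rewrite divr_gt0 ?exprn_gt0 ?pi_gt0.
pose e (d : R) (n : int) := expR (- (d * n%:~R ^+ 2)).
have sE d : 0 < d -> absum (e d) by move=> d0; exact: gsummable_sqr.2.
have sQ d : 0 < d -> absum (fun n => d * n%:~R ^+ 2 * e d n).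
  move=> d0; have := absumZ d (absum_qexp gsummable_sqr d0).
  by congr absum; apply/funext => n; rewrite mulrA.
have H := asum_h1_full 0 t0; move: H.
rewrite (eq_asum (g := fun p : int * int => (c * p.1%:~R ^+ 2 * e c p.1) * e t p.2 + e c p.1 * ((t * p.2%:~R ^+ 2 - 2^-1) * e t p.2))); last first.
  move=> p; rewrite /e (_ : expR (- qform t 0 p) = expR (- (c * p.1%:~R ^+ 2)) * expR (- (t * p.2%:~R ^+ 2))).
    by rewrite /qform -/c; ring.
  by rewrite -expRD; congr expR; rewrite /qform -/c; ring.
have sH : absum (fun n => (t * n%:~R ^+ 2 - 2^-1) * e t n).
  have := absumB (sQ t t0) (absumZ 2^-1 (sE t t0)).
  by congr absum; apply/funext => n; rewrite mulrBl.
have prodE (f g : int -> R) : absum f -> absum g -> asum (fun p : int * int => f p.1 * g p.2) = asum f * asum g.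
  move=> sf sg; have [_ _ ->] := asum_fubini (absum_mul sf sg).
  rewrite /= [RHS]mulrC -asumZ//; apply: eq_asum => m; rewrite asumZ//; exact: mulrC.
rewrite asumD; [|exact: absum_mul (sQ c c0) (sE t t0)|exact: absum_mul (sE c c0) sH].
rewrite (prodE (fun m => c * m%:~R ^+ 2 * e c m) (e t) (sQ c c0) (sE t t0)).
rewrite (prodE (e c) (fun n => (t * n%:~R ^+ 2 - 2^-1) * e t n) (sE c c0) sH).
have tE : asum (e t) = Num.sqrt (pi / t) * asum (e c).
  have := theta_transformation 0 t0.
  rewrite (eq_asum (g := e t)); last by move=> k; rewrite addr0.
  by move=> ->; congr (_ * _); apply: eq_asum => k; rewrite mulr0 cos0 mulr1.
have B0 : 0 < asum (e c).
  have h := @asum_ge_sum R int [:: 0] (e c) isT (sE c c0).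
  apply: lt_le_trans (h _); first by rewrite big_seq1 expR_gt0.
  by move=> *; exact: expR_ge0.
rewrite tE => H; apply: (mulfI (lt0r_neq0 B0)).
move: H; set X := asum _; set Y := asum _; set Z := asum _; set W := Num.sqrt _.
by rewrite /X -/c; set X' := asum _; lra.
Qed.

End QuadraticForms.

(** * Numerical enclosures *)

Section ExpEnclosure.
Import BinInt.
Variable R : realType.

Let zR (z : Z) : R := (int_of_Z z)%:~R.

Let zRD x y : zR (x + y)%Z = zR x + zR y.
Proof. by rewrite /zR -[(x + y)%Z]/(GRing.add x y) !raddfD. Qed.

Let zRM x y : zR (x * y)%Z = zR x * zR y.
Proof. by rewrite /zR -[(x * y)%Z]/(GRing.mul x y) !rmorphM. Qed.

Let zRB x y : zR (x - y)%Z = zR x - zR y.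
Proof. by apply/eqP; rewrite eq_sym subr_eq -zRD; apply/eqP; congr zR; lia. Qed.

Let zR_le x y : (x <= y)%Z -> zR x <= zR y.
Proof. by move=> xy; rewrite /zR ler_int; lia. Qed.

Let zR_gt0 x : (0 < x)%Z -> 0 < zR x.
Proof. by move=> x0; rewrite /zR ltr0z; lia. Qed.

Let zR_nat n : zR (Z.of_nat n) = n%:R.
Proof. by rewrite /zR (_ : int_of_Z (Z.of_nat n) = n)//; lia. Qed.

Let zR1 : zR 1%Z = 1. Proof. by []. Qed.

Fixpoint pow2Z (j : nat) : Z := if j is j'.+1 then (2 * pow2Z j')%Z else 1%Z.

(** Repeated squaring in fixed point arithmetic with denominator W; adding u
    before the division chooses between rounding down (u = 0) and rounding up
    (u = W - 1). *)
Fixpoint squarings (u W x : Z) (j : nat) : Z :=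
  if j is j'.+1 then squarings u W ((x * x + u) / W)%Z j' else x.

(** Decimals in blocks of two digits keep all unary numerals below 100. *)
Definition centiZ (x y z : nat) : Z :=
  ((Z.of_nat x * 100 + Z.of_nat y) * 100 + Z.of_nat z)%Z.

(** With T = A / B the argument divided by 2 ^ j, the check compares the
    (2 ^ j)-th powers of 1 - T and 1 / (1 + T), which enclose exp (- T), with the
    claimed decimals. It runs on binary integers. *)
Definition exp_check_at (E : Z) (j a1 a2 a3 b x y z : nat) : bool :=
  let A := centiZ a1 a2 a3 in let B := (Z.of_nat b * (100 * 100) * pow2Z j)%Z in
  let W := (10 * 10 * 10 * 10 * 10 * 10 * E)%Z in
  [&& (0 <? B)%Z, (A <? B)%Z,
      (centiZ x y z * E <=? squarings 0 W (((B - A) * W) / B)%Z j)%Z &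
      (squarings (W - 1) W ((B * W + (A + B - 1)) / (A + B))%Z j
         <=? (centiZ x y z + 1) * E)%Z].

Let pow2_gt0 j : (0 < pow2Z j)%Z.
Proof. by elim: j => // j IH; apply: Z.mul_pos_pos. Qed.

Let pow2R j : zR (pow2Z j) = 2 ^+ j.
Proof. by elim: j => // j IH; rewrite -[pow2Z _]/(2 * pow2Z j)%Z zRM IH exprS. Qed.

Let zR_div_le X Y : (0 < Y)%Z -> zR (X / Y)%Z <= zR X / zR Y.
Proof.
move=> Y0; have := zR_le (Z.mul_div_le X _ Y0); have := zR_gt0 Y0.
by rewrite zRM => y0 h; rewrite ler_pdivlMr// mulrC.
Qed.

Let zR_div_ge X Y : (0 < Y)%Z -> zR X / zR Y <= zR ((X + (Y - 1)) / Y)%Z.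
Proof.
move=> Y0; have y0 := zR_gt0 Y0.
have /zR_le : (X <= Y * ((X + (Y - 1)) / Y))%Z.
  by have := Z.mul_succ_div_gt (X + (Y - 1))%Z _ Y0; lia.
by rewrite zRM => h; rewrite ler_pdivrMr// mulrC.
Qed.

Let lo_start A B W : (0 <= A)%Z -> (0 < W)%Z -> (A < B)%Z -> (0 <= (B - A) * W / B)%Z.
Proof. by move=> a w ab; apply: Z.div_pos; nia. Qed.

Let hi_start A B W : (0 <= A)%Z -> (0 < W)%Z -> (A < B)%Z ->
  (0 < A + B)%Z /\ (0 <= (B * W + (A + B - 1)) / (A + B))%Z.
Proof. by move=> a w ab; split; [lia | apply: Z.div_pos; nia]. Qed.

Section Squarings.
Variable W : Z.
Hypothesis W0 : (0 < W)%Z.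

Lemma squarings_lo j x (e : R) : (0 <= x)%Z -> 0 <= e ->
  zR x <= zR W * e -> zR (squarings 0 W x j) <= zR W * e ^+ expn 2 j.
Proof.
elim: j x e => [|j IH] x e x0 e0 h; first by rewrite expr1.
have w0 := zR_gt0 W0; have hx := zR_le x0.
rewrite -[squarings _ _ _ _]/(squarings 0 W ((x * x + 0) / W)%Z j) expnS exprM.
apply: IH; first by apply: Z.div_pos; nia.
  exact: exprn_ge0.
have := zR_le (Z.mul_div_le (x * x + 0)%Z _ W0).
rewrite !zRM zRD zRM => h1; rewrite -(ler_pM2l w0).
have : zR x * zR x <= (zR W * e) * (zR W * e) by apply: ler_pM.
by move: h1; rewrite /zR/= expr2; lra.
Qed.

Lemma squarings_hi j x (e : R) : (0 <= x)%Z -> 0 <= e ->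
  zR W * e <= zR x -> zR W * e ^+ expn 2 j <= zR (squarings (W - 1) W x j).
Proof.
elim: j x e => [|j IH] x e x0 e0 h; first by rewrite expr1.
have w0 := zR_gt0 W0; have hx := zR_le x0.
rewrite -[squarings _ _ _ _]/(squarings (W - 1) W ((x * x + (W - 1)) / W)%Z j) expnS exprM.
apply: IH; first by apply: Z.div_pos; nia.
  exact: exprn_ge0.
have /zR_le : (x * x <= W * ((x * x + (W - 1)) / W))%Z.
  by have := Z.mul_succ_div_gt (x * x + (W - 1))%Z _ W0; lia.
rewrite !zRM => h1; rewrite -(ler_pM2l w0).
have : (zR W * e) * (zR W * e) <= zR x * zR x.
  by apply: ler_pM => //; apply: mulr_ge0 => //; exact: ltW.
by rewrite expr2; lra.
Qed.

End Squarings.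

Let decR (x y z : nat) : R := x%:R / 10 ^+ 2 + y%:R / 10 ^+ 4 + z%:R / 10 ^+ 6.

Let zR10 : zR 10%Z = 10. Proof. by rewrite (zR_nat 10). Qed.

Let zR100 : zR 100%Z = 10 * 10.
Proof. by rewrite (_ : 100%Z = (10 * 10)%Z)// zRM zR10. Qed.

Let centiZR x y z : zR (centiZ x y z) = 10 ^+ 6 * decR x y z.
Proof. by rewrite /centiZ !(zRD, zRM) !zR_nat zR100 /decR; field. Qed.

Lemma exp_check_atP E j a1 a2 a3 b x y z t : (0 < E)%Z -> exp_check_at E j a1 a2 a3 b x y z ->
  t = (a1%:R + a2%:R / 10 ^+ 2 + a3%:R / 10 ^+ 4) / b%:R ->
  decR x y z <= expR (- t) <= decR x y z + 1 / 10 ^+ 6.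
Proof.
move=> E0; rewrite /exp_check_at.
set A := centiZ a1 a2 a3; set B := (_ * pow2Z j)%Z; set W := (10 * 10 * 10 * 10 * 10 * 10 * E)%Z.
move=> /and4P[/Z.ltb_lt B0 /Z.ltb_lt AB /Z.leb_le lo /Z.leb_le hi] tE.
have A0 : (0 <= A)%Z by rewrite /A /centiZ; lia.
have W0 : (0 < W)%Z by rewrite /W; lia.
have e0 := zR_gt0 E0; have w0 := zR_gt0 W0; have b0 := zR_gt0 B0.
have a0 := zR_le A0.
have WE : zR W = 10 ^+ 6 * zR E.
  by rewrite /W !zRM zR10; ring.
have ME := centiZR x y z.
have BE : zR B = b%:R * (10 * 10 * (10 * 10)) * 2 ^+ j.
  by rewrite /B !zRM pow2R !zR_nat zR100.
have AE : zR A = (a1%:R + a2%:R / 10 ^+ 2 + a3%:R / 10 ^+ 4) * (10 * 10 * (10 * 10)).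
  by rewrite /A centiZR /decR; field.
clearbody A B W.
set e : R := expR (- (zR A / zR B)).
have eE : expR (- t) = e ^+ expn 2 j.
  rewrite /e -expRM_natl; congr expR; rewrite tE AE BE natrX.
  have : b%:R * (10 * 10 * (10 * 10)) * 2 ^+ j != 0 :> R by rewrite -BE gt_eqF.
  move: (_ + _ + _ : R) (2 ^+ j : R) => u K; rewrite !mulf_eq0 !negb_or -!andbA.
  by move=> /and5P[b1 _ _ _ /andP[_ K1]]; field; rewrite b1 K1.
rewrite {}eE.
have e_lo : 1 - zR A / zR B <= e by exact: expR_ge1Dx.
have e_hi : e * (1 + zR A / zR B) <= 1.
  have h := expR_ge1Dx (zR A / zR B : R).
  have : e * expR (zR A / zR B) = 1 by rewrite /e -expRD addNr expR0.
  move=> ee; apply: (@le_trans _ _ (e * expR (zR A / zR B))); last by rewrite ee.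
  apply: ler_wpM2l h; exact: expR_ge0.
have [k kE k0] : exists2 k : R, 10 ^+ 6 = k & 0 < k.
  by exists (10 ^+ 6) => [//|]; apply: exprn_gt0; rewrite ltr0n.
have ki : k * (1 / 10 ^+ 6) = 1 by rewrite kE mul1r divff// gt_eqF.
rewrite {}kE in WE ME; have c0 : 0 < k * zR E by exact: mulr_gt0.
apply/andP; split.
- have := @squarings_lo W W0 j (((B - A) * W) / B)%Z e.
  have K (P Q S T : Prop) : P -> Q -> S -> (T -> decR x y z <= e ^+ expn 2 j) -> (P -> Q -> S -> T) -> decR x y z <= e ^+ expn 2 j by tauto.
  apply: K.
  + exact: lo_start.
  + exact: expR_ge0.
  + apply: le_trans (zR_div_le _ B0) _; rewrite zRM mulrAC mulrC.
    have -> : zR (B - A)%Z = zR B - zR A by rewrite -zRB.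
    by rewrite mulrBl divff ?gt_eqF// ler_pM2l.
  + move=> h; have := zR_le lo; rewrite zRM ME => h1.
    have := le_trans h1 h; rewrite WE => h2.
    by rewrite -(ler_pM2l c0) mulrAC.
- have := @squarings_hi W W0 j ((B * W + (A + B - 1)) / (A + B))%Z e.
  have K (P Q S T : Prop) : P -> Q -> S -> (T -> e ^+ expn 2 j <= decR x y z + 1 / 10 ^+ 6) -> (P -> Q -> S -> T) -> e ^+ expn 2 j <= decR x y z + 1 / 10 ^+ 6 by tauto.
  apply: K.
  + by case: (hi_start A0 W0 AB).
  + exact: expR_ge0.
  + have [AB0 _] := hi_start A0 W0 AB; have ab0 := zR_gt0 AB0.
    apply: le_trans (zR_div_ge _ AB0); rewrite zRM ler_pdivlMr// -mulrA [leRHS]mulrC ler_pM2l//.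
    have : (e * (1 + zR A / zR B)) * zR B <= 1 * zR B by rewrite ler_pM2r.
    by rewrite mul1r -mulrA mulrDl mul1r divfK ?gt_eqF// addrC -zRD.
  + move=> h; have := le_trans h (zR_le hi); rewrite zRM zRD ME zR1 WE => h1.
    rewrite -(ler_pM2l c0); apply: le_trans h1 _.
    by rewrite [leRHS]mulrAC (mulrDr k (decR x y z)) ki.
Qed.

(** 2 ^ 34 subdivisions leave an error far below the six decimals claimed, and
    24 further digits absorb the rounding of the squarings. *)
Definition exp_check := exp_check_at (10 ^ 24)%Z 34.

Lemma expN_enclosure a1 a2 a3 b x y z t : exp_check a1 a2 a3 b x y z ->
  t = (a1%:R + a2%:R / 10 ^+ 2 + a3%:R / 10 ^+ 4) / b%:R ->
  decR x y z <= expR (- t) <= decR x y z + 1 / 10 ^+ 6.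
Proof. exact: exp_check_atP. Qed.

End ExpEnclosure.

Section ExpBounds.
Variable R : realType.
Implicit Types x : R.

Let pos_of_der (f f' : R -> R) x : 0 <= x -> f 0 = 0 ->
  (forall y, 0 <= y <= x -> is_derive y 1 f (f' y)) ->
  (forall y, 0 <= y <= x -> 0 <= f' y) -> 0 <= f x.
Proof. by move=> x0 f0 d p; rewrite -[leLHS]f0; apply: (is_derive_ge0_le (f' := f')). Qed.

(** With y = sin (pi / 6), tripling the angle gives 3 y - 4 y ^ 3 = 1, that is
    (2 y - 1) ^ 2 (y + 1) = 0. From this value pi is enclosed by means of the
    Taylor polynomials of the sine. *)
Lemma sin_pi_div6 : sin (pi / 6) = 1 / 2 :> R.
Proof.
have aux1 (z : R) : 0 < z -> z + 1 = 0 -> z = 1 / 2 by lra.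
have aux2 (z : R) : 2 * z - 1 = 0 -> z = 1 / 2 by lra.
have pi0 := pi_gt0 R.
set s := sin _; set c := cos (pi / 6 : R).
have sc : c ^+ 2 + s ^+ 2 = 1 by exact: cos2Dsin2.
have s0 : 0 < s by apply: sin_gt0_pi; lra.
have e2 : sin (pi / 6 *+ 2 : R) = c * s *+ 2 by rewrite sin_mulr2n.
have e3 : cos (pi / 6 *+ 2 : R) = c ^+ 2 *+ 2 - 1 by rewrite cos_mulr2n.
have : sin (pi / 2) = 1 :> R.
  by have := sinDpihalf (0 : R); rewrite add0r cos0.
rewrite (_ : pi / 2 = pi / 6 *+ 2 + pi / 6); last by rewrite mulr2n; field.
rewrite sinD e2 e3 -/c -/s !mulr2n => h.
have h2 : (s + 1) * (2 * s - 1) ^+ 2 = 0.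
  have e : (c * s + c * s) * c + (c ^+ 2 + c ^+ 2 - 1) * s = 2 * s * c ^+ 2 + (2 * c ^+ 2 - 1) * s :> R by ring.
  move: h; rewrite e; have -> : c ^+ 2 = 1 - s ^+ 2 by lra.
  move=> h; have -> : (s + 1) * (2 * s - 1) ^+ 2 = 1 - (2 * s * (1 - s ^+ 2) + (2 * (1 - s ^+ 2) - 1) * s) :> R by ring.
  by rewrite h subrr.
move/eqP: h2; rewrite mulf_eq0 sqrf_eq0 => /orP[/eqP|/eqP] h3.
  exact: aux1 h3.
exact: aux2 h3.
Qed.

Lemma sin_taylor x : 0 <= x ->
  x - x ^+ 3 / 6 + x ^+ 5 / 120 - x ^+ 7 / 5040 <= sin x <= x - x ^+ 3 / 6 + x ^+ 5 / 120.
Proof.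
move=> x0.
have p2 (y : R) : 0 <= y -> 0 <= cos y - (1 - y ^+ 2 / 2).
  by move=> y0; have := cos_ge_quad y; lra.
have p3 (y : R) : 0 <= y -> 0 <= sin y - (y - y ^+ 3 / 6).
  move=> y0; apply: (@pos_of_der (fun z : R => sin z - (z - z ^+ 3 / 6)) (fun y : R => cos y - (1 - y ^+ 2 / 2)) y y0).
  - by rewrite sin0; lra.
  - by move=> z _; apply: is_derive_eq; rewrite /GRing.scale /=; field.
  - by move=> z /andP[z0 _]; exact: p2.
have p4 (y : R) : 0 <= y -> 0 <= (1 - y ^+ 2 / 2 + y ^+ 4 / 24) - cos y.
  move=> y0; apply: (@pos_of_der (fun z : R => (1 - z ^+ 2 / 2 + z ^+ 4 / 24) - cos z) (fun y : R => sin y - (y - y ^+ 3 / 6)) y y0).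
  - by rewrite cos0; lra.
  - by move=> z _; apply: is_derive_eq; rewrite /GRing.scale /=; field.
  - by move=> z /andP[z0 _]; exact: p3.
have p5 (y : R) : 0 <= y -> 0 <= (y - y ^+ 3 / 6 + y ^+ 5 / 120) - sin y.
  move=> y0; apply: (@pos_of_der (fun z : R => (z - z ^+ 3 / 6 + z ^+ 5 / 120) - sin z) (fun y : R => (1 - y ^+ 2 / 2 + y ^+ 4 / 24) - cos y) y y0).
  - by rewrite sin0; lra.
  - by move=> z _; apply: is_derive_eq; rewrite /GRing.scale /=; field.
  - by move=> z /andP[z0 _]; exact: p4.
have p6 (i y : R) : 6 * i = 120^-1 -> 0 <= y -> 0 <= cos y - (1 - y ^+ 2 / 2 + y ^+ 4 / 24 - y ^+ 6 * i).
  move=> hi y0; apply: (@pos_of_der (fun z : R => cos z - (1 - z ^+ 2 / 2 + z ^+ 4 / 24 - z ^+ 6 * i)) (fun y : R => (y - y ^+ 3 / 6 + y ^+ 5 / 120) - sin y) y y0).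
  - by rewrite cos0; lra.
  - by move=> z _; apply: is_derive_eq; rewrite /GRing.scale /= -hi; field.
  - by move=> z /andP[z0 _]; exact: p5.
have p7 (i j y : R) : 6 * i = 120^-1 -> 7 * j = i -> 0 <= y -> 0 <= sin y - (y - y ^+ 3 / 6 + y ^+ 5 / 120 - y ^+ 7 * j).
  move=> hi hj y0; apply: (@pos_of_der (fun z : R => sin z - (z - z ^+ 3 / 6 + z ^+ 5 / 120 - z ^+ 7 * j)) (fun y : R => cos y - (1 - y ^+ 2 / 2 + y ^+ 4 / 24 - y ^+ 6 * i)) y y0).
  - by rewrite sin0; lra.
  - by move=> z _; apply: is_derive_eq; rewrite /GRing.scale /= -hj; field.
  - by move=> z /andP[z0 _]; exact: (p6 i).
by have := p5 x x0; have := p7 720^-1 5040^-1 x ltac:(lra) ltac:(lra) x0; lra.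
Qed.

Lemma pi_bounds : (3 + 14 / 10 ^+ 2 + 15 / 10 ^+ 4 : R) <= pi <= (3 + 14 / 10 ^+ 2 + 16 / 10 ^+ 4 : R).
Proof.
have pi0 := pi_gt0 R.
have sin_mono (x y : R) : 0 <= x -> x <= y -> y <= pi / 2 -> sin x <= sin y.
  move=> x0 xy yp; apply: (is_derive_ge0_le (f' := cos)) => // z /andP[z0 zy].
  by apply: cos_ge0_pihalf; lra.
have s6 := sin_pi_div6.
apply/andP; split; rewrite leNgt; apply/negP => h.
- have := @sin_mono (pi / 6) ((3 + 14 / 10 ^+ 2 + 15 / 10 ^+ 4) / 6) ltac:(lra) ltac:(lra).
  case: (leP ((3 + 14 / 10 ^+ 2 + 15 / 10 ^+ 4) / 6 : R) (pi / 2)) => h2; last by have := pi_ge2 R; lra.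
  move=> /(_ isT); rewrite s6.
  have := @sin_taylor ((3 + 14 / 10 ^+ 2 + 15 / 10 ^+ 4) / 6) ltac:(lra); lra.
- have := @sin_mono ((3 + 14 / 10 ^+ 2 + 16 / 10 ^+ 4) / 6) (pi / 6) ltac:(lra) ltac:(lra) ltac:(lra).
  rewrite s6; have := @sin_taylor ((3 + 14 / 10 ^+ 2 + 16 / 10 ^+ 4) / 6) ltac:(lra); lra.
Qed.

(** pi times the squared length of the shortest vectors of the hexagonal
    lattice of area 1: the point at which the ratio of moment functions is
    linearized. *)
Definition vhex : R := 2 * pi / Num.sqrt 3.

Lemma vhex_sqr : vhex ^+ 2 = 4 / 3 * pi ^+ 2.
Proof.
by rewrite /vhex expr_div_n sqr_sqrtr ?exprMn; [field | lra].
Qed.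

Lemma vhex_bounds : (3 + 62 / 10 ^+ 2 + 74 / 10 ^+ 4 : R) <= vhex <= (3 + 62 / 10 ^+ 2 + 77 / 10 ^+ 4 : R).
Proof.
have /andP[pl pu] := pi_bounds; have h := vhex_sqr.
have v0 : 0 <= vhex by rewrite divr_ge0 ?sqrtr_ge0// mulr_ge0// pi_ge0.
move: h; rewrite !expr2 => h.
apply/andP; split; rewrite leNgt; apply/negP => l.
- have h1 : (3 + 14 / 10 ^+ 2 + 15 / 10 ^+ 4) * (3 + 14 / 10 ^+ 2 + 15 / 10 ^+ 4) <= pi * pi :> R.
    by apply: (ler_pM _ _ pl pl); lra.
  have h2 : vhex * vhex <= (3 + 62 / 10 ^+ 2 + 74 / 10 ^+ 4) * (3 + 62 / 10 ^+ 2 + 74 / 10 ^+ 4).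
    by apply: (ler_pM v0 v0); apply: ltW.
  by move: h h1 h2; move: (vhex * vhex) (pi * pi : R) => A B; lra.
- have h1 : pi * pi <= (3 + 14 / 10 ^+ 2 + 16 / 10 ^+ 4) * (3 + 14 / 10 ^+ 2 + 16 / 10 ^+ 4) :> R.
    by apply: (ler_pM _ _ pu pu); exact: pi_ge0.
  have h2 : (3 + 62 / 10 ^+ 2 + 77 / 10 ^+ 4) * (3 + 62 / 10 ^+ 2 + 77 / 10 ^+ 4) <= vhex * vhex.
    by apply: ler_pM; [lra|lra|apply: ltW|apply: ltW].
  by move: h h1 h2; move: (vhex * vhex) (pi * pi : R) => A B; lra.
Qed.

End ExpBounds.

(** * Convexity of the ratio of two moment functions *)

Section Convexity.
Variable R : realType.
Implicit Types f : R -> R.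

Lemma convex_above_tangent f (f' f'' : R -> R) (l r : R) :
  (forall y, l <= y <= r -> is_derive y 1 f (f' y)) ->
  (forall y, l <= y <= r -> is_derive y 1 f' (f'' y)) ->
  (forall y, l <= y <= r -> 0 <= f'' y) ->
  forall q w, l <= q <= r -> l <= w <= r -> f w + f' w * (q - w) <= f q.
Proof.
move=> d1 d2 p q w /andP[lq qr] /andP[lw wr].
have mono x y : l <= x -> x <= y -> y <= r -> f' x <= f' y.
  move=> lx xy yr; apply: (is_derive_ge0_le (f' := f'')) => // z /andP[xz zy].
    by apply: d2; rewrite (le_trans lx)// (le_trans zy).
  by apply: p; rewrite (le_trans lx)// (le_trans zy).
have [qw|wq|->] := ltgtP q w; last by rewrite subrr mulr0 addr0.
- have [|c /andP[c1 c2] E] := @MVT_is_derive R f f' q w qw.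
    by move=> z /andP[z1 z2]; apply: d1; rewrite (le_trans lq)// (le_trans z2).
  have : f' c <= f' w by apply: mono => //; [exact: le_trans lq (ltW c1)|exact: ltW].
  move=> h; have : f' c * (w - q) <= f' w * (w - q) by rewrite ler_wpM2r// subr_ge0 ltW.
  by rewrite -E; lra.
- have [|c /andP[c1 c2] E] := @MVT_is_derive R f f' w q wq.
    by move=> z /andP[z1 z2]; apply: d1; rewrite (le_trans lw)// (le_trans z2).
  have : f' w <= f' c by apply: mono => //; [exact: ltW|exact: le_trans (ltW c2) qr].
  move=> h; have : f' w * (q - w) <= f' c * (q - w) by rewrite ler_wpM2r// subr_ge0 ltW.
  by rewrite -E; lra.
Qed.

End Convexity.

Section RatioTangent.
Variable R : realType.
Implicit Types s v : R.

(** The sum of this function over the nonzero vectors is, up to a factor, minus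
    the derivative in s of sqrt s times the theta series without its constant
    term. *)
Definition hfun s v := (s * v - 1 / 2) * expR (- (s * v)).
Definition ratioA s v := s + (s - 1) / (2 * (v - 1 / 2)).

(** The quotient of h_s by h_1; [slope] is minus its derivative. It is a product
    of two positive decreasing convex functions. *)
Definition ratio s v := ratioA s v * expR (- ((s - 1) * v)).
Definition slope s v :=
  (s - 1) * expR (- ((s - 1) * v)) * (ratioA s v + 1 / (2 * (v - 1 / 2) ^+ 2)).

Lemma hfun1 v : hfun 1 v = (v - 1 / 2) * expR (- v).
Proof. by rewrite /hfun !mul1r. Qed.

Lemma ratioA_ge s v : 1 <= s -> 1 / 2 < v -> s <= ratioA s v.
Proof. by move=> s1 v1; rewrite /ratioA lerDl divr_ge0//; lra. Qed.

Lemma slope_gt0 s v : 1 < s -> 1 / 2 < v -> 0 < slope s v.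
Proof.
move=> s1 v1; apply: mulr_gt0; first by rewrite mulr_gt0 ?expR_gt0// subr_gt0.
have := ratioA_ge (ltW s1) v1.
have : 0 <= 1 / (2 * (v - 1 / 2) ^+ 2) by rewrite divr_ge0// mulr_ge0// sqr_ge0.
lra.
Qed.

Lemma slope_ge0 s v : 1 <= s -> 1 / 2 < v -> 0 <= slope s v.
Proof.
move=> s1 v1; apply: mulr_ge0; first by rewrite mulr_ge0 ?expR_ge0// subr_ge0.
have := ratioA_ge s1 v1.
have : 0 <= 1 / (2 * (v - 1 / 2) ^+ 2) by rewrite divr_ge0// mulr_ge0// sqr_ge0.
lra.
Qed.

Lemma hfun_at s v : 1 / 2 < v -> hfun s v = ratio s v * hfun 1 v.
Proof.
move=> v1; rewrite hfun1 /hfun /ratio /ratioA.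
have -> : expR (- (s * v)) = expR (- ((s - 1) * v)) * expR (- v).
  by rewrite -expRD; congr expR; ring.
by field; lra.
Qed.

(** The exponential factor of the ratio lies above its tangent; since both
    factors of the ratio decrease, their increments have the same sign. *)
Let tangent_core s v v0 : 1 <= s -> 1 / 2 < v -> 1 / 2 < v0 ->
  exists2 B : R, (1 - (s - 1) * (v - v0) <= B /\ (1 < s -> v != v0 -> 1 - (s - 1) * (v - v0) < B)) &
  hfun s v = ratioA s v * (expR (- ((s - 1) * v0)) * B) * hfun 1 v /\ (0 <= (ratioA s v - ratioA s v0) * (B - 1)).
Proof.
move=> s1 v1 v01; exists (expR (- ((s - 1) * (v - v0)))); last split.
- split; first exact: expR_ge1Dx.
  move=> s1' vv; apply: expR_gt1Dx; rewrite oppr_eq0 mulf_neq0// subr_eq0 //.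
  by rewrite gt_eqF.
- by rewrite hfun_at// /ratio -expRD; congr (_ * expR _ * _); ring.
- have dA : ratioA s v - ratioA s v0 = (s - 1) * (v0 - v) / (2 * (v - 1 / 2) * (v0 - 1 / 2)).
    by rewrite /ratioA; field; lra.
  have D0 : 0 < 2 * (v - 1 / 2) * (v0 - 1 / 2) by rewrite !mulr_gt0 ?subr_gt0.
  have [vv|vv] := leP v v0.
    apply: mulr_ge0; first by rewrite dA divr_ge0 ?(ltW D0)// mulr_ge0// subr_ge0.
    rewrite subr_ge0 -[leLHS]expR0 ler_expR.
    have : 0 <= (s - 1) * (v0 - v) by rewrite mulr_ge0// subr_ge0.
    lra.
  apply: mulr_le0.
    rewrite dA; apply: mulr_le0_ge0; last by rewrite invr_ge0 ltW.
    by rewrite mulr_ge0_le0// ?subr_ge0// subr_le0 ltW.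
  rewrite subr_le0 -[leRHS]expR0 ler_expR.
  have : 0 <= (s - 1) * (v - v0) by rewrite mulr_ge0// ?subr_ge0// ltW.
  lra.
Qed.

Let tangent_alg s v v0 (B : R) : 1 <= s -> 1 / 2 < v -> 1 / 2 < v0 ->
  0 <= (ratioA s v - ratioA s v0) * (B - 1) ->
  ratioA s v * B >= ratioA s v0 * (1 - (s - 1) * (v - v0)) - (s - 1) / (2 * (v0 - 1 / 2) ^+ 2) * (v - v0)
     + ratioA s v0 * (B - (1 - (s - 1) * (v - v0))).
Proof.
move=> s1 v1 v01 h.
have : ratioA s v - ratioA s v0 + (s - 1) / (2 * (v0 - 1 / 2) ^+ 2) * (v - v0) >= 0.
  have -> : ratioA s v - ratioA s v0 + (s - 1) / (2 * (v0 - 1 / 2) ^+ 2) * (v - v0) =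
      (s - 1) * (v - v0) ^+ 2 / (2 * (v - 1 / 2) * (v0 - 1 / 2) ^+ 2).
    by rewrite /ratioA; field; lra.
  apply: divr_ge0; apply: mulr_ge0; rewrite ?sqr_ge0//; lra.
move: h; set z := _ / _ * _; set w := _ * (v - v0).
by move: (ratioA s v) (ratioA s v0) => x y h1 h2; lra.
Qed.

(** Convexity of the ratio, obtained from its two factors. *)
Lemma ratio_tangent s v v0 : 1 <= s -> 1 / 2 < v -> 1 / 2 < v0 ->
  (ratio s v0 - slope s v0 * (v - v0)) * hfun 1 v <= hfun s v.
Proof.
move=> s1 v1 v01; have [B [B1 _] [-> AB]] := tangent_core s1 v1 v01.
apply: ler_wpM2r; first by rewrite hfun1 mulr_ge0 ?expR_ge0//; lra.
have := tangent_alg s1 v1 v01 AB; have y0 := ratioA_ge s1 v01.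
have y1 : 0 <= ratioA s v0 * (B - (1 - (s - 1) * (v - v0))).
  by rewrite mulr_ge0 ?subr_ge0//; lra.
move=> h; rewrite mulrCA /ratio /slope.
set e := expR _; have e0 : 0 <= e := expR_ge0 _.
have -> : ratioA s v0 * e - (s - 1) * e * (ratioA s v0 + 1 / (2 * (v0 - 1 / 2) ^+ 2)) * (v - v0) =
  e * (ratioA s v0 * (1 - (s - 1) * (v - v0)) - (s - 1) / (2 * (v0 - 1 / 2) ^+ 2) * (v - v0)).
  by field; lra.
by apply: ler_wpM2l => //; lra.
Qed.

Lemma ratio_tangent_lt s v v0 : 1 < s -> 1 / 2 < v -> 1 / 2 < v0 -> v != v0 ->
  (ratio s v0 - slope s v0 * (v - v0)) * hfun 1 v < hfun s v.
Proof.
move=> s1 v1 v01 vv; have [B [_ /(_ s1 vv) B1] [-> AB]] := tangent_core (ltW s1) v1 v01.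
have h0 : 0 < hfun 1 v by rewrite hfun1 mulr_gt0 ?expR_gt0//; lra.
rewrite ltr_pM2r//.
have := tangent_alg (ltW s1) v1 v01 AB; have y0 := ratioA_ge (ltW s1) v01.
have y1 : 0 < ratioA s v0 * (B - (1 - (s - 1) * (v - v0))).
  by rewrite mulr_gt0 ?subr_gt0//; lra.
move=> h; rewrite mulrCA /ratio /slope.
set e := expR _; have e0 : 0 < e := expR_gt0 _.
have -> : ratioA s v0 * e - (s - 1) * e * (ratioA s v0 + 1 / (2 * (v0 - 1 / 2) ^+ 2)) * (v - v0) =
  e * (ratioA s v0 * (1 - (s - 1) * (v - v0)) - (s - 1) / (2 * (v0 - 1 / 2) ^+ 2) * (v - v0)).
  by field; lra.
by rewrite ltr_pM2l//; lra.
Qed.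

(** Bounds minus the derivative of h_s at the distant point w, in terms that do
    not involve s except through the tangent of the ratio at [v0]. *)
Lemma hfun_slope_bound s v0 w : 1 <= s -> 3 <= v0 -> 3 * v0 <= w ->
  s * (s * w - 3 / 2) * expR (- (s * w)) <=
  slope s v0 * hfun 1 w + ratio s v0 * ((w - 3 / 2) * expR (- w)).
Proof.
move=> s1 v03 w0.
have -> : expR (- (s * w)) = expR (- ((s - 1) * (w - v0))) * (expR (- ((s - 1) * v0)) * expR (- w)).
  by rewrite -!expRD; congr expR; ring.
rewrite hfun1 /slope /ratio.
set e := expR (- ((s - 1) * v0)); set x := expR (- w).
have e0 : 0 < e := expR_gt0 _; have x0 : 0 < x := expR_gt0 _.
set B := expR _; have B0 : 0 < B := expR_gt0 _.
have B1 : B * (1 + (s - 1) * (w - v0)) <= 1.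
  have h := expR_ge1Dx ((s - 1) * (w - v0)).
  apply: (@le_trans _ _ (B * expR ((s - 1) * (w - v0)))); first by rewrite ler_pM2l.
  by rewrite /B -expRD addNr expR0.
have y0 := @ratioA_ge s v0 s1 ltac:(lra); set y := ratioA s v0 in y0 *.
have z0 : 0 <= 1 / (2 * (v0 - 1 / 2) ^+ 2) by rewrite divr_ge0// mulr_ge0// sqr_ge0.
set z := 1 / _ in z0 *.
have -> : (s - 1) * e * (y + z) * ((w - 1 / 2) * x) + y * e * ((w - 3 / 2) * x) =
  ((s - 1) * (y + z) * (w - 1 / 2) + y * (w - 3 / 2)) * (e * x) by ring.
have -> : s * (s * w - 3 / 2) * (B * (e * x)) = (s * ((s * w - 3 / 2) * B)) * (e * x) by ring.
apply: ler_wpM2r; first by rewrite mulr_ge0 ?ltW.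
set t := s - 1; have t0 : 0 <= t by rewrite /t; lra.
have sE : s = 1 + t by rewrite /t; lra.
have key : (s * w - 3 / 2) * B <= t * (w - 1 / 2) + (w - 3 / 2).
  have k1 : s * w - 3 / 2 <= (t * (w - 1 / 2) + (w - 3 / 2)) * (1 + t * (w - v0)).
    rewrite sE; have : 0 <= t * (t * (w - 1 / 2) * (w - v0) + (w - 3 / 2) * (w - v0) - 1 / 2).
      apply: mulr_ge0 => //.
      have : 0 <= t * (w - 1 / 2) * (w - v0) by rewrite !mulr_ge0//; lra.
      have : 1 * 1 <= (w - 3 / 2) * (w - v0) by apply: ler_pM; lra.
      lra.
    lra.
  have m0 : 0 <= t * (w - 1 / 2) + (w - 3 / 2) by rewrite addr_ge0// ?mulr_ge0//; lra.
  apply: (@le_trans _ _ ((t * (w - 1 / 2) + (w - 3 / 2)) * (B * (1 + t * (w - v0))))).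
    by rewrite [leRHS]mulrA [leRHS]mulrAC ler_pM2r.
  by rewrite -[leRHS]mulr1 ler_wpM2l.
apply: (@le_trans _ _ (s * (t * (w - 1 / 2) + (w - 3 / 2)))).
  by apply: ler_wpM2l => //; lra.
apply: (@le_trans _ _ (y * (t * (w - 1 / 2) + (w - 3 / 2)))).
  by apply: ler_wpM2r => //; rewrite addr_ge0// ?mulr_ge0//; lra.
have : 0 <= t * z * (w - 1 / 2) by apply: mulr_ge0; [exact: mulr_ge0 | lra].
lra.
Qed.

End RatioTangent.

Section Potentials.
Variable R : realType.
Implicit Types s v w q : R.

(** The function of constant lattice sum from [asum0_gauss_dual], with its first
    two derivatives. *)
Definition gdual v := expR (- (2 / 3 * v)) - 3 / 2 * expR (- (3 / 2 * v)).
Definition gdual1 v := - (2 / 3) * expR (- (2 / 3 * v)) + 9 / 4 * expR (- (3 / 2 * v)).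
Definition gdual2 v := 4 / 9 * expR (- (2 / 3 * v)) - 27 / 8 * expR (- (3 / 2 * v)).

Lemma is_derive_gdual v : is_derive v 1 gdual (gdual1 v).
Proof. by rewrite /gdual /gdual1; apply: is_derive_eq; rewrite /GRing.scale /=; field. Qed.

Lemma is_derive_gdual1 v : is_derive v 1 gdual1 (gdual2 v).
Proof. by rewrite /gdual1 /gdual2; apply: is_derive_eq; rewrite /GRing.scale /=; field. Qed.

Definition hfun1d s v := s * (3 / 2 - s * v) * expR (- (s * v)).
Definition hfun2d s v := s ^+ 2 * (s * v - 5 / 2) * expR (- (s * v)).

Lemma is_derive_hfun s v : is_derive v 1 (hfun s) (hfun1d s v).
Proof. by rewrite /hfun /hfun1d; apply: is_derive_eq; rewrite /GRing.scale /=; field. Qed.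

Lemma is_derive_hfun1d s v : is_derive v 1 (hfun1d s) (hfun2d s v).
Proof. by rewrite /hfun1d /hfun2d; apply: is_derive_eq; rewrite /GRing.scale /=; field. Qed.

Lemma expR_ge_of_le (m u L : R) : expR (- m) <= u -> L * u <= 1 -> 0 <= L -> L <= expR m.
Proof.
move=> mu Lu L0; have e0 := expR_gt0 (- m).
have E : expR m * expR (- m) = 1 by rewrite -expRD subrr expR0.
rewrite -(ler_pM2r e0) E; apply: le_trans Lu; exact: ler_wpM2l.
Qed.

(** Square 1 + u / 2 <= exp (u / 2), where the left side is nonnegative. *)
Lemma expR_ge_quarter (u : R) : - 2 <= u -> 1 + u + u ^+ 2 / 4 <= expR u.
Proof.
move=> u2; have -> : expR u = expR (u / 2) * expR (u / 2) by rewrite -expRD; congr expR; field.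
have h := expR_ge1Dx (u / 2); have h0 : 0 <= 1 + u / 2 by lra.
have := ler_pM h0 h0 h h; lra.
Qed.

Lemma split23 v : expR (- (2 / 3 * v)) = expR (- v) * expR (v / 3).
Proof. by rewrite -expRD; congr expR; field. Qed.

Lemma split32 v : expR (- (3 / 2 * v)) = expR (- v) * expR (- (v / 2)).
Proof. by rewrite -expRD; congr expR; field. Qed.

Lemma bracket_pos v : 5 / 2 <= v -> 0 <= 4 / 9 * expR (v / 3) - 27 / 8 * expR (- (v / 2)).
Proof.
move=> v1.
have chk : exp_check 5 0 0 6 43 45 98 by vm_compute.
have /andP[_ a] := @expN_enclosure R 5 0 0 6 43 45 98 (5 / 6) chk ltac:(clear; lra); clear chk.
have chk : exp_check 5 0 0 4 28 65 4 by vm_compute.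
have /andP[_ b] := @expN_enclosure R 5 0 0 4 28 65 4 (5 / 4) chk ltac:(clear; lra); clear chk.
have h1 : 23 / 10 <= expR (5 / 6) :> R by apply: expR_ge_of_le a _ _; lra.
have h2 : expR (5 / 6) <= expR (v / 3) by rewrite ler_expR; lra.
have h3 : expR (- (v / 2)) <= expR (- (5 / 4)) by rewrite ler_expR; lra.
lra.
Qed.

Lemma gdual2_ge0 v : 5 / 2 <= v -> 0 <= gdual2 v.
Proof.
move=> v1; rewrite /gdual2 split23 split32.
have -> : 4 / 9 * (expR (- v) * expR (v / 3)) - 27 / 8 * (expR (- v) * expR (- (v / 2))) =
  expR (- v) * (4 / 9 * expR (v / 3) - 27 / 8 * expR (- (v / 2))) by ring.
by rewrite mulr_ge0 ?expR_ge0// bracket_pos.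
Qed.

Lemma bracket_ge v : 5 / 2 <= v ->
  0 <= (5 - v) * (v - 5 / 2) + 31 / 10 * (4 / 9 * expR (v / 3) - 27 / 8 * expR (- (v / 2))).
Proof.
move=> v1; have [v5|v5] := leP v 5.
  have := bracket_pos v1; have : 0 <= (5 - v) * (v - 5 / 2) by rewrite mulr_ge0//; lra.
  lra.
have [v7|v7] := leP v 7.
  have chk : exp_check 2 0 0 1 13 53 35 by vm_compute.
  have /andP[_ a] := @expN_enclosure R 2 0 0 1 13 53 35 (2 / 1) chk ltac:(clear; lra); clear chk.
  have chk : exp_check 5 0 0 2 8 20 84 by vm_compute.
  have /andP[_ b] := @expN_enclosure R 5 0 0 2 8 20 84 (5 / 2) chk ltac:(clear; lra); clear chk.
  have h1 : 738 / 100 <= expR (2 / 1) :> R by apply: expR_ge_of_le a _ _; lra.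
  have h2 : expR (- (v / 2)) <= expR (- (5 / 2)) by rewrite ler_expR; lra.
  have h3 : 738 / 100 * (1 + (v - 6) / 3) <= expR (v / 3).
    have -> : expR (v / 3) = expR (2 / 1) * expR ((v - 6) / 3) by rewrite -expRD; congr expR; field.
    by apply: ler_pM h1 (expR_ge1Dx _); lra.
  have h4 : 0 <= (v - 5) * (7 - v) by rewrite mulr_ge0//; lra.
  lra.
have chk : exp_check 10 0 0 3 3 56 73 by vm_compute.
have /andP[_ a] := @expN_enclosure R 10 0 0 3 3 56 73 (10 / 3) chk ltac:(clear; lra); clear chk.
have chk : exp_check 7 0 0 2 3 1 97 by vm_compute.
have /andP[_ b] := @expN_enclosure R 7 0 0 2 3 1 97 (7 / 2) chk ltac:(clear; lra); clear chk.
have h1 : 2802 / 100 <= expR (10 / 3) :> R by apply: expR_ge_of_le a _ _; lra.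
have h2 : expR (- (v / 2)) <= expR (- (7 / 2)) by rewrite ler_expR; lra.
have [u vE] : exists u : R, v = 10 + 3 * u by exists ((v - 10) / 3); field.
have u1 : - 1 <= u by lra.
have h3 : 2802 / 100 * (1 + u + u ^+ 2 / 4) <= expR (v / 3).
  have -> : expR (v / 3) = expR (10 / 3) * expR u by rewrite -expRD vE; congr expR; field.
  apply: ler_pM h1 (expR_ge_quarter _); [lra| |lra].
  by have := sqr_ge0 (1 + u / 2); lra.
have h4 : 0 <= (u + 11 / 13) ^+ 2 := sqr_ge0 _.
have q : (5 - v) * (v - 5 / 2) = - (75 / 2) - 75 / 2 * u - 9 * u ^+ 2 by rewrite vE; field.
rewrite q; lra.
Qed.

(** The convexity needed below. The first term is negative only for v > 5, where
    the slowly decaying part of the second derivative of [gdual] outweighs it;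
    the coefficient 31/10 is chosen for that purpose. *)
Lemma curvature_ge0 v : 5 / 2 <= v ->
  0 <= (5 - v) * ((v - 5 / 2) * expR (- v)) + 31 / 10 * gdual2 v.
Proof.
move=> v1; rewrite /gdual2 split23 split32.
have := mulr_ge0 (expR_ge0 (- v)) (bracket_ge v1); lra.
Qed.

(** The part of the corrected potential that does not depend on s: the tangent
    line of the ratio, normalized to slope -1 and shifted so as to vanish at
    v = 5, times h_1, plus a multiple of [gdual]. *)
Definition Upot v := (5 - v) * ((v - 1 / 2) * expR (- v)) + 31 / 10 * gdual v.
Definition Upot1 v := (- (v - 1 / 2) - (5 - v) * (v - 3 / 2)) * expR (- v) + 31 / 10 * gdual1 v.
Definition Upot2 v := ((5 - v) * (v - 5 / 2) + 2 * (v - 3 / 2)) * expR (- v) + 31 / 10 * gdual2 v.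

Lemma is_derive_Upot v : is_derive v 1 Upot (Upot1 v).
Proof.
have d := is_derive_gdual v.
by rewrite /Upot /Upot1; apply: is_derive_eq; rewrite /GRing.scale /=; field.
Qed.

Lemma is_derive_Upot1 v : is_derive v 1 Upot1 (Upot2 v).
Proof.
have d := is_derive_gdual1 v.
by rewrite /Upot1 /Upot2; apply: is_derive_eq; rewrite /GRing.scale /=; field.
Qed.

Section Fixed.
Variables s v0 : R.
Hypotheses (s1 : 1 < s) (v03 : 3 <= v0).

Definition alphaH := ratio s v0 - slope s v0 * (5 - v0).

(** h_s corrected by multiples of h_1 and [gdual], whose lattice sums are
    constant, and divided by the slope of the ratio at [v0]. By the tangent
    inequality it dominates [Upot], with equality at [v0]; and it is convex on
    v >= 5/2. *)
Definition Hpot v := (hfun s v - alphaH * hfun 1 v) / slope s v0 + 31 / 10 * gdual v.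
Definition Hpot1 v := (hfun1d s v - alphaH * hfun1d 1 v) / slope s v0 + 31 / 10 * gdual1 v.
Definition Hpot2 v := (hfun2d s v - alphaH * hfun2d 1 v) / slope s v0 + 31 / 10 * gdual2 v.

Let v0h : 1 / 2 < v0. Proof. by have := v03; lra. Qed.
Let sl0 : 0 < slope s v0. Proof. exact: slope_gt0. Qed.

Lemma is_derive_Hpot v : is_derive v 1 Hpot (Hpot1 v).
Proof.
have d := is_derive_gdual v; have d1 := is_derive_hfun s v; have d2 := is_derive_hfun 1 v.
by rewrite /Hpot /Hpot1; apply: is_derive_eq; rewrite /GRing.scale /=; field; rewrite gt_eqF.
Qed.

Lemma is_derive_Hpot1 v : is_derive v 1 Hpot1 (Hpot2 v).
Proof.
have d := is_derive_gdual1 v; have d1 := is_derive_hfun1d s v; have d2 := is_derive_hfun1d 1 v.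
by rewrite /Hpot1 /Hpot2; apply: is_derive_eq; rewrite /GRing.scale /=; field; rewrite gt_eqF.
Qed.

Lemma Upot_le_Hpot v : 1 / 2 < v -> Upot v <= Hpot v.
Proof.
move=> v1; rewrite /Upot /Hpot lerD2r ler_pdivlMr//.
have := @ratio_tangent R s v v0 (ltW s1) v1 v0h; rewrite hfun1 /alphaH.
by lra.
Qed.

Lemma Upot_lt_Hpot v : 1 / 2 < v -> v != v0 -> Upot v < Hpot v.
Proof.
move=> v1 vv; rewrite /Upot /Hpot ltrD2r ltr_pdivlMr//.
have := @ratio_tangent_lt R s v v0 s1 v1 v0h vv; rewrite hfun1 /alphaH.
by lra.
Qed.

Lemma Hpot_at : Hpot v0 = Upot v0.
Proof.
rewrite /Upot /Hpot (hfun_at _ v0h) /alphaH hfun1; field; rewrite gt_eqF//.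
Qed.

(** The second derivative of h_s is compared with that of h_1 by the same
    tangent inequality as the functions themselves, since the polynomial factor
    s v - 5/2 gains at least as much as s v - 1/2; the rest is
    [curvature_ge0]. *)
Lemma Hpot2_ge0 v : 5 / 2 <= v -> 0 <= Hpot2 v.
Proof.
move=> v1; have c := curvature_ge0 v1; apply: le_trans c _; have s1' := s1.
rewrite /Hpot2 lerD2r ler_pdivlMr// /hfun2d ?expr1n ?mul1r /alphaH.
have h := @ratio_tangent R s v v0 (ltW s1) ltac:(lra) v0h.
set rt := ratio _ _ in h *; set sl := slope _ _ in h *.
have x0 : 0 < expR (- v) := expR_gt0 _; set x := expR (- v) in x0 *.
have y0 : 0 < expR (- (s * v)) := expR_gt0 _; set y := expR (- (s * v)) in y0 *.
have w0 : 0 < v - 1 / 2 by lra.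
have k : (rt - sl * (v - v0)) * ((v - 5 / 2) * x) <= s ^+ 2 * (s * v - 5 / 2) * y.
  apply: (@le_trans _ _ ((v - 5 / 2) / (v - 1 / 2) * ((s * v - 1 / 2) * y))).
    have -> : (rt - sl * (v - v0)) * ((v - 5 / 2) * x) =
       (v - 5 / 2) / (v - 1 / 2) * ((rt - sl * (v - v0)) * hfun 1 v).
      by rewrite hfun1 -/x; field; lra.
    by apply: ler_wpM2l h; rewrite divr_ge0//; lra.
  rewrite mulrA ler_pM2r// mulrAC ler_pdivrMr//.
  have s2 : 1 * 1 <= s * s by apply: ler_pM; lra.
  have m : (v - 5 / 2) * (s * v - 1 / 2) <= (s * v - 5 / 2) * (v - 1 / 2).
    have : 0 <= (s - 1) * v by rewrite mulr_ge0//; lra.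
    lra.
  have p0 : 0 <= (s * v - 5 / 2) * (v - 1 / 2).
    apply: mulr_ge0; last by lra.
    have : 0 <= (s - 1) * v by rewrite mulr_ge0//; lra.
    lra.
  by have := ler_wpM2r p0 s2; lra.
have -> : (5 - v) * ((v - 5 / 2) * x) * sl = (rt - sl * (v - v0)) * ((v - 5 / 2) * x) - (rt - sl * (5 - v0)) * ((v - 5 / 2) * x) by ring.
by rewrite lerB.
Qed.

Definition tail_slope w :=
  (w - 1 / 2) * expR (- w) + (5 - v0) * ((w - 3 / 2) * expR (- w)) + 31 / 15 * expR (- (2 / 3 * w)).

Lemma Hpot1_ge w : 3 * v0 <= w -> - tail_slope w <= Hpot1 w.
Proof.
move=> w0; have h := @hfun_slope_bound R s v0 w (ltW s1) v03 w0; have sl0' := sl0.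
rewrite /tail_slope /Hpot1 /gdual1 /hfun1d !mul1r /alphaH.
have e0 := expR_gt0 (- (3 / 2 * w)).
rewrite hfun1 in h.
set x := expR (- w) in h *; set y := expR (- (s * w)) in h *.
set rt := ratio _ _ in h *; set sl := slope _ _ in h sl0' *.
have k : - ((w - 1 / 2) * x + (5 - v0) * ((w - 3 / 2) * x)) <=
   (s * (3 / 2 - s * w) * y - (rt - sl * (5 - v0)) * ((3 / 2 - w) * x)) / sl.
  by rewrite ler_pdivlMr//; lra.
lra.
Qed.

(** Three values of total 3 k w are compared with w by the tangent at w. As the
    function may decrease there, the excess (k - 1) w costs at most the slope. *)
Lemma Hpot_orbit w (k q1 q2 q3 : R) : 3 * v0 <= w -> 1 <= k ->
  5 / 2 <= q1 -> 5 / 2 <= q2 -> 5 / 2 <= q3 -> q1 + q2 + q3 = 3 * (k * w) ->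
  3 * Hpot w - 3 * ((k - 1) * (w * tail_slope w)) <= Hpot q1 + Hpot q2 + Hpot q3.
Proof.
move=> w0 k1 a b c E.
have T q : 5 / 2 <= q -> Hpot w + Hpot1 w * (q - w) <= Hpot q.
  move=> q5; pose r := Num.max q w.
  apply: (@convex_above_tangent R Hpot Hpot1 Hpot2 (5 / 2) r).
  - by move=> y _; exact: is_derive_Hpot.
  - by move=> y _; exact: is_derive_Hpot1.
  - by move=> y /andP[y1 _]; exact: Hpot2_ge0.
  - by rewrite q5 le_max lexx.
  - by rewrite le_max lexx orbT andbT; have := v03; lra.
have V := v03; have h := Hpot1_ge w0.
have : 0 <= (q1 + q2 + q3 - 3 * w) * (Hpot1 w + tail_slope w).
  apply: mulr_ge0; last by lra.
  rewrite E; have : 0 <= (k - 1) * w by rewrite mulr_ge0//; lra.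
  lra.
have Ta := T _ a; have Tb := T _ b; have {T} Tc := T _ c.
have {}E : q3 = 3 * (k * w) - q1 - q2 by lra.
rewrite E in Tc *; lra.
Qed.

End Fixed.
End Potentials.

(** * The three shortest vectors near the hexagonal form *)

Section FirstShell.
Variable R : realType.
Local Notation vhex := (vhex R).

Lemma Upot2_ge0 (v : R) : 5 / 2 <= v <= 7 -> 0 <= Upot2 v.
Proof.
move=> /andP[v1 v2]; rewrite /Upot2.
have h : 0 <= (v - 5 / 2) * (7 - v) by rewrite mulr_ge0//; lra.
have q : 0 <= (5 - v) * (v - 5 / 2) + 2 * (v - 3 / 2) by lra.
by have := mulr_ge0 q (expR_ge0 (- v)); have := gdual2_ge0 v1; lra.
Qed.

Lemma Upot1_le (x y : R) : 5 / 2 <= x -> x <= y -> y <= 7 -> Upot1 x <= Upot1 y.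
Proof.
move=> x1 xy y7; apply: (is_derive_ge0_le (f' := @Upot2 R)) => // z /andP[xz zy].
  exact: is_derive_Upot1.
by apply: Upot2_ge0; rewrite (le_trans x1 xz) (le_trans zy y7).
Qed.

Lemma Upot_above_tangent (c m : R) : 5 / 2 <= c <= 7 -> 5 / 2 <= m <= 7 ->
  Upot m + Upot1 m * (c - m) <= Upot c.
Proof.
move=> hc hm; apply: (@convex_above_tangent R (@Upot R) (@Upot1 R) (@Upot2 R) (5 / 2) 7) => //.
- by move=> y _; exact: is_derive_Upot.
- by move=> y _; exact: is_derive_Upot1.
- by move=> y; exact: Upot2_ge0.
Qed.

(** Lower bound near [m] from enclosures of the value and of the derivative at
    [m]; the inaccuracy [e] of the derivative costs [e] times the distance. *)
Lemma Upot_ge_line (m um d e w c : R) : 5 / 2 <= m <= 7 -> 5 / 2 <= c <= 7 ->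
  um <= Upot m -> d <= Upot1 m <= d + e -> - w <= c - m <= w -> 0 <= e ->
  um - e * w + d * (c - m) <= Upot c.
Proof.
move=> hm hc hu /andP[d1 d2] /andP[w1 w2] e0.
apply: le_trans (Upot_above_tangent hc hm).
have h : d * (c - m) - e * w <= Upot1 m * (c - m).
  have [cm|cm] := leP 0 (c - m).
    have a : 0 <= (Upot1 m - d) * (c - m) by rewrite mulr_ge0//; lra.
    have b : 0 <= e * w by rewrite mulr_ge0//; lra.
    lra.
  have a : 0 <= (d + e - Upot1 m) * (m - c) by rewrite mulr_ge0//; lra.
  have b : 0 <= e * (w + (c - m)) by rewrite mulr_ge0//; lra.
  lra.
by lra.
Qed.

Lemma Upot_at_l : ((37 / 10 ^+ 2 + 5 / 10 ^+ 4 + 30 / 10 ^+ 6 : R) <= @Upot R (3 + 62 / 10 ^+ 2 + 60 / 10 ^+ 4) <= 37 / 10 ^+ 2 + 5 / 10 ^+ 4 + 60 / 10 ^+ 6) /\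
  ((- (31 / 10 ^+ 2 + 49 / 10 ^+ 4 + 70 / 10 ^+ 6) : R) <= @Upot1 R (3 + 62 / 10 ^+ 2 + 60 / 10 ^+ 4) <= - (31 / 10 ^+ 2 + 49 / 10 ^+ 4 + 40 / 10 ^+ 6)).
Proof.
rewrite /Upot /Upot1 /gdual /gdual1.
have chk : exp_check 3 62 60 1 2 66 22 by vm_compute.
have /andP[l0 h0] := @expN_enclosure R 3 62 60 1 2 66 22 (3 + 62 / 10 ^+ 2 + 60 / 10 ^+ 4) chk ltac:(clear; lra); clear chk.
have chk : exp_check 7 25 20 3 8 91 59 by vm_compute.
have /andP[l1 h1] := @expN_enclosure R 7 25 20 3 8 91 59 (2 / 3 * (3 + 62 / 10 ^+ 2 + 60 / 10 ^+ 4)) chk ltac:(clear; lra); clear chk.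
have chk : exp_check 5 43 90 1 0 43 43 by vm_compute.
have /andP[l2 h2] := @expN_enclosure R 5 43 90 1 0 43 43 (3 / 2 * (3 + 62 / 10 ^+ 2 + 60 / 10 ^+ 4)) chk ltac:(clear; lra); clear chk.
move: (expR (- (3 + 62 / 10 ^+ 2 + 60 / 10 ^+ 4))) (expR (- (2 / 3 * (3 + 62 / 10 ^+ 2 + 60 / 10 ^+ 4)))) (expR (- (3 / 2 * (3 + 62 / 10 ^+ 2 + 60 / 10 ^+ 4)))) l0 h0 l1 h1 l2 h2 => x y z l0 h0 l1 h1 l2 h2.
by split; apply/andP; split; lra.
Qed.

Lemma Upot_at_r : ((36 / 10 ^+ 2 + 99 / 10 ^+ 4 : R) <= @Upot R (3 + 62 / 10 ^+ 2 + 80 / 10 ^+ 4) <= 36 / 10 ^+ 2 + 99 / 10 ^+ 4 + 30 / 10 ^+ 6) /\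
  ((- (31 / 10 ^+ 2 + 45 / 10 ^+ 4 + 10 / 10 ^+ 6) : R) <= @Upot1 R (3 + 62 / 10 ^+ 2 + 80 / 10 ^+ 4) <= - (31 / 10 ^+ 2 + 44 / 10 ^+ 4 + 80 / 10 ^+ 6)).
Proof.
rewrite /Upot /Upot1 /gdual /gdual1.
have chk : exp_check 3 62 80 1 2 65 69 by vm_compute.
have /andP[l0 h0] := @expN_enclosure R 3 62 80 1 2 65 69 (3 + 62 / 10 ^+ 2 + 80 / 10 ^+ 4) chk ltac:(clear; lra); clear chk.
have chk : exp_check 7 25 60 3 8 90 40 by vm_compute.
have /andP[l1 h1] := @expN_enclosure R 7 25 60 3 8 90 40 (2 / 3 * (3 + 62 / 10 ^+ 2 + 80 / 10 ^+ 4)) chk ltac:(clear; lra); clear chk.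
have chk : exp_check 5 44 20 1 0 43 30 by vm_compute.
have /andP[l2 h2] := @expN_enclosure R 5 44 20 1 0 43 30 (3 / 2 * (3 + 62 / 10 ^+ 2 + 80 / 10 ^+ 4)) chk ltac:(clear; lra); clear chk.
move: (expR (- (3 + 62 / 10 ^+ 2 + 80 / 10 ^+ 4))) (expR (- (2 / 3 * (3 + 62 / 10 ^+ 2 + 80 / 10 ^+ 4)))) (expR (- (3 / 2 * (3 + 62 / 10 ^+ 2 + 80 / 10 ^+ 4)))) l0 h0 l1 h1 l2 h2 => x y z l0 h0 l1 h1 l2 h2.
by split; apply/andP; split; lra.
Qed.

(** The part of the slope of [Upot] that is kept in reserve on the six shortest
    vectors, to pay for the loss on the longer ones. *)
Definition shell_tilt : R := 1 / 125.

(** Half the second derivative to subtract from [Upot] so that the remainder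
    [shellY] has a double zero at [vhex]: the three lengths satisfy a quadratic
    relation, which allows to add such a quadratic term for free. *)
Definition shell_nu : R := (shell_tilt - Upot1 vhex) / vhex.

Lemma Upot_vhex_le : Upot vhex <= 37 / 10 ^+ 2 + 5 / 10 ^+ 4 + 60 / 10 ^+ 6 :> R.
Proof.
have /andP[v1 v2] := vhex_bounds R.
have [/andP[_ u] /andP[a b]] := Upot_at_l; have [_ /andP[c d]] := Upot_at_r.
have lv : (3 + 62 / 10 ^+ 2 + 60 / 10 ^+ 4) <= vhex by clear - v1; lra.
have vr : vhex <= (3 + 62 / 10 ^+ 2 + 80 / 10 ^+ 4) by clear - v2; lra.
have l0 : 5 / 2 <= (3 + 62 / 10 ^+ 2 + 60 / 10 ^+ 4) :> R by lra.
have r0 : (3 + 62 / 10 ^+ 2 + 80 / 10 ^+ 4) <= 7 :> R by lra.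
have hl : (5 / 2 : R) <= (3 + 62 / 10 ^+ 2 + 60 / 10 ^+ 4) <= (7 : R) by apply/andP; split=> //; exact: le_trans lv (le_trans vr r0).
have hv : 5 / 2 <= vhex <= 7 by rewrite (le_trans l0 lv) (le_trans vr r0).
have t1 := Upot_above_tangent hl hv.
have k2 := Upot1_le (le_trans l0 lv) vr r0.
have k3 : 0 <= (- Upot1 vhex) * (vhex - (3 + 62 / 10 ^+ 2 + 60 / 10 ^+ 4)).
  by apply: mulr_ge0; rewrite ?subr_ge0//; clear - k2 d; lra.
clear - t1 k3 u; lra.
Qed.

Lemma shell_nu_bounds : (8 / 10 ^+ 2 + 88 / 10 ^+ 4 + 90 / 10 ^+ 6 : R) <= shell_nu <= 8 / 10 ^+ 2 + 90 / 10 ^+ 4 + 40 / 10 ^+ 6.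
Proof.
have /andP[v1 v2] := vhex_bounds R.
have [/andP[_ u] /andP[a b]] := Upot_at_l; have [_ /andP[c d]] := Upot_at_r.
have lv : (3 + 62 / 10 ^+ 2 + 60 / 10 ^+ 4) <= vhex by clear - v1; lra.
have vr : vhex <= (3 + 62 / 10 ^+ 2 + 80 / 10 ^+ 4) by clear - v2; lra.
have l0 : 5 / 2 <= (3 + 62 / 10 ^+ 2 + 60 / 10 ^+ 4) :> R by lra.
have r0 : (3 + 62 / 10 ^+ 2 + 80 / 10 ^+ 4) <= 7 :> R by lra.
have k2 := Upot1_le (le_trans l0 lv) vr r0.
have k3 := Upot1_le l0 lv (le_trans vr r0).
rewrite /shell_nu /shell_tilt; have v0 : 0 < vhex by clear - v1; lra.
by apply/andP; split; rewrite ?ler_pdivlMr ?ler_pdivrMr//; clear - v1 v2 k2 k3 a d; lra.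
Qed.

(** If a, b, c are the values of the form at the three shortest vectors, then
    the sum of (v - vhex) ^ 2 - vhex (v - vhex) over v = a, b, c is half the square
    of a + b + c - 3 vhex. So nonnegativity of this function at a, b, c is enough,
    and what is missing at a large c is compensated by that square. *)
Definition shellY (v : R) : R :=
  Upot v - Upot vhex - shell_tilt * (v - vhex) - shell_nu * ((v - vhex) ^+ 2 - vhex * (v - vhex)).

(** Replaces [vhex] and [shell_nu] by decimals, leaving a function which is
    concave in [c] once [Upot] is bounded below by a line, so that inequalities on
    an interval reduce to its endpoints. *)
Lemma shellY_ge (c u : R) : 3 + 63 / 10 ^+ 2 <= c <= 7 -> u <= Upot c ->
  u - (37 / 10 ^+ 2 + 5 / 10 ^+ 4 + 60 / 10 ^+ 6) - 1 / 125 * (c - (3 + 62 / 10 ^+ 2 + 74 / 10 ^+ 4)) + (8 / 10 ^+ 2 + 88 / 10 ^+ 4 + 90 / 10 ^+ 6) * (- c ^+ 2 + 3 * (3 + 62 / 10 ^+ 2 + 74 / 10 ^+ 4) * c - 2 * (3 + 62 / 10 ^+ 2 + 77 / 10 ^+ 4) ^+ 2) <= shellY c.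
Proof.
move=> /andP[c1 c2] cu; rewrite /shellY /shell_tilt.
have /andP[v1 v2] := vhex_bounds R; have /andP[n1 n2] := shell_nu_bounds.
have U0 := Upot_vhex_le.
have p : 0 <= (shell_nu - (8 / 10 ^+ 2 + 88 / 10 ^+ 4 + 90 / 10 ^+ 6)) * ((c - vhex) * (2 * vhex - c)).
  by apply: mulr_ge0; [lra | apply: mulr_ge0; lra].
have q1 : 0 <= (vhex - (3 + 62 / 10 ^+ 2 + 74 / 10 ^+ 4)) * c by apply: mulr_ge0; lra.
have q2 : 0 <= ((3 + 62 / 10 ^+ 2 + 77 / 10 ^+ 4) - vhex) * ((3 + 62 / 10 ^+ 2 + 77 / 10 ^+ 4) + vhex) by apply: mulr_ge0; lra.
have -> : (c - vhex) ^+ 2 - vhex * (c - vhex) = - ((c - vhex) * (2 * vhex - c)) by ring.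
have r : - c ^+ 2 + 3 * (3 + 62 / 10 ^+ 2 + 74 / 10 ^+ 4) * c - 2 * (3 + 62 / 10 ^+ 2 + 77 / 10 ^+ 4) ^+ 2 <= (c - vhex) * (2 * vhex - c) by lra.
have r2 : 0 <= (8 / 10 ^+ 2 + 88 / 10 ^+ 4 + 90 / 10 ^+ 6) * ((c - vhex) * (2 * vhex - c) - (- c ^+ 2 + 3 * (3 + 62 / 10 ^+ 2 + 74 / 10 ^+ 4) * c - 2 * (3 + 62 / 10 ^+ 2 + 77 / 10 ^+ 4) ^+ 2)).
  by apply: mulr_ge0; [lra | rewrite subr_ge0].
lra.
Qed.

(** Enclosures at the point of tangency for the piece of the interval treated
    next. The same pattern recurs for all the following pieces. *)
Lemma shell_mid1_val : ((24 / 10 ^+ 2 + 9 / 10 ^+ 4 + 50 / 10 ^+ 6 : R) <= @Upot R (4 + 12 / 10 ^+ 2) <= 24 / 10 ^+ 2 + 9 / 10 ^+ 4 + 70 / 10 ^+ 6) /\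
  ((- (21 / 10 ^+ 2 + 43 / 10 ^+ 4 + 90 / 10 ^+ 6) : R) <= @Upot1 R (4 + 12 / 10 ^+ 2) <= - (21 / 10 ^+ 2 + 43 / 10 ^+ 4 + 60 / 10 ^+ 6)).
Proof.
rewrite /Upot /Upot1 /gdual /gdual1.
have chk : exp_check 4 12 0 1 1 62 44 by vm_compute.
have /andP[l0 h0] := @expN_enclosure R 4 12 0 1 1 62 44 (4 + 12 / 10 ^+ 2) chk ltac:(clear; lra); clear chk.
have chk : exp_check 8 24 0 3 6 41 41 by vm_compute.
have /andP[l1 h1] := @expN_enclosure R 8 24 0 3 6 41 41 (2 / 3 * (4 + 12 / 10 ^+ 2)) chk ltac:(clear; lra); clear chk.
have chk : exp_check 6 18 0 1 0 20 70 by vm_compute.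
have /andP[l2 h2] := @expN_enclosure R 6 18 0 1 0 20 70 (3 / 2 * (4 + 12 / 10 ^+ 2)) chk ltac:(clear; lra); clear chk.
move: (expR (- (4 + 12 / 10 ^+ 2))) (expR (- (2 / 3 * (4 + 12 / 10 ^+ 2)))) (expR (- (3 / 2 * (4 + 12 / 10 ^+ 2)))) l0 h0 l1 h1 l2 h2 => x y z l0 h0 l1 h1 l2 h2.
by split; apply/andP; split; lra.
Qed.

(** On a short interval [Upot] is replaced by its tangent at a point inside. *)
Lemma shell_mid1 (c : R) : (4 + 5 / 10 ^+ 2) <= c <= (4 + 25 / 10 ^+ 2) -> 0 <= shellY c.
Proof.
move=> /andP[c1 c2].
have hm : (5 / 2 : R) <= 4 + 12 / 10 ^+ 2 <= (7 : R) by lra.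
have hc : 5 / 2 <= c <= 7 by clear - c1 c2; lra.
have hc2 : 3 + 63 / 10 ^+ 2 <= c <= 7 by clear - c1 c2; lra.
have hw : - (13 / 10 ^+ 2) <= c - (4 + 12 / 10 ^+ 2) <= 13 / 10 ^+ 2 by clear - c1 c2; lra.
have he : 0 <= 30 / 10 ^+ 6 :> R by clear; lra.
have h : 0 <= (c - (4 + 5 / 10 ^+ 2)) * ((4 + 25 / 10 ^+ 2) - c) by apply: mulr_ge0; rewrite subr_ge0.
have [/andP[u1 _] hd] := shell_mid1_val.
have hd' : (- (21 / 10 ^+ 2 + 43 / 10 ^+ 4 + 90 / 10 ^+ 6) : R) <= @Upot1 R (4 + 12 / 10 ^+ 2) <= - (21 / 10 ^+ 2 + 43 / 10 ^+ 4 + 90 / 10 ^+ 6) + 30 / 10 ^+ 6 by clear - hd; lra.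
have Y := shellY_ge hc2 (Upot_ge_line hm hc u1 hd' hw he).
clear - Y h c1 c2; lra.
Qed.

Lemma shell_mid2_val : ((19 / 10 ^+ 2 + 42 / 10 ^+ 4 + 80 / 10 ^+ 6 : R) <= @Upot R (4 + 36 / 10 ^+ 2) <= 19 / 10 ^+ 2 + 43 / 10 ^+ 4) /\
  ((- (17 / 10 ^+ 2 + 56 / 10 ^+ 4 + 10 / 10 ^+ 6) : R) <= @Upot1 R (4 + 36 / 10 ^+ 2) <= - (17 / 10 ^+ 2 + 55 / 10 ^+ 4 + 90 / 10 ^+ 6)).
Proof.
rewrite /Upot /Upot1 /gdual /gdual1.
have chk : exp_check 4 36 0 1 1 27 78 by vm_compute.
have /andP[l0 h0] := @expN_enclosure R 4 36 0 1 1 27 78 (4 + 36 / 10 ^+ 2) chk ltac:(clear; lra); clear chk.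
have chk : exp_check 8 72 0 3 5 46 57 by vm_compute.
have /andP[l1 h1] := @expN_enclosure R 8 72 0 3 5 46 57 (2 / 3 * (4 + 36 / 10 ^+ 2)) chk ltac:(clear; lra); clear chk.
have chk : exp_check 6 54 0 1 0 14 44 by vm_compute.
have /andP[l2 h2] := @expN_enclosure R 6 54 0 1 0 14 44 (3 / 2 * (4 + 36 / 10 ^+ 2)) chk ltac:(clear; lra); clear chk.
move: (expR (- (4 + 36 / 10 ^+ 2))) (expR (- (2 / 3 * (4 + 36 / 10 ^+ 2)))) (expR (- (3 / 2 * (4 + 36 / 10 ^+ 2)))) l0 h0 l1 h1 l2 h2 => x y z l0 h0 l1 h1 l2 h2.
by split; apply/andP; split; lra.
Qed.

Lemma shell_mid2 (c : R) : (4 + 25 / 10 ^+ 2) <= c <= (4 + 45 / 10 ^+ 2) -> 0 <= shellY c.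
Proof.
move=> /andP[c1 c2].
have hm : (5 / 2 : R) <= 4 + 36 / 10 ^+ 2 <= (7 : R) by lra.
have hc : 5 / 2 <= c <= 7 by clear - c1 c2; lra.
have hc2 : 3 + 63 / 10 ^+ 2 <= c <= 7 by clear - c1 c2; lra.
have hw : - (11 / 10 ^+ 2) <= c - (4 + 36 / 10 ^+ 2) <= 11 / 10 ^+ 2 by clear - c1 c2; lra.
have he : 0 <= 20 / 10 ^+ 6 :> R by clear; lra.
have h : 0 <= (c - (4 + 25 / 10 ^+ 2)) * ((4 + 45 / 10 ^+ 2) - c) by apply: mulr_ge0; rewrite subr_ge0.
have [/andP[u1 _] hd] := shell_mid2_val.
have hd' : (- (17 / 10 ^+ 2 + 56 / 10 ^+ 4 + 10 / 10 ^+ 6) : R) <= @Upot1 R (4 + 36 / 10 ^+ 2) <= - (17 / 10 ^+ 2 + 56 / 10 ^+ 4 + 10 / 10 ^+ 6) + 20 / 10 ^+ 6 by clear - hd; lra.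
have Y := shellY_ge hc2 (Upot_ge_line hm hc u1 hd' hw he).
clear - Y h c1 c2; lra.
Qed.

Lemma shell_far1_val : ((15 / 10 ^+ 2 + 61 / 10 ^+ 4 + 80 / 10 ^+ 6 : R) <= @Upot R (4 + 60 / 10 ^+ 2) <= 15 / 10 ^+ 2 + 62 / 10 ^+ 4) /\
  ((- (14 / 10 ^+ 2 + 29 / 10 ^+ 4 + 20 / 10 ^+ 6) : R) <= @Upot1 R (4 + 60 / 10 ^+ 2) <= - (14 / 10 ^+ 2 + 28 / 10 ^+ 4 + 90 / 10 ^+ 6)).
Proof.
rewrite /Upot /Upot1 /gdual /gdual1.
have chk : exp_check 4 60 0 1 1 0 51 by vm_compute.
have /andP[l0 h0] := @expN_enclosure R 4 60 0 1 1 0 51 (4 + 60 / 10 ^+ 2) chk ltac:(clear; lra); clear chk.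
have chk : exp_check 9 20 0 3 4 65 76 by vm_compute.
have /andP[l1 h1] := @expN_enclosure R 9 20 0 3 4 65 76 (2 / 3 * (4 + 60 / 10 ^+ 2)) chk ltac:(clear; lra); clear chk.
have chk : exp_check 6 90 0 1 0 10 7 by vm_compute.
have /andP[l2 h2] := @expN_enclosure R 6 90 0 1 0 10 7 (3 / 2 * (4 + 60 / 10 ^+ 2)) chk ltac:(clear; lra); clear chk.
move: (expR (- (4 + 60 / 10 ^+ 2))) (expR (- (2 / 3 * (4 + 60 / 10 ^+ 2)))) (expR (- (3 / 2 * (4 + 60 / 10 ^+ 2)))) l0 h0 l1 h1 l2 h2 => x y z l0 h0 l1 h1 l2 h2.
by split; apply/andP; split; lra.
Qed.

(** For larger [c] the function itself may be negative and the square of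
    S = a + b + c - 3 vhex compensates; [S] is bounded below by a line in [c], a
    tangent of the lower bound which the quadratic relation implies. *)
Lemma shell_far1 (c S : R) : (4 + 45 / 10 ^+ 2) <= c <= (4 + 80 / 10 ^+ 2) -> - (2 + 30 / 10 ^+ 2 + 17 / 10 ^+ 4 + 80 / 10 ^+ 6) + (56 / 10 ^+ 2 + 72 / 10 ^+ 4 + 40 / 10 ^+ 6) * c <= S ->
  0 <= shellY c + shell_nu * S ^+ 2 / 2.
Proof.
move=> /andP[c1 c2] hS.
have hm : (5 / 2 : R) <= 4 + 60 / 10 ^+ 2 <= (7 : R) by lra.
have hc : 5 / 2 <= c <= 7 by clear - c1 c2; lra.
have hc2 : 3 + 63 / 10 ^+ 2 <= c <= 7 by clear - c1 c2; lra.
have hw : - (20 / 10 ^+ 2) <= c - (4 + 60 / 10 ^+ 2) <= 20 / 10 ^+ 2 by clear - c1 c2; lra.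
have he : 0 <= 30 / 10 ^+ 6 :> R by clear; lra.
have h : 0 <= (c - (4 + 45 / 10 ^+ 2)) * ((4 + 80 / 10 ^+ 2) - c) by apply: mulr_ge0; rewrite subr_ge0.
have sg0 : 0 <= (- (2 + 30 / 10 ^+ 2 + 17 / 10 ^+ 4 + 80 / 10 ^+ 6) + (56 / 10 ^+ 2 + 72 / 10 ^+ 4 + 40 / 10 ^+ 6) * c) by clear - c1 c2; lra.
have S2 := ler_pM sg0 sg0 hS hS.
have nl0 : 0 <= 8 / 10 ^+ 2 + 88 / 10 ^+ 4 + 90 / 10 ^+ 6 :> R by clear; lra.
have /andP[n1 _] := shell_nu_bounds.
have N := ler_pM nl0 (mulr_ge0 sg0 sg0) n1 S2.
have [/andP[u1 _] hd] := shell_far1_val.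
have hd' : (- (14 / 10 ^+ 2 + 29 / 10 ^+ 4 + 20 / 10 ^+ 6) : R) <= @Upot1 R (4 + 60 / 10 ^+ 2) <= - (14 / 10 ^+ 2 + 29 / 10 ^+ 4 + 20 / 10 ^+ 6) + 30 / 10 ^+ 6 by clear - hd; lra.
have Y := shellY_ge hc2 (Upot_ge_line hm hc u1 hd' hw he).
rewrite expr2; move: (S * S) (shellY c) N Y => SS y N Y; clear - N Y h c1 c2; lra.
Qed.

Lemma shell_far2_val : ((10 / 10 ^+ 2 + 80 / 10 ^+ 4 + 10 / 10 ^+ 6 : R) <= @Upot R (5) <= 10 / 10 ^+ 2 + 80 / 10 ^+ 4 + 20 / 10 ^+ 6) /\
  ((- (10 / 10 ^+ 2 + 2 / 10 ^+ 4) : R) <= @Upot1 R (5) <= - (10 / 10 ^+ 2 + 1 / 10 ^+ 4 + 70 / 10 ^+ 6)).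
Proof.
rewrite /Upot /Upot1 /gdual /gdual1.
have chk : exp_check 5 0 0 1 0 67 37 by vm_compute.
have /andP[l0 h0] := @expN_enclosure R 5 0 0 1 0 67 37 (5) chk ltac:(clear; lra); clear chk.
have chk : exp_check 10 0 0 3 3 56 73 by vm_compute.
have /andP[l1 h1] := @expN_enclosure R 10 0 0 3 3 56 73 (2 / 3 * (5)) chk ltac:(clear; lra); clear chk.
have chk : exp_check 7 50 0 1 0 5 53 by vm_compute.
have /andP[l2 h2] := @expN_enclosure R 7 50 0 1 0 5 53 (3 / 2 * (5)) chk ltac:(clear; lra); clear chk.
move: (expR (- (5))) (expR (- (2 / 3 * (5)))) (expR (- (3 / 2 * (5)))) l0 h0 l1 h1 l2 h2 => x y z l0 h0 l1 h1 l2 h2.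
by split; apply/andP; split; lra.
Qed.

Lemma shell_far2 (c S : R) : (4 + 80 / 10 ^+ 2) <= c <= (5 + 20 / 10 ^+ 2) -> - (2 + 98 / 10 ^+ 2 + 82 / 10 ^+ 4 + 90 / 10 ^+ 6) + (71 / 10 ^+ 2 + 5 / 10 ^+ 4 + 10 / 10 ^+ 6) * c <= S ->
  0 <= shellY c + shell_nu * S ^+ 2 / 2.
Proof.
move=> /andP[c1 c2] hS.
have hm : (5 / 2 : R) <= 5 <= (7 : R) by lra.
have hc : 5 / 2 <= c <= 7 by clear - c1 c2; lra.
have hc2 : 3 + 63 / 10 ^+ 2 <= c <= 7 by clear - c1 c2; lra.
have hw : - (20 / 10 ^+ 2) <= c - (5) <= 20 / 10 ^+ 2 by clear - c1 c2; lra.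
have he : 0 <= 30 / 10 ^+ 6 :> R by clear; lra.
have h : 0 <= (c - (4 + 80 / 10 ^+ 2)) * ((5 + 20 / 10 ^+ 2) - c) by apply: mulr_ge0; rewrite subr_ge0.
have sg0 : 0 <= (- (2 + 98 / 10 ^+ 2 + 82 / 10 ^+ 4 + 90 / 10 ^+ 6) + (71 / 10 ^+ 2 + 5 / 10 ^+ 4 + 10 / 10 ^+ 6) * c) by clear - c1 c2; lra.
have S2 := ler_pM sg0 sg0 hS hS.
have nl0 : 0 <= 8 / 10 ^+ 2 + 88 / 10 ^+ 4 + 90 / 10 ^+ 6 :> R by clear; lra.
have /andP[n1 _] := shell_nu_bounds.
have N := ler_pM nl0 (mulr_ge0 sg0 sg0) n1 S2.
have [/andP[u1 _] hd] := shell_far2_val.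
have hd' : (- (10 / 10 ^+ 2 + 2 / 10 ^+ 4) : R) <= @Upot1 R (5) <= - (10 / 10 ^+ 2 + 2 / 10 ^+ 4) + 30 / 10 ^+ 6 by clear - hd; lra.
have Y := shellY_ge hc2 (Upot_ge_line hm hc u1 hd' hw he).
rewrite expr2; move: (S * S) (shellY c) N Y => SS y N Y; clear - N Y h c1 c2; lra.
Qed.

Lemma shell_far3_val : ((7 / 10 ^+ 2 + 44 / 10 ^+ 4 + 30 / 10 ^+ 6 : R) <= @Upot R (5 + 40 / 10 ^+ 2) <= 7 / 10 ^+ 2 + 44 / 10 ^+ 4 + 50 / 10 ^+ 6) /\
  ((- (6 / 10 ^+ 2 + 94 / 10 ^+ 4 + 50 / 10 ^+ 6) : R) <= @Upot1 R (5 + 40 / 10 ^+ 2) <= - (6 / 10 ^+ 2 + 94 / 10 ^+ 4 + 30 / 10 ^+ 6)).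
Proof.
rewrite /Upot /Upot1 /gdual /gdual1.
have chk : exp_check 5 40 0 1 0 45 16 by vm_compute.
have /andP[l0 h0] := @expN_enclosure R 5 40 0 1 0 45 16 (5 + 40 / 10 ^+ 2) chk ltac:(clear; lra); clear chk.
have chk : exp_check 3 60 0 1 2 73 23 by vm_compute.
have /andP[l1 h1] := @expN_enclosure R 3 60 0 1 2 73 23 (2 / 3 * (5 + 40 / 10 ^+ 2)) chk ltac:(clear; lra); clear chk.
have chk : exp_check 8 10 0 1 0 3 3 by vm_compute.
have /andP[l2 h2] := @expN_enclosure R 8 10 0 1 0 3 3 (3 / 2 * (5 + 40 / 10 ^+ 2)) chk ltac:(clear; lra); clear chk.
move: (expR (- (5 + 40 / 10 ^+ 2))) (expR (- (2 / 3 * (5 + 40 / 10 ^+ 2)))) (expR (- (3 / 2 * (5 + 40 / 10 ^+ 2)))) l0 h0 l1 h1 l2 h2 => x y z l0 h0 l1 h1 l2 h2.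
by split; apply/andP; split; lra.
Qed.

Lemma shell_far3 (c S : R) : (5 + 20 / 10 ^+ 2) <= c <= (5 + 60 / 10 ^+ 2) -> - (3 + 57 / 10 ^+ 2 + 30 / 10 ^+ 4 + 90 / 10 ^+ 6) + (82 / 10 ^+ 2 + 31 / 10 ^+ 4 + 40 / 10 ^+ 6) * c <= S ->
  0 <= shellY c + shell_nu * S ^+ 2 / 2.
Proof.
move=> /andP[c1 c2] hS.
have hm : (5 / 2 : R) <= 5 + 40 / 10 ^+ 2 <= (7 : R) by lra.
have hc : 5 / 2 <= c <= 7 by clear - c1 c2; lra.
have hc2 : 3 + 63 / 10 ^+ 2 <= c <= 7 by clear - c1 c2; lra.
have hw : - (20 / 10 ^+ 2) <= c - (5 + 40 / 10 ^+ 2) <= 20 / 10 ^+ 2 by clear - c1 c2; lra.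
have he : 0 <= 20 / 10 ^+ 6 :> R by clear; lra.
have h : 0 <= (c - (5 + 20 / 10 ^+ 2)) * ((5 + 60 / 10 ^+ 2) - c) by apply: mulr_ge0; rewrite subr_ge0.
have sg0 : 0 <= (- (3 + 57 / 10 ^+ 2 + 30 / 10 ^+ 4 + 90 / 10 ^+ 6) + (82 / 10 ^+ 2 + 31 / 10 ^+ 4 + 40 / 10 ^+ 6) * c) by clear - c1 c2; lra.
have S2 := ler_pM sg0 sg0 hS hS.
have nl0 : 0 <= 8 / 10 ^+ 2 + 88 / 10 ^+ 4 + 90 / 10 ^+ 6 :> R by clear; lra.
have /andP[n1 _] := shell_nu_bounds.
have N := ler_pM nl0 (mulr_ge0 sg0 sg0) n1 S2.
have [/andP[u1 _] hd] := shell_far3_val.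
have hd' : (- (6 / 10 ^+ 2 + 94 / 10 ^+ 4 + 50 / 10 ^+ 6) : R) <= @Upot1 R (5 + 40 / 10 ^+ 2) <= - (6 / 10 ^+ 2 + 94 / 10 ^+ 4 + 50 / 10 ^+ 6) + 20 / 10 ^+ 6 by clear - hd; lra.
have Y := shellY_ge hc2 (Upot_ge_line hm hc u1 hd' hw he).
rewrite expr2; move: (S * S) (shellY c) N Y => SS y N Y; clear - N Y h c1 c2; lra.
Qed.

Lemma shell_far4_val : ((5 / 10 ^+ 2 + 12 / 10 ^+ 4 + 60 / 10 ^+ 6 : R) <= @Upot R (5 + 80 / 10 ^+ 2) <= 5 / 10 ^+ 2 + 12 / 10 ^+ 4 + 80 / 10 ^+ 6) /\
  ((- (4 / 10 ^+ 2 + 77 / 10 ^+ 4 + 30 / 10 ^+ 6) : R) <= @Upot1 R (5 + 80 / 10 ^+ 2) <= - (4 / 10 ^+ 2 + 77 / 10 ^+ 4 + 10 / 10 ^+ 6)).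
Proof.
rewrite /Upot /Upot1 /gdual /gdual1.
have chk : exp_check 5 80 0 1 0 30 27 by vm_compute.
have /andP[l0 h0] := @expN_enclosure R 5 80 0 1 0 30 27 (5 + 80 / 10 ^+ 2) chk ltac:(clear; lra); clear chk.
have chk : exp_check 11 60 0 3 2 9 28 by vm_compute.
have /andP[l1 h1] := @expN_enclosure R 11 60 0 3 2 9 28 (2 / 3 * (5 + 80 / 10 ^+ 2)) chk ltac:(clear; lra); clear chk.
have chk : exp_check 8 70 0 1 0 1 66 by vm_compute.
have /andP[l2 h2] := @expN_enclosure R 8 70 0 1 0 1 66 (3 / 2 * (5 + 80 / 10 ^+ 2)) chk ltac:(clear; lra); clear chk.
move: (expR (- (5 + 80 / 10 ^+ 2))) (expR (- (2 / 3 * (5 + 80 / 10 ^+ 2)))) (expR (- (3 / 2 * (5 + 80 / 10 ^+ 2)))) l0 h0 l1 h1 l2 h2 => x y z l0 h0 l1 h1 l2 h2.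
by split; apply/andP; split; lra.
Qed.

Lemma shell_far4 (c S : R) : (5 + 60 / 10 ^+ 2) <= c <= (6) -> - (4 + 7 / 10 ^+ 2 + 72 / 10 ^+ 4 + 30 / 10 ^+ 6) + (91 / 10 ^+ 2 + 32 / 10 ^+ 4 + 80 / 10 ^+ 6) * c <= S ->
  0 <= shellY c + shell_nu * S ^+ 2 / 2.
Proof.
move=> /andP[c1 c2] hS.
have hm : (5 / 2 : R) <= 5 + 80 / 10 ^+ 2 <= (7 : R) by lra.
have hc : 5 / 2 <= c <= 7 by clear - c1 c2; lra.
have hc2 : 3 + 63 / 10 ^+ 2 <= c <= 7 by clear - c1 c2; lra.
have hw : - (20 / 10 ^+ 2) <= c - (5 + 80 / 10 ^+ 2) <= 20 / 10 ^+ 2 by clear - c1 c2; lra.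
have he : 0 <= 20 / 10 ^+ 6 :> R by clear; lra.
have h : 0 <= (c - (5 + 60 / 10 ^+ 2)) * ((6) - c) by apply: mulr_ge0; rewrite subr_ge0.
have sg0 : 0 <= (- (4 + 7 / 10 ^+ 2 + 72 / 10 ^+ 4 + 30 / 10 ^+ 6) + (91 / 10 ^+ 2 + 32 / 10 ^+ 4 + 80 / 10 ^+ 6) * c) by clear - c1 c2; lra.
have S2 := ler_pM sg0 sg0 hS hS.
have nl0 : 0 <= 8 / 10 ^+ 2 + 88 / 10 ^+ 4 + 90 / 10 ^+ 6 :> R by clear; lra.
have /andP[n1 _] := shell_nu_bounds.
have N := ler_pM nl0 (mulr_ge0 sg0 sg0) n1 S2.
have [/andP[u1 _] hd] := shell_far4_val.
have hd' : (- (4 / 10 ^+ 2 + 77 / 10 ^+ 4 + 30 / 10 ^+ 6) : R) <= @Upot1 R (5 + 80 / 10 ^+ 2) <= - (4 / 10 ^+ 2 + 77 / 10 ^+ 4 + 30 / 10 ^+ 6) + 20 / 10 ^+ 6 by clear - hd; lra.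
have Y := shellY_ge hc2 (Upot_ge_line hm hc u1 hd' hw he).
rewrite expr2; move: (S * S) (shellY c) N Y => SS y N Y; clear - N Y h c1 c2; lra.
Qed.

Lemma shell_far5_val : ((3 / 10 ^+ 2 + 70 / 10 ^+ 4 + 40 / 10 ^+ 6 : R) <= @Upot R (6 + 15 / 10 ^+ 2) <= 3 / 10 ^+ 2 + 70 / 10 ^+ 4 + 70 / 10 ^+ 6) /\
  ((- (3 / 10 ^+ 2 + 42 / 10 ^+ 4 + 20 / 10 ^+ 6) : R) <= @Upot1 R (6 + 15 / 10 ^+ 2) <= - (3 / 10 ^+ 2 + 42 / 10 ^+ 4)).
Proof.
rewrite /Upot /Upot1 /gdual /gdual1.
have chk : exp_check 6 15 0 1 0 21 33 by vm_compute.
have /andP[l0 h0] := @expN_enclosure R 6 15 0 1 0 21 33 (6 + 15 / 10 ^+ 2) chk ltac:(clear; lra); clear chk.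
have chk : exp_check 4 10 0 1 1 65 72 by vm_compute.
have /andP[l1 h1] := @expN_enclosure R 4 10 0 1 1 65 72 (2 / 3 * (6 + 15 / 10 ^+ 2)) chk ltac:(clear; lra); clear chk.
have chk : exp_check 9 22 50 1 0 0 98 by vm_compute.
have /andP[l2 h2] := @expN_enclosure R 9 22 50 1 0 0 98 (3 / 2 * (6 + 15 / 10 ^+ 2)) chk ltac:(clear; lra); clear chk.
move: (expR (- (6 + 15 / 10 ^+ 2))) (expR (- (2 / 3 * (6 + 15 / 10 ^+ 2)))) (expR (- (3 / 2 * (6 + 15 / 10 ^+ 2)))) l0 h0 l1 h1 l2 h2 => x y z l0 h0 l1 h1 l2 h2.
by split; apply/andP; split; lra.
Qed.

(** From here on [shellY] at the shortest length contributes the additional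
    65/10^4, see [shellY_left]. *)
Lemma shell_far5 (c S : R) : (6) <= c <= (6 + 29 / 10 ^+ 2) -> - (4 + 51 / 10 ^+ 2 + 63 / 10 ^+ 4 + 20 / 10 ^+ 6) + (98 / 10 ^+ 2 + 65 / 10 ^+ 4 + 40 / 10 ^+ 6) * c <= S ->
  0 <= shellY c + shell_nu * S ^+ 2 / 2 + 65 / 10 ^+ 4.
Proof.
move=> /andP[c1 c2] hS.
have hm : (5 / 2 : R) <= 6 + 15 / 10 ^+ 2 <= (7 : R) by lra.
have hc : 5 / 2 <= c <= 7 by clear - c1 c2; lra.
have hc2 : 3 + 63 / 10 ^+ 2 <= c <= 7 by clear - c1 c2; lra.
have hw : - (15 / 10 ^+ 2) <= c - (6 + 15 / 10 ^+ 2) <= 15 / 10 ^+ 2 by clear - c1 c2; lra.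
have he : 0 <= 20 / 10 ^+ 6 :> R by clear; lra.
have h : 0 <= (c - (6)) * ((6 + 29 / 10 ^+ 2) - c) by apply: mulr_ge0; rewrite subr_ge0.
have sg0 : 0 <= (- (4 + 51 / 10 ^+ 2 + 63 / 10 ^+ 4 + 20 / 10 ^+ 6) + (98 / 10 ^+ 2 + 65 / 10 ^+ 4 + 40 / 10 ^+ 6) * c) by clear - c1 c2; lra.
have S2 := ler_pM sg0 sg0 hS hS.
have nl0 : 0 <= 8 / 10 ^+ 2 + 88 / 10 ^+ 4 + 90 / 10 ^+ 6 :> R by clear; lra.
have /andP[n1 _] := shell_nu_bounds.
have N := ler_pM nl0 (mulr_ge0 sg0 sg0) n1 S2.
have [/andP[u1 _] hd] := shell_far5_val.
have hd' : (- (3 / 10 ^+ 2 + 42 / 10 ^+ 4 + 20 / 10 ^+ 6) : R) <= @Upot1 R (6 + 15 / 10 ^+ 2) <= - (3 / 10 ^+ 2 + 42 / 10 ^+ 4 + 20 / 10 ^+ 6) + 20 / 10 ^+ 6 by clear - hd; lra.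
have Y := shellY_ge hc2 (Upot_ge_line hm hc u1 hd' hw he).
rewrite expr2; move: (S * S) (shellY c) N Y => SS y N Y; clear - N Y h c1 c2; lra.
Qed.

Lemma shell_far6_val : ((3 / 10 ^+ 2 + 8 / 10 ^+ 4 + 10 / 10 ^+ 6 : R) <= @Upot R (6 + 35 / 10 ^+ 2) <= 3 / 10 ^+ 2 + 8 / 10 ^+ 4 + 40 / 10 ^+ 6) /\
  ((- (2 / 10 ^+ 2 + 82 / 10 ^+ 4 + 50 / 10 ^+ 6) : R) <= @Upot1 R (6 + 35 / 10 ^+ 2) <= - (2 / 10 ^+ 2 + 82 / 10 ^+ 4 + 30 / 10 ^+ 6)).
Proof.
rewrite /Upot /Upot1 /gdual /gdual1.
have chk : exp_check 6 35 0 1 0 17 46 by vm_compute.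
have /andP[l0 h0] := @expN_enclosure R 6 35 0 1 0 17 46 (6 + 35 / 10 ^+ 2) chk ltac:(clear; lra); clear chk.
have chk : exp_check 12 70 0 3 1 45 3 by vm_compute.
have /andP[l1 h1] := @expN_enclosure R 12 70 0 3 1 45 3 (2 / 3 * (6 + 35 / 10 ^+ 2)) chk ltac:(clear; lra); clear chk.
have chk : exp_check 9 52 50 1 0 0 73 by vm_compute.
have /andP[l2 h2] := @expN_enclosure R 9 52 50 1 0 0 73 (3 / 2 * (6 + 35 / 10 ^+ 2)) chk ltac:(clear; lra); clear chk.
move: (expR (- (6 + 35 / 10 ^+ 2))) (expR (- (2 / 3 * (6 + 35 / 10 ^+ 2)))) (expR (- (3 / 2 * (6 + 35 / 10 ^+ 2)))) l0 h0 l1 h1 l2 h2 => x y z l0 h0 l1 h1 l2 h2.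
by split; apply/andP; split; lra.
Qed.

Lemma shell_far6 (c S : R) : (6 + 28 / 10 ^+ 2) <= c <= (6 + 40 / 10 ^+ 2) -> - (10 + 88 / 10 ^+ 2 + 31 / 10 ^+ 4) + (2) * c <= S ->
  0 <= shellY c + shell_nu * S ^+ 2 / 2 + 65 / 10 ^+ 4.
Proof.
move=> /andP[c1 c2] hS.
have hm : (5 / 2 : R) <= 6 + 35 / 10 ^+ 2 <= (7 : R) by lra.
have hc : 5 / 2 <= c <= 7 by clear - c1 c2; lra.
have hc2 : 3 + 63 / 10 ^+ 2 <= c <= 7 by clear - c1 c2; lra.
have hw : - (7 / 10 ^+ 2) <= c - (6 + 35 / 10 ^+ 2) <= 7 / 10 ^+ 2 by clear - c1 c2; lra.
have he : 0 <= 20 / 10 ^+ 6 :> R by clear; lra.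
have h : 0 <= (c - (6 + 28 / 10 ^+ 2)) * (c - (6 + 28 / 10 ^+ 2)) by apply: mulr_ge0; rewrite subr_ge0.
have sg0 : 0 <= (- (10 + 88 / 10 ^+ 2 + 31 / 10 ^+ 4) + (2) * c) by clear - c1 c2; lra.
have S2 := ler_pM sg0 sg0 hS hS.
have nl0 : 0 <= 8 / 10 ^+ 2 + 88 / 10 ^+ 4 + 90 / 10 ^+ 6 :> R by clear; lra.
have /andP[n1 _] := shell_nu_bounds.
have N := ler_pM nl0 (mulr_ge0 sg0 sg0) n1 S2.
have [/andP[u1 _] hd] := shell_far6_val.
have hd' : (- (2 / 10 ^+ 2 + 82 / 10 ^+ 4 + 50 / 10 ^+ 6) : R) <= @Upot1 R (6 + 35 / 10 ^+ 2) <= - (2 / 10 ^+ 2 + 82 / 10 ^+ 4 + 50 / 10 ^+ 6) + 20 / 10 ^+ 6 by clear - hd; lra.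
have Y := shellY_ge hc2 (Upot_ge_line hm hc u1 hd' hw he).
rewrite expr2; move: (S * S) (shellY c) N Y => SS y N Y; clear - N Y h c1 c2; lra.
Qed.

Lemma shell_left_val : ((54 / 10 ^+ 2 + 84 / 10 ^+ 4 + 40 / 10 ^+ 6 : R) <= @Upot R (3 + 15 / 10 ^+ 2) <= 54 / 10 ^+ 2 + 84 / 10 ^+ 4 + 60 / 10 ^+ 6) /\
  ((- (43 / 10 ^+ 2 + 55 / 10 ^+ 4 + 80 / 10 ^+ 6) : R) <= @Upot1 R (3 + 15 / 10 ^+ 2) <= - (43 / 10 ^+ 2 + 55 / 10 ^+ 4 + 60 / 10 ^+ 6)).
Proof.
rewrite /Upot /Upot1 /gdual /gdual1.
have chk : exp_check 3 15 0 1 4 28 52 by vm_compute.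
have /andP[l0 h0] := @expN_enclosure R 3 15 0 1 4 28 52 (3 + 15 / 10 ^+ 2) chk ltac:(clear; lra); clear chk.
have chk : exp_check 2 10 0 1 12 24 56 by vm_compute.
have /andP[l1 h1] := @expN_enclosure R 2 10 0 1 12 24 56 (2 / 3 * (3 + 15 / 10 ^+ 2)) chk ltac:(clear; lra); clear chk.
have chk : exp_check 4 72 50 1 0 88 70 by vm_compute.
have /andP[l2 h2] := @expN_enclosure R 4 72 50 1 0 88 70 (3 / 2 * (3 + 15 / 10 ^+ 2)) chk ltac:(clear; lra); clear chk.
move: (expR (- (3 + 15 / 10 ^+ 2))) (expR (- (2 / 3 * (3 + 15 / 10 ^+ 2)))) (expR (- (3 / 2 * (3 + 15 / 10 ^+ 2)))) l0 h0 l1 h1 l2 h2 => x y z l0 h0 l1 h1 l2 h2.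
by split; apply/andP; split; lra.
Qed.

Lemma shellY_left : 65 / 10 ^+ 4 <= shellY ((3 + 15 / 10 ^+ 2)) :> R.
Proof.
have [/andP[u1 _] _] := shell_left_val; rewrite /shellY /shell_tilt.
have /andP[v1 v2] := vhex_bounds R; have /andP[n1 n2] := shell_nu_bounds.
have U0 := Upot_vhex_le.
have -> : ((3 + 15 / 10 ^+ 2) - vhex) ^+ 2 - vhex * ((3 + 15 / 10 ^+ 2) - vhex) = (vhex - (3 + 15 / 10 ^+ 2)) * (2 * vhex - (3 + 15 / 10 ^+ 2)) :> R by ring.
have a : (vhex - (3 + 15 / 10 ^+ 2)) * (2 * vhex - (3 + 15 / 10 ^+ 2)) <= (3 + 62 / 10 ^+ 2 + 77 / 10 ^+ 4 - (3 + 15 / 10 ^+ 2)) * (2 * (3 + 62 / 10 ^+ 2 + 77 / 10 ^+ 4) - (3 + 15 / 10 ^+ 2)) :> R.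
  by apply: ler_pM; lra.
have b : shell_nu * ((vhex - (3 + 15 / 10 ^+ 2)) * (2 * vhex - (3 + 15 / 10 ^+ 2))) <= (8 / 10 ^+ 2 + 90 / 10 ^+ 4 + 40 / 10 ^+ 6) * ((3 + 62 / 10 ^+ 2 + 77 / 10 ^+ 4 - (3 + 15 / 10 ^+ 2)) * (2 * (3 + 62 / 10 ^+ 2 + 77 / 10 ^+ 4) - (3 + 15 / 10 ^+ 2))).
  by apply: ler_pM a => //; [lra | apply: mulr_ge0; lra].
lra.
Qed.

Lemma expN_ge_line (m e v : R) : 0 <= e -> e <= expR (- m) -> v - m <= 1 ->
  e * (1 - (v - m)) <= expR (- v).
Proof.
move=> e0 em vm; have -> : - v = - m + (m - v) by ring.
rewrite expRD; apply: ler_pM em _ => //; first by lra.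
by apply: le_trans (expR_ge1Dx _); lra.
Qed.

Lemma expN_quad (d : R) : 0 <= d -> expR (- d) <= 1 - d + d ^+ 2 / 2.
Proof.
move=> d0; rewrite -subr_ge0; set f := fun z : R => 1 - z + z ^+ 2 / 2 - expR (- z).
have -> : 0 = f 0 by rewrite /f oppr0 expR0; lra.
apply: (is_derive_ge0_le (f' := fun z => expR (- z) - (1 - z))) => // z _; rewrite ?/f.
  by apply: is_derive_eq; rewrite /GRing.scale /=; field.
by have := expR_ge1Dx (- z); lra.
Qed.

Lemma expN_le_quad (l e v : R) : expR (- l) <= e -> l <= v ->
  expR (- v) <= e * (1 - (v - l) + (v - l) ^+ 2 / 2).
Proof.
move=> em vm; have -> : - v = - l + - (v - l) by ring.
rewrite expRD; apply: ler_pM em _ => //; try exact: expR_ge0.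
by apply: expN_quad; lra.
Qed.

(** The remainder [shellY] is convex around [vhex]; the exponentials are bounded
    on each piece by a line from below and a quadratic polynomial from above. *)
Lemma shell_curv1 (v : R) : (2 + 60 / 10 ^+ 2) <= v <= (3 + 10 / 10 ^+ 2) -> 2 * shell_nu <= Upot2 v.
Proof.
move=> /andP[v1 v2].
have b0 : 0 <= v - (2 + 60 / 10 ^+ 2) by rewrite subr_ge0.
have b1 : 0 <= (3 + 10 / 10 ^+ 2) - v by rewrite subr_ge0.
have c0 : 0 <= ((3 + 10 / 10 ^+ 2) - v) * ((3 + 10 / 10 ^+ 2) - v) * ((3 + 10 / 10 ^+ 2) - v) by rewrite !mulr_ge0.
have c1 : 0 <= (v - (2 + 60 / 10 ^+ 2)) * ((3 + 10 / 10 ^+ 2) - v) * ((3 + 10 / 10 ^+ 2) - v) by rewrite !mulr_ge0.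
have c2 : 0 <= (v - (2 + 60 / 10 ^+ 2)) * (v - (2 + 60 / 10 ^+ 2)) * ((3 + 10 / 10 ^+ 2) - v) by rewrite !mulr_ge0.
have c3 : 0 <= (v - (2 + 60 / 10 ^+ 2)) * (v - (2 + 60 / 10 ^+ 2)) * (v - (2 + 60 / 10 ^+ 2)) by rewrite !mulr_ge0.
have q : 0 <= (5 - v) * (v - 5 / 2) + 2 * (v - 3 / 2).
  have : 0 <= (v - (2 + 60 / 10 ^+ 2)) * ((3 + 10 / 10 ^+ 2) - v) by rewrite mulr_ge0.
  by clear - v1 v2; lra.
have d0 : v - (2 + 80 / 10 ^+ 2) <= 1 by clear - v1 v2; lra.
have d1 : 2 / 3 * v - 2 / 3 * (2 + 80 / 10 ^+ 2) <= 1 by clear - v1 v2; lra.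
have d2 : 3 / 2 * (2 + 60 / 10 ^+ 2) <= 3 / 2 * v by clear - v1 v2; lra.
have p0 : 0 <= 6 / 10 ^+ 2 + 8 / 10 ^+ 4 + 10 / 10 ^+ 6 :> R by clear; lra.
have p1 : 0 <= 15 / 10 ^+ 2 + 46 / 10 ^+ 4 + 38 / 10 ^+ 6 :> R by clear; lra.
have h0 : 6 / 10 ^+ 2 + 8 / 10 ^+ 4 + 10 / 10 ^+ 6 <= expR (- (2 + 80 / 10 ^+ 2)) :> R.
  have chk : exp_check 2 80 0 1 6 8 10 by vm_compute.
  have /andP[l0 _] := @expN_enclosure R 2 80 0 1 6 8 10 ((2 + 80 / 10 ^+ 2)) chk ltac:(clear; lra); clear chk.
  exact: l0.
have h1 : 15 / 10 ^+ 2 + 46 / 10 ^+ 4 + 38 / 10 ^+ 6 <= expR (- (2 / 3 * (2 + 80 / 10 ^+ 2))) :> R.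
  have chk : exp_check 5 60 0 3 15 46 38 by vm_compute.
  have /andP[l0 _] := @expN_enclosure R 5 60 0 3 15 46 38 (2 / 3 * (2 + 80 / 10 ^+ 2)) chk ltac:(clear; lra); clear chk.
  exact: l0.
have h2 : expR (- (3 / 2 * (2 + 60 / 10 ^+ 2))) <= 2 / 10 ^+ 2 + 2 / 10 ^+ 4 + 42 / 10 ^+ 6 :> R.
  have chk : exp_check 3 90 0 1 2 2 41 by vm_compute.
  have /andP[_ l0] := @expN_enclosure R 3 90 0 1 2 2 41 (3 / 2 * (2 + 60 / 10 ^+ 2)) chk ltac:(clear; lra); clear chk.
  by lra.
have {h0 d0 p0} a0 := ler_wpM2l q (expN_ge_line p0 h0 d0).
have {h1 d1 p1} a1 := expN_ge_line p1 h1 d1.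
have {h2 d2} a2 := expN_le_quad h2 d2.
have /andP[_ n2] := shell_nu_bounds.
rewrite /Upot2 /gdual2; move: (expR (- v)) (expR (- (2 / 3 * v))) (expR (- (3 / 2 * v))) a0 a1 a2 => x y z a0 a1 a2.
clear q b0 b1 v1 v2; lra.
Qed.

Lemma shell_curv2 (v : R) : (3 + 10 / 10 ^+ 2) <= v <= (3 + 60 / 10 ^+ 2) -> 2 * shell_nu <= Upot2 v.
Proof.
move=> /andP[v1 v2].
have b0 : 0 <= v - (3 + 10 / 10 ^+ 2) by rewrite subr_ge0.
have b1 : 0 <= (3 + 60 / 10 ^+ 2) - v by rewrite subr_ge0.
have c0 : 0 <= ((3 + 60 / 10 ^+ 2) - v) * ((3 + 60 / 10 ^+ 2) - v) * ((3 + 60 / 10 ^+ 2) - v) by rewrite !mulr_ge0.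
have c1 : 0 <= (v - (3 + 10 / 10 ^+ 2)) * ((3 + 60 / 10 ^+ 2) - v) * ((3 + 60 / 10 ^+ 2) - v) by rewrite !mulr_ge0.
have c2 : 0 <= (v - (3 + 10 / 10 ^+ 2)) * (v - (3 + 10 / 10 ^+ 2)) * ((3 + 60 / 10 ^+ 2) - v) by rewrite !mulr_ge0.
have c3 : 0 <= (v - (3 + 10 / 10 ^+ 2)) * (v - (3 + 10 / 10 ^+ 2)) * (v - (3 + 10 / 10 ^+ 2)) by rewrite !mulr_ge0.
have q : 0 <= (5 - v) * (v - 5 / 2) + 2 * (v - 3 / 2).
  have : 0 <= (v - (3 + 10 / 10 ^+ 2)) * ((3 + 60 / 10 ^+ 2) - v) by rewrite mulr_ge0.
  by clear - v1 v2; lra.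
have d0 : v - (3 + 40 / 10 ^+ 2) <= 1 by clear - v1 v2; lra.
have d1 : 2 / 3 * v - 2 / 3 * (3 + 40 / 10 ^+ 2) <= 1 by clear - v1 v2; lra.
have d2 : 3 / 2 * (3 + 10 / 10 ^+ 2) <= 3 / 2 * v by clear - v1 v2; lra.
have p0 : 0 <= 3 / 10 ^+ 2 + 33 / 10 ^+ 4 + 73 / 10 ^+ 6 :> R by clear; lra.
have p1 : 0 <= 10 / 10 ^+ 2 + 36 / 10 ^+ 4 + 57 / 10 ^+ 6 :> R by clear; lra.
have h0 : 3 / 10 ^+ 2 + 33 / 10 ^+ 4 + 73 / 10 ^+ 6 <= expR (- (3 + 40 / 10 ^+ 2)) :> R.
  have chk : exp_check 3 40 0 1 3 33 73 by vm_compute.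
  have /andP[l0 _] := @expN_enclosure R 3 40 0 1 3 33 73 ((3 + 40 / 10 ^+ 2)) chk ltac:(clear; lra); clear chk.
  exact: l0.
have h1 : 10 / 10 ^+ 2 + 36 / 10 ^+ 4 + 57 / 10 ^+ 6 <= expR (- (2 / 3 * (3 + 40 / 10 ^+ 2))) :> R.
  have chk : exp_check 6 80 0 3 10 36 57 by vm_compute.
  have /andP[l0 _] := @expN_enclosure R 6 80 0 3 10 36 57 (2 / 3 * (3 + 40 / 10 ^+ 2)) chk ltac:(clear; lra); clear chk.
  exact: l0.
have h2 : expR (- (3 / 2 * (3 + 10 / 10 ^+ 2))) <= 95 / 10 ^+ 4 + 62 / 10 ^+ 6 :> R.
  have chk : exp_check 4 65 0 1 0 95 61 by vm_compute.
  have /andP[_ l0] := @expN_enclosure R 4 65 0 1 0 95 61 (3 / 2 * (3 + 10 / 10 ^+ 2)) chk ltac:(clear; lra); clear chk.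
  by lra.
have {h0 d0 p0} a0 := ler_wpM2l q (expN_ge_line p0 h0 d0).
have {h1 d1 p1} a1 := expN_ge_line p1 h1 d1.
have {h2 d2} a2 := expN_le_quad h2 d2.
have /andP[_ n2] := shell_nu_bounds.
rewrite /Upot2 /gdual2; move: (expR (- v)) (expR (- (2 / 3 * v))) (expR (- (3 / 2 * v))) a0 a1 a2 => x y z a0 a1 a2.
clear q b0 b1 v1 v2; lra.
Qed.

Lemma shell_curv3 (v : R) : (3 + 60 / 10 ^+ 2) <= v <= (3 + 85 / 10 ^+ 2) -> 2 * shell_nu <= Upot2 v.
Proof.
move=> /andP[v1 v2].
have b0 : 0 <= v - (3 + 60 / 10 ^+ 2) by rewrite subr_ge0.
have b1 : 0 <= (3 + 85 / 10 ^+ 2) - v by rewrite subr_ge0.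
have c0 : 0 <= ((3 + 85 / 10 ^+ 2) - v) * ((3 + 85 / 10 ^+ 2) - v) * ((3 + 85 / 10 ^+ 2) - v) by rewrite !mulr_ge0.
have c1 : 0 <= (v - (3 + 60 / 10 ^+ 2)) * ((3 + 85 / 10 ^+ 2) - v) * ((3 + 85 / 10 ^+ 2) - v) by rewrite !mulr_ge0.
have c2 : 0 <= (v - (3 + 60 / 10 ^+ 2)) * (v - (3 + 60 / 10 ^+ 2)) * ((3 + 85 / 10 ^+ 2) - v) by rewrite !mulr_ge0.
have c3 : 0 <= (v - (3 + 60 / 10 ^+ 2)) * (v - (3 + 60 / 10 ^+ 2)) * (v - (3 + 60 / 10 ^+ 2)) by rewrite !mulr_ge0.
have q : 0 <= (5 - v) * (v - 5 / 2) + 2 * (v - 3 / 2).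
  have : 0 <= (v - (3 + 60 / 10 ^+ 2)) * ((3 + 85 / 10 ^+ 2) - v) by rewrite mulr_ge0.
  by clear - v1 v2; lra.
have d0 : v - (3 + 74 / 10 ^+ 2) <= 1 by clear - v1 v2; lra.
have d1 : 2 / 3 * v - 2 / 3 * (3 + 74 / 10 ^+ 2) <= 1 by clear - v1 v2; lra.
have d2 : 3 / 2 * (3 + 60 / 10 ^+ 2) <= 3 / 2 * v by clear - v1 v2; lra.
have p0 : 0 <= 2 / 10 ^+ 2 + 37 / 10 ^+ 4 + 54 / 10 ^+ 6 :> R by clear; lra.
have p1 : 0 <= 8 / 10 ^+ 2 + 26 / 10 ^+ 4 + 34 / 10 ^+ 6 :> R by clear; lra.
have h0 : 2 / 10 ^+ 2 + 37 / 10 ^+ 4 + 54 / 10 ^+ 6 <= expR (- (3 + 74 / 10 ^+ 2)) :> R.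
  have chk : exp_check 3 74 0 1 2 37 54 by vm_compute.
  have /andP[l0 _] := @expN_enclosure R 3 74 0 1 2 37 54 ((3 + 74 / 10 ^+ 2)) chk ltac:(clear; lra); clear chk.
  exact: l0.
have h1 : 8 / 10 ^+ 2 + 26 / 10 ^+ 4 + 34 / 10 ^+ 6 <= expR (- (2 / 3 * (3 + 74 / 10 ^+ 2))) :> R.
  have chk : exp_check 7 48 0 3 8 26 34 by vm_compute.
  have /andP[l0 _] := @expN_enclosure R 7 48 0 3 8 26 34 (2 / 3 * (3 + 74 / 10 ^+ 2)) chk ltac:(clear; lra); clear chk.
  exact: l0.
have h2 : expR (- (3 / 2 * (3 + 60 / 10 ^+ 2))) <= 45 / 10 ^+ 4 + 17 / 10 ^+ 6 :> R.
  have chk : exp_check 5 40 0 1 0 45 16 by vm_compute.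
  have /andP[_ l0] := @expN_enclosure R 5 40 0 1 0 45 16 (3 / 2 * (3 + 60 / 10 ^+ 2)) chk ltac:(clear; lra); clear chk.
  by lra.
have {h0 d0 p0} a0 := ler_wpM2l q (expN_ge_line p0 h0 d0).
have {h1 d1 p1} a1 := expN_ge_line p1 h1 d1.
have {h2 d2} a2 := expN_le_quad h2 d2.
have /andP[_ n2] := shell_nu_bounds.
rewrite /Upot2 /gdual2; move: (expR (- v)) (expR (- (2 / 3 * v))) (expR (- (3 / 2 * v))) a0 a1 a2 => x y z a0 a1 a2.
clear q b0 b1 v1 v2; lra.
Qed.

Lemma shell_curv4 (v : R) : (3 + 85 / 10 ^+ 2) <= v <= (4 + 5 / 10 ^+ 2) -> 2 * shell_nu <= Upot2 v.
Proof.
move=> /andP[v1 v2].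
have b0 : 0 <= v - (3 + 85 / 10 ^+ 2) by rewrite subr_ge0.
have b1 : 0 <= (4 + 5 / 10 ^+ 2) - v by rewrite subr_ge0.
have c0 : 0 <= ((4 + 5 / 10 ^+ 2) - v) * ((4 + 5 / 10 ^+ 2) - v) * ((4 + 5 / 10 ^+ 2) - v) by rewrite !mulr_ge0.
have c1 : 0 <= (v - (3 + 85 / 10 ^+ 2)) * ((4 + 5 / 10 ^+ 2) - v) * ((4 + 5 / 10 ^+ 2) - v) by rewrite !mulr_ge0.
have c2 : 0 <= (v - (3 + 85 / 10 ^+ 2)) * (v - (3 + 85 / 10 ^+ 2)) * ((4 + 5 / 10 ^+ 2) - v) by rewrite !mulr_ge0.
have c3 : 0 <= (v - (3 + 85 / 10 ^+ 2)) * (v - (3 + 85 / 10 ^+ 2)) * (v - (3 + 85 / 10 ^+ 2)) by rewrite !mulr_ge0.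
have q : 0 <= (5 - v) * (v - 5 / 2) + 2 * (v - 3 / 2).
  have : 0 <= (v - (3 + 85 / 10 ^+ 2)) * ((4 + 5 / 10 ^+ 2) - v) by rewrite mulr_ge0.
  by clear - v1 v2; lra.
have d0 : v - (3 + 97 / 10 ^+ 2) <= 1 by clear - v1 v2; lra.
have d1 : 2 / 3 * v - 2 / 3 * (3 + 97 / 10 ^+ 2) <= 1 by clear - v1 v2; lra.
have d2 : 3 / 2 * (3 + 85 / 10 ^+ 2) <= 3 / 2 * v by clear - v1 v2; lra.
have p0 : 0 <= 1 / 10 ^+ 2 + 88 / 10 ^+ 4 + 73 / 10 ^+ 6 :> R by clear; lra.
have p1 : 0 <= 7 / 10 ^+ 2 + 8 / 10 ^+ 4 + 87 / 10 ^+ 6 :> R by clear; lra.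
have h0 : 1 / 10 ^+ 2 + 88 / 10 ^+ 4 + 73 / 10 ^+ 6 <= expR (- (3 + 97 / 10 ^+ 2)) :> R.
  have chk : exp_check 3 97 0 1 1 88 73 by vm_compute.
  have /andP[l0 _] := @expN_enclosure R 3 97 0 1 1 88 73 ((3 + 97 / 10 ^+ 2)) chk ltac:(clear; lra); clear chk.
  exact: l0.
have h1 : 7 / 10 ^+ 2 + 8 / 10 ^+ 4 + 87 / 10 ^+ 6 <= expR (- (2 / 3 * (3 + 97 / 10 ^+ 2))) :> R.
  have chk : exp_check 7 94 0 3 7 8 87 by vm_compute.
  have /andP[l0 _] := @expN_enclosure R 7 94 0 3 7 8 87 (2 / 3 * (3 + 97 / 10 ^+ 2)) chk ltac:(clear; lra); clear chk.
  exact: l0.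
have h2 : expR (- (3 / 2 * (3 + 85 / 10 ^+ 2))) <= 31 / 10 ^+ 4 + 5 / 10 ^+ 6 :> R.
  have chk : exp_check 5 77 50 1 0 31 4 by vm_compute.
  have /andP[_ l0] := @expN_enclosure R 5 77 50 1 0 31 4 (3 / 2 * (3 + 85 / 10 ^+ 2)) chk ltac:(clear; lra); clear chk.
  by lra.
have {h0 d0 p0} a0 := ler_wpM2l q (expN_ge_line p0 h0 d0).
have {h1 d1 p1} a1 := expN_ge_line p1 h1 d1.
have {h2 d2} a2 := expN_le_quad h2 d2.
have /andP[_ n2] := shell_nu_bounds.
rewrite /Upot2 /gdual2; move: (expR (- v)) (expR (- (2 / 3 * v))) (expR (- (3 / 2 * v))) a0 a1 a2 => x y z a0 a1 a2.
clear q b0 b1 v1 v2; lra.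
Qed.

Definition shellY1 (v : R) : R := Upot1 v - shell_tilt - shell_nu * (2 * (v - vhex) - vhex).

Let vhex_in : (26 / 10 : R) <= vhex <= 4 + 5 / 10 ^+ 2.
Proof. by have /andP[v1 v2] := vhex_bounds R; apply/andP; split; lra. Qed.

Lemma shellY_tangent (q w : R) : 26 / 10 <= q <= 4 + 5 / 10 ^+ 2 -> 26 / 10 <= w <= 4 + 5 / 10 ^+ 2 ->
  shellY w + shellY1 w * (q - w) <= shellY q.
Proof.
apply: (@convex_above_tangent R shellY shellY1 (fun v => Upot2 v - 2 * shell_nu)) => y hy.
- have d := is_derive_Upot y.
  by rewrite /shellY /shellY1; apply: is_derive_eq; rewrite /GRing.scale /=; ring.
- have d := is_derive_Upot1 y.
  by rewrite /shellY1; apply: is_derive_eq; rewrite /GRing.scale /=; ring.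
- rewrite subr_ge0; move: hy => /andP[y1 y2].
  have [z1|z1] := leP y (3 + 10 / 10 ^+ 2); first by apply: shell_curv1; apply/andP; split; lra.
  have [z2|z2] := leP y (3 + 60 / 10 ^+ 2); first by apply: shell_curv2; apply/andP; split; lra.
  have [z3|z3] := leP y (3 + 85 / 10 ^+ 2); first by apply: shell_curv3; apply/andP; split; lra.
  by apply: shell_curv4; apply/andP; split; lra.
Qed.

Lemma shellY_vhex : shellY vhex = 0.
Proof. by rewrite /shellY; ring. Qed.

Lemma shellY1_vhex : shellY1 vhex = 0.
Proof.
have /andP[v1 _] := vhex_bounds R; have v0 : vhex != 0 by rewrite gt_eqF//; lra.
by rewrite /shellY1 /shell_nu; field.
Qed.

(** Near [vhex] a convex function with a double zero is nonnegative; further out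
    the tangent estimates take over. *)
Lemma shellY_near (v : R) : 26 / 10 <= v <= 4 + 45 / 10 ^+ 2 -> 0 <= shellY v.
Proof.
move=> /andP[y1 y2].
have [z1|z1] := leP v (4 + 5 / 10 ^+ 2).
  have h : 26 / 10 <= v <= 4 + 5 / 10 ^+ 2 by rewrite y1.
  by have := shellY_tangent h vhex_in; rewrite shellY_vhex shellY1_vhex mul0r addr0.
have [z2|z2] := leP v (4 + 25 / 10 ^+ 2); first by apply: shell_mid1; apply/andP; split; lra.
by apply: shell_mid2; apply/andP; split; lra.
Qed.

(** Convexity with minimum 0 at [vhex] makes [shellY] decreasing to the left of
    it. *)
Lemma shellY_far_left (a : R) : 26 / 10 <= a <= 3 + 15 / 10 ^+ 2 -> 65 / 10 ^+ 4 <= shellY a.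
Proof.
move=> /andP[a1 a2]; have m := shellY_left; have /andP[v1 v2] := vhex_bounds R.
have hm : (26 / 10 : R) <= 3 + 15 / 10 ^+ 2 <= (4 + 5 / 10 ^+ 2 : R) by apply/andP; split; lra.
have ha : 26 / 10 <= a <= 4 + 5 / 10 ^+ 2 by apply/andP; split; lra.
have t1 := shellY_tangent vhex_in hm; have t2 := shellY_tangent ha hm.
rewrite shellY_vhex in t1; set D := shellY1 _ in t1 t2.
have D0 : D <= 0.
  rewrite leNgt; apply/negP => D0.
  have : 0 <= D * (vhex - (3 + 15 / 10 ^+ 2)) by apply: mulr_ge0; lra.
  lra.
have : 0 <= (- D) * ((3 + 15 / 10 ^+ 2) - a) by apply: mulr_ge0; lra.
lra.
Qed.

(** The equation expresses that a form of area 1 takes the values a, b, c at the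
    three shortest vectors. It bounds b by 4.45 and c by 6.4. As long as c is at
    most 4.45 as well, all three values of [shellY] are nonnegative; beyond, the
    equation forces a + b + c - 3 vhex to be large. *)
Lemma first_shell (a b c : R) : 26 / 10 <= a -> a <= vhex -> a <= b -> b <= c -> c <= a + b ->
  (a + b - c) ^+ 2 = 4 * a * b - 3 * vhex ^+ 2 ->
  3 * Upot vhex + 1 / 125 * (a + b + c - 3 * vhex) <= Upot a + Upot b + Upot c.
Proof.
move=> a26 av ab bc cab E; have /andP[v1 v2] := vhex_bounds R.
have /andP[n1 _] := shell_nu_bounds; have n0 : 0 <= shell_nu by clear - n1; lra.
set S := a + b + c - 3 * vhex.
suff key : 0 <= shellY a + shellY b + shellY c + shell_nu * S ^+ 2 / 2.
  have : shellY a + shellY b + shellY c + shell_nu * S ^+ 2 / 2 =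
     Upot a + Upot b + Upot c - 3 * Upot vhex - 1 / 125 * S
     - shell_nu / 2 * ((a + b - c) ^+ 2 - (4 * a * b - 3 * vhex ^+ 2)).
    by rewrite /shellY /shell_tilt /S; field.
  by rewrite E subrr mulr0 subr0; clear - key; lra.
have V1 : (3 + 62 / 10 ^+ 2 + 74 / 10 ^+ 4) * (3 + 62 / 10 ^+ 2 + 74 / 10 ^+ 4) <= vhex * vhex.
  by apply: ler_pM => //; clear - v1; lra.
have V2 : vhex * vhex <= (3 + 62 / 10 ^+ 2 + 77 / 10 ^+ 4) * (3 + 62 / 10 ^+ 2 + 77 / 10 ^+ 4).
  by apply: ler_pM => //; clear - v1; lra.
rewrite !expr2 in E; set W := vhex * vhex in E V1 V2.
have S0 : 0 <= shell_nu * S ^+ 2 / 2 by rewrite divr_ge0// mulr_ge0// sqr_ge0.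
have e0 : 0 <= a + b - c by rewrite subr_ge0.
have ea : a + b - c <= a by clear - bc; lra.
have a0 : 0 < a by clear - a26; lra.
have aq : 0 <= (a - 26 / 10) * (363 / 100 - a) by apply: mulr_ge0; clear - a26 av v2; lra.
have ee : (a + b - c) * (a + b - c) <= a * (a + b - c) by rewrite ler_wpM2r.
have eae : a * (a + b - c) <= a * a by rewrite ler_wpM2l// ltW.
(* with e = a + b - c in [0, a], the relation e ^ 2 = 4 a b - 3 vhex ^ 2 bounds b *)
have b445 : b <= 4 + 45 / 10 ^+ 2.
  rewrite leNgt; apply/negP => h.
  have : a * (4 + 45 / 10 ^+ 2) <= a * b by rewrite ler_pM2l// ltW.
  by clear - aq ee eae E V2 a26; lra.
have Ya : 0 <= shellY a by apply: shellY_near; rewrite a26 (le_trans ab).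
have Yb : 0 <= shellY b by apply: shellY_near; rewrite (le_trans a26 ab).
have [c445|c445] := leP c (4 + 45 / 10 ^+ 2).
  have Yc : 0 <= shellY c by apply: shellY_near; rewrite (le_trans a26 (le_trans ab bc)).
  by clear - Ya Yb Yc S0; lra.
have c0 : 0 < c by clear - c445; lra.
(* the relation gives a + b >= c / 2 + 3 vhex ^ 2 / (2 c); 1 / c is replaced by its
   tangent at m *)
have line (m : R) : 0 < m ->
    c / 2 + 3 / 2 * ((3 + 62 / 10 ^+ 2 + 74 / 10 ^+ 4) * (3 + 62 / 10 ^+ 2 + 74 / 10 ^+ 4)) * (2 / m - c / m ^+ 2) <= a + b.
  move=> m0; rewrite -(ler_pM2l c0); set K := ((3 + 62 / 10 ^+ 2 + 74 / 10 ^+ 4) * (3 + 62 / 10 ^+ 2 + 74 / 10 ^+ 4)) in V1 *.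
  have q : c * (2 / m - c / m ^+ 2) = 1 - (1 - c / m) ^+ 2 by field; rewrite gt_eqF.
  have q1 : c * (2 / m - c / m ^+ 2) <= 1 by rewrite q; have := sqr_ge0 (1 - c / m); lra.
  have K0 : 0 <= 3 / 2 * K by rewrite mulr_ge0 ?mulr_ge0//; lra.
  have h := ler_wpM2l K0 q1; have s := sqr_ge0 (a - b).
  have p : c * c + 3 * W <= 2 * c * (a + b) by clear - E s; lra.
  move: (2 / m - c / m ^+ 2) h => u h; clear - p h V1; lra.
have l1 := line (46 / 10) (divr_gt0 (ltr0Sn _ _) (ltr0Sn _ _)); have l2 := line 5 (ltr0Sn _ _).
have l3 := line (54 / 10) (divr_gt0 (ltr0Sn _ _) (ltr0Sn _ _)); have l4 := line (58 / 10) (divr_gt0 (ltr0Sn _ _) (ltr0Sn _ _)).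
have l5 := line (62 / 10) (divr_gt0 (ltr0Sn _ _) (ltr0Sn _ _)).
have c64 : c <= 6 + 40 / 10 ^+ 2.
  have ae0 : 0 <= a * (a + b - c) by rewrite mulr_ge0// ltW.
  rewrite -(ler_pM2l a0); clear - aq E V2 ee a26 ae0; lra.
have [c1|c1] := leP c (4 + 80 / 10 ^+ 2).
  have H := @shell_far1 c S; have /H{}H : 4 + 45 / 10 ^+ 2 <= c <= 4 + 80 / 10 ^+ 2 by rewrite ltW.
  have {}H := H ltac:(rewrite /S; clear - l1 v2 c0; lra); clear - H Ya Yb; lra.
have [c2|c2] := leP c (5 + 20 / 10 ^+ 2).
  have H := @shell_far2 c S; have /H{}H : 4 + 80 / 10 ^+ 2 <= c <= 5 + 20 / 10 ^+ 2 by rewrite ltW.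
  have {}H := H ltac:(rewrite /S; clear - l2 v2 c0; lra); clear - H Ya Yb; lra.
have [c3|c3] := leP c (5 + 60 / 10 ^+ 2).
  have H := @shell_far3 c S; have /H{}H : 5 + 20 / 10 ^+ 2 <= c <= 5 + 60 / 10 ^+ 2 by rewrite ltW.
  have {}H := H ltac:(rewrite /S; clear - l3 v2 c0; lra); clear - H Ya Yb; lra.
have [c4|c4] := leP c 6.
  have H := @shell_far4 c S; have /H{}H : 5 + 60 / 10 ^+ 2 <= c <= 6 by rewrite ltW.
  have {}H := H ltac:(rewrite /S; clear - l4 v2 c0; lra); clear - H Ya Yb; lra.
(* for c >= 6 the relation forces a below 3.15 *)
have {}Ya : 65 / 10 ^+ 4 <= shellY a.
  apply: shellY_far_left; rewrite a26 /= leNgt; apply/negP => h.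
  have f0 : 0 <= a + b - 6 by clear - h ab; lra.
  have f1 : (a + b - c) * (a + b - c) <= (a + b - 6) * (a + b - 6).
    by apply: ler_pM => //; clear - c4; lra.
  have f2 : (b - a) * (b - a) <= (13 / 10) * (b - a).
    by apply: ler_wpM2r; clear - ab b445 h; lra.
  by clear - f1 f2 E V2 h ab; lra.
have [c5|c5] := leP c (6 + 29 / 10 ^+ 2).
  have H := @shell_far5 c S; have /H{}H : 6 <= c <= 6 + 29 / 10 ^+ 2 by rewrite ltW.
  have {}H := H ltac:(rewrite /S; clear - l5 v2 c0; lra); clear - H Ya Yb; lra.
have H := @shell_far6 c S; have /H{}H : 6 + 28 / 10 ^+ 2 <= c <= 6 + 40 / 10 ^+ 2 by rewrite c64 andbT; clear - c5; lra.
have {}H := H ltac:(rewrite /S; clear - cab v2; lra); clear - H Ya Yb; lra.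
Qed.

End FirstShell.

(** * Forms close to the hexagonal one *)

Section PuncturedSums.
Variable R : realType.
Implicit Types (F G : int * int -> R) (t x s : R).

Lemma asum0D F G : absum F -> absum G -> asum0 (fun p => F p + G p) = asum0 F + asum0 G.
Proof. by move=> sF sG; rewrite !asum0E ?asumD//; [ring | exact: absumD]. Qed.

Lemma asum0B F G : absum F -> absum G -> asum0 (fun p => F p - G p) = asum0 F - asum0 G.
Proof. by move=> sF sG; rewrite !asum0E ?asumB//; [ring | exact: absumB]. Qed.

Lemma asum0Z (k : R) F : absum F -> asum0 (fun p => k * F p) = k * asum0 F.
Proof. by move=> sF; rewrite !asum0E ?asumZ//; [ring | exact: absumZ]. Qed.

Lemma ler_asum0 F G : absum F -> absum G -> (forall p, p != 0 -> F p <= G p) -> asum0 F <= asum0 G.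
Proof.
move=> sF sG FG; apply: ler_asum; [exact: absum_if0|exact: absum_if0|move=> p].
by case: ifPn => // /FG.
Qed.

Lemma eq_asum0 F G : (forall p, p != 0 -> F p = G p) -> asum0 F = asum0 G.
Proof. by move=> FG; apply: eq_asum => p; case: ifPn => // /FG. Qed.

Lemma ltr_asum0 F G p0 : absum F -> absum G -> (forall p, p != 0 -> F p <= G p) ->
  p0 != 0 -> F p0 < G p0 -> asum0 F < asum0 G.
Proof.
move=> sF sG FG z0 lt0; rewrite -subr_gt0 -asum0B//.
have sH := absumB sG sF.
apply: (@lt_le_trans _ _ (\sum_(p <- [:: p0]) (if p == 0 then 0 else G p - F p))).
  by rewrite big_seq1 (negbTE z0) subr_gt0.
apply: asum_ge_sum => //; first exact: absum_if0.
by move=> p _; case: ifPn => // /FG; rewrite subr_ge0.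
Qed.

Lemma asum0_reindex (e e' : int * int -> int * int) F : cancel e e' -> cancel e' e -> e 0 = 0 ->
  asum0 F = asum0 (F \o e).
Proof.
move=> K K' e0; rewrite /asum0 (asum_reindex _ K K'); apply: eq_asum => p /=.
by rewrite -{1}e0 (inj_eq (can_inj K)).
Qed.

(** The sum is unchanged when a function is averaged over a bijection of the
    index set fixing 0; here no metric symmetry of the form is involved. *)
Lemma asum0_average (e e' : int * int -> int * int) F : cancel e e' -> cancel e' e -> e 0 = 0 ->
  absum F ->
  let G p := 1 / 3 * (F p + F (e p) + F (e (e p))) in absum G /\ asum0 F = asum0 G.
Proof.
move=> K K' e0 sF G; have ci := can_inj K.
have s1 : absum (F \o e) by exact: absum_inj.
have s2 : absum ((F \o e) \o e) by exact: absum_inj.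
have s3 := absumD (absumD sF s1) s2.
have E1 := asum0_reindex F K K' e0; have E2 := asum0_reindex (F \o e) K K' e0.
split; first exact: (absumZ (1 / 3) s3).
have := asum0Z (1 / 3) s3; rewrite asum0D//; last exact: absumD.
by rewrite asum0D// -E2 -E1 /G /= => ->; field.
Qed.

Lemma absum_hfun t x s : 0 < t -> 0 < s -> absum (fun p => hfun s (qform t x p)).
Proof.
move=> t0 s0; have gq := gsummable_qform x t0.
have := absumB (absumZ s (absum_qexp gq s0)) (absumZ (1 / 2) (gq.2 s s0)).
by congr absum; apply/funext => p; rewrite /hfun; ring.
Qed.

Lemma absum_gdual t x : 0 < t -> absum (fun p => gdual (qform t x p)).
Proof.
move=> t0; have gq := gsummable_qform x t0.
by apply: absumB; [|apply: absumZ]; apply: gq.2; lra.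
Qed.

Lemma asum0_hfun1 t x : 0 < t -> asum0 (fun p => hfun 1 (qform t x p)) = 1 / 2.
Proof.
move=> t0; transitivity (2^-1 : R); last by lra.
by rewrite -(asum0_h1 x t0); apply: eq_asum0 => p _; rewrite hfun1; congr ((_ - _) * _); lra.
Qed.

Lemma asum0_gdual t x : 0 < t -> asum0 (fun p => gdual (qform t x p)) = 1 / 2.
Proof.
move=> t0; transitivity (2^-1 : R); last by lra.
by rewrite -(asum0_gauss_dual x t0).
Qed.

(** The derivative in u of the functional equation between the parameters u and
    1 / u. All its values are positive where it is used, so that single terms
    bound partial sums. *)
Definition gdualT (u v : R) :=
  u ^- 2 * (v * expR (- (u^-1 * v))) - (expR (- (u * v)) - u * (v * expR (- (u * v)))).

Lemma absum_gdualT u t x : 0 < u -> 0 < t -> absum (fun p => gdualT u (qform t x p)).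
Proof.
move=> u0 t0; have gq := gsummable_qform x t0.
have u1 : 0 < u^-1 by rewrite invr_gt0.
apply: absumB; first by apply: absumZ; exact: absum_qexp gq u1.
by apply: absumB; [exact: gq.2 | apply: absumZ; exact: absum_qexp gq u0].
Qed.

(** Differentiate theta (1 / u) = u theta (u); what remains of the constant term
    of the theta series is 1. *)
Lemma asum0_gdualT u t x : 0 < u -> 0 < t -> asum0 (fun p => gdualT u (qform t x p)) = 1.
Proof.
move=> u0 t0; have gq := gsummable_qform x t0.
have u1 : 0 < u^-1 by rewrite invr_gt0.
have d1 := absum_qexp gq u1; have d2 := absum_qexp gq u0.
rewrite asum0E; last exact: absum_gdualT.
rewrite /gdualT asumB; [|exact: absumZ|by apply: absumB; [exact: gq.2|exact: absumZ]].
rewrite asumZ// asumB; [|exact: gq.2|exact: absumZ].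
rewrite asumZ// qform0 !mul0r !mulr0 oppr0 expR0.
set D1 := asum _; set T := asum _; set D2 := asum _.
have dT1 : is_derive (u^-1 : R) 1 (theta t x) (- D1) by exact: is_derive_theta.
have dT2 : is_derive (u : R) 1 (theta t x) (- D2) by exact: is_derive_theta.
have TE : theta t x u = T by [].
have dI : is_derive (u : R) 1 (fun s : R => s^-1) (- u ^- 2).
  apply: is_derive_eq; first exact: (is_deriveV (f := id) (lt0r_neq0 u0)).
  by rewrite /= /GRing.scale /= mulr1.
have dC : is_derive (u : R) 1 (theta t x \o (fun s : R => s^-1)) (- D1 * - u ^- 2).
  exact: is_derive1_comp.
have dM : is_derive (u : R) 1 (fun s : R => s * theta t x s) (T - u * D2).
  have dM0 : is_derive (u : R) 1 ((id : R -> R) * theta t x) ((id : R -> R) u *: (- D2) + theta t x u *: (1 : R)).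
    exact: is_deriveM.
  by apply: is_derive_eq; rewrite TE /GRing.scale /=; ring.
have F0 : \forall s \near (u : R), (theta t x \o (fun s : R => s^-1)) s = s * theta t x s.
  near=> s; rewrite /= theta_inv//; near: s; exact: (lt_nbhsr u0).
have dC' := near_eq_is_derive F0 dC.
have := @derive_val _ _ _ _ _ _ _ dC'; rewrite (@derive_val _ _ _ _ _ _ _ dM).
move=> E; have -> : u ^- 2 * D1 = T - u * D2 by rewrite E; ring.
by rewrite subrr; lra.
Unshelve. all: by end_near.
Qed.

(** [gdualT] at 3/2, in the form used for numerical estimates. *)
Definition gdualD (v : R) := 4 / 9 * (v * expR (- (2 / 3 * v))) - (expR (- (3 / 2 * v)) - 3 / 2 * (v * expR (- (3 / 2 * v)))).

Lemma gdualDE v : gdualD v = gdualT (3 / 2) v.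
Proof.
rewrite /gdualD /gdualT (_ : (3 / 2)^-1 = 2 / 3); last by field.
by rewrite (_ : (3 / 2) ^- 2 = 4 / 9)//; field.
Qed.

Lemma absum_gdualD t x : 0 < t -> absum (fun p => gdualD (qform t x p)).
Proof.
by move=> t0; rewrite (funext (fun p => gdualDE (qform t x p))); apply: absum_gdualT => //; lra.
Qed.

Lemma asum0_gdualD t x : 0 < t -> asum0 (fun p => gdualD (qform t x p)) = 1.
Proof.
by move=> t0; rewrite (funext (fun p => gdualDE (qform t x p))) asum0_gdualT//; lra.
Qed.

End PuncturedSums.

Section Eisenstein.

(** The hexagonal form up to scaling, and an automorphism of order 6 of it. *)
Definition eisN (p : int * int) : int := p.2 ^+ 2 + p.2 * p.1 + p.1 ^+ 2.
Definition rot6 (p : int * int) : int * int := (p.1 + p.2, - p.1).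
Definition rot6V (p : int * int) : int * int := (- p.2, p.1 + p.2).

Lemma rot6K : cancel rot6 rot6V.
Proof. by move=> [m n]; rewrite /rot6 /rot6V /=; congr pair; lia. Qed.

Lemma rot6VK : cancel rot6V rot6.
Proof. by move=> [m n]; rewrite /rot6 /rot6V /=; congr pair; lia. Qed.

Lemma rot6_0 : rot6 0 = 0.
Proof. by []. Qed.

Lemma eisN_gt0 p : p != 0 -> 1 <= eisN p.
Proof.
case: p => m n; rewrite /eisN /= -[_ == _]/((m == 0) && (n == 0)) => h.
have : (2 * n + m) ^+ 2 + 3 * m ^+ 2 != 0.
  apply/negP => /eqP e; have m0 : m = 0 by nia.
  by move: e h; rewrite m0 => e; have -> : n = 0 by nia.
nia.
Qed.

Lemma eisN_small p : p != 0 -> eisN p <= 2 ->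
  p \in [:: (0, 1); (1, 0); (1, -1); (0, -1); (-1, 0); (-1, 1)].
Proof.
case: p => m n; rewrite /eisN /= -[_ == _]/((m == 0) && (n == 0)) => z h.
have m1 : -1 <= m <= 1 by nia.
have n1 : -1 <= n <= 1 by nia.
move: z h; have [->|[->|->]] : m = -1 \/ m = 0 \/ m = 1 by lia.
all: have [e|[e|e]] : n = -1 \/ n = 0 \/ n = 1 by lia.
all: by rewrite e.
Qed.

End Eisenstein.

Section RegionOne.
Variable R : realType.
Implicit Types (t x s : R) (p : int * int).
Local Notation vhex := (vhex R).

Lemma qform_hex p : qform vhex (1 / 2) p = vhex * (eisN p)%:~R.
Proof.
have v0 : vhex != 0 by rewrite gt_eqF//; have /andP[h _] := vhex_bounds R; lra.
have e : pi ^+ 2 = 3 / 4 * vhex ^+ 2 :> R by rewrite vhex_sqr; field.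
by rewrite /qform e /eisN !(rmorphD, rmorphM, rmorphXn) /=; field.
Qed.

(** An automorphism-invariant average of a quadratic form is a multiple of the
    hexagonal form. Three powers suffice, the third one being - 1. *)
Lemma qform_rot6_sum t x p : t != 0 ->
  qform t x p + qform t x (rot6 p) + qform t x (rot6 (rot6 p)) =
  (eisN p)%:~R * (qform t x (0, 1) + qform t x (1, 0) + qform t x (1, -1)).
Proof.
by move=> t0; rewrite /qform /rot6 /eisN /= !(rmorphD, rmorphM, rmorphXn, rmorphN) /=; field.
Qed.

(** For a reduced form the first vector is a shortest one. *)
Lemma qform_ge_min t x p : 0 < t -> 0 <= x <= 1 / 2 -> t <= qform t x (1, 0) -> p != 0 ->
  t <= qform t x p.
Proof.
move=> t0 /andP[x0 x1] hb p0; have N1 := eisN_gt0 p0.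
set b := qform t x (1, 0) in hb.
have bE : pi ^+ 2 / t = b - t * x ^+ 2 by rewrite /b /qform /=; ring.
have -> : qform t x p = t * p.2%:~R ^+ 2 + b * p.1%:~R ^+ 2 + 2 * t * x * (p.2 * p.1)%:~R.
  by rewrite /qform bE rmorphM /=; ring.
have h1 : t * p.1%:~R ^+ 2 <= b * p.1%:~R ^+ 2 by rewrite ler_wpM2r ?sqr_ge0.
have [mn|mn] := leP 0 (p.2 * p.1).
  have i1 : 1 <= p.2 ^+ 2 + p.1 ^+ 2.
    have : p.2 ^+ 2 + p.1 ^+ 2 != 0; last by nia.
    by apply/negP => /eqP e; move: N1; rewrite /eisN; nia.
  have i2 : 1 <= p.2%:~R ^+ 2 + p.1%:~R ^+ 2 :> R.
    by have := i1; rewrite -(ler_int R) !(rmorphD, rmorphM, rmorphXn).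
  have i3 : 0 <= 2 * t * x * (p.2 * p.1)%:~R by rewrite !mulr_ge0 ?ler0z// ltW.
  have := ler_wpM2l (ltW t0) i2; lra.
have i2 : 1 <= p.2%:~R ^+ 2 + (p.2 * p.1)%:~R + p.1%:~R ^+ 2 :> R.
  by have := N1; rewrite -(ler_int R) /eisN !(rmorphD, rmorphM, rmorphXn).
have i3 : 0 <= - (p.2 * p.1)%:~R :> R by rewrite -rmorphN ler0z; lia.
have i4 : 0 <= t * (1 - 2 * x) * - (p.2 * p.1)%:~R.
  by rewrite !mulr_ge0//; [exact: ltW|lra].
have := ler_wpM2l (ltW t0) i2; lra.
Qed.

Definition tail_const : R := 6 + 1 / 10.

(** The loss on long vectors is dominated by a function of constant lattice sum,
    which avoids summing the tail explicitly. *)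
Lemma tail_slope_le (w : R) : 3 * vhex <= w ->
  w * tail_slope vhex w <= tail_const * gdualD w.
Proof.
have /andP[v1 v2] := vhex_bounds R => w0.
have w1 : 108 / 10 <= w by lra.
rewrite /tail_slope /gdualD.
have e3 : expR (- w) = expR (- (2 / 3 * w)) * expR (- (w / 3)) by rewrite -expRD; congr expR; field.
rewrite e3; set X := expR (- (2 / 3 * w)); set Z := expR (- (w / 3)); set Y := expR (- (3 / 2 * w)).
have X0 : 0 < X := expR_gt0 _; have Y0 : 0 < Y := expR_gt0 _; have Z0 : 0 < Z := expR_gt0 _.
have zb : (12 / 5 * w - 5 / 2) * Z <= 64 / 100.
  have chk : exp_check 3 60 0 1 2 73 23 by vm_compute.
  have /andP[_ u] := @expN_enclosure R 3 60 0 1 2 73 23 (36 / 10) chk ltac:(clear; lra); clear chk.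
  have q : Z = expR (- (36 / 10)) * expR (- (w / 3 - 36 / 10)) by rewrite -expRD; congr expR; field.
  set d := w / 3 - 36 / 10 in q; have d0 : 0 <= d by rewrite /d; lra.
  have e1 := expR_ge1Dx d; have e2 : expR (- d) * expR d = 1 by rewrite -expRD addNr expR0.
  have e4 : expR (- d) * (1 + d) <= 1 by apply: le_trans (ler_wpM2l (expR_ge0 _) e1) _; rewrite e2.
  have wE : w = 3 * d + 108 / 10 by rewrite /d; field.
  have e5 : (12 / 5 * w - 5 / 2) <= (1 + d) * (12 / 5 * (108 / 10) - 5 / 2) by rewrite wE; lra.
  rewrite q; apply: (@le_trans _ _ ((1 + d) * (12 / 5 * (108 / 10) - 5 / 2) * (expR (- (36 / 10)) * expR (- d)))).
    by apply: ler_wpM2r => //; rewrite mulr_ge0 ?expR_ge0.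
  have -> : (1 + d) * (12 / 5 * (108 / 10) - 5 / 2) * (expR (- (36 / 10)) * expR (- d)) =
    (12 / 5 * (108 / 10) - 5 / 2) * expR (- (36 / 10)) * (expR (- d) * (1 + d)) by ring.
  have k0 : 0 <= (12 / 5 * (108 / 10) - 5 / 2) * expR (- (36 / 10)) :> R by rewrite mulr_ge0 ?expR_ge0//; lra.
  have := ler_wpM2l k0 e4; rewrite mulr1 => k1; apply: le_trans k1 _; lra.
have c1 : (w - 1 / 2) + (5 - vhex) * (w - 3 / 2) <= 12 / 5 * w - 5 / 2.
  have : (5 - vhex) * (w - 3 / 2) <= (14 / 10) * (w - 3 / 2) by rewrite ler_wpM2r//; lra.
  lra.
have c2 : ((w - 1 / 2) + (5 - vhex) * (w - 3 / 2)) * Z <= 64 / 100.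
  by apply: le_trans zb; rewrite ler_wpM2r// ltW.
have wX : 0 <= w * X by rewrite mulr_ge0 ?ltW//; lra.
have := ler_wpM2l wX c2.
have wY : 0 <= (3 / 2 * w - 1) * Y by rewrite mulr_ge0 ?ltW//; lra.
rewrite /tail_const; lra.
Qed.

(** The six shortest vectors of the hexagonal lattice carry all but 28/1000 of the
    total mass 1 of [gdualD]. *)
Lemma gdualD_vhex : 1 - 28 / 1000 <= 6 * gdualD vhex.
Proof.
have /andP[v1 v2] := vhex_bounds R.
have chk : exp_check 7 25 54 3 8 90 58 by vm_compute.
have /andP[l1 _] := @expN_enclosure R 7 25 54 3 8 90 58 (2 / 3 * (3 + 62 / 10 ^+ 2 + 77 / 10 ^+ 4)) chk ltac:(clear; lra); clear chk.
have chk : exp_check 10 88 31 2 0 43 32 by vm_compute.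
have /andP[l2 _] := @expN_enclosure R 10 88 31 2 0 43 32 (3 / 2 * (3 + 62 / 10 ^+ 2 + 77 / 10 ^+ 4)) chk ltac:(clear; lra); clear chk.
have m1 : expR (- (2 / 3 * (3 + 62 / 10 ^+ 2 + 77 / 10 ^+ 4))) <= expR (- (2 / 3 * vhex)) by rewrite ler_expR; clear - v2; lra.
have m2 : expR (- (3 / 2 * (3 + 62 / 10 ^+ 2 + 77 / 10 ^+ 4))) <= expR (- (3 / 2 * vhex)) by rewrite ler_expR; clear - v2; lra.
have a1 : (362 / 100) * (89 / 1000) <= vhex * expR (- (2 / 3 * vhex)).
  by apply: ler_pM; clear - v1 l1 m1; lra.
have a2 : (3 / 2 * (362 / 100) - 1) * (43 / 10 ^+ 4) <= (3 / 2 * vhex - 1) * expR (- (3 / 2 * vhex)).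
  by apply: ler_pM; clear - v1 l2 m2; lra.
rewrite /gdualD; clear - a1 a2; lra.
Qed.

Let v0_gt0 : 0 < vhex. Proof. by have /andP[h _] := vhex_bounds R; lra. Qed.

Definition unit_vectors : seq (int * int) := [:: (0, 1); (1, 0); (1, -1); (0, -1); (-1, 0); (-1, 1)].

Lemma unit_vectorsP p : p \in unit_vectors -> (p != 0) && (eisN p == 1).
Proof.
have : all (fun p => (p != 0) && (eisN p == 1)) unit_vectors by [].
by move/allP; apply.
Qed.

Lemma asum0_unit (C : R) :
  absum (fun p => if p \in unit_vectors then C else 0) /\
  asum0 (fun p => if p \in unit_vectors then C else 0) = 6 * C.
Proof.
have [sF E] := @asum_finite R _ unit_vectors (fun p => if p \in unit_vectors then C else 0) isT
  ltac:(by move=> i /negbTE ->).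
split=> //; rewrite asum0E// E; have -> : (0 \in unit_vectors) = false by [].
rewrite (eq_big_seq (fun=> C)); last by move=> p ->.
by rewrite /unit_vectors !big_cons big_nil; ring.
Qed.

(** The reserve [vhex] / 125 on the six shortest vectors pays for the loss on all
    the other ones: the total of [gdualD] is 1, and its part on the six shortest
    vectors is almost everything. *)
Lemma tail_weights_ge0 :
  let T p := (if p \in unit_vectors then vhex / 125 + tail_const * gdualD vhex else 0) -
    tail_const * gdualD (qform vhex (1 / 2) p) in
  absum T /\ 0 <= asum0 T.
Proof.
move=> T; have [s1 e1] := asum0_unit (vhex / 125 + tail_const * gdualD vhex).
have s2 := absum_gdualD (1 / 2) v0_gt0; split; first by apply: absumB => //; exact: absumZ.
rewrite /T asum0B//; last exact: absumZ.
rewrite e1 asum0Z// asum0_gdualD//.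
have := gdualD_vhex; have /andP[v1 _] := vhex_bounds R.
rewrite /tail_const; lra.
Qed.

Lemma absum_Hpot s t x : 1 < s -> 0 < t -> absum (fun p => Hpot s vhex (qform t x p)).
Proof.
move=> s1 t0; have sa := absum_hfun x t0 (lt_trans ltr01 s1); have sb := absum_hfun x t0 ltr01.
have := absumD (absumZ (slope s vhex)^-1 (absumB sa (absumZ (alphaH s vhex) sb))) (absumZ (31 / 10) (absum_gdual x t0)).
by congr absum; apply/funext => p; rewrite /Hpot [_ / slope _ _]mulrC.
Qed.

(** The corrections shift all lattice sums by the same amount. *)
Lemma asum0_Hpot s t x : 1 < s -> 0 < t ->
  asum0 (fun p => Hpot s vhex (qform t x p)) =
  (slope s vhex)^-1 * (asum0 (fun p => hfun s (qform t x p)) - alphaH s vhex * (1 / 2)) + 31 / 10 * (1 / 2).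
Proof.
move=> s1 t0; have sa := absum_hfun x t0 (lt_trans ltr01 s1); have sb := absum_hfun x t0 ltr01.
have sc := absumB sa (absumZ (alphaH s vhex) sb); have sd := absum_gdual x t0.
rewrite (@eq_asum0 _ _ (fun p => (slope s vhex)^-1 * (hfun s (qform t x p) - alphaH s vhex * hfun 1 (qform t x p)) + 31 / 10 * gdual (qform t x p))).
  rewrite asum0D; [|exact: absumZ|exact: absumZ].
  rewrite (asum0Z _ sc) (asum0Z _ sd) asum0B//; last exact: absumZ.
  by rewrite asum0Z// asum0_hfun1// asum0_gdual.
by move=> p _; rewrite /Hpot [_ / slope _ _]mulrC.
Qed.

(** Compare the average F of the convex function H over each orbit of the rotation
    with its values on the hexagonal lattice. Let k >= 1 be the ratio of the sum
    of the three shortest values to its hexagonal minimum. Each of the other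
    orbits loses at most (k - 1) times a weight, the six shortest vectors gain at
    least (k - 1) vhex / 125 each by [first_shell], and [tail_weights_ge0] balances
    the two. *)
Theorem region_one s t x : 1 < s -> 26 / 10 <= t -> t < vhex -> 0 <= x <= 1 / 2 -> t <= qform t x (1, 0) ->
  asum0 (fun p => hfun s (qform vhex (1 / 2) p)) < asum0 (fun p => hfun s (qform t x p)).
Proof.
move=> s1 t26 tv hx hb; have t0 : 0 < t by lra.
have /andP[v1 v2] := vhex_bounds R; have v3 : 3 <= vhex by lra.
have sl0 : 0 < slope s vhex by apply: slope_gt0; [exact: s1|lra].
suff H : asum0 (fun p => Hpot s vhex (qform vhex (1 / 2) p)) < asum0 (fun p => Hpot s vhex (qform t x p)).
  move: H; rewrite !asum0_Hpot// ltrD2r ltr_pM2l ?invr_gt0//; lra.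
set H := Hpot s vhex; set Q := qform t x; set W := qform vhex (1 / 2).
have sQ : absum (fun p => H (Q p)) by exact: absum_Hpot.
have sW : absum (fun p => H (W p)) by exact: absum_Hpot.
have ci : injective rot6 := can_inj rot6K.
have [sF FE] := asum0_average rot6K rot6VK rot6_0 sQ.
rewrite {}FE; set F := fun p => _ in sF *.
set a := qform t x (0, 1); set b := qform t x (1, 0) in hb; set c := qform t x (1, -1).
have aE : a = t by rewrite /a /qform /=; ring.
have bE : b = t * x ^+ 2 + pi ^+ 2 / t by rewrite /b /qform /=; ring.
have cE : c = b + t * (1 - 2 * x) by rewrite /c bE /qform /=; ring.
have vs := vhex_sqr R.
have E : (a + b - c) ^+ 2 = 4 * a * b - 3 * vhex ^+ 2.
  by rewrite cE aE vs bE; field; rewrite gt_eqF.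
move: (hx) => /andP[x0 x1].
have tx : 0 <= t * (1 - 2 * x) by apply: mulr_ge0; [exact: ltW | clear - x1; lra].
have tx2 : 0 <= t * x := mulr_ge0 (ltW t0) x0.
have FS := @first_shell R a b c ltac:(rewrite aE; exact: t26) ltac:(rewrite aE; exact: ltW tv) ltac:(rewrite aE; exact: hb)
  ltac:(rewrite cE; clear - v0_gt0 tx; lra) ltac:(rewrite cE aE; clear - v0_gt0 tx2; lra) E.
(* k is the factor by which the averaged form exceeds the hexagonal one *)
pose k := (a + b + c) / (3 * vhex).
have kE : k * vhex = (a + b + c) / 3 by rewrite /k; field; rewrite gt_eqF.
have k1 : 1 <= k.
  have v30 : 0 < 3 * vhex by clear - v1; lra.
  rewrite /k (ler_pdivlMr _ _ v30) mul1r.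
  have q1 : 9 * vhex ^+ 2 <= (a + b + c) ^+ 2.
    have := sqr_ge0 (a - b); have := sqr_ge0 (b - c); have := sqr_ge0 (a - c); clear - E; lra.
  have abc : 0 <= a + b + c by rewrite aE cE; lra.
  rewrite leNgt; apply/negP => h.
  have := ltr_pM abc abc h h; rewrite -!expr2 => h2; clear - h2 q1; lra.
have [] := tail_weights_ge0; set T := fun p => _; move=> sT T0.
have TU p : p \in unit_vectors -> T p = vhex / 125 + tail_const * gdualD vhex - tail_const * gdualD (W p).
  by rewrite /T => ->.
have TN p : p \notin unit_vectors -> T p = - (tail_const * gdualD (W p)).
  by rewrite /T => /negbTE ->; rewrite sub0r.
clearbody T.
(* the weights T have nonnegative total, so G dominates the hexagonal sum;
   it remains to compare G with the average F term by term *)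
pose G p := H (W p) + (k - 1) * T p.
have sG : absum G by apply: absumD => //; exact: absumZ.
apply: (@le_lt_trans _ _ (asum0 G)).
  by rewrite (asum0D sW (absumZ (k - 1) sT)) (asum0Z (k - 1) sT) lerDl mulr_ge0// subr_ge0.
have Qge p : p != 0 -> 5 / 2 <= Q p.
  by move=> p0; apply: (@le_trans _ _ t); [clear - v0_gt0 t26; lra | exact: qform_ge_min].
have rot0 p : p != 0 -> rot6 p != 0.
  by move=> p0; rewrite -rot6_0 (inj_eq ci).
have case1 p : p \in unit_vectors -> G p < F p.
  move=> hp; have /andP[_ /eqP N1] := unit_vectorsP hp.
  have WE : W p = vhex by rewrite /W qform_hex N1 mulr1.
  have GE : G p = Upot vhex + (a + b + c - 3 * vhex) / 375.
    rewrite /G TU// WE /H Hpot_at//.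
    have -> : (k - 1) * (vhex / 125 + tail_const * gdualD vhex - tail_const * gdualD vhex) =
       (k * vhex - vhex) / 125 by field.
    by rewrite kE; field.
  have Fabc : F p = 1 / 3 * (H a + H b + H c).
    have Qs m n : Q (- m, - n) = Q (m, n) by rewrite /Q /qform /= !rmorphN /=; ring.
    have q0 : Q (0, -1) = a by exact: (Qs 0 1).
    have q1 : Q (-1, 0) = b by exact: (Qs 1 0).
    have q2 : Q (-1, 1) = c by exact: (Qs 1 (-1)).
    rewrite /F; congr (_ * _); move: hp; rewrite /unit_vectors !inE.
    have qa : Q (0, 1) = a by [].
    have qb : Q (1, 0) = b by [].
    have qc : Q (1, -1) = c by [].
    move=> /or4P[/eqP->|/eqP->|/eqP->|/or3P[/eqP->|/eqP->|/eqP->]];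
      rewrite /rot6 /= ?addr0 ?add0r ?oppr0 ?opprK ?subrr ?addNr ?qa ?qb ?qc ?q0 ?q1 ?q2; ring.
  have hU v : 1 / 2 < v -> Upot v <= H v by move=> hv; exact: Upot_le_Hpot.
  have ha : Upot a < H a by apply: Upot_lt_Hpot => //; rewrite ?aE; [clear - v0_gt0 t26; lra | rewrite lt_eqF].
  have hb' : Upot b <= H b by apply: hU; clear - v0_gt0 hb t26; lra.
  have hc : Upot c <= H c by apply: hU; rewrite cE; clear - v0_gt0 hb t26 tx; lra.
  rewrite GE Fabc; clear - v0_gt0 FS ha hb' hc; lra.
apply: (@ltr_asum0 _ _ _ (0, 1)) => //; last exact: case1.
move=> p p0; have [hp|hp] := boolP (p \in unit_vectors); first exact: ltW (case1 p hp).
have N3 : 3 <= eisN p.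
  by rewrite leNgt; apply/negP => h; move/negP: hp; apply; apply: eisN_small => //; lia.
have N3R : 3 <= (eisN p)%:~R :> R by rewrite -(ler_int R) in N3.
have WE : W p = vhex * (eisN p)%:~R by exact: qform_hex.
have w3 : 3 * vhex <= W p by rewrite WE mulrC ler_pM2l.
have sumE : Q p + Q (rot6 p) + Q (rot6 (rot6 p)) = 3 * (k * W p).
  rewrite /Q qform_rot6_sum ?gt_eqF// -/a -/b -/c WE [k * _]mulrA kE; by field.
have O := @Hpot_orbit R s vhex s1 v3 (W p) k _ _ _ w3 k1 (Qge _ p0) (Qge _ (rot0 _ p0)) (Qge _ (rot0 _ (rot0 _ p0))) sumE.
have TL := tail_slope_le w3.
have TE := TN _ hp.
rewrite /G /F TE; have k10 : 0 <= k - 1 by rewrite subr_ge0.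
have := ler_wpM2l k10 TL; rewrite -/H in O; clear - v0_gt0 O; lra.
Qed.

End RegionOne.

(** * Forms of intermediate shortest length *)

Section RegionTwo.
Variable R : realType.
Implicit Types (t x s v : R) (p : int * int).
Local Notation vhex := (vhex R).

(** The derivative of the tangent line bound with respect to the slope. *)
Definition kap0 v := (vhex - v) * (v - 1 / 2) * expR (- v).

(** [gdualT] at 2, in the form used for numerical estimates. *)
Definition gdual2T v := v / 4 * expR (- (1 / 2 * v)) + (2 * v - 1) * expR (- (2 * v)).

Lemma gdual2TE v : gdual2T v = gdualT 2 v.
Proof.
rewrite /gdual2T /gdualT (_ : 2^-1 * v = 1 / 2 * v); last by field.
by rewrite (_ : 2 ^- 2 = 1 / 4 :> R); field.
Qed.

Lemma absum_gdual2T t x : 0 < t -> absum (fun p => gdual2T (qform t x p)).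
Proof.
by move=> t0; rewrite (funext (fun p => gdual2TE (qform t x p))); exact: absum_gdualT.
Qed.

Lemma asum0_gdual2T t x : 0 < t -> asum0 (fun p => gdual2T (qform t x p)) = 1.
Proof.
by move=> t0; rewrite (funext (fun p => gdual2TE (qform t x p))) asum0_gdualT.
Qed.

(** The negative part of [kap0], beyond [vhex], is absorbed by a multiple of the
    positive function [gdual2T]. Its lattice sum 1 costs 47/100 in total, which
    the two shortest vectors will repay. *)
Lemma kap0_ge v : 1 / 2 <= v -> 0 <= kap0 v + 47 / 100 * gdual2T v.
Proof.
move=> v1; have /andP[h1 h2] := vhex_bounds R.
rewrite /kap0 /gdual2T; have z0 := expR_ge0 (- (2 * v)).
have e : expR (- v) = expR (- (1 / 2 * v)) * expR (- (1 / 2 * v)) by rewrite -expRD; congr expR; field.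
rewrite e; set Y := expR (- (1 / 2 * v)) in e *; have Y0 : 0 < Y := expR_gt0 _.
have zz : 0 <= (2 * v - 1) * expR (- (2 * v)) by apply: mulr_ge0 => //; lra.
suff k : (v - vhex) * (v - 1 / 2) * Y <= 47 / 400 * v.
  have := ler_wpM2r (ltW Y0) k; lra.
have [vv|vv] := leP v vhex.
  have w : 0 <= (vhex - v) * (v - 1 / 2) * Y.
    by apply: mulr_ge0 (ltW Y0); apply: mulr_ge0; lra.
  lra.
have q0 : 0 <= (v - vhex) * (v - 1 / 2) by rewrite mulr_ge0//; lra.
have q1 : (v - vhex) * (v - 1 / 2) <= (v - (3 + 62 / 10 ^+ 2)) * (v - 1 / 2).
  by apply: ler_wpM2r; lra.
have B (m e0 : R) : expR (- (1 / 2 * m)) <= e0 -> Y * (1 + (v - m) / 2) <= e0.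
  move=> me; have f1 := expR_ge1Dx ((v - m) / 2).
  have f2 : Y * expR ((v - m) / 2) = expR (- (1 / 2 * m)) by rewrite -expRD; congr expR; field.
  by apply: le_trans me; rewrite -f2 ler_wpM2l// ltW.
have C (m e0 : R) : 0 < 1 + (v - m) / 2 -> expR (- (1 / 2 * m)) <= e0 ->
    (v - (3 + 62 / 10 ^+ 2)) * (v - 1 / 2) * e0 <= 47 / 400 * v * (1 + (v - m) / 2) ->
    (v - vhex) * (v - 1 / 2) * Y <= 47 / 400 * v.
  move=> d0 /B be h; rewrite -(ler_pM2r d0); apply: le_trans h.
  rewrite -[_ * Y * _]mulrA; apply: ler_pM => //.
  exact: mulr_ge0 (ltW Y0) (ltW d0).
have [v5|v5] := leP v (46 / 10).
  have chk : exp_check 2 10 0 1 12 24 56 by vm_compute.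
  have /andP[_ u] := @expN_enclosure R 2 10 0 1 12 24 56 (1 / 2 * (42 / 10)) chk ltac:(clear; lra); clear chk.
  apply: (C _ _ _ u); first by lra.
  have g1 : 0 <= (v - 36 / 10) * (46 / 10 - v) by rewrite mulr_ge0//; lra.
  lra.
have chk : exp_check 2 85 0 1 5 78 44 by vm_compute.
have /andP[_ u] := @expN_enclosure R 2 85 0 1 5 78 44 (1 / 2 * (57 / 10)) chk ltac:(clear; lra); clear chk.
apply: (C _ _ _ u); first by lra.
have g1 : 0 <= (v - 46 / 10) * (v - 46 / 10) by rewrite mulr_ge0//; lra.
lra.
Qed.

(** Over each piece every exponential is replaced by its tangent line near
    the midpoint, leaving a polynomial inequality. *)
Lemma gain_piece1 (t : R) : (65 / 10 ^+ 2) <= t <= (85 / 10 ^+ 2) -> 0 <= 2 * (kap0 t + 47 / 100 * gdual2T t) - 47 / 100.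
Proof.
have h0 : 47 / 10 ^+ 2 + 71 / 10 ^+ 4 + 13 / 10 ^+ 6 <= expR (- ((74 / 10 ^+ 2))) :> R.
  have chk : exp_check 0 74 0 1 47 71 13 by vm_compute.
  have /andP[l0 _] := @expN_enclosure R 0 74 0 1 47 71 13 ((74 / 10 ^+ 2)) chk ltac:(clear; lra); clear chk.
  lra.
have p0 : 0 <= 47 / 10 ^+ 2 + 71 / 10 ^+ 4 + 13 / 10 ^+ 6 :> R by clear; lra.
have h1 : 69 / 10 ^+ 2 + 7 / 10 ^+ 4 + 34 / 10 ^+ 6 <= expR (- (1 / 2 * (74 / 10 ^+ 2))) :> R.
  have chk : exp_check 0 37 0 1 69 7 34 by vm_compute.
  have /andP[l0 _] := @expN_enclosure R 0 37 0 1 69 7 34 (1 / 2 * (74 / 10 ^+ 2)) chk ltac:(clear; lra); clear chk.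
  lra.
have p1 : 0 <= 69 / 10 ^+ 2 + 7 / 10 ^+ 4 + 34 / 10 ^+ 6 :> R by clear; lra.
have h2 : 22 / 10 ^+ 2 + 76 / 10 ^+ 4 + 37 / 10 ^+ 6 <= expR (- (2 * (74 / 10 ^+ 2))) :> R.
  have chk : exp_check 1 48 0 1 22 76 37 by vm_compute.
  have /andP[l0 _] := @expN_enclosure R 1 48 0 1 22 76 37 (2 * (74 / 10 ^+ 2)) chk ltac:(clear; lra); clear chk.
  lra.
have p2 : 0 <= 22 / 10 ^+ 2 + 76 / 10 ^+ 4 + 37 / 10 ^+ 6 :> R by clear; lra.
move=> /andP[v1 v2]; have /andP[h _] := vhex_bounds R.
have b0 : 0 <= t - (65 / 10 ^+ 2) by rewrite subr_ge0.
have b1 : 0 <= (85 / 10 ^+ 2) - t by rewrite subr_ge0.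
have c0 : 0 <= ((85 / 10 ^+ 2) - t) * ((85 / 10 ^+ 2) - t) * ((85 / 10 ^+ 2) - t) by rewrite !mulr_ge0.
have c1 : 0 <= (t - (65 / 10 ^+ 2)) * ((85 / 10 ^+ 2) - t) * ((85 / 10 ^+ 2) - t) by rewrite !mulr_ge0.
have c2 : 0 <= (t - (65 / 10 ^+ 2)) * (t - (65 / 10 ^+ 2)) * ((85 / 10 ^+ 2) - t) by rewrite !mulr_ge0.
have c3 : 0 <= (t - (65 / 10 ^+ 2)) * (t - (65 / 10 ^+ 2)) * (t - (65 / 10 ^+ 2)) by rewrite !mulr_ge0.
have q : 0 <= ((3 + 62 / 10 ^+ 2 + 74 / 10 ^+ 4) - t) * (t - 1 / 2) by apply: mulr_ge0; clear - v1 v2; lra.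
have q' : ((3 + 62 / 10 ^+ 2 + 74 / 10 ^+ 4) - t) * (t - 1 / 2) <= (vhex - t) * (t - 1 / 2) by apply: ler_wpM2r; clear - v1 h; lra.
have t0 : 0 <= t / 4 by clear - v1; lra.
have t1 : 0 <= 2 * t - 1 by clear - v1; lra.
have d0 : t - (74 / 10 ^+ 2) <= 1 by clear - v1 v2; lra.
have {h0 d0 p0} a0 := expN_ge_line p0 h0 d0.
have d1 : 1 / 2 * t - 1 / 2 * (74 / 10 ^+ 2) <= 1 by clear - v1 v2; lra.
have {h1 d1 p1} a1 := expN_ge_line p1 h1 d1.
have d2 : 2 * t - 2 * (74 / 10 ^+ 2) <= 1 by clear - v1 v2; lra.
have {h2 d2 p2} a2 := expN_ge_line p2 h2 d2.
have {}a0 := ler_wpM2l q a0; have {}a1 := ler_wpM2l t0 a1; have {}a2 := ler_wpM2l t1 a2.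
have a4 := ler_wpM2r (expR_ge0 (- t)) q'.
rewrite /kap0 /gdual2T; move: (expR (- t)) (expR (- (1 / 2 * t))) (expR (- (2 * t))) a0 a1 a2 a4 => x y z a0 a1 a2 a4.
clear q q' b0 b1 t0 t1 h v1 v2; move: (vhex) a4 => V a4; lra.
Qed.

Lemma gain_piece2 (t : R) : (85 / 10 ^+ 2) <= t <= (1 + 30 / 10 ^+ 2) -> 0 <= 2 * (kap0 t + 47 / 100 * gdual2T t) - 47 / 100.
Proof.
have h0 : 34 / 10 ^+ 2 + 99 / 10 ^+ 4 + 37 / 10 ^+ 6 <= expR (- ((1 + 5 / 10 ^+ 2))) :> R.
  have chk : exp_check 1 5 0 1 34 99 37 by vm_compute.
  have /andP[l0 _] := @expN_enclosure R 1 5 0 1 34 99 37 ((1 + 5 / 10 ^+ 2)) chk ltac:(clear; lra); clear chk.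
  lra.
have p0 : 0 <= 34 / 10 ^+ 2 + 99 / 10 ^+ 4 + 37 / 10 ^+ 6 :> R by clear; lra.
have h1 : 59 / 10 ^+ 2 + 15 / 10 ^+ 4 + 55 / 10 ^+ 6 <= expR (- (1 / 2 * (1 + 5 / 10 ^+ 2))) :> R.
  have chk : exp_check 0 52 50 1 59 15 55 by vm_compute.
  have /andP[l0 _] := @expN_enclosure R 0 52 50 1 59 15 55 (1 / 2 * (1 + 5 / 10 ^+ 2)) chk ltac:(clear; lra); clear chk.
  lra.
have p1 : 0 <= 59 / 10 ^+ 2 + 15 / 10 ^+ 4 + 55 / 10 ^+ 6 :> R by clear; lra.
have h2 : 12 / 10 ^+ 2 + 24 / 10 ^+ 4 + 56 / 10 ^+ 6 <= expR (- (2 * (1 + 5 / 10 ^+ 2))) :> R.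
  have chk : exp_check 2 10 0 1 12 24 56 by vm_compute.
  have /andP[l0 _] := @expN_enclosure R 2 10 0 1 12 24 56 (2 * (1 + 5 / 10 ^+ 2)) chk ltac:(clear; lra); clear chk.
  lra.
have p2 : 0 <= 12 / 10 ^+ 2 + 24 / 10 ^+ 4 + 56 / 10 ^+ 6 :> R by clear; lra.
move=> /andP[v1 v2]; have /andP[h _] := vhex_bounds R.
have b0 : 0 <= t - (85 / 10 ^+ 2) by rewrite subr_ge0.
have b1 : 0 <= (1 + 30 / 10 ^+ 2) - t by rewrite subr_ge0.
have c0 : 0 <= ((1 + 30 / 10 ^+ 2) - t) * ((1 + 30 / 10 ^+ 2) - t) * ((1 + 30 / 10 ^+ 2) - t) by rewrite !mulr_ge0.
have c1 : 0 <= (t - (85 / 10 ^+ 2)) * ((1 + 30 / 10 ^+ 2) - t) * ((1 + 30 / 10 ^+ 2) - t) by rewrite !mulr_ge0.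
have c2 : 0 <= (t - (85 / 10 ^+ 2)) * (t - (85 / 10 ^+ 2)) * ((1 + 30 / 10 ^+ 2) - t) by rewrite !mulr_ge0.
have c3 : 0 <= (t - (85 / 10 ^+ 2)) * (t - (85 / 10 ^+ 2)) * (t - (85 / 10 ^+ 2)) by rewrite !mulr_ge0.
have q : 0 <= ((3 + 62 / 10 ^+ 2 + 74 / 10 ^+ 4) - t) * (t - 1 / 2) by apply: mulr_ge0; clear - v1 v2; lra.
have q' : ((3 + 62 / 10 ^+ 2 + 74 / 10 ^+ 4) - t) * (t - 1 / 2) <= (vhex - t) * (t - 1 / 2) by apply: ler_wpM2r; clear - v1 h; lra.
have t0 : 0 <= t / 4 by clear - v1; lra.
have t1 : 0 <= 2 * t - 1 by clear - v1; lra.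
have d0 : t - (1 + 5 / 10 ^+ 2) <= 1 by clear - v1 v2; lra.
have {h0 d0 p0} a0 := expN_ge_line p0 h0 d0.
have d1 : 1 / 2 * t - 1 / 2 * (1 + 5 / 10 ^+ 2) <= 1 by clear - v1 v2; lra.
have {h1 d1 p1} a1 := expN_ge_line p1 h1 d1.
have d2 : 2 * t - 2 * (1 + 5 / 10 ^+ 2) <= 1 by clear - v1 v2; lra.
have {h2 d2 p2} a2 := expN_ge_line p2 h2 d2.
have {}a0 := ler_wpM2l q a0; have {}a1 := ler_wpM2l t0 a1; have {}a2 := ler_wpM2l t1 a2.
have a4 := ler_wpM2r (expR_ge0 (- t)) q'.
rewrite /kap0 /gdual2T; move: (expR (- t)) (expR (- (1 / 2 * t))) (expR (- (2 * t))) a0 a1 a2 a4 => x y z a0 a1 a2 a4.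
clear q q' b0 b1 t0 t1 h v1 v2; move: (vhex) a4 => V a4; lra.
Qed.

Lemma gain_piece3 (t : R) : (1 + 30 / 10 ^+ 2) <= t <= (1 + 80 / 10 ^+ 2) -> 0 <= 2 * (kap0 t + 47 / 100 * gdual2T t) - 47 / 100.
Proof.
have h0 : 21 / 10 ^+ 2 + 22 / 10 ^+ 4 + 47 / 10 ^+ 6 <= expR (- ((1 + 55 / 10 ^+ 2))) :> R.
  have chk : exp_check 1 55 0 1 21 22 47 by vm_compute.
  have /andP[l0 _] := @expN_enclosure R 1 55 0 1 21 22 47 ((1 + 55 / 10 ^+ 2)) chk ltac:(clear; lra); clear chk.
  lra.
have p0 : 0 <= 21 / 10 ^+ 2 + 22 / 10 ^+ 4 + 47 / 10 ^+ 6 :> R by clear; lra.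
have h1 : 46 / 10 ^+ 2 + 7 / 10 ^+ 4 + 3 / 10 ^+ 6 <= expR (- (1 / 2 * (1 + 55 / 10 ^+ 2))) :> R.
  have chk : exp_check 0 77 50 1 46 7 3 by vm_compute.
  have /andP[l0 _] := @expN_enclosure R 0 77 50 1 46 7 3 (1 / 2 * (1 + 55 / 10 ^+ 2)) chk ltac:(clear; lra); clear chk.
  lra.
have p1 : 0 <= 46 / 10 ^+ 2 + 7 / 10 ^+ 4 + 3 / 10 ^+ 6 :> R by clear; lra.
have h2 : 4 / 10 ^+ 2 + 50 / 10 ^+ 4 + 49 / 10 ^+ 6 <= expR (- (2 * (1 + 55 / 10 ^+ 2))) :> R.
  have chk : exp_check 3 10 0 1 4 50 49 by vm_compute.
  have /andP[l0 _] := @expN_enclosure R 3 10 0 1 4 50 49 (2 * (1 + 55 / 10 ^+ 2)) chk ltac:(clear; lra); clear chk.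
  lra.
have p2 : 0 <= 4 / 10 ^+ 2 + 50 / 10 ^+ 4 + 49 / 10 ^+ 6 :> R by clear; lra.
move=> /andP[v1 v2]; have /andP[h _] := vhex_bounds R.
have b0 : 0 <= t - (1 + 30 / 10 ^+ 2) by rewrite subr_ge0.
have b1 : 0 <= (1 + 80 / 10 ^+ 2) - t by rewrite subr_ge0.
have c0 : 0 <= ((1 + 80 / 10 ^+ 2) - t) * ((1 + 80 / 10 ^+ 2) - t) * ((1 + 80 / 10 ^+ 2) - t) by rewrite !mulr_ge0.
have c1 : 0 <= (t - (1 + 30 / 10 ^+ 2)) * ((1 + 80 / 10 ^+ 2) - t) * ((1 + 80 / 10 ^+ 2) - t) by rewrite !mulr_ge0.
have c2 : 0 <= (t - (1 + 30 / 10 ^+ 2)) * (t - (1 + 30 / 10 ^+ 2)) * ((1 + 80 / 10 ^+ 2) - t) by rewrite !mulr_ge0.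
have c3 : 0 <= (t - (1 + 30 / 10 ^+ 2)) * (t - (1 + 30 / 10 ^+ 2)) * (t - (1 + 30 / 10 ^+ 2)) by rewrite !mulr_ge0.
have q : 0 <= ((3 + 62 / 10 ^+ 2 + 74 / 10 ^+ 4) - t) * (t - 1 / 2) by apply: mulr_ge0; clear - v1 v2; lra.
have q' : ((3 + 62 / 10 ^+ 2 + 74 / 10 ^+ 4) - t) * (t - 1 / 2) <= (vhex - t) * (t - 1 / 2) by apply: ler_wpM2r; clear - v1 h; lra.
have t0 : 0 <= t / 4 by clear - v1; lra.
have t1 : 0 <= 2 * t - 1 by clear - v1; lra.
have d0 : t - (1 + 55 / 10 ^+ 2) <= 1 by clear - v1 v2; lra.
have {h0 d0 p0} a0 := expN_ge_line p0 h0 d0.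
have d1 : 1 / 2 * t - 1 / 2 * (1 + 55 / 10 ^+ 2) <= 1 by clear - v1 v2; lra.
have {h1 d1 p1} a1 := expN_ge_line p1 h1 d1.
have d2 : 2 * t - 2 * (1 + 55 / 10 ^+ 2) <= 1 by clear - v1 v2; lra.
have {h2 d2 p2} a2 := expN_ge_line p2 h2 d2.
have {}a0 := ler_wpM2l q a0; have {}a1 := ler_wpM2l t0 a1; have {}a2 := ler_wpM2l t1 a2.
have a4 := ler_wpM2r (expR_ge0 (- t)) q'.
rewrite /kap0 /gdual2T; move: (expR (- t)) (expR (- (1 / 2 * t))) (expR (- (2 * t))) a0 a1 a2 a4 => x y z a0 a1 a2 a4.
clear q q' b0 b1 t0 t1 h v1 v2; move: (vhex) a4 => V a4; lra.
Qed.

Lemma gain_piece4 (t : R) : (1 + 80 / 10 ^+ 2) <= t <= (2 + 20 / 10 ^+ 2) -> 0 <= 2 * (kap0 t + 47 / 100 * gdual2T t) - 47 / 100.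
Proof.
have h0 : 13 / 10 ^+ 2 + 53 / 10 ^+ 4 + 35 / 10 ^+ 6 <= expR (- ((2))) :> R.
  have chk : exp_check 2 0 0 1 13 53 35 by vm_compute.
  have /andP[l0 _] := @expN_enclosure R 2 0 0 1 13 53 35 ((2)) chk ltac:(clear; lra); clear chk.
  lra.
have p0 : 0 <= 13 / 10 ^+ 2 + 53 / 10 ^+ 4 + 35 / 10 ^+ 6 :> R by clear; lra.
have h1 : 36 / 10 ^+ 2 + 78 / 10 ^+ 4 + 79 / 10 ^+ 6 <= expR (- (1 / 2 * (2))) :> R.
  have chk : exp_check 1 0 0 1 36 78 79 by vm_compute.
  have /andP[l0 _] := @expN_enclosure R 1 0 0 1 36 78 79 (1 / 2 * (2)) chk ltac:(clear; lra); clear chk.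
  lra.
have p1 : 0 <= 36 / 10 ^+ 2 + 78 / 10 ^+ 4 + 79 / 10 ^+ 6 :> R by clear; lra.
have h2 : 1 / 10 ^+ 2 + 83 / 10 ^+ 4 + 15 / 10 ^+ 6 <= expR (- (2 * (2))) :> R.
  have chk : exp_check 4 0 0 1 1 83 15 by vm_compute.
  have /andP[l0 _] := @expN_enclosure R 4 0 0 1 1 83 15 (2 * (2)) chk ltac:(clear; lra); clear chk.
  lra.
have p2 : 0 <= 1 / 10 ^+ 2 + 83 / 10 ^+ 4 + 15 / 10 ^+ 6 :> R by clear; lra.
move=> /andP[v1 v2]; have /andP[h _] := vhex_bounds R.
have b0 : 0 <= t - (1 + 80 / 10 ^+ 2) by rewrite subr_ge0.
have b1 : 0 <= (2 + 20 / 10 ^+ 2) - t by rewrite subr_ge0.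
have c0 : 0 <= ((2 + 20 / 10 ^+ 2) - t) * ((2 + 20 / 10 ^+ 2) - t) * ((2 + 20 / 10 ^+ 2) - t) by rewrite !mulr_ge0.
have c1 : 0 <= (t - (1 + 80 / 10 ^+ 2)) * ((2 + 20 / 10 ^+ 2) - t) * ((2 + 20 / 10 ^+ 2) - t) by rewrite !mulr_ge0.
have c2 : 0 <= (t - (1 + 80 / 10 ^+ 2)) * (t - (1 + 80 / 10 ^+ 2)) * ((2 + 20 / 10 ^+ 2) - t) by rewrite !mulr_ge0.
have c3 : 0 <= (t - (1 + 80 / 10 ^+ 2)) * (t - (1 + 80 / 10 ^+ 2)) * (t - (1 + 80 / 10 ^+ 2)) by rewrite !mulr_ge0.
have q : 0 <= ((3 + 62 / 10 ^+ 2 + 74 / 10 ^+ 4) - t) * (t - 1 / 2) by apply: mulr_ge0; clear - v1 v2; lra.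
have q' : ((3 + 62 / 10 ^+ 2 + 74 / 10 ^+ 4) - t) * (t - 1 / 2) <= (vhex - t) * (t - 1 / 2) by apply: ler_wpM2r; clear - v1 h; lra.
have t0 : 0 <= t / 4 by clear - v1; lra.
have t1 : 0 <= 2 * t - 1 by clear - v1; lra.
have d0 : t - (2) <= 1 by clear - v1 v2; lra.
have {h0 d0 p0} a0 := expN_ge_line p0 h0 d0.
have d1 : 1 / 2 * t - 1 / 2 * (2) <= 1 by clear - v1 v2; lra.
have {h1 d1 p1} a1 := expN_ge_line p1 h1 d1.
have d2 : 2 * t - 2 * (2) <= 1 by clear - v1 v2; lra.
have {h2 d2 p2} a2 := expN_ge_line p2 h2 d2.
have {}a0 := ler_wpM2l q a0; have {}a1 := ler_wpM2l t0 a1; have {}a2 := ler_wpM2l t1 a2.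
have a4 := ler_wpM2r (expR_ge0 (- t)) q'.
rewrite /kap0 /gdual2T; move: (expR (- t)) (expR (- (1 / 2 * t))) (expR (- (2 * t))) a0 a1 a2 a4 => x y z a0 a1 a2 a4.
clear q q' b0 b1 t0 t1 h v1 v2; move: (vhex) a4 => V a4; lra.
Qed.

Lemma gain_piece5 (t : R) : (2 + 20 / 10 ^+ 2) <= t <= (2 + 40 / 10 ^+ 2) -> 0 <= 2 * (kap0 t + 47 / 100 * gdual2T t) - 47 / 100.
Proof.
have h0 : 10 / 10 ^+ 2 + 2 / 10 ^+ 4 + 58 / 10 ^+ 6 <= expR (- ((2 + 30 / 10 ^+ 2))) :> R.
  have chk : exp_check 2 30 0 1 10 2 58 by vm_compute.
  have /andP[l0 _] := @expN_enclosure R 2 30 0 1 10 2 58 ((2 + 30 / 10 ^+ 2)) chk ltac:(clear; lra); clear chk.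
  lra.
have p0 : 0 <= 10 / 10 ^+ 2 + 2 / 10 ^+ 4 + 58 / 10 ^+ 6 :> R by clear; lra.
have h1 : 31 / 10 ^+ 2 + 66 / 10 ^+ 4 + 36 / 10 ^+ 6 <= expR (- (1 / 2 * (2 + 30 / 10 ^+ 2))) :> R.
  have chk : exp_check 1 15 0 1 31 66 36 by vm_compute.
  have /andP[l0 _] := @expN_enclosure R 1 15 0 1 31 66 36 (1 / 2 * (2 + 30 / 10 ^+ 2)) chk ltac:(clear; lra); clear chk.
  lra.
have p1 : 0 <= 31 / 10 ^+ 2 + 66 / 10 ^+ 4 + 36 / 10 ^+ 6 :> R by clear; lra.
have h2 : 1 / 10 ^+ 2 + 51 / 10 ^+ 6 <= expR (- (2 * (2 + 30 / 10 ^+ 2))) :> R.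
  have chk : exp_check 4 60 0 1 1 0 51 by vm_compute.
  have /andP[l0 _] := @expN_enclosure R 4 60 0 1 1 0 51 (2 * (2 + 30 / 10 ^+ 2)) chk ltac:(clear; lra); clear chk.
  lra.
have p2 : 0 <= 1 / 10 ^+ 2 + 51 / 10 ^+ 6 :> R by clear; lra.
move=> /andP[v1 v2]; have /andP[h _] := vhex_bounds R.
have b0 : 0 <= t - (2 + 20 / 10 ^+ 2) by rewrite subr_ge0.
have b1 : 0 <= (2 + 40 / 10 ^+ 2) - t by rewrite subr_ge0.
have c0 : 0 <= ((2 + 40 / 10 ^+ 2) - t) * ((2 + 40 / 10 ^+ 2) - t) * ((2 + 40 / 10 ^+ 2) - t) by rewrite !mulr_ge0.
have c1 : 0 <= (t - (2 + 20 / 10 ^+ 2)) * ((2 + 40 / 10 ^+ 2) - t) * ((2 + 40 / 10 ^+ 2) - t) by rewrite !mulr_ge0.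
have c2 : 0 <= (t - (2 + 20 / 10 ^+ 2)) * (t - (2 + 20 / 10 ^+ 2)) * ((2 + 40 / 10 ^+ 2) - t) by rewrite !mulr_ge0.
have c3 : 0 <= (t - (2 + 20 / 10 ^+ 2)) * (t - (2 + 20 / 10 ^+ 2)) * (t - (2 + 20 / 10 ^+ 2)) by rewrite !mulr_ge0.
have q : 0 <= ((3 + 62 / 10 ^+ 2 + 74 / 10 ^+ 4) - t) * (t - 1 / 2) by apply: mulr_ge0; clear - v1 v2; lra.
have q' : ((3 + 62 / 10 ^+ 2 + 74 / 10 ^+ 4) - t) * (t - 1 / 2) <= (vhex - t) * (t - 1 / 2) by apply: ler_wpM2r; clear - v1 h; lra.
have t0 : 0 <= t / 4 by clear - v1; lra.
have t1 : 0 <= 2 * t - 1 by clear - v1; lra.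
have d0 : t - (2 + 30 / 10 ^+ 2) <= 1 by clear - v1 v2; lra.
have {h0 d0 p0} a0 := expN_ge_line p0 h0 d0.
have d1 : 1 / 2 * t - 1 / 2 * (2 + 30 / 10 ^+ 2) <= 1 by clear - v1 v2; lra.
have {h1 d1 p1} a1 := expN_ge_line p1 h1 d1.
have d2 : 2 * t - 2 * (2 + 30 / 10 ^+ 2) <= 1 by clear - v1 v2; lra.
have {h2 d2 p2} a2 := expN_ge_line p2 h2 d2.
have {}a0 := ler_wpM2l q a0; have {}a1 := ler_wpM2l t0 a1; have {}a2 := ler_wpM2l t1 a2.
have a4 := ler_wpM2r (expR_ge0 (- t)) q'.
rewrite /kap0 /gdual2T; move: (expR (- t)) (expR (- (1 / 2 * t))) (expR (- (2 * t))) a0 a1 a2 a4 => x y z a0 a1 a2 a4.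
clear q q' b0 b1 t0 t1 h v1 v2; move: (vhex) a4 => V a4; lra.
Qed.

Lemma gain_piece6 (t : R) : (2 + 40 / 10 ^+ 2) <= t <= (2 + 60 / 10 ^+ 2) -> 0 <= 2 * (kap0 t + 47 / 100 * gdual2T t) - 47 / 100.
Proof.
have h0 : 8 / 10 ^+ 2 + 20 / 10 ^+ 4 + 84 / 10 ^+ 6 <= expR (- ((2 + 50 / 10 ^+ 2))) :> R.
  have chk : exp_check 2 50 0 1 8 20 84 by vm_compute.
  have /andP[l0 _] := @expN_enclosure R 2 50 0 1 8 20 84 ((2 + 50 / 10 ^+ 2)) chk ltac:(clear; lra); clear chk.
  lra.
have p0 : 0 <= 8 / 10 ^+ 2 + 20 / 10 ^+ 4 + 84 / 10 ^+ 6 :> R by clear; lra.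
have h1 : 28 / 10 ^+ 2 + 65 / 10 ^+ 4 + 4 / 10 ^+ 6 <= expR (- (1 / 2 * (2 + 50 / 10 ^+ 2))) :> R.
  have chk : exp_check 1 25 0 1 28 65 4 by vm_compute.
  have /andP[l0 _] := @expN_enclosure R 1 25 0 1 28 65 4 (1 / 2 * (2 + 50 / 10 ^+ 2)) chk ltac:(clear; lra); clear chk.
  lra.
have p1 : 0 <= 28 / 10 ^+ 2 + 65 / 10 ^+ 4 + 4 / 10 ^+ 6 :> R by clear; lra.
have h2 : 67 / 10 ^+ 4 + 37 / 10 ^+ 6 <= expR (- (2 * (2 + 50 / 10 ^+ 2))) :> R.
  have chk : exp_check 5 0 0 1 0 67 37 by vm_compute.
  have /andP[l0 _] := @expN_enclosure R 5 0 0 1 0 67 37 (2 * (2 + 50 / 10 ^+ 2)) chk ltac:(clear; lra); clear chk.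
  lra.
have p2 : 0 <= 67 / 10 ^+ 4 + 37 / 10 ^+ 6 :> R by clear; lra.
move=> /andP[v1 v2]; have /andP[h _] := vhex_bounds R.
have b0 : 0 <= t - (2 + 40 / 10 ^+ 2) by rewrite subr_ge0.
have b1 : 0 <= (2 + 60 / 10 ^+ 2) - t by rewrite subr_ge0.
have c0 : 0 <= ((2 + 60 / 10 ^+ 2) - t) * ((2 + 60 / 10 ^+ 2) - t) * ((2 + 60 / 10 ^+ 2) - t) by rewrite !mulr_ge0.
have c1 : 0 <= (t - (2 + 40 / 10 ^+ 2)) * ((2 + 60 / 10 ^+ 2) - t) * ((2 + 60 / 10 ^+ 2) - t) by rewrite !mulr_ge0.
have c2 : 0 <= (t - (2 + 40 / 10 ^+ 2)) * (t - (2 + 40 / 10 ^+ 2)) * ((2 + 60 / 10 ^+ 2) - t) by rewrite !mulr_ge0.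
have c3 : 0 <= (t - (2 + 40 / 10 ^+ 2)) * (t - (2 + 40 / 10 ^+ 2)) * (t - (2 + 40 / 10 ^+ 2)) by rewrite !mulr_ge0.
have q : 0 <= ((3 + 62 / 10 ^+ 2 + 74 / 10 ^+ 4) - t) * (t - 1 / 2) by apply: mulr_ge0; clear - v1 v2; lra.
have q' : ((3 + 62 / 10 ^+ 2 + 74 / 10 ^+ 4) - t) * (t - 1 / 2) <= (vhex - t) * (t - 1 / 2) by apply: ler_wpM2r; clear - v1 h; lra.
have t0 : 0 <= t / 4 by clear - v1; lra.
have t1 : 0 <= 2 * t - 1 by clear - v1; lra.
have d0 : t - (2 + 50 / 10 ^+ 2) <= 1 by clear - v1 v2; lra.
have {h0 d0 p0} a0 := expN_ge_line p0 h0 d0.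
have d1 : 1 / 2 * t - 1 / 2 * (2 + 50 / 10 ^+ 2) <= 1 by clear - v1 v2; lra.
have {h1 d1 p1} a1 := expN_ge_line p1 h1 d1.
have d2 : 2 * t - 2 * (2 + 50 / 10 ^+ 2) <= 1 by clear - v1 v2; lra.
have {h2 d2 p2} a2 := expN_ge_line p2 h2 d2.
have {}a0 := ler_wpM2l q a0; have {}a1 := ler_wpM2l t0 a1; have {}a2 := ler_wpM2l t1 a2.
have a4 := ler_wpM2r (expR_ge0 (- t)) q'.
rewrite /kap0 /gdual2T; move: (expR (- t)) (expR (- (1 / 2 * t))) (expR (- (2 * t))) a0 a1 a2 a4 => x y z a0 a1 a2 a4.
clear q q' b0 b1 t0 t1 h v1 v2; move: (vhex) a4 => V a4; lra.
Qed.

Lemma gain_ge0 t : 65 / 10 ^+ 2 <= t <= 26 / 10 -> 0 <= 2 * (kap0 t + 47 / 100 * gdual2T t) - 47 / 100.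
Proof.
move=> /andP[t1 t2].
have [z1|z1] := leP t (85 / 10 ^+ 2); first by apply: gain_piece1; apply/andP; split; lra.
have [z2|z2] := leP t (1 + 30 / 10 ^+ 2); first by apply: gain_piece2; apply/andP; split; lra.
have [z3|z3] := leP t (1 + 80 / 10 ^+ 2); first by apply: gain_piece3; apply/andP; split; lra.
have [z4|z4] := leP t (2 + 20 / 10 ^+ 2); first by apply: gain_piece4; apply/andP; split; lra.
have [z5|z5] := leP t (2 + 40 / 10 ^+ 2); first by apply: gain_piece5; apply/andP; split; lra.
by apply: gain_piece6; apply/andP; split; lra.
Qed.

Lemma ratio_le s (u v : R) : 1 <= s -> 1 / 2 < u -> u <= v -> ratio s v <= ratio s u.
Proof.
move=> s1 u1 uv; apply: ler_pM; rewrite ?expR_ge0//.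
- by apply: le_trans (ratioA_ge s1 _); lra.
- rewrite /ratioA lerD2l; apply: ler_wpM2l; first by rewrite subr_ge0.
  by rewrite lef_pV2 ?posrE; lra.
- by rewrite ler_expR lerN2 ler_wpM2l// subr_ge0.
Qed.

Let v0_gt0 : 0 < vhex. Proof. by have /andP[h _] := vhex_bounds R; lra. Qed.

(** All values of q on the hexagonal lattice are at least [vhex], the ratio is
    decreasing, and the values of h_1 sum to 1/2. *)
Lemma hex_sum_le s : 1 <= s ->
  asum0 (fun p => hfun s (qform vhex (1 / 2) p)) <= ratio s vhex * (1 / 2).
Proof.
move=> s1; have /andP[h1 h2] := vhex_bounds R.
have s0 : 0 < s by lra.
have sa := absum_hfun (1 / 2) v0_gt0 s0; have sb := absum_hfun (1 / 2) v0_gt0 (@ltr01 R).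
have E := asum0_hfun1 (1 / 2) v0_gt0; rewrite -[X in _ <= _ * X]E -(asum0Z _ sb).
apply: ler_asum0 => //; first exact: absumZ.
move=> p p0; have N1 : 1 <= (eisN p)%:~R :> R by have := eisN_gt0 p0; rewrite -(ler_int R).
have w1 : vhex <= qform vhex (1 / 2) p by rewrite qform_hex ler_peMr// ltW.
rewrite hfun_at; last by lra.
apply: ler_wpM2r; first by rewrite hfun1 mulr_ge0 ?expR_ge0//; lra.
by apply: ratio_le => //; lra.
Qed.

(** It suffices that the sum of [kap0] is nonnegative: the tangent inequality then
    bounds the moment sum below by that of the tangent point, which dominates
    the hexagonal one. *)
Theorem region_two s t x : 1 < s -> 65 / 10 ^+ 2 <= t -> t <= 26 / 10 ->
  (forall p, p != 0 -> t <= qform t x p) ->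
  asum0 (fun p => hfun s (qform vhex (1 / 2) p)) < asum0 (fun p => hfun s (qform t x p)).
Proof.
move=> s1 t1 t2 hmin; have /andP[h1 h2] := vhex_bounds R.
have t0 : 0 < t by lra.
have s0 : 0 < s by lra.
apply: le_lt_trans (hex_sum_le (ltW s1)) _.
have gq := gsummable_qform x t0.
have sa := absum_hfun x t0 s0; have sb := absum_hfun x t0 (@ltr01 R).
have sB := absum_gdual2T x t0.
have sK : absum (fun p => kap0 (qform t x p)).
  have e2 := absum_q2exp gq ltr01; have e1 := absum_qexp gq ltr01; have e0 := gq.2 1 ltr01.
  have := absumD (absumB (absumZ (vhex + 1 / 2) e1) (absumZ (vhex / 2) e0)) (absumZ (-1) e2).
  by congr absum; apply/funext => p; rewrite /kap0 !mul1r; field.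
have vh : 1 / 2 < vhex by lra.
have K0 : 0 <= asum0 (fun p => kap0 (qform t x p)).
  have sKB := absumD sK (absumZ (47 / 100) sB).
  have E : asum0 (fun p => kap0 (qform t x p) + 47 / 100 * gdual2T (qform t x p)) =
     asum0 (fun p => kap0 (qform t x p)) + 47 / 100.
    by rewrite asum0D//; [rewrite asum0Z// asum0_gdual2T// mulr1 | exact: absumZ].
  have L : 2 * (kap0 t + 47 / 100 * gdual2T t) <= asum0 (fun p => kap0 (qform t x p) + 47 / 100 * gdual2T (qform t x p)).
    apply: (@le_trans _ _ (\sum_(p <- [:: (0, 1); (0, -1)]) (if p == 0 then 0 else kap0 (qform t x p) + 47 / 100 * gdual2T (qform t x p)))).
      rewrite !big_cons big_nil /= (_ : qform t x (0, 1) = t); last by rewrite /qform /=; ring.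
      by rewrite (_ : qform t x (0, -1) = t); [lra | rewrite /qform /=; ring].
    apply: asum_ge_sum => //; first exact: absum_if0.
    move=> p _; case: ifPn => // p0; apply: kap0_ge; have := hmin p p0; clear - v0_gt0 t1; lra.
  have := @gain_ge0 t ltac:(by rewrite t1 t2); lra.
have sT : absum (fun p => ratio s vhex * hfun 1 (qform t x p) + slope s vhex * kap0 (qform t x p)).
  by apply: absumD; exact: absumZ.
apply: (@le_lt_trans _ _ (asum0 (fun p => ratio s vhex * hfun 1 (qform t x p) + slope s vhex * kap0 (qform t x p)))).
  rewrite asum0D; [|exact: absumZ|exact: absumZ].
  rewrite !asum0Z// asum0_hfun1// lerDl mulr_ge0//; apply: slope_ge0 => //; exact: ltW.
have T v : ratio s vhex * hfun 1 v + slope s vhex * kap0 v = (ratio s vhex - slope s vhex * (v - vhex)) * hfun 1 v.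
  by rewrite /kap0 hfun1; ring.
apply: (@ltr_asum0 _ _ _ (0, 1)) => //.
  move=> p p0; rewrite T; apply: ratio_tangent => //; [exact: ltW|have := hmin p p0; lra].
rewrite T (_ : qform t x (0, 1) = t); last by rewrite /qform /=; ring.
by apply: ratio_tangent_lt => //; [lra | rewrite lt_eqF//; lra].
Qed.

End RegionTwo.

(** * Elongated forms *)

Section RegionThree.
Variable R : realType.
Implicit Types (t x s v u w : R) (p : int * int) (k n : int).
Local Notation vhex := (vhex R).

(** How much the sum of h over the nonzero multiples of the shortest vector falls
    short of 1/2; it is tiny for small w. *)
Definition rowdef w : R :=
  Num.sqrt (pi / w) * asum (fun k : int => pi ^+ 2 / w * k%:~R ^+ 2 * expR (- (pi ^+ 2 / w * k%:~R ^+ 2))).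

Lemma pi_sq_gt0 : 0 < pi ^+ 2 :> R. Proof. by rewrite exprn_gt0// pi_gt0. Qed.

Lemma absum_dual_row d : 0 < d ->
  absum (fun k : int => d * k%:~R ^+ 2 * expR (- (d * k%:~R ^+ 2)) : R).
Proof.
move=> d0; have := absumZ d (absum_qexp (gsummable_sqr R) d0).
by congr absum; apply/funext => k; rewrite mulrA.
Qed.

Lemma sqr_int_ge1 n : n != 0 -> 1 <= n%:~R ^+ 2 :> R.
Proof.
move=> n0; rewrite -rmorphXn /= (ler_int R 1).
by rewrite expr2; case: (ltrgtP n 0) n0 => // h _; nia.
Qed.

Lemma rowdef_ge0 w : 0 < w -> 0 <= rowdef w.
Proof.
move=> w0; apply: mulr_ge0; first exact: sqrtr_ge0.
apply: asum_ge0 => k; apply: mulr_ge0; last exact: expR_ge0.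
apply: mulr_ge0 (sqr_ge0 _); exact: ltW (divr_gt0 pi_sq_gt0 w0).
Qed.

Lemma asum_row t u : 0 < t -> 0 < u ->
  absum (fun n : int => if n == 0 then 0 else hfun u (t * n%:~R ^+ 2)) /\
  asum (fun n : int => if n == 0 then 0 else hfun u (t * n%:~R ^+ 2)) = 1 / 2 - rowdef (u * t).
Proof.
move=> t0 u0; have w0 : 0 < u * t by rewrite mulr_gt0.
have sF : absum (fun n : int => (u * t * n%:~R ^+ 2 - 2^-1) * expR (- (u * t * n%:~R ^+ 2)) : R).
  have := absumB (absum_dual_row w0) (absumZ 2^-1 ((gsummable_sqr R).2 _ w0)).
  by congr absum; apply/funext => n; rewrite mulrBl.
have E := asum_row0 w0.
have e1 := @asum_split R _ [:: 0] _ isT sF.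
have FE : (fun n : int => if n == 0 then 0 else hfun u (t * n%:~R ^+ 2)) =
  (fun n : int => if n \in [:: 0] then 0 else (u * t * n%:~R ^+ 2 - 2^-1) * expR (- (u * t * n%:~R ^+ 2))).
  apply/funext => n; rewrite inE; case: ifP => // _; rewrite /hfun !mulrA; congr ((_ - _) * _); lra.
rewrite FE; split.
  by apply: absum_le (absum_norm sF) => n; case: ifP => // _; rewrite normr0.
move: e1; rewrite E big_seq1 expr0n !mulr0 oppr0 expR0 /rowdef; lra.
Qed.

Lemma asum0_ge_row0 (F : int * int -> R) : absum F -> (forall p, p.1 != 0 -> 0 <= F p) ->
  asum (fun n : int => if n == 0 then 0 else F (0, n)) <= asum0 F.
Proof.
move=> sF F0; have s1 := absum_if0 sF; rewrite /asum0.
have [s2 s3 ->] := asum_fubini s1.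
pose r m := asum (fun n : int => if ((m, n) : int * int) == 0 then 0 else F (m, n)).
apply: (@le_trans _ _ (\sum_(m <- [:: 0]) r m)).
  by rewrite big_seq1 /r; apply: ler_asum; [|exact: s2|]; have := s2 0.
apply: asum_ge_sum => // m; rewrite inE => m0; apply: asum_ge0 => n.
by case: ifP => // _; exact: F0.
Qed.

(** Evaluated on the direct side of the transformation, where already three pairs
    of terms suffice. *)
Lemma rowdef_ref : rowdef (13 / 10) <= 122 / 10 ^+ 4.
Proof.
have w0 : 0 < 13 / 10 :> R by lra.
have [sF E] := asum_row w0 (@ltr01 R); rewrite (mul1r (13 / 10)) in E.
have chk : exp_check 1 30 0 1 27 25 31 by vm_compute.
have /andP[l1 _] := @expN_enclosure R 1 30 0 1 27 25 31 (13 / 10) chk ltac:(clear; lra); clear chk.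
have chk : exp_check 5 20 0 1 0 55 16 by vm_compute.
have /andP[l2 _] := @expN_enclosure R 5 20 0 1 0 55 16 (52 / 10) chk ltac:(clear; lra); clear chk.
have L : 2 * (8 / 10 * expR (- (13 / 10))) + 2 * (47 / 10 * expR (- (52 / 10))) <= 1 / 2 - rowdef (13 / 10).
  rewrite -E; apply: (@le_trans _ _ (\sum_(n <- [:: 1; -1; 2; -2]) (if n == 0 then 0 else hfun 1 (13 / 10 * n%:~R ^+ 2)))).
    rewrite !big_cons big_nil /= !hfun1.
    have -> : 13 / 10 * 1%:~R ^+ 2 = 13 / 10 :> R by rewrite expr1n mulr1.
    have -> : 13 / 10 * (-1)%:~R ^+ 2 = 13 / 10 :> R by rewrite rmorphN sqrrN expr1n mulr1.
    have -> : 13 / 10 * 2%:~R ^+ 2 = 52 / 10 :> R by rewrite (_ : 2%:~R = 2)//; lra.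
    have -> : 13 / 10 * (-2)%:~R ^+ 2 = 52 / 10 :> R by rewrite (_ : (-2)%:~R = - 2)//; lra.
    lra.
  apply: asum_ge_sum => // n _; case: ifPn => // n0; rewrite hfun1 mulr_ge0 ?expR_ge0//.
  have : 1 <= n%:~R ^+ 2 :> R by exact: sqr_int_ge1.
  lra.
lra.
Qed.

(** Each term of the dual series is increasing in w, up to the reference point. *)
Lemma rowdef_le w : 0 < w <= 13 / 10 -> rowdef w <= 122 / 10 ^+ 4.
Proof.
move=> /andP[w0 w1]; apply: le_trans rowdef_ref; rewrite /rowdef.
set w1' := 13 / 10 : R; have w10 : 0 < w1' by rewrite /w1'; lra.
set q := pi ^+ 2 / w1'; have q0 : 2 <= q.
  have /andP[p1 _] := pi_bounds R; have : 3 * 3 <= pi ^+ 2 :> R by rewrite expr2; apply: ler_pM; lra.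
  by move=> h; rewrite /q ler_pdivlMr// /w1'; lra.
pose r := w1' / w; have r1 : 1 <= r by rewrite /r ler_pdivlMr// mul1r.
have rE : pi ^+ 2 / w = q * r by rewrite /q /r; field; rewrite !gt_eqF.
have sE : Num.sqrt (pi / w) <= Num.sqrt (pi / w1') * r.
  have -> : pi / w = pi / w1' * r by rewrite /r; field; rewrite !gt_eqF.
  rewrite sqrtrM; last by apply: divr_ge0; [exact: pi_ge0 | exact: ltW].
  apply: ler_wpM2l; first exact: sqrtr_ge0.
  have r0 : 0 <= r by lra.
  by rewrite -[leRHS](ger0_norm r0) -sqrtr_sqr ler_wsqrtr// expr2 ler_peMr.
have wb0 : 0 < pi ^+ 2 / w by rewrite divr_gt0// pi_sq_gt0.
have qb0 : 0 < q by lra.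
have Z0 : 0 <= asum (fun k : int => pi ^+ 2 / w * k%:~R ^+ 2 * expR (- (pi ^+ 2 / w * k%:~R ^+ 2))).
  apply: asum_ge0 => k; apply: mulr_ge0; last exact: expR_ge0.
  exact: mulr_ge0 (ltW wb0) (sqr_ge0 _).
apply: le_trans (ler_wpM2r Z0 sE) _; rewrite -mulrA; apply: ler_wpM2l; first exact: sqrtr_ge0.
rewrite -asumZ; last exact: absum_dual_row.
apply: ler_asum; [exact: absumZ (absum_dual_row wb0)|exact: absum_dual_row|move=> k].
rewrite rE; set K := k%:~R ^+ 2; have [->|k0] := eqVneq K 0; first by rewrite !mulr0 !mul0r mulr0.
have K1 : 1 <= K.
  have k00 : k != 0 by apply: contraNneq k0 => kz; rewrite /K kz expr0n.
  exact: sqr_int_ge1.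
have -> : r * (q * r * K * expR (- (q * r * K))) = q * K * (r * r * expR (- (q * r * K))) by ring.
apply: ler_wpM2l; first by rewrite mulr_ge0//; lra.
have -> : - (q * r * K) = - (q * K) + - (q * K * (r - 1)) by ring.
rewrite expRD mulrCA -[leRHS]mulr1; apply: ler_wpM2l; first exact: expR_ge0.
have h1 : r <= expR (r - 1) by have := expR_ge1Dx (r - 1); lra.
have r0 : 0 <= r by lra.
have h2 := ler_pM r0 r0 h1 h1; rewrite -expRD in h2.
apply: (@le_trans _ _ (expR (r - 1 + (r - 1)) * expR (- (q * K * (r - 1))))).
  by apply: ler_wpM2r => //; exact: expR_ge0.
rewrite -expRD -[leRHS]expR0 ler_expR.
have qK : 2 * 1 <= q * K by apply: ler_pM; lra.
have : 0 <= (q * K - 2) * (r - 1) by rewrite mulr_ge0//; lra.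
lra.
Qed.

(** In terms of 1 / s the dual series is convex, hence between s = 1 and s = 2 it
    lies below its chord; the factor 3 covers the change of the prefactor. *)
Lemma rowdef_convex t s : 0 < t -> 1 <= s <= 2 ->
  rowdef (s * t) <= (1 - 2 * (1 - s^-1)) * rowdef t + 2 * (1 - s^-1) * (3 * rowdef (2 * t)).
Proof.
move=> t0 /andP[s1 s2]; have s0 : 0 < s by lra.
have st0 : 0 < s * t by rewrite mulr_gt0.
pose i := s^-1; have i1 : i <= 1 by rewrite /i invf_le1.
have i2 : 1 / 2 <= i by rewrite /i -(ler_pM2l s0) mulfV ?gt_eqF//; lra.
rewrite -/i; set c := pi ^+ 2 / t; have c0 : 0 < c by rewrite divr_gt0// pi_sq_gt0.
have cs : pi ^+ 2 / (s * t) = c * i by rewrite /c /i; field; rewrite !gt_eqF.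
have c2 : pi ^+ 2 / (2 * t) = c / 2 by rewrite /c; field; rewrite !gt_eqF.
set S := Num.sqrt (pi / t); have S0 : 0 <= S := sqrtr_ge0 _.
have S1 : Num.sqrt (pi / (s * t)) <= S.
  apply: ler_wsqrtr; apply: ler_wpM2l; first exact: pi_ge0.
  by rewrite lef_pV2 ?posrE// ler_peMl// ltW.
have S2 : S <= 3 / 2 * Num.sqrt (pi / (2 * t)).
  have e : 3 / 2 = Num.sqrt ((3 / 2) ^+ 2) :> R by rewrite sqrtr_sqr ger0_norm//; lra.
  rewrite e -sqrtrM ?sqr_ge0//; apply: ler_wsqrtr.
  have -> : (3 / 2) ^+ 2 * (pi / (2 * t)) = 9 / 8 * (pi / t) by field; rewrite gt_eqF.
  have : 0 <= pi / t by rewrite divr_ge0 ?pi_ge0// ltW.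
  lra.
pose E (d : R) (k : int) := k%:~R ^+ 2 * expR (- (d * k%:~R ^+ 2)) : R.
have sE d : 0 < d -> absum (E d) by move=> d0; exact: absum_qexp (gsummable_sqr R) d0.
have rdE w : 0 < w -> rowdef w = Num.sqrt (pi / w) * (pi ^+ 2 / w) * asum (E (pi ^+ 2 / w)).
  move=> w0; have d0 : 0 < pi ^+ 2 / w by rewrite divr_gt0// pi_sq_gt0.
  rewrite /rowdef -mulrA -(asumZ _ (sE _ d0)); congr (_ * _).
  by apply: eq_asum => k; rewrite /E; ring.
have t20 : 0 < 2 * t by rewrite mulr_gt0.
have ci0 : 0 < c * i by rewrite mulr_gt0//; lra.
have c20 : 0 < c / 2 by lra.
rewrite !rdE// cs c2 -/c -/S.
have Z1 := asum_ge0 (fun k => _ : 0 <= E c k).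
have E0 d k : 0 <= E d k by rewrite mulr_ge0 ?sqr_ge0 ?expR_ge0.
have A0 d : 0 <= asum (E d) by apply: asum_ge0 => k; exact: E0.
have conv : asum (E (c * i)) <= (1 - 2 * (1 - i)) * asum (E c) + 2 * (1 - i) * asum (E (c / 2)).
  have sa := absumZ (1 - 2 * (1 - i)) (sE c c0); have sb := absumZ (2 * (1 - i)) (sE _ c20).
  rewrite -(asumZ _ (sE c c0)) -(asumZ _ (sE _ c20)) -asumD//.
  apply: ler_asum => [||k]; [exact: sE|exact: absumD|].
  rewrite /E; set K := k%:~R ^+ 2; have K0 : 0 <= K := sqr_ge0 _.
  have -> : (1 - 2 * (1 - i)) * (K * expR (- (c * K))) + 2 * (1 - i) * (K * expR (- (c / 2 * K))) =
    K * ((1 - 2 * (1 - i)) * expR (- (c * K)) + 2 * (1 - i) * expR (- (c / 2 * K))) by ring.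
  apply: ler_wpM2l => //.
  have T a : expR (- (c * i * K)) * (1 + (a + c * i * K)) <= expR a.
    have -> : expR a = expR (- (c * i * K)) * expR (a + c * i * K) by rewrite -expRD; congr expR; ring.
    by apply: ler_wpM2l; [exact: expR_ge0 | exact: expR_ge1Dx].
  have l1 : 0 <= 1 - 2 * (1 - i) by lra.
  have l2 : 0 <= 2 * (1 - i) by lra.
  have := ler_wpM2l l1 (T (- (c * K))); have := ler_wpM2l l2 (T (- (c / 2 * K))).
  lra.
apply: (@le_trans _ _ (S * c * asum (E (c * i)))).
  apply: ler_wpM2r => //; apply: ler_pM => //; first exact: ltW.
  by rewrite ler_piMr// ltW.
have Sc : 0 <= S * c by rewrite mulr_ge0// ltW.
apply: le_trans (ler_wpM2l Sc conv) _.
have h : S * c * asum (E (c / 2)) <= 3 * (Num.sqrt (pi / (2 * t)) * (c / 2) * asum (E (c / 2))).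
  have -> : 3 * (Num.sqrt (pi / (2 * t)) * (c / 2) * asum (E (c / 2))) = (3 / 2 * Num.sqrt (pi / (2 * t))) * c * asum (E (c / 2)) by field.
  by apply: ler_wpM2r => //; apply: ler_wpM2r => //; exact: ltW.
have l2 : 0 <= 2 * (1 - i) by lra.
have := ler_wpM2l l2 h; lra.
Qed.

(** The functional equation between 2 and 1/2 and its derivative: a positive
    combination with constant lattice sum that decays slowly enough to control
    the far rows. *)
Lemma asum0_hfun_pair t x : 0 < t ->
  2 * asum0 (fun p => hfun 2 (qform t x p)) + asum0 (fun p => hfun (1 / 2) (qform t x p)) = 3 / 2.
Proof.
move=> t0; have gq := gsummable_qform x t0.
have h2 : 0 < 2 :> R by lra.
have h12 : 0 < 1 / 2 :> R by lra.
have s2 := absum_hfun x t0 h2; have s12 := absum_hfun x t0 h12.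
have sB := absum_gdual2T x t0; have e2 := gq.2 _ h2; have e12 := gq.2 _ h12.
have D : asum0 (fun p => expR (- (1 / 2 * qform t x p)) - 2 * expR (- (2 * qform t x p))) = 1.
  rewrite asum0E; last by apply: absumB => //; exact: absumZ.
  rewrite asumB//; last exact: absumZ.
  have i2 : 2^-1 = 1 / 2 :> R by field.
  have T := theta_inv x t0 h2; rewrite /theta {1}i2 in T.
  by rewrite asumZ// T subrr qform0 !mulr0 oppr0 expR0; lra.
rewrite -(asum0Z _ s2) -asum0D//; last exact: absumZ.
have sD : absum (fun p => expR (- (1 / 2 * qform t x p)) - 2 * expR (- (2 * qform t x p))).
  by apply: absumB => //; exact: absumZ.
transitivity (asum0 (fun p => 2 * gdual2T (qform t x p) - 1 / 2 * (expR (- (1 / 2 * qform t x p)) - 2 * expR (- (2 * qform t x p))))).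
  by apply: eq_asum0 => p _; rewrite /hfun /gdual2T; field.
rewrite asum0B; [|exact: absumZ|exact: absumZ].
rewrite (asum0Z _ sB) (asum0Z _ sD) D asum0_gdual2T//; lra.
Qed.

(** Vectors off the line of the shortest one have q >= 15; there h_1 is
    negligible against the slowly decaying h_(1/2). *)
Lemma far_row_bound v : 15 <= v -> (v - vhex) * hfun 1 v <= 1 / 50 * hfun (1 / 2) v.
Proof.
move=> v15; have /andP[h1 h2] := vhex_bounds R.
have chk : exp_check 7 50 0 1 0 5 53 by vm_compute.
have /andP[_ u] := @expN_enclosure R 7 50 0 1 0 5 53 (15 / 2) chk ltac:(clear; lra); clear chk.
rewrite hfun1 /hfun; have e : expR (- v) = expR (- (1 / 2 * v)) * expR (- (1 / 2 * v)) by rewrite -expRD; congr expR; field.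
rewrite e; set Y := expR (- (1 / 2 * v)) in e *; have Y0 : 0 < Y := expR_gt0 _.
have f1 := expR_ge1Dx ((v - 15) / 2).
have f2 : Y * expR ((v - 15) / 2) = expR (- (15 / 2)) by rewrite -expRD; congr expR; field.
have f3 : Y * (1 + (v - 15) / 2) <= expR (- (15 / 2)) by rewrite -f2 ler_wpM2l// ltW.
have k : (v - 1 / 2) * Y <= 1 / 100.
  have d0 : 0 < 1 + (v - 15) / 2 by lra.
  rewrite -(ler_pM2r d0) -mulrA; have v0 : 0 <= v - 1 / 2 by lra.
  apply: le_trans (ler_wpM2l v0 f3) _.
  apply: (@le_trans _ _ ((v - 1 / 2) * (56 / 10 ^+ 5))); last by lra.
  by apply: ler_wpM2l => //; lra.
have k2 : (v - vhex) * ((v - 1 / 2) * Y) <= (v - 1) * (1 / 100).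
  by apply: ler_pM => //; [lra | rewrite mulr_ge0 ?ltW//; lra | lra].
have := ler_wpM2r (ltW Y0) k2; lra.
Qed.

(** A rational upper bound for the ratio at [vhex], from
    exp ((s - 1) v) >= 1 + (s - 1) v. *)
Lemma ratio_vhex_le s : 1 <= s -> ratio s vhex * (1 + 362 / 100 * (s - 1)) <= 1 + 117 / 100 * (s - 1).
Proof.
move=> s1; have /andP[h1 h2] := vhex_bounds R.
rewrite /ratio; set e := expR _; have e0 : 0 < e := expR_gt0 _.
have e1 : e * (1 + (s - 1) * vhex) <= 1.
  have -> : 1 = e * expR ((s - 1) * vhex) by rewrite -expRD addNr expR0.
  by apply: ler_wpM2l; [exact: ltW | have := expR_ge1Dx ((s - 1) * vhex); rewrite -expRD addNr expR0; lra].
have A : ratioA s vhex <= 1 + 117 / 100 * (s - 1).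
  rewrite /ratioA; have : (s - 1) / (2 * (vhex - 1 / 2)) <= 17 / 100 * (s - 1); last by lra.
  rewrite ler_pdivrMr; last by lra.
  have : (s - 1) * 1 <= (s - 1) * (17 / 100 * (2 * (vhex - 1 / 2))) by apply: ler_wpM2l; lra.
  lra.
have A0 : 0 <= ratioA s vhex by have := @ratioA_ge R s vhex s1 ltac:(lra); lra.
have e2 : e * (1 + 362 / 100 * (s - 1)) <= 1.
  apply: le_trans e1; apply: ler_wpM2l; first exact: ltW.
  have : (s - 1) * (362 / 100) <= (s - 1) * vhex by apply: ler_wpM2l; lra.
  lra.
have := ler_wpM2l A0 e2; rewrite mulr1 mulrA => h; exact: le_trans h A.
Qed.

Lemma ratioA_vhex_le s : 1 <= s -> ratioA s vhex <= 1 + 117 / 100 * (s - 1).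
Proof.
move=> s1; have /andP[h1 _] := vhex_bounds R.
rewrite /ratioA; have : (s - 1) / (2 * (vhex - 1 / 2)) <= 17 / 100 * (s - 1); last by lra.
rewrite ler_pdivrMr; last by lra.
have : (s - 1) * 1 <= (s - 1) * (17 / 100 * (2 * (vhex - 1 / 2))) by apply: ler_wpM2l; lra.
lra.
Qed.

Lemma ratio_vhex_ge0 s : 1 <= s -> 0 <= ratio s vhex.
Proof.
move=> s1; have /andP[h1 _] := vhex_bounds R; have v1 : 1 / 2 < vhex by lra.
by rewrite mulr_ge0 ?expR_ge0//; have := ratioA_ge s1 v1; lra.
Qed.

Lemma ratio_gap s : 1 < s -> s <= 2 -> 5 / 10 * (s - 1) <= 1 - ratio s vhex.
Proof.
move=> s1 s2; have rle := ratio_vhex_le (ltW s1).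
have d0 : 0 < 1 + 362 / 100 * (s - 1) by lra.
have q : 0 <= (s - 1) * (2 - s) by apply: mulr_ge0; lra.
rewrite -(ler_pM2r d0); move: (ratio s vhex) rle => r rle; clear d0; lra.
Qed.

Lemma slope_vhex_le s : 1 < s -> s <= 2 -> slope s vhex <= 2 * (s - 1).
Proof.
move=> s1 s2; have g := ratio_gap s1 s2; have /andP[h1 _] := vhex_bounds R.
have s10 : 0 <= s - 1 by lra.
have re : expR (- ((s - 1) * vhex)) * ratioA s vhex = ratio s vhex by rewrite mulrC.
rewrite /slope; set e := expR _ in re *.
have e1 : e <= 1.
  rewrite -[leRHS]expR0 ler_expR oppr_le0; apply: mulr_ge0 => //; lra.
have e0 : 0 <= e by exact: expR_ge0.
have z1 : 1 / (2 * (vhex - 1 / 2) ^+ 2) <= 1.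
  have : 1 * 1 <= (vhex - 1 / 2) * (vhex - 1 / 2) by apply: ler_pM; lra.
  rewrite -expr2 => h; rewrite ler_pdivrMr; lra.
have z0 : 0 <= 1 / (2 * (vhex - 1 / 2) ^+ 2) by rewrite divr_ge0// mulr_ge0// sqr_ge0.
have y1 : e * (1 / (2 * (vhex - 1 / 2) ^+ 2)) <= 1 * 1 by apply: ler_pM.
have y2 : e * (ratioA s vhex + 1 / (2 * (vhex - 1 / 2) ^+ 2)) <= 2 by rewrite mulrDr re; clear - y1 g s10; lra.
by rewrite -mulrA mulrC ler_wpM2r.
Qed.

(** The final estimate for s <= 2, as a polynomial inequality in the deficits of
    the row sums: every term is at most a multiple of s - 1, and the gain
    (1 - rho) / 2 has the largest constant. *)
Lemma near_arith s (rho b i D D2 D3 Ds : R) : 1 < s -> 0 <= rho -> 5 / 10 * (s - 1) <= 1 - rho ->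
  0 <= b -> b <= 1 / 25 * (s - 1) -> i < 1 -> 1 - i <= s - 1 ->
  0 <= D -> D <= 122 / 10 ^+ 4 -> 0 <= D2 -> D2 <= 122 / 10 ^+ 4 -> 0 <= D3 -> D3 <= 122 / 10 ^+ 4 ->
  Ds <= (1 - 2 * (1 - i)) * D + 2 * (1 - i) * (3 * D2) ->
  0 < 1 / 2 * (1 - rho) - Ds + rho * D - b * (2 * D2 + D3).
Proof.
move=> s1 r0 r1 b0 bl i1 l0 D0 d1 D20 d2 D30 d3 cv.
have m1 : 0 <= (1 - rho) * (122 / 10 ^+ 4 - D) by apply: mulr_ge0; clear - s1 r1 d1; lra.
have m2 : (1 - i) * D2 <= (s - 1) * (122 / 10 ^+ 4) by apply: ler_pM => //; clear - i1; lra.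
have m3 : b * (2 * D2 + D3) <= 1 / 25 * (s - 1) * (3 * (122 / 10 ^+ 4)).
  by apply: ler_pM => //; clear - D20 D30 d2 d3; lra.
have m4 : 0 <= (1 - i) * D by apply: mulr_ge0 => //; clear - i1; lra.
clear - s1 r1 m1 m2 m3 m4 cv; lra.
Qed.

(** The sum over the line of the shortest vector is 1/2 minus a tiny deficit,
    while the hexagonal sum is at most rho / 2 with rho < 1. For s >= 2 this is
    enough, the other vectors contributing nonnegative terms. As s tends to 1
    the gap (1 - rho) / 2 vanishes too; there the deficits are compared to first
    order in s - 1 and the other rows enter through the tangent inequality. *)
Theorem region_three s t x : 1 < s -> 0 < t -> t <= 65 / 10 ^+ 2 ->
  asum0 (fun p => hfun s (qform vhex (1 / 2) p)) < asum0 (fun p => hfun s (qform t x p)).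
Proof.
move=> s1 t0 t1; have /andP[h1 h2] := vhex_bounds R.
have s0 : 0 < s by lra.
have st0 : 0 < s * t by rewrite mulr_gt0.
apply: le_lt_trans (hex_sum_le (ltW s1)) _.
have sa := absum_hfun x t0 s0; have sb := absum_hfun x t0 (@ltr01 R).
have h2' : 0 < 2 :> R by lra.
have h12 : 0 < 1 / 2 :> R by lra.
have sc := absum_hfun x t0 h2'; have sd := absum_hfun x t0 h12.
have [ra Ea] := asum_row t0 s0; have [rb Eb] := asum_row t0 (@ltr01 R).
have [rc Ec] := asum_row t0 h2'; have [rd Ed] := asum_row t0 h12.
have Q0 n : qform t x (0, n) = t * n%:~R ^+ 2 by rewrite /qform /=; ring.
have far p : p.1 != 0 -> 15 <= qform t x p.
  move=> p0; have P : 1 <= p.1%:~R ^+ 2 :> R by exact: sqr_int_ge1.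
  have p1 : 15 <= pi ^+ 2 / t.
    have /andP[pl _] := pi_bounds R; have : (314 / 100) * (314 / 100) <= pi ^+ 2 :> R by rewrite expr2; apply: ler_pM; move: pl; clear; lra.
    by move=> h; rewrite ler_pdivlMr//; lra.
  have : 15 * 1 <= pi ^+ 2 / t * p.1%:~R ^+ 2 by apply: ler_pM; move: p1 P; clear; lra.
  rewrite /qform; have : 0 <= t * (p.2%:~R + p.1%:~R * x) ^+ 2 by rewrite mulr_ge0 ?sqr_ge0// ltW.
  lra.
have hpos u v : 1 / 2 <= u * v -> 0 <= hfun u v by move=> h; rewrite mulr_ge0 ?expR_ge0// subr_ge0.
set rho := ratio s vhex; have rle := ratio_vhex_le (ltW s1); rewrite -/rho in rle.
have row_le : 1 / 2 - rowdef (s * t) <= asum0 (fun p => hfun s (qform t x p)).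
  rewrite -Ea; have := @asum0_ge_row0 (fun p => hfun s (qform t x p)) sa; under eq_asum => n do rewrite Q0.
  apply=> p p0; apply: hpos; have := far p p0 => f.
  have : 1 * 15 <= s * qform t x p by apply: ler_pM; move: s1 f; clear; lra.
  by clear; lra.
(* s > 2: the rows off the axis are dropped *)
have [s2|s2] := leP s 2; last first.
  have rho2 : rho <= 47 / 100.
    have d0 : 0 < 1 + 362 / 100 * (s - 1) by lra.
    rewrite -(ler_pM2r d0); lra.
  have [st1|st1] := leP (s * t) (13 / 10).
    have := @rowdef_le (s * t) ltac:(by rewrite st0 st1); lra.
  have L : 2 * ((s * t - 1 / 2) * expR (- (s * t))) <= 1 / 2 - rowdef (s * t).
    rewrite -Ea; apply: (@le_trans _ _ (\sum_(n <- [:: 1; -1]) (if n == 0 then 0 else hfun s (t * n%:~R ^+ 2)))).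
      rewrite !big_cons big_nil /= (_ : t * 1%:~R ^+ 2 = t); last by rewrite expr1n mulr1.
      by rewrite (_ : t * (-1)%:~R ^+ 2 = t); [rewrite /hfun; lra | rewrite rmorphN sqrrN expr1n mulr1].
    apply: asum_ge_sum => // n _; case: ifPn => // n0; apply: hpos.
    have N1 : 1 <= n%:~R ^+ 2 :> R by exact: sqr_int_ge1.
    have : s * t * 1 <= s * t * n%:~R ^+ 2 by apply: ler_wpM2l => //; exact: ltW.
    rewrite mulrA; lra.
  apply: lt_le_trans row_le; apply: lt_le_trans L.
  have g1 : expR (- (65 / 10 ^+ 2)) * expR (- (65 / 10 ^+ 2 * (s - 1))) <= expR (- (s * t)).
    rewrite -expRD ler_expR; have : s * t <= s * (65 / 10 ^+ 2) by apply: ler_wpM2l; move: s0 t1; clear; lra.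
    by clear; lra.
  have g2 : 35 / 100 <= expR (- (65 / 10 ^+ 2)) :> R by have := expR_ge1Dx (- (65 / 10 ^+ 2) : R); clear; lra.
  set z := expR (- (65 / 10 ^+ 2 * (s - 1))) in g1; have z0 : 0 < z := expR_gt0 _.
  have g3 : rho <= z.
    have A := ratioA_vhex_le (ltW s1).
    rewrite /rho /ratio; apply: (@le_trans _ _ (expR (117 / 100 * (s - 1)) * expR (- ((s - 1) * vhex)))).
      by apply: ler_wpM2r; [exact: expR_ge0 | apply: le_trans A _; exact: expR_ge1Dx].
    rewrite -expRD ler_expR; have : (s - 1) * (362 / 100) <= (s - 1) * vhex by apply: ler_wpM2l; move: s1 h1; clear; lra.
    by move: s1; clear; lra.
  have g4 : 35 / 100 * z <= expR (- (s * t)) by apply: le_trans g1; apply: ler_wpM2r => //; exact: ltW.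
  have : 8 / 10 * (35 / 100 * z) <= (s * t - 1 / 2) * expR (- (s * t)).
    by apply: ler_pM => //; clear - z0 st1; lra.
  lra.
(* s <= 2: adding b times a function of constant lattice sum makes all rows
   off the axis nonnegative *)
set b := slope s vhex * (1 / 50).
have sl0 : 0 <= slope s vhex by apply: slope_ge0; [exact: ltW | lra].
have b0 : 0 <= b by rewrite mulr_ge0//; lra.
pose F p := hfun s (qform t x p) - rho * hfun 1 (qform t x p) + b * (2 * hfun 2 (qform t x p) + hfun (1 / 2) (qform t x p)).
have sF : absum F.
  apply: absumD; first by apply: absumB => //; exact: absumZ.
  by apply: absumZ; apply: absumD => //; exact: absumZ.
have E0 : asum0 F = asum0 (fun p => hfun s (qform t x p)) - rho * (1 / 2) + b * (3 / 2).
  rewrite -(asum0_hfun_pair x t0) /F asum0D; [|by apply: absumB => //; exact: absumZ|by apply: absumZ; apply: absumD => //; exact: absumZ].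
  rewrite asum0B//; last exact: absumZ.
  rewrite asum0Z// asum0_hfun1// asum0Z; last by apply: absumD => //; exact: absumZ.
  by rewrite asum0D//; [rewrite asum0Z | exact: absumZ].
have Er : asum (fun n : int => if n == 0 then 0 else F (0, n)) =
   1 / 2 - rowdef (s * t) - rho * (1 / 2 - rowdef (1 * t)) + b * (2 * (1 / 2 - rowdef (2 * t)) + (1 / 2 - rowdef (1 / 2 * t))).
  rewrite -Ea -Eb -Ec -Ed -(asumZ _ rb) -asumB//; last exact: absumZ.
  rewrite -(asumZ _ rc) -asumD//; last exact: absumZ.
  rewrite -asumZ; last by apply: absumD => //; exact: absumZ.
  rewrite -asumD; [|by apply: absumB => //; exact: absumZ|by apply: absumZ; apply: absumD => //; exact: absumZ].
  by apply: eq_asum => n; rewrite /F !Q0; case: ifP => // _; rewrite !mulr0 subr0 addr0 mulr0 addr0.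
have FL : asum (fun n : int => if n == 0 then 0 else F (0, n)) <= asum0 F.
  apply: asum0_ge_row0 => // p p0; have v15 := far p p0.
  have r1 := @ratio_tangent R s (qform t x p) vhex (ltW s1) ltac:(clear - v15; lra) ltac:(clear - h1; lra).
  have r2 := ler_wpM2l sl0 (far_row_bound v15).
  have r3 : 0 <= b * hfun 2 (qform t x p) by rewrite mulr_ge0//; apply: hpos; lra.
  rewrite /F; rewrite -/rho in r1; rewrite /b in r3 *; move: r1 r2 r3; clear; lra.
rewrite Er E0 in FL; have t20 := mulr_gt0 h2' t0; have t12 := mulr_gt0 h12 t0.
have d1 := @rowdef_le t ltac:(by rewrite t0; clear - t1; lra).
have d2 := @rowdef_le (2 * t) ltac:(by rewrite t20; clear - t1; lra).
have d3 := @rowdef_le (1 / 2 * t) ltac:(by rewrite t12; clear - t1; lra).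
have cv := @rowdef_convex t s t0 ltac:(by rewrite (ltW s1) s2).
have i0 : 0 < s^-1 by rewrite invr_gt0.
have i1 : s^-1 < 1 by rewrite invf_lt1.
have l0 : 1 - s^-1 <= s - 1.
  have -> : 1 - s^-1 = s^-1 * (s - 1) by field; rewrite gt_eqF.
  by rewrite ler_piMl ?(ltW i1)// subr_ge0 ltW.
have bl : b <= 1 / 25 * (s - 1) by have := slope_vhex_le s1 s2; rewrite /b; clear; lra.
rewrite (mul1r t) in FL.
have fin := near_arith s1 (ratio_vhex_ge0 (ltW s1)) (ratio_gap s1 s2) b0 bl i1 l0 (rowdef_ge0 t0) d1
  (rowdef_ge0 t20) d2 (rowdef_ge0 t12) d3 cv.
move: FL fin; rewrite -/rho; move: (asum0 _) (rowdef _) (rowdef _) (rowdef _) (rowdef _) => KK A1 A2 A3 A4; clear; lra.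
Qed.

End RegionThree.

(** * Monotone comparison of theta series *)

Section ThetaComparison.
Variable R : realType.
Implicit Types (t x s a b : R) (p : int * int).
Local Notation vhex := (vhex R).

(** Every lattice of area 1 has a basis with these properties, the second one
    after a reflection. *)
Definition reduced t x : Prop :=
  [/\ 0 < t, 0 <= x <= 1 / 2 & forall p, p != 0 -> t <= qform t x p].

Lemma vhex_gt0 : 0 < vhex.
Proof. by have /andP[h _] := vhex_bounds R; lra. Qed.

(** The second basis vector has squared length t x ^ 2 + pi ^ 2 / t with x <= 1/2,
    and it is not shorter than the first one: Hermite's bound. *)
Lemma reduced_le_vhex t x : reduced t x -> t <= vhex.
Proof.
move=> [t0 /andP[x0 x1] hm]; have := hm (1, 0) isT; have v0 := vhex_gt0.
rewrite /qform /= add0r mul1r expr1n mulr1 => h.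
have x2 : x ^+ 2 <= 1 / 4 by have : x * x <= 1 / 2 * (1 / 2); [apply: ler_pM | rewrite -expr2; lra].
have h2 : t * t <= t * (t * x ^+ 2 + pi ^+ 2 / t) by rewrite ler_pM2l.
have h3 : t * (t * x ^+ 2 + pi ^+ 2 / t) = t * t * x ^+ 2 + pi ^+ 2 by field; rewrite gt_eqF.
have h4 : t * t * x ^+ 2 <= t * t * (1 / 4) by apply: ler_wpM2l => //; rewrite mulr_ge0 ?ltW.
have h5 : t * t <= vhex * vhex by rewrite -(expr2 vhex) vhex_sqr; lra.
rewrite leNgt; apply/negP => h6; have := ltr_pM (ltW v0) (ltW v0) h6 h6; lra.
Qed.

Lemma reduced_at_vhex x : reduced vhex x -> x = 1 / 2.
Proof.
move=> [v0 /andP[x0 x1] hm]; have h := hm (1, 0) isT.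
rewrite /qform /= add0r mul1r expr1n mulr1 in h.
have E : pi ^+ 2 / vhex = 3 / 4 * vhex.
  rewrite (_ : pi ^+ 2 = 3 / 4 * vhex ^+ 2); first by field; rewrite gt_eqF.
  by rewrite vhex_sqr; field.
rewrite {}E in h; have h2 : vhex * (1 / 4) <= vhex * x ^+ 2 by lra.
rewrite ler_pM2l// in h2; apply/eqP; rewrite eq_le x1 /= leNgt; apply/negP => h3.
have : x * x <= x * (1 / 2) by apply: ler_wpM2l => //; exact: ltW.
rewrite -expr2; lra.
Qed.

Lemma reduced_hex : reduced vhex (1 / 2).
Proof.
split; [exact: vhex_gt0 | by apply/andP; split; lra | move=> p p0].
have N1 : 1 <= (eisN p)%:~R :> R by have := eisN_gt0 p0; rewrite -(ler_int R).
by rewrite qform_hex ler_peMr// ltW// vhex_gt0.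
Qed.

(** The central inequality, combining the three ranges of the least value t. *)
Lemma hfun_sum_lt t x s : reduced t x -> t != vhex -> 1 < s ->
  asum0 (fun p => hfun s (qform vhex (1 / 2) p)) < asum0 (fun p => hfun s (qform t x p)).
Proof.
move=> rd tv s1; have tle := reduced_le_vhex rd; case: rd => t0 hx hm.
have [t1|t1] := leP t (65 / 10 ^+ 2); first exact: region_three.
have [t2|t2] := leP t (26 / 10); first by apply: region_two => //; exact: ltW.
by apply: region_one => //; [exact: ltW | rewrite lt_neqAle tv | exact: hm].
Qed.

Definition thetaD t x s := theta t x s - theta vhex (1 / 2) s.

Definition momentD t x s :=
  asum0 (fun p => hfun s (qform t x p)) - asum0 (fun p => hfun s (qform vhex (1 / 2) p)).

Lemma theta_asum0 t x s : 0 < t -> 0 < s ->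
  asum0 (fun p => expR (- (s * qform t x p))) = theta t x s - 1.
Proof.
move=> t0 s0; rewrite asum0E; last exact: (gsummable_qform x t0).2.
by rewrite qform0 mulr0 oppr0 expR0.
Qed.

Lemma hfun_asum0 t x s : 0 < t -> 0 < s ->
  asum0 (fun p => hfun s (qform t x p)) =
  s * asum (fun p => qform t x p * expR (- (s * qform t x p))) - 1 / 2 * (theta t x s - 1).
Proof.
move=> t0 s0; have gq := gsummable_qform x t0.
have e1 := absum_qexp gq s0; have e0 := gq.2 s s0.
rewrite -(theta_asum0 x t0 s0) -(asum0Z _ e0).
have -> : asum (fun p => qform t x p * expR (- (s * qform t x p))) = asum0 (fun p => qform t x p * expR (- (s * qform t x p))).
  by rewrite asum0E// qform0 mul0r subr0.
rewrite -(asum0Z _ e1) -asum0B; [|exact: absumZ|exact: absumZ].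
by apply: eq_asum0 => p _; rewrite /hfun; ring.
Qed.

(** Its derivative involves the moment sums only, the square root accounting for
    the term 1/2 in [hfun]. *)
Definition phi t x s := Num.sqrt s * thetaD t x s.

Lemma is_derive_phi t x s : 0 < t -> 0 < s ->
  is_derive s 1 (phi t x) (- ((Num.sqrt s)^-1 * momentD t x s)).
Proof.
move=> t0 s0; have v0 := vhex_gt0.
have d1 := is_derive_theta x t0 s0; have d2 := is_derive_theta (1 / 2) v0 s0.
have d3 := is_derive1_sqrt s0.
have q0 : 0 < Num.sqrt s by rewrite sqrtr_gt0.
have qq : Num.sqrt s * Num.sqrt s = s by rewrite -expr2 sqr_sqrtr// ltW.
have d4 : is_derive s 1 (thetaD t x) (- asum (fun p => qform t x p * expR (- (s * qform t x p))) + asum (fun p => qform vhex (1 / 2) p * expR (- (s * qform vhex (1 / 2) p)))).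
  by rewrite /thetaD; apply: is_derive_eq; rewrite opprK.
have d5 : is_derive s 1 (Num.sqrt * thetaD t x) (Num.sqrt s *: (- asum (fun p => qform t x p * expR (- (s * qform t x p))) + asum (fun p => qform vhex (1 / 2) p * expR (- (s * qform vhex (1 / 2) p)))) + thetaD t x s *: (2 * Num.sqrt s)^-1).
  exact: is_deriveM.
apply: is_derive_eq; rewrite /GRing.scale /= /momentD !hfun_asum0// /thetaD.
move: (asum _) (asum _) (theta t x s) (theta _ _ s) => A B C D.
by move: (Num.sqrt s) q0 qq => q q0 <-; field; rewrite gt_eqF.
Qed.

Lemma phi_lt t x s1 s2 : reduced t x -> t != vhex -> 1 <= s1 -> s1 < s2 -> phi t x s2 < phi t x s1.
Proof.
move=> rd tv h1 h12; have t0 : 0 < t by case: rd.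
have [|c /andP[c1 c2] E] := @MVT_is_derive R (phi t x) (fun s => - ((Num.sqrt s)^-1 * momentD t x s)) s1 s2 h12.
  by move=> z /andP[z1 _]; apply: is_derive_phi => //; lra.
have c3 : 1 < c by lra.
rewrite -subr_lt0 E mulNr oppr_lt0 mulr_gt0 ?subr_gt0// mulr_gt0 ?invr_gt0 ?sqrtr_gt0 ?subr_gt0//; first by lra.
exact: hfun_sum_lt.
Qed.

(** A decreasing function tending to 0 is nonnegative. The limit is replaced by
    an explicit lower bound: the hexagonal theta series minus 1 is at most a
    constant times exp (- (r - 1)). *)
Lemma phi_ge0 t x s : reduced t x -> t != vhex -> 1 <= s -> 0 <= phi t x s.
Proof.
move=> rd tv s1; rewrite leNgt; apply/negP => neg.
have t0 : 0 < t by case: rd.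
have v0 := vhex_gt0; have gq := gsummable_qform (1 / 2) v0.
pose C := asum (fun p => expR (- (1 * qform vhex (1 / 2) p))).
have C0 : 0 <= C by apply: asum_ge0 => p; exact: expR_ge0.
have lower r : 1 <= r -> - (r * (expR (- (r - 1)) * C)) <= phi t x r.
  move=> r1; have r0 : 0 < r by lra.
  have u1 : asum0 (fun p => expR (- (r * qform vhex (1 / 2) p))) <= expR (- (r - 1)) * C.
    have sC := gq.2 1 ltr01.
    apply: (@le_trans _ _ (asum0 (fun p => expR (- (r - 1)) * expR (- (1 * qform vhex (1 / 2) p))))).
      apply: ler_asum0; [exact: gq.2|exact: absumZ|move=> p p0].
      rewrite -expRD ler_expR; case: reduced_hex => _ _ /(_ p p0) h.
      have : 0 <= (r - 1) * (qform vhex (1 / 2) p - 1).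
        by apply: mulr_ge0; have /andP[? _] := vhex_bounds R; lra.
      lra.
    rewrite asum0Z//; apply: ler_wpM2l; first exact: expR_ge0.
    by rewrite asum0E// lerBlDr lerDl expR_ge0.
  have u2 : 0 <= asum0 (fun p => expR (- (r * qform t x p))).
    by apply: asum_ge0 => p; case: ifP => // _; exact: expR_ge0.
  rewrite theta_asum0// in u1; rewrite theta_asum0// in u2.
  have sr : Num.sqrt r <= r by rewrite -[leRHS](ger0_norm (ltW r0)) -sqrtr_sqr ler_wsqrtr// expr2 ler_peMr// ltW.
  have w0 : 0 <= expR (- (r - 1)) * C by rewrite mulr_ge0 ?expR_ge0.
  have w1 : Num.sqrt r * (expR (- (r - 1)) * C) <= r * (expR (- (r - 1)) * C) by rewrite ler_wpM2r.
  have w2 : 0 <= Num.sqrt r * (thetaD t x r + expR (- (r - 1)) * C).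
    by rewrite mulr_ge0 ?sqrtr_ge0// /thetaD; lra.
  rewrite /phi; lra.
(* far enough out the lower bound exceeds phi s, contradicting monotonicity;
   the distance comes from r exp (- (r - 1)) <= 4 / r *)
pose M := 4 * C / - phi t x s; have M0 : 0 <= M by rewrite divr_ge0 ?mulr_ge0//; lra.
pose r := s + M + 1; have r1 : 1 <= r by rewrite /r; lra.
have sr : s < r by rewrite /r; lra.
have := phi_lt rd tv s1 sr; have := lower r r1.
have e1 : expR (- (r - 1)) * (r * r) <= 4.
  have h := @expR_ge_quarter R (r - 1) ltac:(lra).
  have h2 : (r * r) / 4 <= expR (r - 1) by lra.
  have E : expR (- (r - 1)) * expR (r - 1) = 1 by rewrite -expRD addNr expR0.
  have := ler_wpM2l (expR_ge0 (- (r - 1))) h2; rewrite E; lra.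
have e2 : r * (expR (- (r - 1)) * C) * r <= 4 * C.
  have -> : r * (expR (- (r - 1)) * C) * r = expR (- (r - 1)) * (r * r) * C by ring.
  exact: ler_wpM2r.
have e3 : 4 * C = M * - phi t x s by rewrite /M divfK// oppr_eq0 lt_eqF.
have e4 : M * - phi t x s <= r * - phi t x s by apply: ler_wpM2r; [lra | rewrite /r; lra].
have r0 : 0 < r by lra.
have e5 : r * (expR (- (r - 1)) * C) <= - phi t x s.
  by rewrite -(ler_pM2r r0); rewrite e3 in e2; apply: le_trans e2 _; rewrite [leRHS]mulrC.
lra.
Qed.

Lemma thetaD_ge0 t x s : reduced t x -> t != vhex -> 1 <= s -> 0 <= thetaD t x s.
Proof.
move=> rd tv s1; have := phi_ge0 rd tv s1; rewrite /phi pmulr_rge0// sqrtr_gt0; lra.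
Qed.

(** The inequality phi (a s) < phi s divided by sqrt s. *)
Lemma thetaD_combination_gt0 t x s a b : reduced t x -> t != vhex -> 1 <= s -> 1 < a -> b <= Num.sqrt a ->
  0 < thetaD t x s - b * thetaD t x (a * s).
Proof.
move=> rd tv s1 a1 ba.
have as1 : s < a * s by rewrite ltr_pMl//; lra.
have h := phi_lt rd tv s1 as1; have T := @thetaD_ge0 t x (a * s) rd tv ltac:(lra).
have q0 : 0 < Num.sqrt s by rewrite sqrtr_gt0; lra.
rewrite /phi sqrtrM in h; last by lra.
have b1 : b * thetaD t x (a * s) <= Num.sqrt a * thetaD t x (a * s) by rewrite ler_wpM2r.
have h2 : 0 < Num.sqrt s * (thetaD t x s - Num.sqrt a * thetaD t x (a * s)) by lra.
rewrite pmulr_rgt0// in h2; lra.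
Qed.

End ThetaComparison.

(** * Reduced bases of lattices *)

Section Reduction.
Variable R : realType.
Implicit Types (p : int * int).

Lemma seq_argmin (T : eqType) (q : T -> R) (x0 : T) (s : seq T) :
  exists2 x, x \in x0 :: s & forall y, y \in x0 :: s -> q x <= q y.
Proof.
elim: s x0 => [|y s IH] x0; first by exists x0; rewrite ?mem_head// => y; rewrite inE => /eqP->.
have [x xs hx] := IH y; have [xl|xl] := leP (q x) (q x0).
  exists x; first by rewrite inE xs orbT.
  by move=> z; rewrite inE => /predU1P[->//|/hx].
exists x0; first exact: mem_head.
move=> z; rewrite inE => /predU1P[->//|/hx h]; exact: le_trans (ltW xl) h.
Qed.

(** Only finitely many values of a Gaussian-summable family lie below a given
    bound, so a least one exists. *)
Lemma gsummable_min (q : int * int -> R) : gsummable q ->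
  exists2 u, u != 0 & forall p, p != 0 -> q u <= q p.
Proof.
move=> [q0 sq]; pose g p := expR (- (1 * q p)); have sg : absum g := sq 1 ltr01.
have g0 p : 0 <= g p := expR_ge0 _.
have [s us hs] := absum_tail g0 sg (expR_gt0 (- (1 * q (1, 0)))).
have [u us' hu] := seq_argmin q (1, 0) [seq p <- s | p != 0].
exists u.
  by move: us'; rewrite inE mem_filter => /predU1P[->//|/andP[]].
move=> p p0; have [ps|ps] := boolP (p \in s).
  by apply: hu; rewrite inE mem_filter p0 ps orbT.
apply: le_trans (hu _ (mem_head _ _)) _.
have : g p < g (1, 0).
  apply: le_lt_trans hs.
  apply: (@le_trans _ _ (\sum_(i <- [:: p]) (if i \in s then 0 else g i))).
    by rewrite big_seq1 (negbTE ps).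
  apply: asum_ge_sum => //; last by move=> i _; case: ifP.
  by apply: absum_le (absum_norm sg) => i; case: ifP; rewrite ?normr0.
by rewrite ltr_expR ltrN2 !mul1r => /ltW.
Qed.

Lemma qform_gram (A H C : R) p : 0 < A -> A * C - H ^+ 2 = 1 ->
  qform (pi * A) (H / A) p =
  pi * (A * p.2%:~R ^+ 2 + 2 * H * (p.1%:~R * p.2%:~R) + C * p.1%:~R ^+ 2).
Proof.
move=> a0 d1; have pi0 := pi_gt0 R.
have [an pn] : A != 0 /\ (pi : R) != 0 by rewrite !gt_eqF.
have -> : C = (1 + H ^+ 2) / A by rewrite -d1; field.
rewrite /qform; move: (pi : R) pn => P pn.
by field; rewrite an pn.
Qed.

Variables A H C : R.
Hypotheses (A0 : 0 < A) (det1 : A * C - H ^+ 2 = 1).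

(** The bilinear form with Gram matrix ((A, H), (H, C)) in the coordinates used
    for [qform]; the second coordinate belongs to the first basis vector. *)
Definition gram (p p' : int * int) : R :=
  A * (p.2%:~R * p'.2%:~R) + H * (p.1%:~R * p'.2%:~R + p'.1%:~R * p.2%:~R) + C * (p.1%:~R * p'.1%:~R).

(** Take u of least length. It is primitive, since otherwise a fraction of it
    would be shorter; by Bezout it extends to a basis, and the second basis
    vector is translated by a multiple of u and possibly reflected. *)
Lemma reduction : exists u w : int * int,
  (u.2 * w.1 - u.1 * w.2) ^+ 2 = 1 /\ reduced (pi * gram u u) (gram u w / gram u u).
Proof.
have d1 := det1; have a0 := A0; have pi0 := pi_gt0 R.
pose Q := qform (pi * A) (H / A); have piA : 0 < pi * A by rewrite mulr_gt0.
have QE p : Q p = pi * gram p p.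
  rewrite /Q (qform_gram _ a0 d1) /gram; congr (_ * _); ring.
have [u u0 hu] := gsummable_min (gsummable_qform (H / A) piA); rewrite -/Q in hu.
have Gu : 0 < gram u u.
  have : 0 < Q u.
    rewrite lt_neqAle qform_ge0// andbT eq_sym; apply/negP => /eqP Z.
    have b0 : 0 < pi ^+ 2 / (pi * A) by rewrite divr_gt0// exprn_gt0.
    move/eqP: Z; rewrite /Q /qform paddr_eq0; last 2 first.
    - by rewrite mulr_ge0 ?sqr_ge0// ltW.
    - by rewrite mulr_ge0 ?sqr_ge0// ltW.
    rewrite [pi * A * _ == 0]mulf_eq0 [pi ^+ 2 / _ * _ == 0]mulf_eq0 (gt_eqF piA) (gt_eqF b0)/=.
    rewrite !sqrf_eq0 => /andP[h1 h2].
    have m0 : u.1 = 0 by apply/eqP; rewrite -(intr_eq0 R).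
    move: h1; rewrite m0 mul0r addr0 intr_eq0 => /eqP n0.
    by move: u0; rewrite [u]surjective_pairing m0 n0 eqxx.
  by rewrite QE pmulr_rgt0.
(* a common divisor d >= 2 of the coordinates would make u / d shorter *)
have [a [b ab]] := Bezoutz u.1 u.2; set d := gcdz u.1 u.2 in ab.
have d0 : 0 <= d by rewrite /d /gcdz.
have [k1 e1] : exists k, u.1 = k * d by exists (u.1 %/ d)%Z; rewrite divzK// dvdz_gcdl.
have [k2 e2] : exists k, u.2 = k * d by exists (u.2 %/ d)%Z; rewrite divzK// dvdz_gcdr.
have dE : d = 1.
  have k0 : (k1, k2) != 0.
    by apply: contraNneq u0 => -[z1 z2]; rewrite [u]surjective_pairing e1 e2 z1 z2 !mul0r.
  have h := hu _ k0; have uE : Q u = d%:~R ^+ 2 * Q (k1, k2).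
    by rewrite !QE /gram e1 e2 /= !rmorphM /=; ring.
  have Qk : 0 < Q (k1, k2).
    have : 0 < Q u by rewrite QE mulr_gt0.
    rewrite uE; have := qform_ge0 (H / A) (k1, k2) piA; rewrite -/Q => q0 h2.
    rewrite lt_neqAle q0 andbT eq_sym; apply/negP => /eqP Z.
    by rewrite Z mulr0 ltxx in h2.
  have [//|d2] : d = 1 \/ d != 1 by case: eqP; [left|right].
  have d3 : d = 0 \/ 2 <= d by lia.
  case: d3 => [dz|d3]; first by move: u0; rewrite [u]surjective_pairing e1 e2 dz !mulr0.
  have d4 : 2 <= d%:~R :> R by rewrite (ler_int R 2).
  have d5 : 2 * 2 <= d%:~R ^+ 2 :> R by rewrite expr2; apply: ler_pM.
  have h4 : 2 * 2 * Q (k1, k2) <= Q u by rewrite uE ler_wpM2r// ltW.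
  by exfalso; move: (Q u) (Q (k1, k2)) h Qk h4 => y z; lra.
rewrite dE in ab.
have gB (p p' p'' : int * int) (k : int) :
    gram p (p'.1 - k * p''.1, p'.2 - k * p''.2) = gram p p' - k%:~R * gram p p''.
  by rewrite /gram /= !(rmorphB, rmorphM) /=; ring.
have gN (p p' : int * int) : gram p (- p'.1, - p'.2) = - gram p p'.
  by rewrite /gram /= !rmorphN /=; ring.
have Gn : gram u u != 0 by rewrite gt_eqF.
have [w [dw xw]] : exists w : int * int, (u.2 * w.1 - u.1 * w.2) ^+ 2 = 1 /\
    0 <= gram u w / gram u u <= 1 / 2.
  pose w0 : int * int := (b, - a); pose x1 := gram u w0 / gram u u.
  (* the nearest integer brings the shear into [-1/2, 1/2] *)
  pose k : int := Num.floor (x1 + 1 / 2).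
  pose w1 : int * int := (w0.1 - k * u.1, w0.2 - k * u.2).
  have dw1 : u.2 * w1.1 - u.1 * w1.2 = 1 by rewrite /w1 /w0 /= -ab; ring.
  have xE : gram u w1 / gram u u = x1 - k%:~R.
    by rewrite /w1 gB mulrBl mulfK// -/x1.
  have l1 : k%:~R <= x1 + 1 / 2 := floor_le _.
  have l2 : x1 + 1 / 2 < (k + 1)%:~R := floorD1_gt _.
  have l3 : (k + 1)%:~R = k%:~R + 1 :> R by rewrite rmorphD.
  have [s0|s0] := leP 0 (x1 - k%:~R).
    exists w1; split; first by rewrite dw1 expr1n.
    by rewrite xE s0/=; move: l2; rewrite l3; lra.
  exists (- w1.1, - w1.2); split.
    by transitivity ((u.2 * w1.1 - u.1 * w1.2) ^+ 2); [rewrite /w1 /=; ring | rewrite dw1 expr1n].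
  rewrite gN mulNr xE; apply/andP; split; move: l1 l2 s0; rewrite l3; lra.
exists u, w; split=> //; split=> //; first by rewrite mulr_gt0.
move=> p p0; have dR : (u.2%:~R * w.1%:~R - u.1%:~R * w.2%:~R) ^+ 2 = 1 :> R.
  by rewrite -!intrM -intrB -rmorphXn dw.
have d' : gram u u * gram w w - gram u w ^+ 2 = 1.
  transitivity ((A * C - H ^+ 2) * (u.2%:~R * w.1%:~R - u.1%:~R * w.2%:~R) ^+ 2).
    by rewrite /gram; ring.
  by rewrite d1 dR mul1r.
pose z : int * int := (p.2 * u.1 + p.1 * w.1, p.2 * u.2 + p.1 * w.2).
have -> : qform (pi * gram u u) (gram u w / gram u u) p = Q z.
  rewrite (qform_gram p Gu d') QE /gram /z /= !(rmorphD, rmorphM) /=; ring.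
rewrite -QE; apply: hu.
have [z1 z2] : p.2 * (u.2 * w.1 - u.1 * w.2) = w.1 * z.2 - w.2 * z.1 /\
   p.1 * (u.2 * w.1 - u.1 * w.2) = u.2 * z.1 - u.1 * z.2 by split; rewrite /z /=; ring.
have dn : u.2 * w.1 - u.1 * w.2 != 0 by apply/eqP => e; rewrite e in dw.
apply: contraNneq p0 => z0; rewrite z0 /= !mulr0 subrr in z1; rewrite z0 /= !mulr0 subrr in z2.
move/eqP: z1; rewrite mulf_eq0 (negbTE dn) orbF => /eqP q1.
move/eqP: z2; rewrite mulf_eq0 (negbTE dn) orbF => /eqP q2.
by rewrite [p]surjective_pairing q1 q2.
Qed.
End Reduction.

Section Lattices.
Variable R : realType.
Implicit Types (p : int * int) (U B : 'M[R]_2).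

Lemma det2 U : \det U = U 0 0 * U 1 1 - U 0 1 * U 1 0.
Proof.
rewrite (expand_det_row _ 0) !big_ord_recl big_ord0 addr0 /cofactor !det_mx11 !mxE /=.
rewrite (_ : lift 0 0 = 1); last exact/val_inj.
rewrite (_ : lift 1 0 = 0); last exact/val_inj.
by rewrite expr0 expr1; ring.
Qed.

(** The lattice point with coordinates p = (m, n): n times the first row plus m
    times the second. *)
Definition latpt U p : 'rV[R]_2 := p.2%:~R *: row 0 U + p.1%:~R *: row 1 U.

Definition gram11 U := U 0 0 ^+ 2 + U 0 1 ^+ 2.
Definition gram12 U := U 0 0 * U 1 0 + U 0 1 * U 1 1.
Definition gram22 U := U 1 0 ^+ 2 + U 1 1 ^+ 2.

Lemma gram_det U : gram11 U * gram22 U - gram12 U ^+ 2 = (\det U) ^+ 2.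
Proof. by rewrite det2 /gram11 /gram12 /gram22; ring. Qed.

Lemma gram11_gt0 U : (\det U) ^+ 2 = 1 -> 0 < gram11 U.
Proof.
move=> d; rewrite lt_neqAle addr_ge0 ?sqr_ge0// andbT eq_sym.
apply/negP; rewrite paddr_eq0 ?sqr_ge0// !sqrf_eq0 => /andP[/eqP z1 /eqP z2].
by move: d; rewrite det2 z1 z2 !mul0r subrr expr0n => /eqP; rewrite eq_sym oner_eq0.
Qed.

Lemma latpt_inj U : (\det U) ^+ 2 = 1 -> injective (latpt U).
Proof.
move=> d p p' /rowP e; have := e 0; have := e 1; rewrite !mxE => e1 e0.
have dn : \det U != 0 by apply/eqP => z; move/eqP: d; rewrite z expr0n eq_sym oner_eq0.
rewrite [p]surjective_pairing [p']surjective_pairing; congr (_, _).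
  apply: (@intr_inj R); apply: (mulIf dn); rewrite det2.
  rewrite [LHS](_ : _ = U 0 0 * (p.2%:~R * U 0 1 + p.1%:~R * U 1 1)
    - U 0 1 * (p.2%:~R * U 0 0 + p.1%:~R * U 1 0)); last by ring.
  by rewrite e0 e1; ring.
apply: (@intr_inj R); apply: (mulIf dn); rewrite det2.
rewrite [LHS](_ : _ = U 1 1 * (p.2%:~R * U 0 0 + p.1%:~R * U 1 0)
    - U 1 0 * (p.2%:~R * U 0 1 + p.1%:~R * U 1 1)); last by ring.
by rewrite e0 e1; ring.
Qed.

Lemma lattice_latpt U : lattice U = range (latpt U).
Proof.
have E (z : 'rV[int]_2) : map_mx intr z *m U = latpt U (z 0 1, z 0 0).
  apply/rowP => j; rewrite !mxE !big_ord_recl big_ord0 addr0 !mxE.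
  by rewrite (_ : lift 0 0 = 1); last exact/val_inj.
apply/seteqP; split => [_ [z _ <-]|_ [p _ <-]]; first by exists (z 0 1, z 0 0); rewrite ?E.
exists (\row_j (if j == 0 then p.2 else p.1)) => //.
by rewrite E !mxE /= -surjective_pairing.
Qed.

Lemma latpt0 U : latpt U 0 = 0.
Proof. by rewrite /latpt /= !scale0r addr0. Qed.

Lemma sqnorm_latpt U p : sqnorm (latpt U p) =
  gram11 U * p.2%:~R ^+ 2 + 2 * gram12 U * (p.1%:~R * p.2%:~R) + gram22 U * p.1%:~R ^+ 2.
Proof.
rewrite /sqnorm !big_ord_recl big_ord0 addr0 !mxE (_ : lift 0 0 = 1); last exact/val_inj.
by rewrite /gram11 /gram12 /gram22; ring.
Qed.

(** The parameters of [qform] for the basis U. *)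
Definition lat_t U := pi * gram11 U.
Definition lat_x U := gram12 U / gram11 U.

Lemma sqnorm_qform U p : (\det U) ^+ 2 = 1 ->
  qform (lat_t U) (lat_x U) p = pi * sqnorm (latpt U p).
Proof.
move=> d; rewrite sqnorm_latpt /lat_t /lat_x (@qform_gram _ _ _ (gram22 U)) ?gram11_gt0//.
by rewrite gram_det.
Qed.

Lemma lattice_reduced (L : set 'rV[R]_2) : is_lattice_of_area 1 L ->
  exists U, [/\ (\det U) ^+ 2 = 1, L = lattice U & reduced (lat_t U) (lat_x U)].
Proof.
move=> [B [_ dB ->]].
have d : (\det B) ^+ 2 = 1 by rewrite -real_normK ?num_real// dB expr1n.
have gd : gram11 B * gram22 B - gram12 B ^+ 2 = 1 by rewrite gram_det.
have [u [w [duw red]]] := reduction (gram11_gt0 d) gd.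
pose U : 'M[R]_2 := \matrix_(i < 2) (if i == 0 then latpt B u else latpt B w).
have Ue : (forall j, U 0 j = u.2%:~R * B 0 j + u.1%:~R * B 1 j) /\
  (forall j, U 1 j = w.2%:~R * B 0 j + w.1%:~R * B 1 j) by split=> j; rewrite !mxE.
have [U0 U1] := Ue.
have dR : (u.2%:~R * w.1%:~R - u.1%:~R * w.2%:~R) ^+ 2 = 1 :> R.
  by rewrite -!intrM -intrB -rmorphXn duw.
exists U; split.
- rewrite (_ : \det U = (u.2%:~R * w.1%:~R - u.1%:~R * w.2%:~R) * \det B).
    by rewrite exprMn dR d mulr1.
  by rewrite !det2 !U0 !U1; ring.
- rewrite !lattice_latpt; set e := u.2 * w.1 - u.1 * w.2 in duw.
  apply/seteqP; split => [_ [p _ <-]|_ [p _ <-]].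
    exists (e * (u.2 * p.1 - u.1 * p.2), e * (w.1 * p.2 - w.2 * p.1)) => //.
    have eR : e%:~R = u.2%:~R * w.1%:~R - u.1%:~R * w.2%:~R :> R.
      by rewrite /e rmorphB !rmorphM.
    have ee : e%:~R * (u.2%:~R * w.1%:~R - u.1%:~R * w.2%:~R) = 1 :> R.
      by rewrite eR -expr2.
    apply/rowP => j; rewrite !mxE /= !(rmorphB, rmorphM) /=.
    apply: (@etrans _ _ ((u.2%:~R * w.1%:~R - u.1%:~R * w.2%:~R) ^+ 2
      * (p.2%:~R * B 0 j + p.1%:~R * B 1 j))); first by ring.
    by rewrite dR mul1r.
  exists (p.1 * w.1 + p.2 * u.1, p.2 * u.2 + p.1 * w.2) => //.
  by apply/rowP => j; rewrite !mxE /= !(rmorphD, rmorphM) /=; ring.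
have -> : lat_t U = pi * gram (gram11 B) (gram12 B) (gram22 B) u u.
  by rewrite /lat_t /gram11 /gram12 /gram22 /gram !U0; ring.
suff -> : lat_x U = gram (gram11 B) (gram12 B) (gram22 B) u w / gram (gram11 B) (gram12 B) (gram22 B) u u by [].
by rewrite /lat_x; congr (_ / _); rewrite /gram11 /gram12 /gram22 /gram !U0 ?U1; ring.
Qed.

Lemma asum_posneg_esum (I : choiceType) (f : I -> R) : absum f ->
  (asum f)%:E = (\esum_(i in [set: I]) (EFin \o f)^\+ i - \esum_(i in [set: I]) (EFin \o f)^\- i)%E.
Proof.
move=> sf; rewrite unlock /asum_def EFinB.
have {}sf : summable [set: I] (EFin \o f) := sf.
have fin1 := summable_funepos sf; have fin2 := summable_funeneg sf.
rewrite !fineK//.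
- rewrite summableE in fin2; rewrite (eq_esum (b := fun i => `|(EFin \o f)^\- i|%E))// => i _.
  by rewrite gee0_abs.
- rewrite summableE in fin1; rewrite (eq_esum (b := fun i => `|(EFin \o f)^\+ i|%E))// => i _.
  by rewrite gee0_abs.
Qed.

(** For an absolutely convergent energy the extended real sums of positive and
    negative parts are finite, and the parametrization by Z^2 is a bijection. *)
Lemma energy_lattice (f : R -> R) U : (\det U) ^+ 2 = 1 ->
  let F p := f (qform (lat_t U) (lat_x U) p / pi) in
  absum (fun p => if p == 0 then 0 else F p) ->
  energy f (lattice U) = (asum0 F)%:E.
Proof.
move=> d F sF; rewrite /energy.
have -> : lattice U `\ 0 = latpt U @` [set p | p != 0].
  rewrite lattice_latpt; apply/seteqP; split => [_ [[p _ <-] h]|_ [p p0 <-]].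
    by exists p => //=; apply/eqP => z; apply: h; rewrite z /= latpt0.
  split; first by exists p.
  by rewrite /= -(latpt0 U) => /(latpt_inj d)/eqP; apply/negP.
have ji : set_inj [set p : int * int | p != 0] (latpt U) by move=> p p' _ _; exact: latpt_inj.
have FE p : f (sqnorm (latpt U p)) = F p.
  by rewrite /F sqnorm_qform// mulrC mulKf// gt_eqF// pi_gt0.
rewrite !(esum_image _ _ _ ji) esum_mkcond [X in (_ - X)%E]esum_mkcond.
rewrite /asum0 asum_posneg_esum//.
have pE p : (p \in [set p : int * int | p != 0]) = (p != 0).
  by apply/idP/idP => [/set_mem|h]//; apply/mem_set.
congr (_ - _)%E; apply: eq_esum => p _; rewrite pE ?funeposE ?funenegE /= FE;
  by case: (p == 0) => //=; rewrite ?oppr0 ?oppe0 maxxx.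
Qed.

Lemma hex_gram (H := hexagonal_basis R) : [/\ gram11 H = 2 / Num.sqrt 3,
  gram12 H = 1 / Num.sqrt 3, gram22 H = 2 / Num.sqrt 3 & \det H = 1].
Proof.
have s3 : (Num.sqrt 3 : R) ^+ 2 = 3 by rewrite sqr_sqrtr.
have s0 : 0 < (Num.sqrt 3 : R) by rewrite sqrtr_gt0.
have c2 : (Num.sqrt (2 / Num.sqrt 3) : R) ^+ 2 = 2 / Num.sqrt 3 by rewrite sqr_sqrtr// divr_ge0// ltW.
rewrite det2 /gram11 /gram12 /gram22 /H /hexagonal_basis !mxE /=.
move: (Num.sqrt (2 / Num.sqrt 3)) c2 => c c2; move: (Num.sqrt 3) s3 s0 c2 => s s3 s0 c2.
have sn : s != 0 by rewrite gt_eqF.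
have sV : 1 / s = s / 3 by rewrite -s3; field.
have c2' : c ^+ 2 = 2 * (s / 3) by rewrite c2 -sV; field.
have e1 : 2 / s = 2 * (s / 3) by rewrite -sV; field.
by rewrite e1 sV; split; nra.
Qed.

(** Bases with the same Gram matrix and determinant differ by a rotation. *)
Lemma lattice_hexagonal U : gram11 U = 2 / Num.sqrt 3 -> gram12 U = 1 / Num.sqrt 3 ->
  gram22 U = 2 / Num.sqrt 3 -> \det U = 1 -> is_hexagonal (lattice U).
Proof.
move=> g1 g2 g3 dU; have [h1 h2 h3 dH] := hex_gram; set H := hexagonal_basis R in h1 h2 h3 dH.
have Hu : H \in unitmx by rewrite unitmxE dH unitr1.
have UU : U *m U^T = H *m H^T.
  have tw (V W : 'M[R]_2) : gram11 V = gram11 W -> gram12 V = gram12 W -> gram22 V = gram22 W ->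
     V *m V^T = W *m W^T.
    rewrite /gram11 /gram12 /gram22 => e1 e2 e3; apply/matrixP => i j.
    rewrite !mxE !big_ord_recl !big_ord0 !addr0 !mxE (_ : lift 0 0 = 1); last exact/val_inj.
    have ord2 (k : 'I_2) : k = 0 \/ k = 1.
      by case: k => -[|[|//]] hk; [left|right]; exact/val_inj.
    case: (ord2 i) => ->; case: (ord2 j) => ->; rewrite -?expr2//.
    by rewrite [U' in U' + _]mulrC [X in _ + X]mulrC e2; ring.
  by apply: tw; rewrite ?g1 ?g2 ?g3 ?h1 ?h2 ?h3.
exists (invmx H *m U); first split.
- rewrite trmx_mul -mulmxA (mulmxA U) UU -!mulmxA -trmx_mul mulVmx// trmx1 mulmx1.
  by rewrite mulVmx.
- by rewrite det_mulmx det_inv dH dU invr1 mulr1.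
rewrite /Lambda1 /lattice; apply/seteqP; split => [_ [z _ <-]|_ [_ [z _ <-] <-]].
  by exists (map_mx intr z *m H); [exists z|rewrite -!mulmxA mulKVmx].
by exists z => //; rewrite -!mulmxA mulKVmx.
Qed.

(** The parameters determine the Gram matrix. A basis of the wrong orientation is
    corrected by exchanging its two vectors, which have the same length. *)
Lemma lat_hexagonal U : (\det U) ^+ 2 = 1 -> lat_t U = vhex R -> lat_x U = 1 / 2 ->
  is_hexagonal (lattice U).
Proof.
move=> d; have s3 : (Num.sqrt 3 : R) ^+ 2 = 3 by rewrite sqr_sqrtr.
have s0 : 0 < (Num.sqrt 3 : R) by rewrite sqrtr_gt0.
have pi0 := pi_gt0 R; have sn : (Num.sqrt 3 : R) != 0 by rewrite gt_eqF.
have pn : (pi : R) != 0 by rewrite gt_eqF.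
rewrite /lat_t /lat_x /vhex => e1 e2; have gd := gram_det U; rewrite d in gd.
have g1 : gram11 U = 2 / Num.sqrt 3.
  by apply: (mulfI pn); rewrite e1; field; rewrite sn.
have g2 : gram12 U = 1 / Num.sqrt 3.
  have : gram12 U = 1 / 2 * gram11 U by rewrite -e2 divfK// gt_eqF// gram11_gt0.
  by rewrite g1 => ->; field; rewrite sn.
have g3 : gram22 U = 2 / Num.sqrt 3.
  have : 2 / Num.sqrt 3 != 0 :> R by rewrite mulf_neq0// ?invr_eq0.
  move=> h; apply: (mulfI h); rewrite -[X in X * _]g1.
  rewrite (_ : gram11 U * gram22 U = 1 + gram12 U ^+ 2); last by rewrite -gd; ring.
  have hv : (Num.sqrt 3 : R)^-1 ^+ 2 = 3^-1 by rewrite exprVn s3.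
  by rewrite g2 div1r mulrACA -(expr2 (_^-1)) hv; field.
have [d1|d1] : \det U = 1 \/ \det U = - 1.
  by move/eqP: d; rewrite sqrf_eq1 => /orP[]/eqP; [left|right].
  exact: lattice_hexagonal.
pose V : 'M[R]_2 := \matrix_(i < 2) (if i == 0 then row 1 U else row 0 U).
have [V0 V1] : (forall j, V 0 j = U 1 j) /\ (forall j, V 1 j = U 0 j) by split=> j; rewrite !mxE.
have -> : lattice U = lattice V.
  rewrite !lattice_latpt; have E p : latpt U p = latpt V (p.2, p.1).
    by apply/rowP => j; rewrite !mxE /= addrC.
  apply/seteqP; split => [_ [p _ <-]|_ [p _ <-]]; exists (p.2, p.1) => //.
apply: lattice_hexagonal; rewrite /gram11 /gram12 /gram22 ?V0 ?V1//.
  by rewrite -g2 /gram12; ring.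
by rewrite det2 !V0 !V1 -[RHS]opprK -d1 det2; ring.
Qed.

Lemma lat_Lambda1 (H := hexagonal_basis R) :
  [/\ (\det H) ^+ 2 = 1, lat_t H = vhex R & lat_x H = 1 / 2].
Proof.
have [h1 h2 h3 dH] := hex_gram; rewrite /lat_t /lat_x -/H h1 h2 dH expr1n /vhex.
have sn : (Num.sqrt 3 : R) != 0 by rewrite gt_eqF// sqrtr_gt0.
by split=> //; field; rewrite sn.
Qed.

Lemma Lambda1_area : is_lattice_of_area 1 (Lambda1 R).
Proof.
have [_ _ _ dH] := hex_gram; exists (hexagonal_basis R); split=> //.
  by rewrite unitmxE dH unitr1.
by rewrite dH normr1.
Qed.
End Lattices.

(** * Exchanging lattice sums and integrals *)

Section SumIntegral.
Variables (R : realType) (I : countType).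

(** An exhaustion of a countable index type by finite sequences, which reduces
    the next lemma to dominated convergence of a sequence of functions. *)
Definition enum_upto (n : nat) : seq I := pmap (@pickle_inv I) (iota 0 n).

Lemma enum_upto_uniq n : uniq (enum_upto n).
Proof. by apply: pmap_uniq (iota_uniq 0 n); exact: pickle_invK. Qed.

Lemma mem_enum_upto n i : (pickle i < n)%N -> i \in enum_upto n.
Proof.
move=> h; rewrite mem_pmap; apply/mapP; exists (pickle i); first by rewrite mem_iota.
by rewrite pickleK_inv.
Qed.

Lemma asum_cvg (f : I -> R) : absum f ->
  (fun n => \sum_(i <- enum_upto n) f i) @ \oo --> asum f.
Proof.
move=> sf; pose g n i := if i \in enum_upto n then f i else 0.
have gf n i : `|g n i| <= `|f i| by rewrite /g; case: ifP; rewrite ?normr0.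
have gc i : g ^~ i @ \oo --> f i.
  by apply: cvg_near_cst; exists (pickle i).+1 => // n /= h; rewrite /g mem_enum_upto.
have [_] := asum_dominated (absum_norm sf) gf gc; rewrite /g.
rewrite (_ : (fun n => asum _) = (fun n => \sum_(i <- enum_upto n) f i))//.
apply/funext => n; have [_ ->] := @asum_finite R I (enum_upto n)
  (fun i => if i \in enum_upto n then f i else 0) (enum_upto_uniq n) ltac:(by move=> i /negbTE ->).
by rewrite !big_seq; apply: eq_bigr => i ->.
Qed.

Lemma absum_bounded (f : I -> R) M :
  (forall s, uniq s -> \sum_(i <- s) `|f i| <= M) -> absum f.
Proof.
move=> h; apply: le_lt_trans (ltry M); apply: ge_ereal_sup => _ [A [finA _] <-].
by rewrite fsbig_finite//= sumEFin lee_fin h// finmap.fset_uniq.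
Qed.

Context d (T : measurableType d) (mu : {measure set T -> \bar R}) (D : set T).
Hypothesis mD : measurable D.

(** Fubini for a sum and an integral, from dominated convergence applied to the
    partial sums along [enum_upto]. *)
Lemma asum_Rintegral (h : I -> T -> R) (G : T -> R) :
  (forall i, measurable_fun D (h i)) ->
  mu.-integrable D (EFin \o G) ->
  (forall x, D x -> absum (h^~ x)) ->
  (forall x, D x -> asum (fun i => `|h i x|) <= G x) ->
  [/\ absum (fun i => \int[mu]_(x in D) h i x),
      mu.-integrable D (EFin \o (fun x => asum (h^~ x))) &
      asum (fun i => \int[mu]_(x in D) h i x) = \int[mu]_(x in D) asum (h^~ x)].
Proof.
move=> mh iG sh hG.
have le1 s x : D x -> uniq s -> \sum_(i <- s) `|h i x| <= G x.
  move=> Dx us; apply: le_trans (hG x Dx); apply: asum_ge_sum => //.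
  exact: absum_norm (sh x Dx).
have hiG i x : D x -> `|h i x| <= G x.
  by move=> Dx; have := le1 [:: i] x Dx isT; rewrite big_seq1.
have G0 x : D x -> 0 <= G x by move=> Dx; have := le1 [::] x Dx isT; rewrite big_nil.
have ih i : mu.-integrable D (EFin \o h i).
  apply: (le_integrable mD) iG; first exact/measurable_EFinP.
  by move=> x Dx; rewrite /= lee_fin (ger0_norm (G0 x Dx)) hiG.
have ihn i : mu.-integrable D (EFin \o (fun x => `|h i x|)).
  by have := integrable_abse (ih i).
have isum (k : I -> T -> R) s : (forall i, mu.-integrable D (EFin \o k i)) ->
  mu.-integrable D (EFin \o (fun x => \sum_(i <- s) k i x)) /\
  \int[mu]_(x in D) (\sum_(i <- s) k i x) = \sum_(i <- s) \int[mu]_(x in D) k i x.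
  move=> ik; have E x : (\sum_(i <- s) k i x)%:E = (\sum_(i <- s) (k i x)%:E)%E by rewrite sumEFin.
  split.
    rewrite (_ : EFin \o _ = fun x => (\sum_(i <- s) (k i x)%:E)%E); last by apply/funext => x /=; rewrite E.
    by apply: integrable_sum => // i _; exact: ik.
  rewrite /Rintegral; under eq_integral do rewrite E.
  have Fi i : (\int[mu]_(x in D) (k i x)%:E)%E \is a fin_num := integrable_fin_num mD (ik i).
  rewrite integral_sum; [|exact: mD|exact: ik].
  by rewrite sum_fine.
have sI : absum (fun i => \int[mu]_(x in D) h i x).
  apply: (@absum_bounded _ (\int[mu]_(x in D) G x)) => s us.
  apply: (@le_trans _ _ (\sum_(i <- s) \int[mu]_(x in D) `|h i x|)).
    by apply: ler_sum => i _; exact: le_normr_Rintegral.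
  have [i1 <-] := isum _ s ihn.
  by apply: le_Rintegral => // x Dx; exact: le1.
have cv x : D x -> (fun n => (\sum_(i <- enum_upto n) h i x)%:E) @ \oo --> (asum (h^~ x))%:E.
  by move=> Dx; apply/cvg_EFin; [exact: nearW | exact: asum_cvg (sh x Dx)].
have mS n : measurable_fun D (EFin \o (fun x => \sum_(i <- enum_upto n) h i x)).
  have [m _] := isum h (enum_upto n) ih; exact: (measurable_int mu m).
have mA : measurable_fun D (EFin \o (fun x => asum (h^~ x))).
  exact: (emeasurable_fun_cvg _ _ mS cv).
have [||i2 _ c] := dominated_convergence mD mS mA _ iG.
- by apply: aeW => x Dx; exact: cv.
- apply: aeW => x n Dx; rewrite /= lee_fin; apply: le_trans (le1 (enum_upto n) x Dx (enum_upto_uniq n)).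
  exact: ler_norm_sum.
split=> //.
have E : (fun n => \sum_(i <- enum_upto n) \int[mu]_(x in D) h i x) =
  fine \o (fun n => \int[mu]_(x in D) (EFin \o (fun x => (\sum_(i <- enum_upto n) h i x)%R)) x)%E.
  by apply/funext => n; have [_ <-] := isum _ (enum_upto n) ih.
have c1 := asum_cvg sI; rewrite E in c1.
apply: (cvg_unique _ c1); first exact: norm_hausdorff.
apply: fine_cvg; rewrite /Rintegral fineK//.
exact: integrable_fin_num.
Qed.
End SumIntegral.

Section Optimality.
Variable R : realType.
Implicit Types (t x y c : R) (P : R -> R) (k h : R -> R -> R).
Local Notation D := (`[1, +oo[%classic : set R).
Local Notation mu := (@lebesgue_measure R).

(** The integrability condition on the weight that makes every energy converge;
    it is a consequence of the potential being finite at all r > 0, see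
    [f_weight] and [g_weight]. *)
Definition decaying_weight P : Prop :=
  (forall y, 1 <= y -> 0 <= P y) /\
  forall c, 0 < c -> mu.-integrable D (EFin \o (fun y => expR (- (c * y)) * P y)).

Lemma in_ray y : D y -> 1 <= y.
Proof. by rewrite /= in_itv/= andbT. Qed.

Lemma measurable_expRM c : measurable_fun D (fun y => expR (c * y)).
Proof.
by apply: (@measurable_comp _ _ _ _ _ _ setT).
Qed.

Lemma decaying_measurable P : decaying_weight P -> measurable_fun D P.
Proof.
move=> [_ h]; have m1 := measurable_int mu (h 1 ltr01); move/measurable_EFinP in m1.
have m2 := measurable_funM (measurable_expRM 1) m1.
apply: eq_measurable_fun m2 => y _ /=.
by rewrite mulrA -expRD subrr expR0 mul1r.
Qed.

(** For p nonzero and y >= 1 the exponent y q / 2 is at least t y / 4 + q / 4, so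
    the bound separates into an integrable function of y and a summable family
    in p. *)
Lemma lattice_Rintegral t x k K P : reduced t x -> decaying_weight P -> 0 <= K ->
  (forall v, measurable_fun D (k v)) ->
  (forall v y, 0 < v -> 1 <= y -> `|k v y| <= K * expR (- (y / 2 * v))) ->
  [/\ absum (fun p => if p == 0 then 0 else \int[mu]_(y in D) (k (qform t x p) y * P y)),
      mu.-integrable D (EFin \o (fun y => asum0 (fun p => k (qform t x p) y) * P y)) &
      asum0 (fun p => \int[mu]_(y in D) (k (qform t x p) y * P y)) =
      \int[mu]_(y in D) (asum0 (fun p => k (qform t x p) y) * P y)].
Proof.
move=> [t0 _ hm] wP K0 mk bk; have mP := decaying_measurable wP; have [P0 iP] := wP.
have mD : measurable (D : set (measurableTypeR R)) by exact: measurable_itv.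
pose q := qform t x; have gq : gsummable q := gsummable_qform x t0.
pose C := asum (fun p => expR (- (1 / 4 * q p))).
pose h p y := if p == 0 then 0 else k (q p) y * P y.
have c4 : 0 < 1 / 4 :> R by lra.
have sC := gq.2 _ c4; have t4 : 0 < t / 4 by lra.
have kb y p : 1 <= y -> `|if p == 0 then 0 else k (q p) y| <=
    K * expR (- (t / 4 * y)) * expR (- (1 / 4 * q p)).
  move=> y1; case: eqP => [_|/eqP p0]; first by rewrite normr0 !mulr_ge0// expR_ge0.
  have qt : t <= q p := hm p p0.
  apply: le_trans (bk _ _ _ y1) _; first exact: lt_le_trans qt.
  rewrite -[leRHS]mulrA ler_wpM2l// -expRD ler_expR.
  have h1 : t * y <= q p * y by rewrite ler_wpM2r//; lra.
  have h2 : q p * 1 <= q p * y by rewrite ler_wpM2l//; lra.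
  by rewrite (_ : y / 2 * q p = (q p * y) / 2); [lra | ring].
have sk y : 1 <= y -> absum (fun p => if p == 0 then 0 else k (q p) y).
  by move=> y1; apply: absum_le (absumZ _ sC) => p; exact: kb.
have hE y : h^~ y = fun p => P y * (if p == 0 then 0 else k (q p) y).
  by apply/funext => p; rewrite /h; case: ifP => _; rewrite ?mulr0// mulrC.
have [||||s1 i1 e1] := @asum_Rintegral R _ _ _ mu D mD h (fun y => K * C * (expR (- (t / 4 * y)) * P y)).
- move=> p; rewrite /h; case: (p == 0); first exact: measurable_cst.
  exact: (measurable_funM (mk (q p)) mP).
- exact: (integrableZl mD (K * C) (iP _ t4)).
- by move=> y /in_ray y1; rewrite hE; apply: absumZ; exact: sk.
- move=> y /in_ray y1.
  rewrite [leRHS](_ : _ = asum (fun p => P y * (K * expR (- (t / 4 * y))) * expR (- (1 / 4 * q p)))); last first.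
    by rewrite asumZ// -/C; ring.
  apply: ler_asum.
  + by rewrite -[X in absum X]/(fun p => `|(h^~ y) p|) hE; apply: absum_norm; apply: absumZ; exact: sk.
  + exact: absumZ.
  + move=> p; rewrite -[h p y]/((h^~ y) p) hE normrM (ger0_norm (P0 y y1)) -mulrA.
    by rewrite ler_wpM2l// ?P0// kb.
have E1 : (fun p => \int[mu]_(y in D) h p y) = fun p => if p == 0 then 0 else \int[mu]_(y in D) (k (q p) y * P y).
  by apply/funext => p; rewrite /h; case: (p == 0) => //; rewrite /Rintegral integral0.
have E2 : {in D, forall y, asum (h^~ y) = asum0 (fun p => k (q p) y) * P y}.
  by move=> y /set_mem/in_ray y1; rewrite hE asumZ 1?mulrC//; exact: sk.
rewrite E1 in s1 e1; split=> //.
  by apply: (eq_integrable mD) i1 => y yD /=; rewrite E2.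
by rewrite /asum0 e1; apply: eq_Rintegral => y yD; rewrite E2.
Qed.

(** The energy is the integral of the lattice sum Phi against the weight. A
    pointwise inequality of Phi gives the minimizer; if another lattice attained
    the minimum, the strict inequality on y > 1 would force the weight to vanish
    almost everywhere. *)
Lemma hexagonal_optimal h k K P : decaying_weight P -> 0 <= K ->
  (forall r y, h r y = k (pi * r) y * P y) ->
  (forall v, measurable_fun D (k v)) ->
  (forall v y, 0 < v -> 1 <= y -> `|k v y| <= K * expR (- (y / 2 * v))) ->
  let Phi t x y := asum0 (fun p => k (qform t x p) y) in
  (forall t x y, reduced t x -> t != vhex R -> 1 <= y -> Phi (vhex R) (1 / 2) y <= Phi t x y) ->
  (forall t x y, reduced t x -> t != vhex R -> 1 < y -> Phi (vhex R) (1 / 2) y < Phi t x y) ->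
  is_minimizer (potential h) (Lambda1 R) /\
  (nontrivial_weight P -> forall L, is_minimizer (potential h) L -> is_hexagonal L).
Proof.
move=> wP K0 hk mk bk Phi hle hlt; have mD : measurable (D : set (measurableTypeR R)) by exact: measurable_itv.
have pin : (pi : R) != 0 by rewrite gt_eqF// pi_gt0.
have [P0 _] := wP.
pose S t x := \int[mu]_(y in D) (Phi t x y * P y).
have iS t x : reduced t x -> mu.-integrable D (EFin \o (fun y => Phi t x y * P y)).
  by move=> rd; have [] := lattice_Rintegral rd wP K0 mk bk.
have pot v : potential h (v / pi) = \int[mu]_(y in D) (k v y * P y).
  by rewrite /potential; apply: eq_Rintegral => y _; rewrite hk (_ : pi * (v / pi) = v)// mulrC divfK.
have EL (U : 'M[R]_2) : (\det U) ^+ 2 = 1 -> reduced (lat_t U) (lat_x U) ->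
    energy (potential h) (lattice U) = (S (lat_t U) (lat_x U))%:E.
  move=> d rd; have [sI _ eI] := lattice_Rintegral rd wP K0 mk bk.
  rewrite energy_lattice//; last by under eq_fun do rewrite pot.
  by rewrite /S -eI; congr (_%:E); rewrite /asum0; apply: eq_asum => p; rewrite pot.
have [dH tH xH] := lat_Lambda1 R; have rH := reduced_hex R.
have EH : energy (potential h) (Lambda1 R) = (S (vhex R) (1 / 2))%:E.
  by rewrite EL ?tH ?xH.
split.
  split; first exact: Lambda1_area.
  move=> L' /lattice_reduced[U [d -> rd]]; rewrite EH EL// lee_fin.
  have [tv|tv] := eqVneq (lat_t U) (vhex R).
    by rewrite tv in rd *; rewrite (reduced_at_vhex rd).
  apply: le_Rintegral => //; [exact: iS|exact: iS|].
  by move=> y /in_ray y1; rewrite ler_wpM2r ?P0// hle.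
move=> nP L [/lattice_reduced[U [d -> rd]] hmin].
have [tv|tv] := eqVneq (lat_t U) (vhex R).
  by apply: lat_hexagonal => //; rewrite tv in rd; exact: reduced_at_vhex rd.
exfalso; apply: nP; have := hmin _ (Lambda1_area R); rewrite EH EL// lee_fin => hS.
pose g y := Phi (lat_t U) (lat_x U) y * P y - Phi (vhex R) (1 / 2) y * P y.
have g0 y : 1 <= y -> 0 <= g y by move=> y1; rewrite subr_ge0 ler_wpM2r ?P0// hle.
have ig : mu.-integrable D (EFin \o g).
  exact: (integrableB mD (iS _ _ rd) (iS _ _ rH)).
have gz : \int[mu]_(y in D) g y = 0.
  apply/eqP; rewrite eq_le Rintegral_ge0 ?andbT; last by move=> y /in_ray; exact: g0.
  by rewrite RintegralB//; [rewrite subr_le0 | exact: iS | exact: iS].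
have ga : (\int[mu]_(y in D) `|(g y)%:E| = 0)%E.
  transitivity (\int[mu]_(y in D) (g y)%:E)%E.
    by apply: eq_integral => y /set_mem/in_ray y1; rewrite gee0_abs// lee_fin g0.
  have := integrable_fin_num mD ig => /= fg; rewrite -[LHS]fineK//.
  by rewrite -[fine _]/(\int[mu]_(y in D) g y) gz.
have ae1 := (ae_eq_integral_abs mu mD (measurable_int mu ig)).1 ga.
have ae2 : {ae mu, forall y, y <> 1}.
  exists [set 1]; split => //; first exact: lebesgue_measure_set1.
  by move=> y /= /contrapT.
apply: filterS2 ae1 ae2 => y hy y1 yD.
have {}hy : g y = 0 by apply: EFin_inj; apply: hy; rewrite /= in_itv/= andbT.
have yl : 1 < y by rewrite lt_neqAle yD andbT eq_sym; apply/eqP.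
move/eqP: hy; rewrite /g -mulrBl mulf_eq0 gt_eqF ?subr_gt0 ?hlt//= => /eqP.
by [].
Qed.
End Optimality.

(** * The two families of potentials *)

Section FinalTheorem.
Variable R : realType.
Implicit Types (t x y c : R) (P : R -> R) (k h : R -> R -> R).
Local Notation D := (`[1, +oo[%classic : set R).
Local Notation mu := (@lebesgue_measure R).

(** The weight is only known through its products with positive measurable
    functions. *)
Lemma measurable_ray_div (d P : R -> R) : (forall y, 1 <= y -> 0 < d y) ->
  measurable_fun D d -> measurable_fun D (fun y => d y * P y) -> measurable_fun D P.
Proof.
move=> d0 md mdP.
have ml : measurable_fun D (fun y => expR (- 1 * ln (d y))).
  apply: (@measurable_comp _ _ _ _ _ _ setT) => //.
  apply: measurable_funM; first exact: measurable_cst.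
  by apply: (@measurable_comp _ _ _ _ _ _ setT).
apply: eq_measurable_fun (measurable_funM ml mdP) => y /set_mem/in_ray y1 /=.
by rewrite mulN1r expRN lnK ?posrE ?d0// mulKf// gt_eqF// d0.
Qed.

(** A bound at one large rate controls a bounded interval, and for each small
    rate it is enough to have a bound far out. *)
Lemma decaying_weight_bound P :
  (forall y, 1 <= y -> 0 <= P y) -> measurable_fun D P ->
  (exists c G, 0 < c /\ mu.-integrable D (EFin \o G) /\
     forall y, 1 <= y -> expR (- (c * y)) * P y <= G y) ->
  (forall c, 0 < c -> exists X G, mu.-integrable D (EFin \o G) /\
     forall y, 1 <= y -> X <= y -> expR (- (c * y)) * P y <= G y) ->
  decaying_weight P.
Proof.
move=> P0 mP [c0 [G0 [c00 [iG0 hG0]]]] hG; split=> // c c_gt0.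
have [X [G [iG hX]]] := hG c c_gt0.
have mD : measurable (D : set (measurableTypeR R)) by exact: measurable_itv.
pose M := expR (c0 * X).
have iM : mu.-integrable D (EFin \o (fun y => `|G y| + M * `|G0 y|)).
  have i1 := integrable_abse iG; have i2 := integrable_abse iG0.
  exact: (integrableD mD i1 (integrableZl mD M i2)).
apply: (le_integrable mD) iM.
  apply/measurable_EFinP; apply: measurable_funM mP.
  by apply: eq_measurable_fun (measurable_expRM (- c)) => y _; rewrite mulNr.
move=> y /in_ray y1; rewrite /= lee_fin.
have e0 : 0 <= expR (- (c * y)) * P y by rewrite mulr_ge0 ?expR_ge0 ?P0.
have M0 : 0 <= M := expR_ge0 _.
rewrite (ger0_norm e0) ger0_norm; last by rewrite addr_ge0// mulr_ge0.
have [Xy|yX] := leP X y.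
  apply: le_trans (hX y y1 Xy) _; apply: le_trans (ler_norm _) _.
  by rewrite lerDl mulr_ge0.
apply: (@le_trans _ _ (M * G0 y)); last first.
  by rewrite -[leLHS]add0r lerD// ler_wpM2l// ler_norm.
apply: (@le_trans _ _ (M * (expR (- (c0 * y)) * P y))); last by rewrite ler_wpM2l// hG0.
rewrite mulrA ler_wpM2r ?P0// /M -expRD ler_expR.
have h1 : 0 <= c * y by apply: mulr_ge0; lra.
have h2 : c0 * y <= c0 * X by rewrite ler_wpM2l// ltW.
by lra.
Qed.

(** Where |b| exp (- pi (a - 1) alpha r x) <= 1/2, the integrand is at least half of
    its first term. This holds on the whole ray for large r, and far out for
    every r. *)
Lemma f_weight (a alpha b : R) P : 1 < a -> 1 <= alpha -> (forall y, 1 <= y -> 0 <= P y) ->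
  finite_potential (f_integrand a alpha b P) -> decaying_weight P.
Proof.
move=> a1 al1 P0 fin; have pi0 := pi_gt0 R.
have al0 : 0 < alpha by lra.
have pa : 0 < pi * alpha by rewrite mulr_gt0.
have mD : measurable (D : set (measurableTypeR R)) by exact: measurable_itv.
have key r y : 0 < r -> 2 * `|b| <= pi * alpha * (a - 1) * r * y ->
    expR (- (pi * alpha * r * y)) / 2 <= expR (- (pi * alpha * y * r)) - b * expR (- (pi * a * alpha * y * r)).
  move=> r0 hb; set u := pi * alpha * (a - 1) * r * y in hb.
  have u0 : 0 <= u by apply: le_trans hb; rewrite mulr_ge0.
  rewrite (_ : - (pi * a * alpha * y * r) = - (pi * alpha * r * y) + - u); last by rewrite /u; ring.
  rewrite (_ : pi * alpha * y * r = pi * alpha * r * y); last by ring.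
  rewrite expRD; have e0 := expR_gt0 (- (pi * alpha * r * y)).
  move: (expR (- (pi * alpha * r * y))) e0 => e e0.
  have h1 : `|b| * expR (- u) <= 1 / 2.
    rewrite expRN ler_pdivrMr ?expR_gt0//; have := expR_ge1Dx u; lra.
  have h2 : b * expR (- u) <= `|b| * expR (- u) by rewrite ler_wpM2r ?expR_ge0// ler_norm.
  have h3 : b * expR (- u) <= 1 / 2 by exact: le_trans h2 h1.
  have h4 : e * (b * expR (- u)) <= e * (1 / 2) by rewrite ler_wpM2l// ltW.
  by rewrite (_ : b * (e * expR (- u)) = e * (b * expR (- u))); [lra | ring].
have pas : 0 < pi * alpha * (a - 1) by rewrite mulr_gt0//; lra.
pose r0 := (2 * `|b| + 1) / (pi * alpha * (a - 1)).
have r00 : 0 < r0 by rewrite divr_gt0// ltr_wpDl// mulr_ge0.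
have kr0 y : 1 <= y -> 2 * `|b| <= pi * alpha * (a - 1) * r0 * y.
  move=> y1; rewrite /r0 [X in X * y]mulrC divfK ?gt_eqF//.
  have b0 : 0 <= `|b| := normr_ge0 b.
  have : (2 * `|b| + 1) * 1 <= (2 * `|b| + 1) * y by rewrite ler_wpM2l//; lra.
  lra.
have mf r : 0 < r -> measurable_fun D (f_integrand a alpha b P r).
  by move=> rp; apply/measurable_EFinP; exact: (measurable_int mu (fin r rp)).
have mP : measurable_fun D P.
  apply: (@measurable_ray_div (fun y => expR (- (pi * alpha * y * r0)) - b * expR (- (pi * a * alpha * y * r0)))).
  - move=> y y1; apply: lt_le_trans (key r0 y r00 (kr0 y y1)).
    by rewrite divr_gt0// expR_gt0.
  - apply: measurable_funB.
      apply: eq_measurable_fun (measurable_expRM (- (pi * alpha * r0))) => y _.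
      by congr expR; ring.
    apply: measurable_funM; first exact: measurable_cst.
    apply: eq_measurable_fun (measurable_expRM (- (pi * a * alpha * r0))) => y _.
    by congr expR; ring.
  - exact: (mf r0 r00).
have bound r y : 0 < r -> 1 <= y -> 2 * `|b| <= pi * alpha * (a - 1) * r * y ->
    expR (- (pi * alpha * r * y)) * P y <= 2 * f_integrand a alpha b P r y.
  move=> rp y1 /(key _ _ rp) h; rewrite /f_integrand mulrA ler_wpM2r ?P0//.
  by move: h; lra.
have iF r : 0 < r -> mu.-integrable D (EFin \o (fun y => 2 * f_integrand a alpha b P r y)).
  by move=> rp; exact: (integrableZl mD 2 (fin r rp)).
apply: decaying_weight_bound => //.
  exists (pi * alpha * r0), (fun y => 2 * f_integrand a alpha b P r0 y).
  split; first by rewrite mulr_gt0.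
  by split; [exact: iF | move=> y y1; apply: bound => //; exact: kr0].
move=> c c0; pose r := c / (pi * alpha).
have rp : 0 < r by rewrite divr_gt0.
have rE : pi * alpha * r = c by rewrite /r mulrC divfK// gt_eqF.
have ca : 0 < (a - 1) * c by rewrite mulr_gt0//; lra.
exists (2 * `|b| / ((a - 1) * c)), (fun y => 2 * f_integrand a alpha b P r y); split; first exact: iF.
move=> y y1; rewrite ler_pdivrMr// => hy; rewrite -rE; apply: bound => //.
by apply: le_trans hy _; rewrite -rE le_eqVlt; apply/orP; left; apply/eqP; ring.
Qed.

(** As pi > 1 and alpha >= 1, the constant b / alpha is at most 1/2. So the factor
    r x - b / alpha is at least 1/2 on the whole ray for r = 1, and at least 1 far
    out for every r. *)
Lemma g_weight (alpha b : R) P : 1 <= alpha -> b <= 1 / (2 * pi) -> (forall y, 1 <= y -> 0 <= P y) ->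
  finite_potential (g_integrand alpha b P) -> decaying_weight P.
Proof.
move=> al1 hb P0 fin; have pi0 := pi_gt0 R.
have al0 : 0 < alpha by lra.
have pa : 0 < pi * alpha by rewrite mulr_gt0.
have mD : measurable (D : set (measurableTypeR R)) by exact: measurable_itv.
have pi1 : 1 < pi :> R by have := pi_ge2 R; lra.
have ba : b / alpha <= 1 / 2.
  have [b0|b0] := leP b 0.
    apply: (@le_trans _ _ 0); last by lra.
    by rewrite mulr_le0_ge0// invr_ge0 ltW.
  apply: (@le_trans _ _ b); first by rewrite ler_pdivrMr// ler_peMr// ltW.
  apply: le_trans hb _; rewrite !div1r lef_pV2 ?posrE ?mulr_gt0//; lra.
have mP : measurable_fun D P.
  apply: (@measurable_ray_div (fun y => (1 * y - b / alpha) * expR (- (pi * alpha * y * 1)))).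
  - by move=> y y1; rewrite mulr_gt0 ?expR_gt0//; lra.
  - apply: measurable_funM.
      apply: measurable_funB; last exact: measurable_cst.
      by apply: measurable_funM; [exact: measurable_cst | exact: measurable_id].
    apply: eq_measurable_fun (measurable_expRM (- (pi * alpha))) => y _.
    by congr expR; ring.
  - by apply/measurable_EFinP; exact: (measurable_int mu (fin 1 ltr01)).
have iF r (m : R) : 0 < r -> mu.-integrable D (EFin \o (fun y => m * g_integrand alpha b P r y)).
  by move=> rp; exact: (integrableZl mD m (fin r rp)).
apply: decaying_weight_bound => //.
  exists (pi * alpha), (fun y => 2 * g_integrand alpha b P 1 y).
  split=> //; split; first exact: iF.
  move=> y y1; rewrite /g_integrand !mulrA ler_wpM2r ?P0// mulr1 -[leLHS]mul1r ler_wpM2r ?expR_ge0//.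
  by lra.
move=> c c0; pose r := c / (pi * alpha).
have rp : 0 < r by rewrite divr_gt0.
have rE : pi * alpha * r = c by rewrite /r mulrC divfK// gt_eqF.
exists (2 / r), (fun y => 1 * g_integrand alpha b P r y); split; first exact: iF.
move=> y y1; rewrite ler_pdivrMr// => hy.
rewrite mul1r /g_integrand ler_wpM2r ?P0// -[leLHS]mul1r.
rewrite (_ : pi * alpha * y * r = c * y); last by rewrite -rE; ring.
by rewrite ler_wpM2r ?expR_ge0// (mulrC r); lra.
Qed.

(** The Gaussian part of the integrand as a function of v = pi r. *)
Definition f_kernel (a alpha b : R) (v y : R) : R :=
  expR (- (alpha * y * v)) - b * expR (- (a * (alpha * y) * v)).

Definition g_kernel (alpha b : R) (v y : R) : R :=
  (v * y / pi - b / alpha) * expR (- (alpha * y * v)).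

Lemma asum0_f_kernel (a alpha b t x y : R) : 0 < a -> 0 < alpha -> 0 < t -> 0 < y ->
  asum0 (fun p => f_kernel a alpha b (qform t x p) y) =
  theta t x (alpha * y) - 1 - b * (theta t x (a * (alpha * y)) - 1).
Proof.
move=> a0 al0 t0 y0; have gq := gsummable_qform x t0.
have s0 : 0 < alpha * y by rewrite mulr_gt0.
have as0 : 0 < a * (alpha * y) by rewrite mulr_gt0.
have e1 := gq.2 _ s0; have e2 := gq.2 _ as0.
rewrite /f_kernel asum0B ?asum0Z//; last exact: absumZ.
by rewrite !theta_asum0.
Qed.

(** Since v y alpha - pi b = (alpha y v - 1/2) + (1/2 - pi b), the sum splits into a
    moment sum and a theta series; this is where the threshold 1 / (2 pi) for b
    comes from. *)
Lemma asum0_g_kernel (alpha b t x y : R) : 0 < alpha -> 0 < t -> 0 < y ->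
  asum0 (fun p => g_kernel alpha b (qform t x p) y) =
  (pi * alpha)^-1 * (asum0 (fun p => hfun (alpha * y) (qform t x p))
                     + (1 / 2 - pi * b) * (theta t x (alpha * y) - 1)).
Proof.
move=> al0 t0 y0; have gq := gsummable_qform x t0.
have s0 : 0 < alpha * y by rewrite mulr_gt0.
have e1 := gq.2 _ s0; have h1 := absum_hfun x t0 s0.
rewrite -theta_asum0// -asum0Z// -asum0D//; last exact: absumZ.
rewrite -asum0Z; last by apply: absumD => //; exact: absumZ.
apply: eq_asum0 => p _; rewrite /g_kernel /hfun.
have [an pn] : alpha != 0 /\ (pi : R) != 0 by rewrite !gt_eqF ?pi_gt0.
move: (pi : R) pn => w wn; by field; rewrite an ?wn.
Qed.

Lemma measurable_expR_kernel c v : measurable_fun D (fun y => expR (- (c * y * v))).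
Proof.
apply: eq_measurable_fun (measurable_expRM (- (c * v))) => y _.
by congr expR; ring.
Qed.

Lemma f_optimal (a alpha b : R) P : 1 < a -> 1 <= alpha -> b <= Num.sqrt a ->
  (forall x, 1 <= x -> 0 <= P x) -> finite_potential (f_integrand a alpha b P) ->
  is_minimizer (potential (f_integrand a alpha b P)) (Lambda1 R) /\
  (nontrivial_weight P -> forall L, is_minimizer (potential (f_integrand a alpha b P)) L -> is_hexagonal L).
Proof.
move=> a1 al1 hb P0 fin; have wP := f_weight a1 al1 P0 fin.
have a0 : 0 < a by lra.
have al0 : 0 < alpha by lra.
have K0 : 0 <= 1 + `|b| by rewrite addr_ge0.
have diff t x y : reduced t x -> t != vhex R -> 1 <= y ->
    asum0 (fun p => f_kernel a alpha b (qform (vhex R) (1 / 2) p) y) <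
    asum0 (fun p => f_kernel a alpha b (qform t x p) y).
  move=> rd tv y1; have t0 : 0 < t by case: rd.
  have y0 : 0 < y by lra.
  have s1 : 1 <= alpha * y by rewrite -[leLHS]mulr1 ler_pM.
  have := thetaD_combination_gt0 rd tv s1 a1 hb.
  by rewrite !asum0_f_kernel ?vhex_gt0// /thetaD; lra.
apply: (hexagonal_optimal (k := f_kernel a alpha b) wP K0).
- move=> r y; rewrite /f_integrand /f_kernel; congr ((expR _ - _ * expR _) * _); ring.
- move=> v; apply: measurable_funB; first exact: measurable_expR_kernel.
  apply: measurable_funM; first exact: measurable_cst.
  apply: eq_measurable_fun (measurable_expR_kernel (a * alpha) v) => y _.
  by congr expR; ring.
- move=> v y v0 y1; have yv : 0 <= y * v by rewrite mulr_ge0 ?(ltW v0)//; lra.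
  have e1 : expR (- (alpha * y * v)) <= expR (- (y / 2 * v)).
    rewrite ler_expR; have : 1 * (y * v) <= alpha * (y * v) by rewrite ler_wpM2r.
    by rewrite mulrA (_ : y / 2 * v = y * v / 2); [lra | ring].
  have e2 : expR (- (a * (alpha * y) * v)) <= expR (- (y / 2 * v)).
    apply: le_trans e1; rewrite ler_expR lerN2.
    have ayv : 0 <= alpha * y * v by rewrite -mulrA mulr_ge0// ltW.
    by rewrite -[a * _ * v]mulrA ler_peMl// ltW.
  rewrite /f_kernel; apply: le_trans (ler_normB _ _) _.
  rewrite normrM !(ger0_norm (expR_ge0 _)) mulrDl mul1r lerD// ler_wpM2l//.
- by move=> t x y rd tv y1; exact/ltW/diff.
- by move=> t x y rd tv /ltW y1; exact: diff.
Qed.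

Lemma g_optimal (alpha b : R) P : 1 <= alpha -> b <= 1 / (2 * pi) ->
  (forall x, 1 <= x -> 0 <= P x) -> finite_potential (g_integrand alpha b P) ->
  is_minimizer (potential (g_integrand alpha b P)) (Lambda1 R) /\
  (nontrivial_weight P -> forall L, is_minimizer (potential (g_integrand alpha b P)) L -> is_hexagonal L).
Proof.
move=> al1 hb P0 fin; have wP := g_weight al1 hb P0 fin.
have al0 : 0 < alpha by lra.
have pi0 := pi_gt0 R; have pn : (pi : R) != 0 by rewrite gt_eqF.
have b2 : 0 <= 1 / 2 - pi * b.
  have : pi * b <= pi * (1 / (2 * pi)) by rewrite ler_wpM2l// ltW.
  rewrite (_ : pi * (1 / (2 * pi)) = 1 / 2); first by rewrite subr_ge0.
  by move: (pi : R) pn => w wn; field.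
have K0 : 0 <= 2 / pi + `|b| by rewrite addr_ge0// divr_ge0// ltW.
have pa : 0 < (pi * alpha)^-1 by rewrite invr_gt0 mulr_gt0.
have diff t x y : reduced t x -> t != vhex R -> 1 <= y ->
    asum0 (fun p => g_kernel alpha b (qform (vhex R) (1 / 2) p) y) <=
    asum0 (fun p => g_kernel alpha b (qform t x p) y) /\
    (1 < y -> asum0 (fun p => g_kernel alpha b (qform (vhex R) (1 / 2) p) y) <
    asum0 (fun p => g_kernel alpha b (qform t x p) y)).
  move=> rd tv y1; have t0 : 0 < t by case: rd.
  have y0 : 0 < y by lra.
  have s1 : 1 <= alpha * y by rewrite -[leLHS]mulr1 ler_pM.
  have T0 := thetaD_ge0 rd tv s1; have v0 := vhex_gt0 R.
  have T1 : 0 <= (1 / 2 - pi * b) * thetaD t x (alpha * y) by rewrite mulr_ge0.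
  rewrite !asum0_g_kernel// !(ler_pM2l pa) !(ltr_pM2l pa).
  rewrite /thetaD mulrBr in T1; rewrite !mulrBr.
  have lt1 : 1 < alpha * y -> asum0 (fun p => hfun (alpha * y) (qform (vhex R) (1 / 2) p))
      < asum0 (fun p => hfun (alpha * y) (qform t x p)) by move=> s2; exact: hfun_sum_lt.
  split.
    move: s1; rewrite le_eqVlt => /predU1P[E|/lt1]; last by lra.
    by rewrite -E in T1 *; rewrite !asum0_hfun1// lerD2l lerD2r -subr_ge0.
  move=> y2; have /lt1 : 1 < alpha * y by apply: lt_le_trans y2 _; rewrite ler_peMl// ltW.
  by lra.
apply: (hexagonal_optimal (k := g_kernel alpha b) wP K0).
- move=> r y; rewrite /g_integrand /g_kernel (_ : pi * r * y / pi = r * y); last first.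
    by rewrite mulrC !mulrA mulVf// mul1r.
  by congr (_ * expR _ * _); ring.
- move=> v; apply: measurable_funM; last exact: measurable_expR_kernel.
  apply: measurable_funB; last exact: measurable_cst.
  apply: measurable_funM; last exact: measurable_cst.
  by apply: measurable_funM; [exact: measurable_cst | exact: measurable_id].
- move=> v y v0 y1; have yv : 0 <= y * v by rewrite mulr_ge0 ?(ltW v0)//; lra.
  have e1 : expR (- (alpha * y * v)) <= expR (- (1 * (y * v))).
    rewrite ler_expR; have : 1 * (y * v) <= alpha * (y * v) by rewrite ler_wpM2r.
    by rewrite mulrA; lra.
  have e2 : expR (- (1 * (y * v))) <= expR (- (y / 2 * v)).
    by rewrite ler_expR (_ : y / 2 * v = y * v / 2); [lra | ring].
  have e3 := expR_mul_le ltr01 yv.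
  have e4 : expR (- (1 / 2 * (y * v))) = expR (- (y / 2 * v)) by congr expR; ring.
  rewrite e4 divr1 in e3.
  rewrite /g_kernel normrM (ger0_norm (expR_ge0 _)).
  apply: le_trans (ler_wpM2r (expR_ge0 _) (ler_normB _ _)) _.
  rewrite mulrDl mulrDl lerD//.
    rewrite ger0_norm; last by rewrite divr_ge0 ?(ltW pi0)// mulrC.
    rewrite (_ : v * y / pi = pi^-1 * (y * v)); last by ring.
    rewrite (_ : 2 / pi = pi^-1 * 2); last by ring.
    rewrite -[leLHS]mulrA -[leRHS]mulrA ler_wpM2l ?invr_ge0 ?(ltW pi0)//.
    by apply: le_trans e3; rewrite ler_wpM2l.
  apply: ler_pM; [exact: normr_ge0|exact: expR_ge0| |exact: le_trans e1 e2].
  by rewrite normrM normfV (ger0_norm (ltW al0)) ler_pdivrMr// ler_peMr.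
- by move=> t x y rd tv y1; have [] := diff t x y rd tv y1.
- by move=> t x y rd tv y1; have [_] := diff t x y rd tv (ltW y1); apply.
Qed.
End FinalTheorem.

Theorem theorem1p3 (R : realType) (a : R) (a_gt1 : 1 < a) :
  exists beta_c beta_s : R,
    [/\ beta_c = Num.sqrt a,
        beta_s = 1 / (2 * pi),
        forall (alpha b : R) (P : R -> R),
          1 <= alpha -> b <= beta_c ->
          (forall x, 1 <= x -> 0 <= P x) ->
          finite_potential (f_integrand a alpha b P) ->
          is_minimizer (potential (f_integrand a alpha b P)) (Lambda1 R) /\
          (nontrivial_weight P ->
           forall L : set 'rV[R]_2,
             is_minimizer (potential (f_integrand a alpha b P)) L ->
             is_hexagonal L)
      & forall (alpha b : R) (P : R -> R),
          1 <= alpha -> b <= beta_s ->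
          (forall x, 1 <= x -> 0 <= P x) ->
          finite_potential (g_integrand alpha b P) ->
          is_minimizer (potential (g_integrand alpha b P)) (Lambda1 R) /\
          (nontrivial_weight P ->
           forall L : set 'rV[R]_2,
             is_minimizer (potential (g_integrand alpha b P)) L ->
             is_hexagonal L)].
Proof.
exists (Num.sqrt a), (1 / (2 * pi)); split=> //.
- by move=> alpha b P al1 hb P0 fin; exact: f_optimal.
- by move=> alpha b P al1 hb P0 fin; exact: g_optimal.
Qed.
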